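(* Let $f_0$ be an initial condition with mass $\rho>0$, and $f$ the corresponding solution of $\partial_tf=Q(f)$. Suppose that $\left(\frac jc\right)'(\kappa)>0$ for all $\kappa\in(0,\kappa_{max})$. Then: (i) If $\rho<\rho_c$, then $f$ converges exponentially fast towards the uniform distribution $f_\infty=\rho$. (ii) If $\rho=\rho_c$, then $f$ converges to the uniform distribution $f_\infty=\rho$. (iii) If $\rho>\rho_c$ and $J_{f_0}\ne0$, then there exists $\Omega_\infty\in\mathbb S$ such that $f$ converges exponentially fast to the von Mises–Fisher distribution $f_\infty=\rho M_{\kappa\Omega_\infty}$, where $\kappa>0$ is the unique positive solution of the equation $\rho\,c(\kappa)=j(\kappa)$.
   Context: Let $n\ge 2$ and let $\mathbb S$ be the unit sphere of $\mathbb R^n$ with the uniform probability measure $d\omega$. $\nabla_\omega$, $\nabla_\omega\cdot$, $\Delta_\omega$ are the gradient, divergence and Laplace–Beltrami operator on $\mathbb S$; $P_{\omega^\perp}=\mathrm{Id}-\omega\otimes\omega$. The functions $\nu:[0,\infty)\to[0,\infty)$ and $\tau:[0,\infty)\to(0,\infty)$ are such that $r\mapsto\nu(r)/r$ and $r\mapsto\tau(r)$ are Lipschitz and bounded; $\tau_0=\tau(0)>0$. The function $k(r)=\nu(r)/\tau(r)$ is increasing; $\kappa_{max}=\lim_{r\to\infty}k(r)$ and $j:[0,\kappa_{max})\to[0,\infty)$ is the inverse function of $k$. Moreover $k$ is differentiable with Lipschitz derivative $k'$. For $f$ on $\mathbb S$, $J_f=\int_{\mathbb S}\omega f\,d\omega$,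 $\Omega_f=J_f/|J_f|$, and $$Q(f)=-\nu(|J_f|)\nabla_\omega\cdot(P_{\omega^\perp}\Omega_f\,f)+\tau(|J_f|)\Delta_\omega f$$ (with $Q(f)=\tau_0\Delta_\omega f$ if $J_f=0$). An initial condition is a finite nonnegative measure $f_0$ on $\mathbb S$, with mass $\int_{\mathbb S}f_0\,d\omega$; there is a unique global weak solution $f$ of $\partial_t f=Q(f)$, $f(0)=f_0$, with $f\in C^1((0,\infty),C^\infty(\mathbb S))$; mass is conserved. $M_{\kappa\Omega}(\omega)=e^{\kappa\,\omega\cdot\Omega}/\int_{\mathbb S}e^{\kappa\,\upsilon\cdot\Omega}d\upsilon$, and $c(\kappa)=\frac{\int_0^\pi\cos\theta\,e^{\kappa\cos\theta}\sin^{n-2}\theta\,d\theta}{\int_0^\pi e^{\kappa\cos\theta}\sin^{n-2}\theta\,d\theta}$. Primes on $\frac jc$ denote derivatives with respect to $\kappa$. The critical density is $\rho_c=\lim_{\kappa\to0}\frac{j(\kappa)}{c(\kappa)}=\lim_{r\to0}\frac{n\,r}{k(r)}\in(0,+\infty]$. Convergence of $f$ to $f_\infty$ means $\|f(t)-f_\infty\|_{H^s}\to0$ as $t\to\infty$ for every $s\in\mathbb R$; exponentially fast convergence means that for every $s$ there are $C,\lambda,t_0>0$ (possibly depending on $f_0$) with $\|f(t)-f_\infty\|_{H^s}\le Ce^{-\lambda t}$ for $t\ge t_0$. *)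

(* Defs.v *)
From HB Require Import structures.
From mathcomp Require Import all_boot all_order all_algebra.
From mathcomp Require Import all_classical all_reals all_analysis.
Set Implicit Arguments.
Unset Strict Implicit.
Unset Printing Implicit Defensive.
Import Order.TTheory GRing.Theory Num.Theory.
Import numFieldNormedType.Exports.
Local Open Scope classical_set_scope.
Local Open Scope ring_scope.

(* R^n with its Borel sigma-algebra. *)
Definition borel_rV (R : realType) (n : nat) := g_sigma_algebraType (@open 'rV[R]_n).

Section Sphere.
Variables (R : realType) (n : nat).
Implicit Types (x v : 'rV[R]_n) (g h : 'rV[R]_n -> R).

(* The library norm on 'rV[R]_n is the sup norm, hence the Euclidean one here. *)
Definition edot (x y : 'rV[R]_n) : R := \sum_i x 0 i * y 0 i.
Definition enorm x : R := Num.sqrt (edot x x).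

Definition sphere : set 'rV[R]_n := [set x | enorm x = 1].

(* The uniform probability measure on the sphere, as a Borel measure on R^n:
   the unique rotation-invariant probability carried by the sphere. *)
Definition uniform_sphere (sigma : probability (borel_rV R n) R) : Prop :=
  sigma sphere = 1%E /\
  forall (U : 'M[R]_n) (A : set (borel_rV R n)), U *m U^T = 1%:M -> measurable A ->
    sigma [set x | A ((x : 'rV[R]_n) *m U)] = sigma A.

(* A function on the sphere is represented by any g : 'rV[R]_n -> R, of which
   only the values on the sphere matter: the differential operators act on
   its extension which is constant along rays. On the sphere, the Euclidean
   gradient of this extension is the tangential gradient of g, and the Euclidean
   divergence of the extension of a vector field is its surface divergence. *)
Definition radial_ext g : 'rV[R]_n -> R := fun x => g ((enorm x)^-1 *: x).

Definition partial (i : 'I_n) g : 'rV[R]_n -> R := fun x => 'D_(delta_mx 0 i) g x.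
Definition partials (I : seq 'I_n) g : 'rV[R]_n -> R := foldr partial g I.

Definition sphere_grad g : 'rV[R]_n -> 'rV[R]_n :=
  fun x => \row_i partial i (radial_ext g) x.
Definition sphere_div (A : 'rV[R]_n -> 'rV[R]_n) : 'rV[R]_n -> R :=
  fun x => \sum_i partial i (radial_ext (fun y => A y 0 i)) x.
Definition sphere_lap g : 'rV[R]_n -> R := sphere_div (sphere_grad g).

Definition smooth_sphere g : Prop :=
  forall (I : seq 'I_n) x, x != 0 ->
    {for x, continuous (partials I (radial_ext g))} /\
    forall i, derivable (partials I (radial_ext g)) x (delta_mx 0 i).

(* The seminorms, indexed by I, defining the topology of C^oo(sphere). *)
Definition smooth_seminorm (I : seq 'I_n) g : \bar R :=
  ereal_sup [set `|partials I (radial_ext g) x|%:E | x in sphere].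

(* t |-> f t is of class C^1 from (0,+oo) to C^oo(sphere). *)
Definition time_deriv (f : R -> 'rV[R]_n -> R) : R -> 'rV[R]_n -> R :=
  fun t x => derive1 (fun u => f u x) t.

Definition C1_smooth (f : R -> 'rV[R]_n -> R) : Prop :=
  [/\ forall t, 0 < t -> smooth_sphere (f t),
      forall t, 0 < t -> smooth_sphere (time_deriv f t),
      forall t, 0 < t -> forall I : seq 'I_n,
        smooth_seminorm I (fun x => h^-1 * (f (t + h) x - f t x) - time_deriv f t x)
          @[h --> 0^'] --> 0%E
    & forall t, 0 < t -> forall I : seq 'I_n,
        smooth_seminorm I (fun x => time_deriv f u x - time_deriv f t x)
          @[u --> t] --> 0%E].

Section Measure.
Variable sigma : probability (borel_rV R n) R.

Definition sphere_int g : R := \int[sigma]_(x in (sphere : set (borel_rV R n))) g x.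

Definition flux g : 'rV[R]_n := \row_i sphere_int (fun x => x 0 i * g x).
Definition measure_flux (f0 : {measure set (borel_rV R n) -> \bar R}) : 'rV[R]_n :=
  \row_i \int[f0]_(x in (sphere : set (borel_rV R n))) (x : 'rV[R]_n) 0 i.

Definition tangent_proj x : 'M[R]_n := 1%:M - x^T *m x.

Definition Qop (nu tau : R -> R) g : 'rV[R]_n -> R :=
  let J := flux g in
  if J == 0 then fun x => tau 0 * sphere_lap g x
  else
    let Omega := (enorm J)^-1 *: J in
    fun x =>
      - nu (enorm J) * sphere_div (fun y => g y *: (Omega *m tangent_proj y)) x
      + tau (enorm J) * sphere_lap g x.

(* Distributions on the sphere are represented by their action on test functions. *)
Definition distr_of_fun g : ('rV[R]_n -> R) -> R :=
  fun h => sphere_int (fun x => g x * h x).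
Definition distr_of_measure (f0 : {measure set (borel_rV R n) -> \bar R}) :
    ('rV[R]_n -> R) -> R :=
  fun h => \int[f0]_(x in (sphere : set (borel_rV R n))) h x.

(* Spherical harmonics of degree l: the eigenspace of the Laplace-Beltrami
   operator for the l-th eigenvalue - l (l + n - 2). *)
Definition lap_eigenvalue (l : nat) : R := (l * (l + n - 2))%:R.
Definition spherical_harmonic (l : nat) : set ('rV[R]_n -> R) :=
  [set Y | smooth_sphere Y /\
           forall x, sphere x -> sphere_lap Y x = - lap_eigenvalue l * Y x].

(* L^2 norm of the component of T on spherical harmonics of degree l, by duality. *)
Definition harmonic_norm (l : nat) (T : ('rV[R]_n -> R) -> R) : \bar R :=
  ereal_sup [set `|T Y|%:E | Y in
    [set Y | spherical_harmonic l Y /\ sphere_int (fun x => Y x ^+ 2) <= 1]].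

(* ||T||_{H^s}^2 = < (Id - Delta)^s T, T >, diagonalized in spherical harmonics. *)
Definition Hs_norm (s : R) (T : ('rV[R]_n -> R) -> R) : \bar R :=
  ((\sum_(0 <= l <oo)
     ((1 + lap_eigenvalue l) `^ s)%:E * harmonic_norm l T ^+ 2) `^ 2^-1)%E.

(* The solution of d_t f = Q(f) with initial datum the measure f0: as f is
   C^1 in time with values in C^oo, the equation holds pointwise for t > 0, and
   the initial datum is reached in some Sobolev space H^s, s possibly negative
   (finite measures are in H^s only for s < -(n-1)/2 in general). Such an f
   is continuous on [0,T] with values in H^s, hence in
   L^2((0,T),H^s) /\ H^1((0,T),H^(s-2)), the class of weak solutions in which
   uniqueness holds. *)
Definition solution (nu tau : R -> R) (f0 : {measure set (borel_rV R n) -> \bar R})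
    (f : R -> 'rV[R]_n -> R) : Prop :=
  [/\ C1_smooth f,
      forall t, 0 < t -> forall x, sphere x -> time_deriv f t x = Qop nu tau (f t) x
    & exists s : R,
        Hs_norm s (fun h => distr_of_fun (f t) h - distr_of_measure f0 h)
          @[t --> 0^'+] --> 0%E].

Definition Hs_dist (s : R) g h : \bar R := Hs_norm s (distr_of_fun (fun x => g x - h x)).

Definition converges_to (f : R -> 'rV[R]_n -> R) (finf : 'rV[R]_n -> R) : Prop :=
  forall s : R, Hs_dist s (f t) finf @[t --> +oo] --> 0%E.

Definition converges_exp_to (f : R -> 'rV[R]_n -> R) (finf : 'rV[R]_n -> R) : Prop :=
  forall s : R, exists C lambda t0 : R, [/\ 0 < C, 0 < lambda, 0 < t0 &
    forall t, t0 <= t -> (Hs_dist s (f t) finf <= (C * expR (- lambda * t))%:E)%E].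

Definition von_mises_fisher (kappa : R) (Omega : 'rV[R]_n) : 'rV[R]_n -> R :=
  fun x => expR (kappa * edot x Omega)
           / sphere_int (fun y => expR (kappa * edot y Omega)).

End Measure.
End Sphere.

Definition order_param (R : realType) (n : nat) (kappa : R) : R :=
  (\int[lebesgue_measure]_(theta in `[0, pi])
      (cos theta * expR (kappa * cos theta) * sin theta ^+ (n - 2)))
  / (\int[lebesgue_measure]_(theta in `[0, pi])
      (expR (kappa * cos theta) * sin theta ^+ (n - 2))).

Section Coefficients.
Variable R : realType.
Implicit Types nu tau j : R -> R.

Definition ratio nu tau : R -> R := fun r => nu r / tau r.

(* Derivative relative to [0,+oo), one-sided at 0. *)
Definition is_derive_nonneg (k : R -> R) (r dk : R) : Prop :=
  h^-1 * (k (r + h) - k r) @[h --> within [set h | 0 <= r + h] (0 : R)^'] --> dk.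

Definition admissible_coefficients nu tau : Prop :=
  [/\ forall r, 0 <= r -> 0 <= nu r /\ 0 < tau r,
      [lipschitz nu r / r | r in `]0, +oo[] /\ [bounded nu r / r | r in `]0, +oo[],
      [lipschitz tau r | r in `[0, +oo[] /\ [bounded tau r | r in `[0, +oo[],
      {in `[0, +oo[ &, {homo ratio nu tau : r s / r < s}}
    & exists dk : R -> R,
        (forall r, 0 <= r -> is_derive_nonneg (ratio nu tau) r (dk r)) /\
        [lipschitz dk r | r in `[0, +oo[]].

Definition is_kappa_max nu tau (kappa_max : \bar R) : Prop :=
  (ratio nu tau r)%:E @[r --> +oo] --> kappa_max.

(* j : [0, kappa_max) -> [0, +oo) is the inverse function of k = nu / tau. *)
Definition is_inverse_ratio nu tau (kappa_max : \bar R) j : Prop :=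
  (forall kappa, 0 <= kappa -> (kappa%:E < kappa_max)%E ->
     0 <= j kappa /\ ratio nu tau (j kappa) = kappa) /\
  (forall r, 0 <= r -> ((ratio nu tau r)%:E < kappa_max)%E /\ j (ratio nu tau r) = r).

Definition is_critical_density (n : nat) j (rho_c : \bar R) : Prop :=
  (j kappa / order_param n kappa)%:E @[kappa --> 0^'+] --> rho_c.

End Coefficients.

(* Main.v *)
Require Import Defs.
From HB Require Import structures.
From mathcomp Require Import all_boot all_order all_algebra.
From mathcomp Require Import all_classical all_reals all_analysis.
From mathcomp Require Import ring lra zify.
Set Implicit Arguments.
Unset Strict Implicit.
Unset Printing Implicit Defensive.
Import Order.TTheory GRing.Theory Num.Theory.
Import numFieldNormedType.Exports.
Local Open Scope classical_set_scope.
Local Open Scope ring_scope.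

(** Put w = (k(|J|) / |J|) J and m_w(x) = e^(w . x) / Z(w).  The equation is the Fokker-Planck flow
    f' = tau div (m_w grad (f / m_w)), which dissipates the free energy F = int f ln f - Phi(|J|), where
    Phi' = k.  Up to a constant, F is the relative entropy of f with respect to rho m_w plus V(|J|), where
    V' = k' G and G(r) = r - rho c(k(r)).  With D the squared L^2 distance from f to rho m_w one has
    G(|J|)^2 <= D, c D <= F - V(|J|) <= C D and F' <= - c D, proved for f + delta to avoid ln 0.  The
    monotonicity of j / c determines the sign of G.  If rho < rho_c, or if rho > rho_c and |J| stays away
    from 0, then V - min V <= C G^2, so that F - min V and D decay exponentially; as J' = O(sqrt D), J
    converges.  If rho = rho_c, D is bounded from below as long as |J| is, so F decreases to min V.  If
    rho > rho_c, (ln |J|)' = - (n - 1) tau G / |J| + O(sqrt D) forces F close to min V at some time,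
    after which |J| stays away from 0.

    L^2 convergence is upgraded to all Sobolev norms by interpolation with uniform bounds on the
    derivatives, from an energy estimate and the Nash inequality.  Nonnegativity of f, whose initial
    datum is a measure, is proved by duality, with positive operators approximating the backward
    evolution.  Analysis on the sphere rests on the rotation fields and on the kernels (1 + x . y)^N. *)

(** * The sphere and its rotations *)

(** The datum is a measure, reached in a Sobolev space of possibly negative order, so near t = 0
    only tests against smooth functions are available. Positivity yields |J| <= rho, an L^1 bound
    and a usable logarithm, but its proof needs bounds on the coefficients, which depend on J. The
    circle is broken by bounding J on bounded times from the datum and continuity alone, and then
    treating the equation as linear with given coefficients.

    The kernels play the part of spectral theory: with lam_l = l (l + n - 2), the operators satisfy
    K_N = (1 + Lap / lam_(N+1)) K_(N+1). Telescoping this identity yields the approximation of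
    smooth functions, the harmonic decomposition, and the Poincare, Nash and Sobolev inequalities.

    Passing from f to f + delta leaves an error in every entropy inequality. The decay lemmas
    therefore assume, for each e > 0, an energy depending on e whose inequalities hold up to e.
    Their conclusions mention only D and V, so that e can be sent to 0. *)

Section Geometry.
Variables (R : realType) (n : nat).
Implicit Types (x y v w : 'rV[R]_n) (U : 'M[R]_n).

Lemma edotC x y : edot x y = edot y x.
Proof. by apply: eq_bigr => i _; rewrite mulrC. Qed.

Lemma edotDl x y v : edot (x + y) v = edot x v + edot y v.
Proof. by rewrite /edot -big_split; apply: eq_bigr => i _; rewrite mxE mulrDl. Qed.

Lemma edotZl a x v : edot (a *: x) v = a * edot x v.
Proof. by rewrite /edot big_distrr; apply: eq_bigr => i _ /=; rewrite mxE mulrA. Qed.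

Lemma edotDr x y v : edot v (x + y) = edot v x + edot v y.
Proof. by rewrite edotC edotDl !(edotC v). Qed.

Lemma edotZr a x v : edot v (a *: x) = a * edot v x.
Proof. by rewrite edotC edotZl (edotC v). Qed.

Lemma edotNl x v : edot (- x) v = - edot x v.
Proof. by rewrite -scaleN1r edotZl mulN1r. Qed.

Lemma edotNr x v : edot v (- x) = - edot v x.
Proof. by rewrite edotC edotNl (edotC v). Qed.

Lemma edot0l v : edot 0 v = 0.
Proof. by rewrite /edot big1 // => i _; rewrite mxE mul0r. Qed.

Lemma edot_ge0 x : 0 <= edot x x.
Proof. by apply: sumr_ge0 => i _; rewrite -expr2 sqr_ge0. Qed.

Lemma edot_eq0 x : (edot x x == 0) = (x == 0).
Proof.
apply/idP/eqP => [|->]; last by rewrite edot0l.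
rewrite psumr_eq0 => [/allP h|i _]; last by rewrite -expr2 sqr_ge0.
apply/rowP => i; rewrite mxE; have := h i (mem_index_enum i).
by rewrite /= mulf_eq0 orbb => /eqP.
Qed.

Lemma edotE x y : edot x y = (x *m y^T) 0 0.
Proof. by rewrite mxE; apply: eq_bigr => i _; rewrite mxE. Qed.

Lemma edot_mulmx U x y : U *m U^T = 1%:M -> edot (x *m U) (y *m U) = edot x y.
Proof. by move=> h; rewrite !edotE trmx_mul mulmxA -(mulmxA x) h mulmx1. Qed.

Lemma enorm_ge0 x : 0 <= enorm x.
Proof. exact: sqrtr_ge0. Qed.

Lemma enorm_sqr x : enorm x ^+ 2 = edot x x.
Proof. by rewrite sqr_sqrtr // edot_ge0. Qed.

Lemma enorm_eq0 x : (enorm x == 0) = (x == 0).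
Proof. by rewrite sqrtr_eq0 -edot_eq0 eq_le edot_ge0 andbT. Qed.

Lemma enorm0 : enorm (0 : 'rV[R]_n) = 0.
Proof. by apply/eqP; rewrite enorm_eq0. Qed.

Lemma enorm_gt0 x : (0 < enorm x) = (x != 0).
Proof. by rewrite lt0r enorm_eq0 enorm_ge0 andbT. Qed.

Lemma sphereP x : sphere x <-> edot x x = 1.
Proof.
rewrite /sphere /= -enorm_sqr; split=> [->|/eqP]; first by rewrite expr1n.
by rewrite sqrf_eq1 => /orP[/eqP //|/eqP h]; have := enorm_ge0 x; rewrite h; lra.
Qed.

(** The difference of the two sides is the squared length of v - (x . v) x. *)
Lemma edot_sphere_sqr x v : sphere x -> edot x v ^+ 2 <= edot v v.
Proof.
move=> /sphereP xx; rewrite -subr_ge0.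
have := edot_ge0 (v - edot x v *: x).
rewrite edotDl !edotDr !edotNl !edotNr !edotZl !edotZr xx (edotC v x).
by set a := edot x v; lra.
Qed.

Lemma edot_sphere_le x v : sphere x -> `|edot x v| <= enorm v.
Proof.
move=> xS; rewrite -(@ler_pXn2r _ 2) ?nnegrE ?enorm_ge0 //.
by rewrite real_normK ?num_real // enorm_sqr edot_sphere_sqr.
Qed.

Lemma edot_le x v : `|edot x v| <= enorm x * enorm v.
Proof.
have [->|x0] := eqVneq x 0; first by rewrite edot0l normr0 mulr_ge0 ?enorm_ge0.
have ex : 0 < enorm x by rewrite enorm_gt0.
have xS : sphere ((enorm x)^-1 *: x).
  apply/sphereP; rewrite edotZl edotZr -enorm_sqr; field; exact: lt0r_neq0.
have := edot_sphere_le v xS.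
by rewrite edotZl normrM gtr0_norm ?invr_gt0 // mulrC ler_pdivrMr // mulrC.
Qed.

(** Multiplied by [enorm x], the left side is a sum of n products x_i x_i, each at most [enorm x]
    times M. The constant n is crude but sufficient. *)
Lemma enorm_le_coord x (M : R) : 0 <= M -> (forall i, `|x 0 i| <= M) ->
  enorm x <= n%:R * M.
Proof.
move=> M0 h; have [->|x0] := eqVneq x 0.
  by have -> : enorm (0 : 'rV[R]_n) = 0; [apply/eqP; rewrite enorm_eq0|rewrite mulr_ge0].
have ex : 0 < enorm x by rewrite enorm_gt0.
rewrite -(ler_pM2l ex) -expr2 enorm_sqr /edot mulrCA -[in leLHS]/(\sum_i _).
have -> : n%:R * (enorm x * M) = \sum_(i < n) enorm x * M.
  by rewrite sumr_const card_ord mulr_natl.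
apply: ler_sum => i _.
apply: le_trans (ler_norm _) _; rewrite normrM ler_pM //.
rewrite -(@ler_pXn2r _ 2) ?nnegrE ?enorm_ge0 // real_normK ?num_real // enorm_sqr.
rewrite /edot (bigD1 i) //= -expr2 lerDl sumr_ge0 // => k _.
by rewrite -expr2 sqr_ge0.
Qed.

Lemma coord_le_enorm x i : `|x 0 i| <= enorm x.
Proof.
rewrite -(@ler_pXn2r _ 2) ?nnegrE ?enorm_ge0 // real_normK ?num_real // enorm_sqr.
rewrite /edot (bigD1 i) //= -expr2 lerDl sumr_ge0 // => k _.
by rewrite -expr2 sqr_ge0.
Qed.

(* [skew i j] generates the rotations in the plane (i, j); it vanishes for i = j. *)
Definition skew (i j : 'I_n) : 'M[R]_n := delta_mx i j - delta_mx j i.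
(** Rodrigues' formula: since the cube of [skew i j] is its opposite, this is the exponential of t
    times [skew i j]. For i = j it is the identity. *)
Definition rotmx i j (t : R) : 'M[R]_n :=
  1%:M + sin t *: skew i j + (1 - cos t) *: (skew i j *m skew i j).

Lemma skew_cube i j : skew i j *m skew i j *m skew i j = - skew i j.
Proof.
rewrite /skew; have [->|ij] := eqVneq i j; first by rewrite subrr !mul0mx oppr0.
have h (a b c d : 'I_n) : (delta_mx a b *m delta_mx c d : 'M[R]_n) = delta_mx a d *+ (b == c).
  by rewrite mul_delta_mx_cond.
rewrite !(mulmxBl, mulmxBr, h) !eqxx !(eq_sym j i) (negPf ij) !mulr0n !mulr1n.
rewrite !(subr0, sub0r, mulmxBl, mulmxBr, mulNmx, mulmxN, h) !eqxx !(eq_sym j i) (negPf ij).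
by rewrite !mulr0n !mulr1n !mul0mx; apply/matrixP => a b; rewrite !mxE; ring.
Qed.

Lemma skew_tr i j : (skew i j)^T = - skew i j.
Proof. by rewrite /skew linearB /= !trmx_delta opprB. Qed.

Lemma rotmx0 i j : rotmx i j 0 = 1%:M.
Proof. by rewrite /rotmx sin0 cos0 subrr !scale0r !addr0. Qed.

Lemma rotmxD i j s t : rotmx i j s *m rotmx i j t = rotmx i j (s + t).
Proof.
have := skew_cube i j; rewrite /rotmx sinD cosD; move: (skew i j) => A A3.
rewrite !mulmxDl !mulmxDr !mul1mx !mulmx1 -!scalemxAl -!scalemxAr !mulmxA A3 mulNmx.
move: (A *m A) => B; apply/matrixP => a b; rewrite !mxE; ring.
Qed.

Lemma rotmx_tr i j t : (rotmx i j t)^T = rotmx i j (- t).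
Proof.
have := skew_tr i j; rewrite /rotmx sinN cosN; move: (skew i j) => A T.
by rewrite !linearD /= !linearZ /= trmx1 trmx_mul T mulmxN mulNmx opprK scalerN scaleNr.
Qed.

Lemma rotmx_orth i j t : rotmx i j t *m (rotmx i j t)^T = 1%:M.
Proof. by rewrite rotmx_tr rotmxD subrr rotmx0. Qed.

Lemma mul_skew x i j : x *m skew i j = x 0 i *: delta_mx 0 j - x 0 j *: delta_mx 0 i.
Proof.
apply/rowP => k; rewrite /skew mulmxBr mxE [in RHS]mxE; congr (_ + _).
  rewrite mxE (bigD1 i) //= big1 ?addr0 => [|l /negPf li]; rewrite !mxE ?eqxx //=.
  by rewrite li mulr0.
rewrite !mxE (bigD1 j) //= big1 ?addr0 => [|l /negPf li]; rewrite !mxE ?eqxx //=.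
by rewrite li mulr0.
Qed.

End Geometry.

Section Sphere_type.
Variables (R : realType) (n : nat).

(** The sphere as a type with the induced topology: continuity and derivatives along rotations then
    involve no choice of an extension. *)
Definition pt := set_type (@sphere R n).
Notation V := 'rV[R]_n.
Implicit Types (g h : pt -> R) (p q : pt).

Definition vec p : V := set_val p.

Lemma vec_sphere p : sphere (vec p).
Proof. exact: set_valP. Qed.

Lemma vec_inj p q : vec p = vec q -> p = q.
Proof. exact: val_inj. Qed.

Lemma edot_vec p : edot (vec p) (vec p) = 1.
Proof. exact/sphereP/vec_sphere. Qed.

Definition mkpt x (hx : sphere x) : pt := exist _ x (mem_set hx).

Lemma vec_mkpt x (hx : sphere x) : vec (mkpt hx) = x.
Proof. by []. Qed.

(** Extension by 0 off the sphere, because the measures live on the whole space. *)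
Definition ext g : borel_rV R n -> R := valL_ 0 g.

Lemma ext_vec g p : ext g (vec p) = g p.
Proof. exact: (congr1 (fun F => F p) (valLK 0 g)). Qed.

Lemma ext_mkpt g x (hx : sphere x) : ext g x = g (mkpt hx).
Proof. by rewrite -ext_vec vec_mkpt. Qed.

Lemma ext_off g x : ~ sphere x -> ext g x = 0.
Proof.
move=> hx; rewrite /ext /valL_ /= oinv_set_val insubN //.
by apply/negP; rewrite inE.
Qed.

Lemma edot_continuous v : continuous (fun x : V => edot x v).
Proof.
apply: continuous_big => [|i _ x]; first exact: add_continuous.
exact: (cvgM (@coord_continuous R 1 n 0 i x) (cvg_cst _)).
Qed.

Lemma edot_sqr_continuous : continuous (fun x : V => edot x x).
Proof.
apply: continuous_big => [|i _ x]; first exact: add_continuous.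
exact: (cvgM (@coord_continuous R 1 n 0 i x) (@coord_continuous R 1 n 0 i x)).
Qed.

Lemma enorm_continuous : continuous (@enorm R n).
Proof.
move=> x; apply: (@continuous_comp _ _ _ (fun x : V => edot x x)).
  exact: edot_sqr_continuous.
exact: sqrt_continuous.
Qed.

Lemma closed_sphere : closed (@sphere R n).
Proof. by apply: (closed_comp _ (@closed_eq _ (1 : R))) => x _; exact: enorm_continuous. Qed.

Lemma compact_sphere : compact (@sphere R n).
Proof.
apply: bounded_closed_compact; last exact: closed_sphere.
exists 1; split => // M M1 x /= xS; apply: le_trans (ltW M1).
rewrite [leLHS]/Num.norm /= mx_normrE; apply: bigmax_le => // -[i j] _ /=.
by rewrite ord1 -xS coord_le_enorm.
Qed.

Lemma open_borel (A : set V) : open A -> measurable (A : set (borel_rV R n)).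
Proof. by move=> oA; exact: sub_sigma_algebra. Qed.

Lemma measurable_sphere : measurable (@sphere R n : set (borel_rV R n)).
Proof.
rewrite -[X in measurable X]setCK; apply: measurableC.
by apply: open_borel; exact/closed_openC/closed_sphere.
Qed.

(* A record, so that unification does not unfold it. *)
Record cont g : Prop := Cont { contP : continuous (g : pt -> R) }.
Coercion contP : cont >-> Funclass.

Lemma cont_vec (F : V -> R) : continuous F -> cont (F \o vec).
Proof.
move=> cF; split=> p; apply: continuous_comp; last exact: cF.
exact: initial_continuous.
Qed.

Lemma measurable_ext g : cont g -> measurable_fun [set: borel_rV R n] (ext g).
Proof.
move=> -[/continuousP cg].
have mg : measurable_fun (@sphere R n : set (borel_rV R n)) (ext g).
  apply: (measurability _ (measurable_realfun.RGenOpens.measurableE R)).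
  move=> _ [_ [a [b ->] <-]].
  have [B oB gB] := cg _ (@interval_open R (BRight a) (BLeft b) (erefl _) (erefl _)).
  rewrite (_ : _ `&` _ = @sphere R n `&` B).
    by apply: measurableI; [exact: measurable_sphere|exact: open_borel].
  apply/seteqP; split => x [xS]; rewrite /preimage /= (ext_mkpt g xS) => hx;
    split => //.
    by have : (vec @^-1` B) (mkpt xS) by rewrite gB.
  by have : (g @^-1` `]a, b[%classic) (mkpt xS) by rewrite -gB.
move/(measurable_restrictT _ measurable_sphere) : mg.
rewrite (_ : _ \_ _ = ext g) //; apply/funext => x; rewrite patchE.
by case: ifPn => // /negP; rewrite inE => /ext_off ->.
Qed.

Lemma cont_bounded g : cont g -> exists M : R, forall p, `|g p| <= M.
Proof.
(* The sphere is empty for n = 0, which this section does not exclude. *)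
move=> cg; have [S0|/set0P/negP/negPn/eqP S0] := pselect (@sphere R n !=set0); last first.
  by exists 0 => p; have := vec_sphere p; rewrite S0.
have h (u : pt -> R) : cont u -> exists M : R, forall p, u p <= M.
  move=> cu; have [|c _ hc] := compact_EVT_max S0 compact_sphere (f := ext u).
    by case: cu => cu; exact/subspace_valL_continuousP'.
  by exists (ext u c) => p; rewrite -(ext_vec u); apply: hc; rewrite inE; exact: vec_sphere.
have [M hM] := h _ cg; have [|N hN] := h (fun p => - g p).
  by split=> p; exact: (cvgN (cg p)).
by exists (Num.max M N) => p; rewrite ler_norml lerNl !le_max hM hN orbT.
Qed.

Lemma cont_cst c : cont (fun=> c).
Proof. by split; exact: cst_continuous. Qed.

Lemma contD g h : cont g -> cont h -> cont (fun p => g p + h p).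
Proof. by move=> cg ch; split=> p; exact: (cvgD (cg p) (ch p)). Qed.

Lemma contB g h : cont g -> cont h -> cont (fun p => g p - h p).
Proof. by move=> cg ch; split=> p; exact: (cvgB (cg p) (ch p)). Qed.

Lemma contN g : cont g -> cont (fun p => - g p).
Proof. by move=> cg; split=> p; exact: (cvgN (cg p)). Qed.

Lemma contM g h : cont g -> cont h -> cont (fun p => g p * h p).
Proof. by move=> cg ch; split=> p; exact: (cvgM (cg p) (ch p)). Qed.

Lemma contZ c g : cont g -> cont (fun p => c * g p).
Proof. by move=> cg; apply: contM => //; exact: cont_cst. Qed.

Lemma contX g k : cont g -> cont (fun p => g p ^+ k).
Proof.
move=> cg; elim: k => [|k IH]; first exact: cont_cst.
by under eq_fun do rewrite exprS; exact: contM.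
Qed.

Lemma cont_norm g : cont g -> cont (fun p => `|g p|).
Proof. by move=> cg; split=> p; exact: (cvg_norm (cg p)). Qed.

Lemma cont_sum (I : Type) (r : seq I) (P : pred I) (G : I -> pt -> R) :
  (forall i, cont (G i)) -> cont (fun p => \sum_(i <- r | P i) G i p).
Proof.
move=> cG; elim: r => [|i r IH].
  by under eq_fun do rewrite big_nil; exact: cont_cst.
under eq_fun do rewrite big_cons; case: (P i) => //; exact: contD.
Qed.

Lemma cont_comp (F : R -> R) g : (forall p, {for g p, continuous F}) -> cont g ->
  cont (fun p => F (g p)).
Proof. by move=> cF cg; split=> p; exact: (continuous_comp (cg p) (cF p)). Qed.

Lemma cont_expR g : cont g -> cont (fun p => expR (g p)).
Proof. by apply: cont_comp => p; exact: continuous_expR. Qed.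

Lemma cont_ln g : (forall p, 0 < g p) -> cont g -> cont (fun p => ln (g p)).
Proof. by move=> g0; apply: cont_comp => p; exact: continuous_ln. Qed.

Lemma cont_inv g : (forall p, g p != 0) -> cont g -> cont (fun p => (g p)^-1).
Proof. by move=> g0 cg; split=> p; exact: (cvgV (g0 p) (cg p)). Qed.

Definition lin (v : V) : pt -> R := fun p => edot (vec p) v.

Lemma cont_lin v : cont (lin v).
Proof. exact: (@cont_vec (fun x => edot x v) (@edot_continuous v)). Qed.

Lemma lin_le v p : `|lin v p| <= enorm v.
Proof. exact/edot_sphere_le/vec_sphere. Qed.

Definition mulp (U : 'M[R]_n) (hU : U *m U^T = 1%:M) p : pt :=
  mkpt (proj2 (sphereP (vec p *m U)) (eq_trans (edot_mulmx _ _ hU) (edot_vec p))).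

Lemma vec_mulp U (hU : U *m U^T = 1%:M) p : vec (mulp hU p) = vec p *m U.
Proof. by []. Qed.

Lemma cvg_rV (T : Type) (F : set_system T) (FF : Filter F) (f : T -> V) (l : V) :
  (forall i, f x 0 i @[x --> F] --> l 0 i) -> f x @[x --> F] --> l.
Proof.
move=> h A [P hP sPA]; rewrite /= /nbhs /=.
have : \forall x \near F, forall i, P 0 i (f x 0 i).
  by apply: filter_forall => i; exact: (h i _ (hP 0 i)).
by apply: filterS => x hx; apply: sPA => i j; rewrite ord1.
Qed.

Lemma mulmx_continuous (U : 'M[R]_n) : continuous (fun x : V => x *m U).
Proof.
move=> x; apply: (@cvg_rV _ _ (nbhs_filter x)) => i.
have E (y : V) : edot y (row i U^T) = (y *m U) 0 i.
  by rewrite edotE mxE [in RHS]mxE; apply: eq_bigr => l _; rewrite !mxE.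
by rewrite -E; under eq_fun do rewrite -E; exact: edot_continuous.
Qed.

Lemma cont_mulp U (hU : U *m U^T = 1%:M) g : cont g -> cont (g \o mulp hU).
Proof.
move=> cg; split=> p; apply: continuous_comp; last exact: (cg _).
apply: (@continuous_comp_initial _ _ _ _ (mulp hU)) => {}p.
apply: (@continuous_comp _ _ _ vec (fun x : V => x *m U)).
  exact: initial_continuous.
exact: mulmx_continuous.
Qed.

End Sphere_type.

(** Locked, so that unification does not unfold integrals. *)
HB.lock Definition Int (R : realType) (n : nat) (mu : {measure set (borel_rV R n) -> \bar R})
  (g : pt R n -> R) : R := \int[mu]_(x in (@sphere R n : set (borel_rV R n))) ext g x.

(** * Integration on the sphere *)

Section Integral.
Variables (R : realType) (n : nat).
Notation V := 'rV[R]_n.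
Notation pt := (pt R n).
Implicit Types (g h : pt -> R) (p q : pt).
Variables (mu : {measure set (borel_rV R n) -> \bar R}) (m : R).
Notation Int := (Int mu).
Hypothesis mass : mu (@sphere R n) = m%:E.

Lemma Int_vec (F : V -> R) :
  \int[mu]_(x in (@sphere R n : set (borel_rV R n))) F x = Int (F \o vec (n:=n)).
Proof.
rewrite Int.unlock; apply: eq_Rintegral => x; rewrite inE => hx.
by rewrite (ext_mkpt _ hx).
Qed.

Lemma integrable_ext g : cont g ->
  mu.-integrable (@sphere R n : set (borel_rV R n)) (EFin \o ext g).
Proof.
move=> cg; apply: measurable_bounded_integrable.
- exact: measurable_sphere.
- by rewrite mass ltry.
- exact: (measurable_funTS (measurable_ext cg)).
- have [M hM] := cont_bounded cg; exists M; split; first exact: num_real.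
  by move=> N MN x /= hx; rewrite (ext_mkpt _ hx) (le_trans (hM _)) // ltW.
Qed.

Lemma Int_eq g h : (forall p, g p = h p) -> Int g = Int h.
Proof. by move=> gh; congr Int; apply/funext. Qed.

(** Moves a pointwise operation across [ext], so that the general rules for integrals apply to
    functions of [pt]. *)
Lemma Int_op (op : R -> R -> R) g h :
  \int[mu]_(x in (@sphere R n : set (borel_rV R n))) op (ext g x) (ext h x) =
  Int (fun p => op (g p) (h p)).
Proof. by rewrite Int.unlock; apply: eq_Rintegral => x; rewrite inE => hx; rewrite !(ext_mkpt _ hx). Qed.

Lemma IntD g h : cont g -> cont h -> Int (fun p => g p + h p) = Int g + Int h.
Proof.
move=> cg ch; rewrite -(Int_op +%R) Int.unlock RintegralD //; try exact: integrable_ext.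
exact: measurable_sphere.
Qed.

Lemma IntZ c g : cont g -> Int (fun p => c * g p) = c * Int g.
Proof.
move=> cg; rewrite -(Int_op (fun a _ => c * a) g g) Int.unlock RintegralZl //.
  exact: measurable_sphere.
exact: integrable_ext.
Qed.

Lemma IntZr c g : cont g -> Int (fun p => g p * c) = Int g * c.
Proof. by move=> cg; rewrite mulrC -IntZ //; apply: Int_eq => p; rewrite mulrC. Qed.

Lemma IntN g : cont g -> Int (fun p => - g p) = - Int g.
Proof.
move=> cg; rewrite -mulN1r -IntZ //; apply: Int_eq => p; by rewrite mulN1r.
Qed.

Lemma IntB g h : cont g -> cont h -> Int (fun p => g p - h p) = Int g - Int h.
Proof.
move=> cg ch; rewrite -(Int_op (fun a b => a - b)) Int.unlock RintegralB //; try exact: integrable_ext.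
exact: measurable_sphere.
Qed.

Lemma Int_cst c : Int (fun=> c) = c * m.
Proof.
rewrite -(Int_op (fun _ _ => c) (fun=> 0) (fun=> 0)) Rintegral_cst ?mass //.
exact: measurable_sphere.
Qed.

Lemma Int_le g h : cont g -> cont h -> (forall p, g p <= h p) -> Int g <= Int h.
Proof.
move=> cg ch gh; rewrite Int.unlock; apply: le_Rintegral; try exact: integrable_ext.
  exact: measurable_sphere.
by move=> x hx; rewrite !(ext_mkpt _ hx).
Qed.

Lemma Int_ge0 g : (forall p, 0 <= g p) -> 0 <= Int g.
Proof. by move=> g0; rewrite Int.unlock; apply: Rintegral_ge0 => x hx; rewrite (ext_mkpt _ hx). Qed.

Lemma Int_norm g : cont g -> `|Int g| <= Int (fun p => `|g p|).
Proof.
move=> cg; rewrite Int.unlock; apply: le_trans (le_normr_Rintegral _ _) _; first exact: measurable_sphere.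
  exact: integrable_ext.
by rewrite (Int_op (fun a _ => `|a|) g g) Int.unlock.
Qed.

Lemma Int_bound g (M : R) : cont g -> (forall p, `|g p| <= M) -> `|Int g| <= M * m.
Proof.
move=> cg h; apply: le_trans (Int_norm cg) _.
rewrite -Int_cst; apply: Int_le => //; [exact: cont_norm|exact: cont_cst].
Qed.

Lemma Int_sum (I : Type) (r : seq I) (P : pred I) (G : I -> pt -> R) :
  (forall i, cont (G i)) ->
  Int (fun p => \sum_(i <- r | P i) G i p) = \sum_(i <- r | P i) Int (G i).
Proof.
move=> cG; elim: r => [|i r IH].
  rewrite big_nil -[RHS](mul0r m) -Int_cst; apply: Int_eq => p; by rewrite big_nil.
rewrite big_cons -IH; under [LHS]Int_eq do rewrite big_cons.
by case: (P i) => //; rewrite IntD //; exact: cont_sum.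
Qed.

Lemma Int_lim (G : nat -> pt -> R) g (M : R) : (forall k, cont (G k)) -> cont g ->
  (forall k p, `|G k p| <= M) -> (forall p, G k p @[k --> \oo] --> g p) ->
  Int (G k) @[k --> \oo] --> Int g.
Proof.
move=> cG cg bG hG; rewrite Int.unlock; apply: fine_cvg.
rewrite fineK; last by apply: integrable_fin_num; [exact: measurable_sphere|exact: integrable_ext].
apply: (@dominated_cvg _ _ _ mu _ _ _ _ (fun=> M%:E)) => //.
- exact: measurable_sphere.
- by move=> k; apply/measurable_realfun.measurable_EFinP; exact: (measurable_funTS (measurable_ext (cG k))).
- move=> x hx; rewrite (ext_mkpt _ hx); apply: cvg_EFin; first exact: nearW.
  by rewrite /=; under eq_fun do rewrite (ext_mkpt _ hx); exact: hG.
- have := integrable_ext (@cont_cst R n M); apply: eq_integrable => //.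
    exact: measurable_sphere.
  by move=> x; rewrite inE => hx /=; rewrite (ext_mkpt _ hx).
- by move=> k x hx; rewrite (ext_mkpt _ hx) lee_fin.
Qed.

End Integral.

Section Invariance.
Variables (R : realType) (n : nat) (sigma : probability (borel_rV R n) R).
Hypothesis hsigma : uniform_sphere sigma.
Notation pt := (pt R n).

Lemma sigma_mass : sigma (@sphere R n) = 1%:E.
Proof. by case: hsigma. Qed.

(** A change of variables: by invariance, the pushforward of [sigma] under x |-> x U is [sigma]
    itself. *)
Lemma Int_mulp (U : 'M[R]_n) (hU : U *m U^T = 1%:M) (g : pt -> R) : cont g ->
  Int sigma (fun p => g (mulp hU p)) = Int sigma g.
Proof.
move=> cg; case: hsigma => _ inv.
pose phi : borel_rV R n -> borel_rV R n := fun x => (x : 'rV[R]_n) *m U.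
have mphi : measurable_fun [set: borel_rV R n] phi.
  apply: (@measurability _ _ (borel_rV R n) (borel_rV R n) setT phi (@open 'rV[R]_n) erefl).
  move=> _ [A oA <-]; rewrite setTI; apply: open_borel.
  exact: (continuousP _).1 (@mulmx_continuous R n U) _ oA.
have S : phi @^-1` (@sphere R n) = (@sphere R n).
  apply/seteqP; split => x; rewrite /preimage /= => /sphereP h; apply/sphereP; move: h;
    by rewrite edot_mulmx.
rewrite Int.unlock /Rintegral; congr fine.
rewrite -[RHS](@eq_measure_integral _ _ _ _ _ (pushforward sigma phi)); last first.
  by move=> A mA _; rewrite /pushforward; exact: inv.
rewrite integral_pushforward //.
- rewrite S; apply: eq_integral => x; rewrite inE => hx /=; congr EFin.
  have hx' : sphere (phi x) by move: hx; rewrite -{1}S.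
  rewrite (ext_mkpt _ hx) (ext_mkpt _ hx'); congr g; exact: vec_inj.
- by apply/measurable_realfun.measurable_EFinP; exact: measurable_ext.
- rewrite S; have := integrable_ext sigma_mass (@cont_mulp _ _ U hU g cg); apply: eq_integrable.
    exact: measurable_sphere.
  move=> x; rewrite inE => hx /=; congr EFin.
  have hx' : sphere (phi x) by move: hx; rewrite -{1}S.
  rewrite (ext_mkpt _ hx) (ext_mkpt _ hx'); congr g; exact: vec_inj.
- exact: measurable_sphere.
Qed.

End Invariance.

Definition rot (R : realType) (n : nat) (a : 'I_n * 'I_n) (t : R) : pt R n -> pt R n :=
  mulp (rotmx_orth a.1 a.2 t).

(** With a = (i, j) this is the field x_i d_j - x_j d_i, taken as the derivative along its flow, so
    that functions need only be defined on the sphere. *)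
HB.lock Definition L (R : realType) (n : nat) (a : 'I_n * 'I_n) (g : pt R n -> R) :
  pt R n -> R := fun p => 'D_1 (fun t => g (rot a t p)) (0 : R).

(** * Rotation fields and smooth functions *)

Section Derivations.
Variables (R : realType) (n : nat).
Notation V := 'rV[R]_n.
Notation pt := (pt R n).
Notation idx := ('I_n * 'I_n)%type.
Implicit Types (g h : pt -> R) (p q : pt) (a : idx) (I : seq idx).

Lemma rot0 a p : rot a 0 p = p.
Proof. by apply: vec_inj; rewrite vec_mulp rotmx0 mulmx1. Qed.

Lemma rotD a s t p : rot a t (rot a s p) = rot a (s + t) p.
Proof. by apply: vec_inj; rewrite !vec_mulp -mulmxA rotmxD. Qed.

Lemma cont_rot a t g : cont g -> cont (fun p => g (rot a t p)).
Proof. exact: cont_mulp. Qed.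

Definition LL I g := foldr (@L R n) g I.

(* Records, so that unification does not unfold them. *)
Record dd g : Prop := Dd { ddP : forall a p, derivable (fun t => g (rot a t p)) (0 : R) 1 }.
Record sm g : Prop := Sm { smP : forall I, cont (LL I g) /\ dd (LL I g) }.

Lemma is_L g a p : dd g -> is_derive (0 : R) 1 (fun t => g (rot a t p)) (L a g p).
Proof. by move=> dg; rewrite L.unlock; apply: derivableP; exact: (ddP dg). Qed.

(** The group law [rotD] turns a derivative at time t into one at time 0 from the rotated point. *)
Lemma is_L_at g a p (t : R) : dd g ->
  is_derive t 1 (fun s => g (rot a s p)) (L a g (rot a t p)).
Proof.
move=> dg; have h : is_derive (t - t) 1 (fun u : R => g (rot a u (rot a t p)))
    (L a g (rot a t p)) by rewrite subrr; exact: is_L.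
have k : is_derive t 1 (fun s : R => s - t) 1.
  by rewrite -[X in is_derive _ _ _ X]subr0; exact: is_deriveB.
have := @is_derive1_comp _ _ (fun s : R => s - t) _ _ _ h k; rewrite mulr1.
rewrite (_ : _ \o _ = (fun s => g (rot a s p))) //.
by apply/funext => s /=; rewrite rotD addrC subrK.
Qed.

Lemma L_val g a p d : is_derive (0 : R) 1 (fun t => g (rot a t p)) d -> L a g p = d.
Proof. by move=> h; rewrite L.unlock derive_val. Qed.

Lemma sm_cont g : sm g -> cont g.
Proof. by case=> /(_ [::])[]. Qed.

Lemma sm_dd g : sm g -> dd g.
Proof. by case=> /(_ [::])[]. Qed.

Lemma LL_rcons I a g : LL (rcons I a) g = LL I (L a g).
Proof. by rewrite /LL foldr_rcons. Qed.

Lemma LL_cat I I' g : LL (I ++ I') g = LL I (LL I' g).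
Proof. by rewrite /LL foldr_cat. Qed.

Lemma sm_L g a : sm g -> sm (L a g).
Proof. by case=> sg; split=> I; rewrite -LL_rcons. Qed.

Lemma sm_LL g I : sm g -> sm (LL I g).
Proof. by move=> sg; elim: I => //= a I IH; exact: sm_L. Qed.

Lemma L_ddD g h a p : dd g -> dd h ->
  is_derive (0 : R) 1 (fun t => g (rot a t p) + h (rot a t p)) (L a g p + L a h p).
Proof. by move=> dg dh; exact: is_deriveD (is_L a p dg) (is_L a p dh). Qed.

Lemma L_ddM g h a p : dd g -> dd h ->
  is_derive (0 : R) 1 (fun t => g (rot a t p) * h (rot a t p))
    (L a g p * h p + g p * L a h p).
Proof.
move=> dg dh; apply: is_derive_eq; first exact: is_deriveM (is_L a p dg) (is_L a p dh).
by rewrite /= !rot0 /GRing.scale /=; ring.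
Qed.

Lemma L_ddcomp (F : R -> R) d g a p : dd g -> is_derive (g p) 1 F d ->
  is_derive (0 : R) 1 (fun t => F (g (rot a t p))) (d * L a g p).
Proof.
move=> dg dF; apply: (is_derive1_comp (g := fun t => g (rot a t p))); last exact: is_L.
by rewrite rot0.
Qed.

Lemma LD g h a : dd g -> dd h -> L a (fun p => g p + h p) = fun p => L a g p + L a h p.
Proof. by move=> dg dh; apply/funext => p; apply/L_val/L_ddD. Qed.

Lemma LM g h a : dd g -> dd h ->
  L a (fun p => g p * h p) = fun p => L a g p * h p + g p * L a h p.
Proof. by move=> dg dh; apply/funext => p; apply/L_val/L_ddM. Qed.

Lemma L_cst c a : L a (fun _ : pt => c) = fun=> 0.
Proof. by apply/funext => p; apply/L_val; exact: is_derive_cst. Qed.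

Lemma dd_cst c : dd (fun _ : pt => c).
Proof. by split=> a p; exact: derivable_cst. Qed.

Lemma ddD g h : dd g -> dd h -> dd (fun p => g p + h p).
Proof. by move=> dg dh; split=> a p; case: (L_ddD a p dg dh). Qed.

Lemma ddM g h : dd g -> dd h -> dd (fun p => g p * h p).
Proof. by move=> dg dh; split=> a p; case: (L_ddM a p dg dh). Qed.

(* Smoothness of all orders is obtained by exhibiting a set of functions whose
   derivatives are polynomial expressions in the set. *)
Inductive alg (B : (pt -> R) -> Prop) : (pt -> R) -> Prop :=
| alg_base g : B g -> alg B g
| alg_cst c : alg B (fun=> c)
| alg_add g h : alg B g -> alg B h -> alg B (fun p => g p + h p)
| alg_mul g h : alg B g -> alg B h -> alg B (fun p => g p * h p).

Lemma alg_sub (B C : (pt -> R) -> Prop) g : (forall h, B h -> C h) -> alg B g -> alg C g.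
Proof.
by move=> BC; elim=> *; [apply/alg_base/BC|exact: alg_cst|exact: alg_add|exact: alg_mul].
Qed.

Lemma sm_alg (B : (pt -> R) -> Prop) :
  (forall b : pt -> R, B b -> [/\ cont b, dd b & forall a, alg B (L a b)]) ->
  forall g, alg B g -> sm g.
Proof.
move=> hB.
have step g : alg B g -> [/\ cont g, dd g & forall a, alg B (L a g)].
  elim=> {g} [b /hB //|c|g h _ [cg dg ag] _ [ch dh ah]|g h Bg [cg dg ag] Bh [ch dh ah]].
  - by split=> [||a]; [exact: cont_cst|exact: dd_cst|rewrite L_cst; exact: alg_cst].
  - by split=> [||a]; [exact: contD|exact: ddD|rewrite LD //; exact: alg_add].
  - split=> [||a]; [exact: contM|exact: ddM|rewrite LM //].
    by apply: alg_add; apply: alg_mul.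
have w I g : alg B g -> alg B (LL I g).
  by elim: I => //= a I IH /IH; move/step => -[].
by move=> g Bg; split=> I; have [] := step _ (w I g Bg).
Qed.

Lemma alg_sm g : alg sm g -> sm g.
Proof.
apply: sm_alg => b sb; split=> [||a]; [exact: sm_cont|exact: sm_dd|].
by apply: alg_base; exact: sm_L.
Qed.

Lemma sm_cst c : sm (fun _ : pt => c).
Proof. by apply: alg_sm; exact: alg_cst. Qed.

Lemma smD g h : sm g -> sm h -> sm (fun p => g p + h p).
Proof. by move=> sg sh; apply: alg_sm; apply: alg_add; exact: alg_base. Qed.

Lemma smM g h : sm g -> sm h -> sm (fun p => g p * h p).
Proof. by move=> sg sh; apply: alg_sm; apply: alg_mul; exact: alg_base. Qed.

Lemma smZ c g : sm g -> sm (fun p => c * g p).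
Proof. by apply: smM; exact: sm_cst. Qed.

Lemma smN g : sm g -> sm (fun p => - g p).
Proof. by move=> sg; under eq_fun do rewrite -mulN1r; exact: smZ. Qed.

Lemma smB g h : sm g -> sm h -> sm (fun p => g p - h p).
Proof. by move=> sg sh; apply: smD => //; exact: smN. Qed.

Lemma smX k g : sm g -> sm (fun p => g p ^+ k).
Proof.
move=> sg; elim: k => [|k IH]; first exact: sm_cst.
by under eq_fun do rewrite exprS; exact: smM.
Qed.

Lemma sm_sum (J : Type) (r : seq J) (P : pred J) (G : J -> pt -> R) :
  (forall i, sm (G i)) -> sm (fun p => \sum_(i <- r | P i) G i p).
Proof.
move=> sG; elim: r => [|i r IH].
  by under eq_fun do rewrite big_nil; exact: sm_cst.
under eq_fun do rewrite big_cons; case: (P i) => //; exact: smD.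
Qed.

Lemma LZ c g a : sm g -> L a (fun p => c * g p) = fun p => c * L a g p.
Proof.
move=> sg; rewrite (LM a (dd_cst c) (sm_dd sg)) L_cst; apply/funext => p.
by rewrite mul0r add0r.
Qed.

Lemma LN g a : sm g -> L a (fun p => - g p) = fun p => - L a g p.
Proof.
move=> sg; under eq_fun do rewrite -mulN1r; rewrite LZ //.
by apply/funext => p; rewrite mulN1r.
Qed.

Lemma LB g h a : sm g -> sm h -> L a (fun p => g p - h p) = fun p => L a g p - L a h p.
Proof. by move=> sg sh; rewrite (LD _ (sm_dd sg) (sm_dd (smN sh))) LN. Qed.

Lemma L_sum (J : Type) (r : seq J) (P : pred J) (G : J -> pt -> R) a :
  (forall i, sm (G i)) ->
  L a (fun p => \sum_(i <- r | P i) G i p) = fun p => \sum_(i <- r | P i) L a (G i) p.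
Proof.
move=> sG; elim: r => [|i r IH].
  under eq_fun do rewrite big_nil.
  by rewrite L_cst; apply/funext => p; rewrite big_nil.
under eq_fun do rewrite big_cons; under [RHS]eq_fun do rewrite big_cons.
case: (P i) => //; rewrite LD ?IH //; first exact: sm_dd.
exact/sm_dd/sm_sum.
Qed.

Lemma L_comp (F dF : R -> R) g a : (forall p, is_derive (g p) 1 F (dF (g p))) -> dd g ->
  L a (fun p => F (g p)) = fun p => dF (g p) * L a g p.
Proof. by move=> hF dg; apply/funext => p; apply/L_val/L_ddcomp. Qed.

Lemma dd_comp (F dF : R -> R) g : (forall p, is_derive (g p) 1 F (dF (g p))) -> dd g ->
  dd (fun p => F (g p)).
Proof. by move=> hF dg; split=> a p; case: (L_ddcomp a dg (hF p)). Qed.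

Lemma L_expR g a : sm g -> L a (fun p => expR (g p)) = fun p => expR (g p) * L a g p.
Proof. by move=> /sm_dd; apply: L_comp => p; exact: is_derive_expR. Qed.

(** [sm_alg] for the smooth functions together with e^g itself: the derivative e^g L g remains in
    the algebra. The inverse is treated below in the same way. *)
Lemma sm_expR g : sm g -> sm (fun p => expR (g p)).
Proof.
move=> sg; pose B h := sm h \/ h = fun p => expR (g p).
apply: (@sm_alg B); last by apply: alg_base; right.
move=> b [sb|->]; split=> [||a].
- exact: sm_cont.
- exact: sm_dd.
- by apply: alg_base; left; exact: sm_L.
- exact/cont_expR/sm_cont.
- by apply: (dd_comp (dF := expR)); exact: sm_dd.
- rewrite L_expR //; apply: alg_mul; apply: alg_base; first by right.
  by left; exact: sm_L.
Qed.

Lemma is_derive_inv (x : R) : x != 0 -> is_derive x 1 (fun y : R => y^-1) (- x ^- 2).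
Proof.
move=> x0; apply: is_derive_eq; first exact: is_deriveV.
by rewrite /GRing.scale /= mulr1.
Qed.

Lemma L_inv g a : (forall p, g p != 0) -> sm g ->
  L a (fun p => (g p)^-1) = fun p => - (g p) ^- 2 * L a g p.
Proof.
move=> g0 /sm_dd dg; apply: (L_comp (F := fun x => x^-1) (dF := fun x => - x ^- 2)) => // p.
exact: is_derive_inv.
Qed.

Lemma sm_inv g : (forall p, g p != 0) -> sm g -> sm (fun p => (g p)^-1).
Proof.
move=> g0 sg; pose B h := sm h \/ h = fun p => (g p)^-1.
apply: (@sm_alg B); last by apply: alg_base; right.
move=> b [sb|->]; split=> [||a].
- exact: sm_cont.
- exact: sm_dd.
- by apply: alg_base; left; exact: sm_L.
- by apply: cont_inv => //; exact: sm_cont.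
- apply: (dd_comp (F := fun x => x^-1) (dF := fun x => - x ^- 2)); last exact: sm_dd.
  by move=> p; exact: is_derive_inv.
- rewrite L_inv //.
  have -> : (fun p => - (g p) ^- 2 * L a g p) =
            (fun p => (-1 * ((g p)^-1 * (g p)^-1)) * L a g p).
    by apply/funext => p; rewrite expr2 invfM mulN1r.
  have al : alg B (fun p => (g p)^-1) by apply: alg_base; right.
  apply: alg_mul; last by apply: alg_base; left; exact: sm_L.
  by apply: alg_mul; [exact: alg_cst|exact: alg_mul].
Qed.

Lemma L_ln g a : (forall p, 0 < g p) -> sm g ->
  L a (fun p => ln (g p)) = fun p => (g p)^-1 * L a g p.
Proof.
move=> g0 /sm_dd; apply: (L_comp (F := @ln R) (dF := fun x => x^-1)) => p.
exact: is_derive1_ln.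
Qed.

(** The innermost field of a word acts first and turns ln g into g^-1 L g, already known to be
    smooth. *)
Lemma sm_ln g : (forall p, 0 < g p) -> sm g -> sm (fun p => ln (g p)).
Proof.
move=> g0 sg; have dl : dd (fun p => ln (g p)).
  apply: (dd_comp (F := @ln R) (dF := fun x => x^-1)); last exact: sm_dd.
  by move=> p; exact: is_derive1_ln.
split=> I; case/lastP: I => [|I a]; first by split=> //; exact/cont_ln/sm_cont.
suff [h] : sm (L a (fun p => ln (g p))) by rewrite LL_rcons; exact: h.
rewrite L_ln //; apply: (@smM (fun p => (g p)^-1)); last exact: sm_L.
by apply: sm_inv => // p; exact: lt0r_neq0.
Qed.

(** The image of v under the infinitesimal rotation, chosen so that [L a (lin v)] is
    [lin (lskew a v)]: linear functions are stable under all fields. *)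
Definition lskew a (v : V) : V := v 0 a.2 *: delta_mx 0 a.1 - v 0 a.1 *: delta_mx 0 a.2.

Lemma edot_delta (x : V) i : edot x (delta_mx 0 i) = x 0 i.
Proof.
rewrite /edot (bigD1 i) //= big1 ?addr0 => [|k /negPf ki]; rewrite mxE eqxx /= ?eqxx ?mulr1 //.
by rewrite ki mulr0.
Qed.

Lemma lin_lskew a v p : lin (lskew a v) p = v 0 a.2 * vec p 0 a.1 - v 0 a.1 * vec p 0 a.2.
Proof. by rewrite /lin /lskew edotDr edotNr !edotZr !edot_delta. Qed.

Lemma is_L_lin a v p : is_derive (0 : R) 1 (fun t => lin v (rot a t p)) (lin (lskew a v) p).
Proof.
have -> : (fun t => lin v (rot a t p)) = fun t =>
    lin v p + sin t * edot (vec p *m skew R a.1 a.2) v +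
    (1 - cos t) * edot (vec p *m (skew R a.1 a.2 *m skew R a.1 a.2)) v.
  apply/funext => t; rewrite /lin vec_mulp /rotmx; move: (skew _ _ _) => A.
  by rewrite !mulmxDr mulmx1 -!scalemxAr !edotDl !edotZl.
apply: is_derive_eq.
rewrite /GRing.scale /= sin0 cos0 lin_lskew mul_skew edotDl edotNl !edotZl.
rewrite !(edotC (delta_mx _ _)) !edot_delta; ring.
Qed.

Lemma L_lin a v : L a (lin v) = lin (lskew a v).
Proof. by apply/funext => p; apply/L_val/is_L_lin. Qed.

Lemma sm_lin v : sm (lin v).
Proof.
pose B h := exists w : V, h = lin w.
apply: (@sm_alg B); last by apply: alg_base; exists v.
move=> _ [w ->]; split=> [||a]; first exact: cont_lin.
  by split=> a p; case: (is_L_lin a w p).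
by rewrite L_lin; apply: alg_base; eexists.
Qed.

(** Carre du champ, and below it the Laplace-Beltrami operator as a sum of squares of rotation
    fields. The pairs (i, j) and (j, i) give opposite fields, hence the factor 1/2. *)
Definition Gam g h : pt -> R := fun p => 2^-1 * \sum_a L a g p * L a h p.
Definition Lap g : pt -> R := fun p => 2^-1 * \sum_a L a (L a g) p.

Lemma GamC g h : Gam g h = Gam h g.
Proof. by apply/funext => p; congr (_ * _); apply: eq_bigr => a _; rewrite mulrC. Qed.

Lemma sm_Gam g h : sm g -> sm h -> sm (Gam g h).
Proof. by move=> sg sh; apply: smZ; apply: sm_sum => a; apply: smM; exact: sm_L. Qed.

Lemma sm_Lap g : sm g -> sm (Lap g).
Proof. by move=> sg; apply: smZ; apply: sm_sum => a; do 2 apply: sm_L. Qed.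

Lemma Gam_ge0 g p : 0 <= Gam g g p.
Proof. by rewrite mulr_ge0 // ?invr_ge0 // sumr_ge0 // => a _; rewrite -expr2 sqr_ge0. Qed.

Lemma GamMl g h k : sm g -> sm h -> forall p,
  Gam (fun q => g q * h q) k p = g p * Gam h k p + h p * Gam g k p.
Proof.
move=> sg sh p; rewrite /Gam !(mulrCA _ 2^-1) -mulrDr; congr (_ * _).
rewrite !mulr_sumr -big_split; apply: eq_bigr => a _ /=.
rewrite (LM _ (sm_dd sg) (sm_dd sh)); ring.
Qed.

Lemma GamDl g h k : sm g -> sm h -> forall p,
  Gam (fun q => g q + h q) k p = Gam g k p + Gam h k p.
Proof.
move=> sg sh p; rewrite /Gam -mulrDr; congr (_ * _).
rewrite -big_split; apply: eq_bigr => a _ /=.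
by rewrite (LD _ (sm_dd sg) (sm_dd sh)) mulrDl.
Qed.

Lemma GamZl c g k : sm g -> forall p, Gam (fun q => c * g q) k p = c * Gam g k p.
Proof.
move=> sg p; rewrite /Gam mulrCA; congr (_ * _).
by rewrite mulr_sumr; apply: eq_bigr => a _ /=; rewrite LZ // mulrA.
Qed.

Lemma GamBl g h k : sm g -> sm h -> forall p,
  Gam (fun q => g q - h q) k p = Gam g k p - Gam h k p.
Proof.
move=> sg sh p; rewrite (GamDl _ sg (smN sh)); congr (_ + _).
rewrite -mulN1r -GamZl //; congr (Gam _ _ _); apply/funext => q; by rewrite mulN1r.
Qed.

Lemma Gam_cstl c k : Gam (fun _ : pt => c) k = fun=> 0.
Proof.
apply/funext => p; rewrite /Gam big1 ?mulr0 // => a _.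
by rewrite L_cst mul0r.
Qed.

Lemma Gam_comp (F dF : R -> R) g k : (forall p, is_derive (g p) 1 F (dF (g p))) -> sm g ->
  forall p, Gam (fun q => F (g q)) k p = dF (g p) * Gam g k p.
Proof.
move=> hF sg p; rewrite /Gam mulrCA; congr (_ * _).
rewrite mulr_sumr; apply: eq_bigr => a _ /=.
by rewrite (L_comp a hF (sm_dd sg)) mulrA.
Qed.

Lemma LapD g h : sm g -> sm h -> forall p, Lap (fun q => g q + h q) p = Lap g p + Lap h p.
Proof.
move=> sg sh p; rewrite /Lap -mulrDr; congr (_ * _).
rewrite -big_split; apply: eq_bigr => a _ /=.
by rewrite !LD //; apply: sm_dd => //; exact: sm_L.
Qed.

Lemma LapZ c g : sm g -> forall p, Lap (fun q => c * g q) p = c * Lap g p.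
Proof.
move=> sg p; rewrite /Lap mulrCA; congr (_ * _).
rewrite mulr_sumr; apply: eq_bigr => a _ /=.
by rewrite !LZ //; exact: sm_L.
Qed.

Lemma LapB g h : sm g -> sm h -> forall p, Lap (fun q => g q - h q) p = Lap g p - Lap h p.
Proof.
move=> sg sh p; rewrite (LapD sg (smN sh)); congr (_ + _).
rewrite -mulN1r -LapZ //; congr (Lap _ _); apply/funext => q; by rewrite mulN1r.
Qed.

Lemma Lap_sum (J : Type) (r : seq J) (P : pred J) (G : J -> pt -> R) p :
  (forall i, sm (G i)) ->
  Lap (fun p => \sum_(i <- r | P i) G i p) p = \sum_(i <- r | P i) Lap (G i) p.
Proof.
move=> sG; rewrite /Lap -mulr_sumr exchange_big; congr (_ * _); apply: eq_bigr => a _ /=.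
by rewrite !L_sum // => i; exact: sm_L.
Qed.

Lemma LapM g h : sm g -> sm h -> forall p,
  Lap (fun q => g q * h q) p = g p * Lap h p + h p * Lap g p + 2 * Gam g h p.
Proof.
move=> sg sh p; rewrite /Lap /Gam !(mulrCA _ 2^-1) -!mulrDr; congr (_ * _).
rewrite !mulr_sumr -!big_split; apply: eq_bigr => a _ /=.
have sa (u : pt -> R) : sm u -> dd (L a u) by move=> su; exact/sm_dd/sm_L.
rewrite (LM a (sm_dd sg) (sm_dd sh)) LD ?LM //; try exact: sm_dd; try exact: sa.
- ring.
- by apply: ddM; [exact: sa|exact: sm_dd].
- by apply: ddM; [exact: sm_dd|exact: sa].
Qed.

Lemma Lap_comp (F dF ddF : R -> R) g : (forall p, is_derive (g p) 1 F (dF (g p))) ->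
  (forall p, is_derive (g p) 1 dF (ddF (g p))) -> sm g ->
  forall p, Lap (fun q => F (g q)) p = dF (g p) * Lap g p + ddF (g p) * Gam g g p.
Proof.
move=> hF hdF sg p; rewrite /Lap /Gam !(mulrCA _ 2^-1) -!mulrDr; congr (_ * _).
rewrite !mulr_sumr -!big_split; apply: eq_bigr => a _ /=.
rewrite (L_comp a hF (sm_dd sg)) LM ?(L_comp a hdF (sm_dd sg)).
- ring.
- exact: (dd_comp hdF (sm_dd sg)).
- exact/sm_dd/sm_L.
Qed.

Lemma sum_idx (F : 'I_n -> 'I_n -> R) : \sum_(a : idx) F a.1 a.2 = \sum_i \sum_j F i j.
Proof. by rewrite pair_bigA. Qed.

(** Lagrange's identity with |p| = 1: the double sum is twice |p|^2 (v . w) - (p . v) (p . w). *)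
Lemma Gam_lin v w p : Gam (lin v) (lin w) p = edot v w - lin v p * lin w p.
Proof.
rewrite /Gam; under eq_bigr do rewrite !L_lin !lin_lskew.
rewrite (sum_idx (fun i j => (v 0 j * vec p 0 i - v 0 i * vec p 0 j) *
  (w 0 j * vec p 0 i - w 0 i * vec p 0 j))).
have E (x y x' y' : V) :
    edot x y * edot x' y' = \sum_i \sum_j (x 0 i * y 0 i) * (x' 0 j * y' 0 j).
  by rewrite /edot big_distrlr.
suff -> : \sum_i \sum_j (v 0 j * vec p 0 i - v 0 i * vec p 0 j) *
     (w 0 j * vec p 0 i - w 0 i * vec p 0 j) =
   edot (vec p) (vec p) * edot v w + edot v w * edot (vec p) (vec p)
   - edot (vec p) v * edot (vec p) w - edot (vec p) w * edot (vec p) v.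
  by rewrite edot_vec /lin; field.
rewrite !E -!sumrN -!big_split; apply: eq_bigr => i _ /=.
rewrite -!sumrN -!big_split; apply: eq_bigr => j _ /=; ring.
Qed.

Lemma Lap_lin v p : Lap (lin v) p = - (n%:R - 1) * lin v p.
Proof.
rewrite /Lap; under eq_bigr do rewrite !L_lin lin_lskew /lskew !mxE !eqxx /=.
(* The indicator comes from the entries of the basis vectors. It makes the terms with equal indices
   cancel, as they must since those fields are zero. *)
rewrite (eq_bigr (fun a : idx => (a.1 == a.2)%:R * (v 0 a.2 * vec p 0 a.1 + v 0 a.1 * vec p 0 a.2)
  - (v 0 a.1 * vec p 0 a.1 + v 0 a.2 * vec p 0 a.2))); last first.
  by move=> [i j] _ /=; rewrite (eq_sym j i); ring.
rewrite (sum_idx (fun i j => (i == j)%:R * (v 0 j * vec p 0 i + v 0 i * vec p 0 j)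
  - (v 0 i * vec p 0 i + v 0 j * vec p 0 j))).
rewrite (eq_bigr (fun i => 2 * (vec p 0 i * v 0 i) - (n%:R * (vec p 0 i * v 0 i) + lin v p))).
  rewrite sumrB big_split /= -!mulr_sumr sumr_const card_ord -/(edot (vec p) v) -/(lin v p).
  by rewrite -mulr_natl; field.
move=> i _; rewrite sumrB big_split /= sumr_const card_ord (bigD1 i) //= eqxx big1.
  rewrite addr0 mul1r -mulr_natl; congr (_ - (_ + _)); try ring.
  by apply: eq_bigr => k _; rewrite mulrC.
by move=> k /negPf ki; rewrite eq_sym ki mul0r.
Qed.

End Derivations.

(** [smt] and [cnt] read smoothness and continuity off the shape of a function. The tactics on
    integrals use [cnt] for their side conditions. *)
Ltac smt := repeat first
  [ assumption | simple apply sm_cst | simple apply sm_lin | simple apply sm_L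
  | simple apply sm_LL | simple apply sm_Lap | simple apply sm_Gam
  | simple apply smX | simple apply sm_expR
  | simple apply smD | simple apply smN | simple apply smM
  | (simple apply sm_sum; intros) ].
Ltac cnt := repeat first
  [ assumption | (simple apply sm_cont; solve [smt]) | simple apply cont_cst | simple apply cont_lin
  | simple apply contX | simple apply cont_expR | simple apply cont_norm
  | simple apply contD | simple apply contN | simple apply contM
  | (simple apply cont_sum; intros) ].

Ltac intD h := rewrite (IntD h); [|by cnt|by cnt].
Ltac intB h := rewrite (IntB h); [|by cnt|by cnt].
Ltac intZ h := rewrite (IntZ h); last by cnt.
Ltac intD' h := rewrite -(IntD h); [|by cnt|by cnt].
Ltac intB' h := rewrite -(IntB h); [|by cnt|by cnt].
Ltac intZ' h := rewrite -(IntZ h); last by cnt.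
Ltac int_le h := apply: (Int_le h); [by cnt|by cnt|].

(** * Differentiation under the integral sign and integration by parts *)

Section Real_calculus.
Variable R : realType.

Lemma is_derive_pow (F : R -> R) k (x d : R) : is_derive x 1 F d ->
  is_derive x 1 (fun y => F y ^+ k.+1) (k.+1%:R * F x ^+ k * d).
Proof.
move=> hF; elim: k => [|k IH].
  by rewrite expr0 mulr1 mul1r; under eq_fun do rewrite expr1.
under eq_fun do rewrite exprS.
have H := @is_deriveM R R F (fun y => F y ^+ k.+1) x 1 _ _ hF IH.
have -> : k.+2%:R * F x ^+ k.+1 * d = F x *: (k.+1%:R * F x ^+ k * d) + F x ^+ k.+1 *: d.
  by rewrite /GRing.scale /= -[in LHS]natr1 exprS; ring.
exact: H.
Qed.

End Real_calculus.

Section Under_integral.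
Variables (R : realType) (n : nat) (mu : {measure set (borel_rV R n) -> \bar R}) (m : R).
Hypothesis mass : mu (@sphere R n) = m%:E.
Notation pt := (pt R n).

Lemma Int_derive (W dW : R -> pt -> R) (M e t0 : R) : 0 < e ->
  (forall t, `|t - t0| < e -> cont (W t)) ->
  (forall t p, `|t - t0| < e -> is_derive t 1 (W ^~ p) (dW t p)) ->
  (forall t p, `|t - t0| < e -> `|dW t p| <= M) ->
  is_derive t0 1 (fun t => Int mu (W t)) (Int mu (dW t0)).
Proof.
move=> e0 cW hW bW.
rewrite Int.unlock; pose f (t : R) (y : borel_rV R n) := ext (W t) y.
have inI t : `]t0 - e, t0 + e[%classic t -> `|t - t0| < e.
  by rewrite /= in_itv /= ltr_distl.
have It0 : `]t0 - e, t0 + e[%classic t0 by rewrite /= in_itv /= ltrBlDr !ltrDl e0.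
have hf t y (hy : sphere y) : `|t - t0| < e -> is_derive t 1 (f ^~ y) (dW t (mkpt hy)).
  by move=> ht; rewrite /f; under eq_fun do rewrite (ext_mkpt _ hy); exact: hW.
have i1 t : `]t0 - e, t0 + e[%classic t ->
   mu.-integrable (@sphere R n : set (borel_rV R n)) (EFin \o f t).
  by move=> /inI ht; apply: (integrable_ext mass); exact: cW.
have i2 t y : `]t0 - e, t0 + e[%classic t -> @sphere R n y -> derivable (f ^~ y) t 1.
  by move=> /inI ht hy; case: (hf t y hy ht).
(* The dominating constant has to be nonnegative on the whole space, whereas M is only known to
   bound values on the sphere. *)
have i3 t y : `]t0 - e, t0 + e[%classic t -> @sphere R n y ->
    `|partial1of2 f t y| <= Num.max M 0.
  move=> /inI ht hy; rewrite partial1of2E; have := hf t y hy ht => /@derive_val ->.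
  by rewrite le_max bW.
have i4 : mu.-integrable (@sphere R n : set (borel_rV R n)) (EFin \o (fun=> Num.max M 0)).
  have := integrable_ext mass (@cont_cst R n (Num.max M 0)); apply: eq_integrable => //.
    exact: measurable_sphere.
  by move=> x; rewrite inE => hx /=; rewrite (ext_mkpt _ hx).
have M0 (y : borel_rV R n) : 0 <= Num.max M 0 by rewrite le_max lexx orbT.
have dF := derivable_under_integral (measurable_sphere (n := n)) It0 i1 i2 M0 i4 i3.
have vF := differentiation_under_integral (measurable_sphere (n := n)) It0 i1 i2 M0 i4 i3.
set I0 := (X in is_derive _ _ _ X); set F0 := (X in is_derive _ _ X _).
rewrite (_ : I0 = 'D_1 F0 t0); first exact: derivableP.
rewrite -derive1E vF; apply: eq_Rintegral => y; rewrite inE => hy.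
rewrite partial1of2E (ext_mkpt _ hy); have := hf t0 y hy.
by rewrite subrr normr0 => /(_ e0) /@derive_val ->.
Qed.

End Under_integral.

Section By_parts.
Variables (R : realType) (n : nat) (sigma : probability (borel_rV R n) R).
Hypothesis hsigma : uniform_sphere sigma.
Notation pt := (pt R n).
Notation J := (Int sigma).
Let m1 := sigma_mass hsigma.
Implicit Types (g h : pt -> R) (p q x y : pt).

Lemma Int_rot a t g : cont g -> J (fun p => g (rot a t p)) = J g.
Proof. exact: Int_mulp. Qed.

Lemma Int_derive_rot h g a : cont h -> sm g ->
  is_derive (0 : R) 1 (fun t => J (fun p => h p * g (rot a t p))) (J (fun p => h p * L a g p)).
Proof.
move=> ch sg.
have [M hM] := cont_bounded (sm_cont (sm_L a sg)); have [N hN] := cont_bounded ch.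
have := @Int_derive R n sigma 1 m1 (fun t p => h p * g (rot a t p))
  (fun t p => h p * L a g (rot a t p)) (N * M) 1 0 ltr01.
have E : (fun p => h p * L a g (rot a 0 p)) = (fun p => h p * L a g p).
  by apply/funext => p; rewrite rot0.
rewrite E; apply.
- by move=> t _; apply: contM => //; apply: cont_rot; exact: sm_cont.
- move=> t p _; apply: is_derive_eq; first exact: (is_deriveZ (h p) (is_L_at a p t (sm_dd sg))).
  by [].
- by move=> t p _; rewrite normrM ler_pM.
Qed.

(** The integral of g at rotated points does not depend on the angle, so its derivative in the angle
    vanishes. *)
Lemma Int_L g a : sm g -> J (L a g) = 0.
Proof.
move=> sg; have := Int_derive_rot a (@cont_cst R n 1) sg.
rewrite (_ : (fun t => _) = fun=> J g); last first.
  apply/funext => t; rewrite -(Int_rot a t (sm_cont sg)); apply: Int_eq => p.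
  by rewrite mul1r.
move=> /@derive_val; rewrite derive_cst => ->; apply: Int_eq => p; by rewrite mul1r.
Qed.

Lemma Int_parts g h a : sm g -> sm h ->
  J (fun p => g p * L a h p) = - J (fun p => L a g p * h p).
Proof.
move=> sg sh; have := Int_L a (smM sg sh); rewrite (LM _ (sm_dd sg) (sm_dd sh)).
rewrite (IntD m1); [lra|by cnt|by cnt].
Qed.

Lemma Int_Gam g h : sm g -> sm h -> J (fun p => g p * Lap h p) = - J (Gam g h).
Proof.
move=> sg sh; rewrite /Lap /Gam.
have c1 a : cont (fun p => L a g p * L a h p) by apply: contM; apply: sm_cont; exact: sm_L.
have c2 a : cont (fun p => g p * L a (L a h) p).
  by apply: contM; apply: sm_cont => //; do 2 apply: sm_L.
intZ m1.
rewrite (Int_sum m1) // -mulrN -sumrN.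
transitivity (J (fun p => 2^-1 * \sum_a g p * L a (L a h) p)).
  by apply: Int_eq => p; rewrite mulrCA mulr_sumr.
intZ m1.
rewrite (Int_sum m1) //; congr (_ * _); apply: eq_bigr => a _.
by rewrite Int_parts //; exact: sm_L.
Qed.

Lemma Int_Lap_sym g h : sm g -> sm h -> J (fun p => g p * Lap h p) = J (fun p => Lap g p * h p).
Proof.
move=> sg sh; rewrite Int_Gam // GamC -Int_Gam //; apply: Int_eq => p; by rewrite mulrC.
Qed.

Lemma Int_Lap g : sm g -> J (Lap g) = 0.
Proof.
move=> sg; have := Int_Gam (@sm_cst R n 1) sg; rewrite Gam_cstl (Int_cst m1) mul0r oppr0 => <-.
by apply: Int_eq => p; rewrite mul1r.
Qed.

Lemma Cauchy_Schwarz g h : cont g -> cont h ->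
  J (fun p => g p * h p) ^+ 2 <= J (fun p => g p ^+ 2) * J (fun p => h p ^+ 2).
Proof.
move=> cg ch.
set A := J (fun p => g p ^+ 2); set B := J (fun p => g p * h p); set C := J (fun p => h p ^+ 2).
have key (s t : R) : 0 <= s ^+ 2 * A + 2 * (s * t) * B + t ^+ 2 * C.
  have -> : s ^+ 2 * A + 2 * (s * t) * B + t ^+ 2 * C = J (fun p => (s * g p + t * h p) ^+ 2).
    rewrite /A /B /C -!(IntZ m1) -?(IntD m1); try by cnt.
    by apply: Int_eq => p; ring.
  by apply: Int_ge0 => p; exact: sqr_ge0.
have A0 : 0 <= A by apply: Int_ge0 => p; exact: sqr_ge0.
have C0 : 0 <= C by apply: Int_ge0 => p; exact: sqr_ge0.
have [CE|Cp] := eqVneq C 0.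
  have [->|B0] := eqVneq B 0; first by rewrite expr0n mulr_ge0.
  (* For C = 0 the form is affine in its second argument, and this value makes it equal to -1. *)
  have := key 1 (- (A + 1) / (2 * B)); rewrite CE.
  have -> : 1 ^+ 2 * A + 2 * (1 * (- (A + 1) / (2 * B))) * B + (- (A + 1) / (2 * B)) ^+ 2 * 0 = -1.
    by field.
  by rewrite ler0N1.
have {}C0 : 0 < C by rewrite lt0r Cp.
have := key C (- B).
have -> : C ^+ 2 * A + 2 * (C * - B) * B + (- B) ^+ 2 * C = C * (A * C - B ^+ 2) by ring.
by rewrite pmulr_rge0 // subr_ge0.
Qed.

Definition nrm2 g : R := J (fun p => g p ^+ 2).

Lemma nrm2_ge0 g : 0 <= nrm2 g.
Proof. by apply: Int_ge0 => p; exact: sqr_ge0. Qed.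

Lemma CS_sqrt g h : cont g -> cont h ->
  `|J (fun p => g p * h p)| <= Num.sqrt (nrm2 g) * Num.sqrt (nrm2 h).
Proof.
move=> cg ch; rewrite -sqrtrM ?nrm2_ge0 // -sqrtr_sqr; apply: ler_wsqrtr.
exact: Cauchy_Schwarz.
Qed.

End By_parts.

(** The squared cosine of half the angle between x and y: it lies in [0, 1] and equals 1 only at y =
    x, so that its powers concentrate at x. *)
Definition uu (R : realType) (n : nat) (x y : pt R n) : R := (1 + lin (vec x) y) / 2.

(* The normalization of the kernel: cc N is the integral of uu x ^+ N. *)
Fixpoint cc (R : realType) (n : nat) N : R :=
  if N is N'.+1 then cc R n N' * ((N'%:R + (n%:R - 1) / 2) / (N'%:R + n%:R - 1)) else 1.

(** Averaging against the normalized N-th power of [uu]: a positive operator that preserves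
    constants, commutes with rotations and takes values in polynomials. *)
HB.lock Definition KK (R : realType) (n : nat) (sigma : probability (borel_rV R n) R)
  (N : nat) (g : pt R n -> R) : pt R n -> R :=
  fun x => (cc R n N)^-1 * Int sigma (fun y => uu x y ^+ N * g y).

(** * Polynomial kernels *)

Section Kernel.
Variables (R : realType) (n : nat) (sigma : probability (borel_rV R n) R).
Hypotheses (hn : (2 <= n)%N) (hsigma : uniform_sphere sigma).
Notation n1 := (n%:R - 1).
Notation V := 'rV[R]_n.
Notation pt := (pt R n).
Notation J := (Int sigma).
Let m1 := sigma_mass hsigma.
Implicit Types (g h : pt -> R) (p q x y : pt) (N : nat).
Notation lam := (lap_eigenvalue R n).
Notation cc := (cc R n).
Notation KK := (KK sigma).
Notation nrm2 := (nrm2 sigma).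

Lemma n_ge2 : 2 <= n%:R :> R.
Proof. by rewrite ler_nat. Qed.

Lemma lam0 : lam 0 = 0.
Proof. by rewrite /lap_eigenvalue mul0n. Qed.

Lemma lamS N : lam N.+1 = N.+1%:R * (N%:R + n%:R - 1).
Proof.
rewrite /lap_eigenvalue natrM; congr (_ * _).
have -> : (N.+1 + n - 2 = N + (n - 1))%N by move: hn; lia.
by rewrite natrD natrB ?addrA // ltnW.
Qed.

Lemma lam_ge N : N%:R ^+ 2 <= lam N.
Proof.
case: N => [|N]; first by rewrite lam0 expr0n.
rewrite lamS expr2 ler_pM2l ?ltr0n // -natr1.
by have := n_ge2; lra.
Qed.

Lemma lam_gt0 N : 0 < lam N.+1.
Proof. by apply: lt_le_trans (lam_ge _); rewrite exprn_gt0 // ltr0n. Qed.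

Lemma lam_ge0 N : 0 <= lam N.
Proof. by apply: le_trans (lam_ge _); rewrite sqr_ge0. Qed.

Lemma lam_inj : injective lam.
Proof.
move=> a b; rewrite /lap_eigenvalue => /eqP; rewrite eqr_nat => /eqP.
by have [|ab|ba] := ltngtP a b => //; move: hn; nia.
Qed.

Lemma lin_pt_le x y : `|lin (vec x) y| <= 1.
Proof. by apply: le_trans (lin_le _ _) _; rewrite (vec_sphere x : enorm _ = 1). Qed.

Lemma uu_ge0 x y : 0 <= uu x y.
Proof. by have := lin_pt_le x y; rewrite ler_norml /uu => /andP[? ?]; lra. Qed.

Lemma uu_le1 x y : uu x y <= 1.
Proof. by have := lin_pt_le x y; rewrite ler_norml /uu => /andP[? ?]; lra. Qed.

Lemma uu_rot a t x y : uu (rot a t x) (rot a t y) = uu x y.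
Proof. by rewrite /uu /lin !vec_mulp edot_mulmx // rotmx_orth. Qed.

Lemma sm_uu x : sm (uu x).
Proof. by rewrite /uu; smt. Qed.

Lemma sm_uuX N x : sm (fun y => uu x y ^+ N).
Proof. by apply: smX; exact: sm_uu. Qed.

Lemma cc_gt0 N : 0 < cc N.
Proof.
elim: N => //= N IH; rewrite mulr_gt0 // divr_gt0 //; have := n_ge2; have := ler0n R N; lra.
Qed.

(** For l = x . y the Laplacian of F(l) is - (n - 1) l F' + (1 - l^2) F'', and 1 - l^2 = 4 u (1 - u)
    for u = (1 + l) / 2. Only two consecutive powers of u occur, and all spectral information below
    comes from this relation. *)
Lemma Lap_uu N x y : Lap (fun y => uu x y ^+ N.+1) y =
  - lam N.+1 * uu x y ^+ N.+1 + N.+1%:R * (N%:R + n1 / 2) * uu x y ^+ N.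
Proof.
pose u (s : R) : R := (1 + s) / 2.
have du (s : R) : is_derive s 1 u 2^-1.
  have -> : u = (fun s => 2^-1 *: (1 + s)) by apply/funext => r; rewrite /u mulrC.
  apply: is_derive_eq; rewrite /GRing.scale /=; ring.
pose dF (s : R) := N.+1%:R * u s ^+ N * 2^-1.
(* For N = 0 the predecessor is 0, which is harmless since the factor [N%:R] vanishes. *)
pose ddF (s : R) := N.+1%:R * (N%:R * u s ^+ N.-1 * 2^-1) * 2^-1.
have h1 (s : R) : is_derive s 1 (fun s => u s ^+ N.+1) (dF s) by exact: is_derive_pow.
have h2 (s : R) : is_derive s 1 dF (ddF s).
  rewrite /dF /ddF; case: (N) => [|N'] /=.
    rewrite mul0r mul0r mulr0 mul0r; under eq_fun do rewrite expr0.
    exact: is_derive_cst.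
  have -> : (fun s => N'.+2%:R * u s ^+ N'.+1 / 2) =
            (fun s => (N'.+2%:R / 2) *: (u s ^+ N'.+1)).
    by apply/funext => r; rewrite /GRing.scale /= mulrAC.
  have H := is_deriveZ (N'.+2%:R / 2) (is_derive_pow N' (du s)).
  rewrite (_ : _ * _ / 2 = (N'.+2%:R / 2) *: (N'.+1%:R * u s ^+ N' / 2)) //.
  by rewrite /GRing.scale /= mulrAC.
rewrite -[LHS]/(Lap (fun q => (fun s => u s ^+ N.+1) (lin (vec x) q)) y).
rewrite (@Lap_comp R n _ dF ddF (lin (vec x))) //; last exact: sm_lin.
rewrite Lap_lin Gam_lin edot_vec lamS.
have -> : lin (vec x) y = 2 * uu x y - 1 by rewrite /uu; field.
have uE : u (2 * uu x y - 1) = uu x y by rewrite /u; field.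
rewrite /dF /ddF uE; case: (N) => [|N'] /=; first by rewrite expr0 expr1; field.
by rewrite -!natr1 !exprS; field.
Qed.

(** A Laplacian has integral 0; with [Lap_uu] this is the recursion that defines [cc]. *)
Lemma Int_uu N x : J (fun y => uu x y ^+ N) = cc N.
Proof.
elim: N => [|N IH]; first by rewrite (Int_cst m1) mulr1.
have := Int_Lap hsigma (sm_uuX N.+1 x).
rewrite (Int_eq _ (Lap_uu N x)).
have cu k : cont (fun y => uu x y ^+ k) by exact/sm_cont/sm_uuX.
rewrite (IntD m1) ?(IntZ m1) //; try exact: contZ.
rewrite IH lamS /=; set I := J _.
have n2 := n_ge2; have N0 := ler0n R N.
have N1 : N.+1%:R != 0 :> R by rewrite pnatr_eq0.
have d0 : N%:R + n%:R - 1 != 0 :> R by apply: lt0r_neq0; lra.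
move=> E.
have : N.+1%:R * ((N%:R + n%:R - 1) * I - (N%:R + n1 / 2) * cc N) = 0.
  by rewrite -[RHS]oppr0 -E; ring.
move/eqP; rewrite mulf_eq0 (negPf N1) /= subr_eq0 => /eqP E'.
apply: (mulfI d0); rewrite E'; field; lra.
Qed.

Lemma cont_uuX N x : cont (fun y => uu x y ^+ N).
Proof. exact/sm_cont/sm_uuX. Qed.

Lemma cont_uuM N x g : cont g -> cont (fun y => uu x y ^+ N * g y).
Proof. by move=> cg; apply: contM => //; exact: cont_uuX. Qed.

Lemma KK_cst N c x : KK N (fun=> c) x = c.
Proof.
rewrite KK.unlock (IntZr m1); last exact: cont_uuX.
by rewrite Int_uu mulrA mulVf ?mul1r // lt0r_neq0 // cc_gt0.
Qed.

Lemma KKD N g h x : cont g -> cont h -> KK N (fun y => g y + h y) x = KK N g x + KK N h x.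
Proof.
move=> cg ch; rewrite KK.unlock -mulrDr -(IntD m1); try exact: cont_uuM.
by congr (_ * _); apply: Int_eq => y; rewrite mulrDr.
Qed.

Lemma KKZ N c g x : cont g -> KK N (fun y => c * g y) x = c * KK N g x.
Proof.
move=> cg; rewrite KK.unlock (@Int_eq _ _ _ _ (fun y => c * (uu x y ^+ N * g y))).
  by rewrite (IntZ m1) 1?mulrCA //; exact: cont_uuM.
by move=> y; rewrite mulrCA.
Qed.

Lemma KKB N g h x : cont g -> cont h -> KK N (fun y => g y - h y) x = KK N g x - KK N h x.
Proof.
move=> cg ch; rewrite (KKD _ _ cg); last by split=> p; exact: (cvgN (ch p)).
congr (_ + _); rewrite -mulN1r -KKZ //; congr (KK _ _ _); apply/funext => y.
by rewrite mulN1r.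
Qed.

Lemma KK_sum N (I : Type) (r : seq I) (P : pred I) (G : I -> pt -> R) x :
  (forall i, cont (G i)) ->
  KK N (fun p => \sum_(i <- r | P i) G i p) x = \sum_(i <- r | P i) KK N (G i) x.
Proof.
move=> cG; elim: r => [|i r IH].
  rewrite big_nil -[RHS](KK_cst N 0 x); congr (KK _ _ _); apply/funext => y.
  by rewrite big_nil.
rewrite big_cons -IH.
have -> : (fun p => \sum_(j <- i :: r | P j) G j p) =
  (fun p => if P i then G i p + \sum_(j <- r | P j) G j p else \sum_(j <- r | P j) G j p).
  by apply/funext => y; rewrite big_cons.
by case: (P i) => //; rewrite KKD //; exact: cont_sum.
Qed.

Lemma KK_ge0 N g x : (forall y, 0 <= g y) -> 0 <= KK N g x.
Proof.
move=> g0; rewrite KK.unlock mulr_ge0 ?invr_ge0 ?(ltW (cc_gt0 _)) //.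
by apply: Int_ge0 => y; rewrite mulr_ge0 // exprn_ge0 // uu_ge0.
Qed.

Lemma KK_le N g h x : cont g -> cont h -> (forall y, g y <= h y) -> KK N g x <= KK N h x.
Proof.
move=> cg ch gh; rewrite -subr_ge0 -KKB //; apply: KK_ge0 => y; by rewrite subr_ge0.
Qed.

Lemma KK_bound N g (M : R) x : cont g -> (forall y, `|g y| <= M) -> `|KK N g x| <= M.
Proof.
move=> cg h; rewrite ler_norml -{1}(KK_cst N (- M) x) -{2}(KK_cst N M x) !KK_le //; try exact: cont_cst.
  by move=> y; have := h y; rewrite ler_norml => /andP[].
by move=> y; have := h y; rewrite ler_norml => /andP[].
Qed.

Lemma KK_rot N g a t x : cont g -> KK N g (rot a t x) = KK N (fun y => g (rot a t y)) x.
Proof.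
move=> cg; rewrite KK.unlock; congr (_ * _).
rewrite -(Int_rot hsigma a t (cont_uuM N (rot a t x) cg)).
by apply: Int_eq => y; rewrite uu_rot.
Qed.

(* Expanding one factor at a time shows that K_N g is a polynomial and that K_N is symmetric. *)
Definition QQ N g : pt -> R := fun x => J (fun y => (1 + lin (vec x) y) ^+ N * g y).

Lemma lin_coord x y : lin (vec x) y = \sum_i vec x 0 i * lin (delta_mx 0 i) y.
Proof.
rewrite /lin edotC; apply: eq_bigr => i _.
by rewrite edot_delta.
Qed.

Lemma cont_QQ N x g : cont g -> cont (fun y => (1 + lin (vec x) y) ^+ N * g y).
Proof. by move=> cg; cnt. Qed.

Lemma QQS N g x : cont g -> QQ N.+1 g x =
  QQ N g x + \sum_i lin (delta_mx 0 i) x * QQ N (fun y => lin (delta_mx 0 i) y * g y) x.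
Proof.
move=> cg; rewrite /QQ.
rewrite (eq_bigr (fun i => J (fun y =>
    lin (delta_mx 0 i) x * ((1 + lin (vec x) y) ^+ N * (lin (delta_mx 0 i) y * g y))))); last first.
  by move=> i _; rewrite (IntZ m1) //; cnt.
rewrite -(Int_sum m1); last by move=> i; cnt.
intD' m1.
apply: Int_eq => y; rewrite exprS lin_coord.
rewrite mulrDl mul1r mulrDl; congr (_ + _).
rewrite mulr_suml mulr_suml; apply: eq_bigr => i _.
have -> : lin (delta_mx 0 i) x = vec x 0 i by rewrite /lin edot_delta.
ring.
Qed.

Lemma KK_QQ N g x : cont g -> KK N g x = (cc N)^-1 * 2^-1 ^+ N * QQ N g x.
Proof.
move=> cg; rewrite KK.unlock /QQ.
rewrite (@Int_eq _ _ _ _ (fun y => 2^-1 ^+ N * ((1 + lin (vec x) y) ^+ N * g y))).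
  by rewrite (IntZ m1) 1?mulrA //; exact: cont_QQ.
by move=> y; rewrite /uu exprMn; ring.
Qed.

Notation is_poly := (alg (fun h => exists v : V, h = lin v)).

Lemma is_poly_sm g : is_poly g -> sm g.
Proof.
move=> pg; apply: alg_sm; apply: alg_sub pg => h [v ->]; exact: sm_lin.
Qed.

Lemma is_poly_sum (I : Type) (r : seq I) (G : I -> pt -> R) : (forall i, is_poly (G i)) ->
  is_poly (fun p => \sum_(i <- r) G i p).
Proof.
move=> pG; elim: r => [|i r IH]; last first.
  rewrite (_ : (fun p : pt => _) = fun p => G i p + \sum_(j <- r) G j p); first exact: alg_add.
  by apply/funext => p; rewrite big_cons.
rewrite (_ : (fun p : pt => _) = fun=> 0); first exact: alg_cst.
by apply/funext => p; rewrite big_nil.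
Qed.

Lemma is_poly_QQ N g : cont g -> is_poly (QQ N g).
Proof.
elim: N g => [|N IH] g cg.
  by rewrite (_ : QQ 0 g = fun=> J g); [exact: alg_cst|apply/funext => x; apply: Int_eq => y; rewrite mul1r].
have -> : QQ N.+1 g = fun x => QQ N g x +
    \sum_i lin (delta_mx 0 i) x * QQ N (fun y => lin (delta_mx 0 i) y * g y) x.
  by apply/funext => x; exact: QQS.
apply: alg_add; first exact: IH.
apply: is_poly_sum => i; apply: alg_mul; last by apply: IH; cnt.
by apply: alg_base; eexists.
Qed.

Lemma is_poly_KK N g : cont g -> is_poly (KK N g).
Proof.
move=> cg; have -> : KK N g = fun x => (cc N)^-1 * 2^-1 ^+ N * QQ N g x.
  by apply/funext => x; exact: KK_QQ.
by apply: alg_mul; [exact: alg_cst|exact: is_poly_QQ].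
Qed.

Lemma sm_KK N g : cont g -> sm (KK N g).
Proof. by move=> cg; exact/is_poly_sm/is_poly_KK. Qed.

(** The factors 1 + x . y are carried from one side to the other one at a time, as sums of products
    of coordinates, which avoids any exchange of integrals. *)
Lemma QQ_sym N g h : cont g -> cont h -> J (fun x => h x * QQ N g x) = J (fun x => QQ N h x * g x).
Proof.
elim: N g h => [|N IH] g h cg ch.
  have E k x : QQ 0 k x = J k by apply: Int_eq => y; rewrite mul1r.
  under Int_eq do rewrite E; under [RHS]Int_eq do rewrite E.
  by rewrite (IntZr m1) // (IntZ m1) // mulrC.
have cQ k : cont k -> cont (QQ N k) by move=> ck; exact/sm_cont/is_poly_sm/is_poly_QQ.
have cl i k : cont k -> cont (fun y => lin (delta_mx 0 i) y * k y) by move=> ck; cnt.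
under Int_eq do rewrite QQS // mulrDr mulr_sumr.
under [RHS]Int_eq do rewrite QQS // mulrDl mulr_suml.
have c1 := cQ _ cg; have c2 := cQ _ ch.
have c3 i := cQ _ (cl i _ cg); have c4 i := cQ _ (cl i _ ch).
rewrite !(IntD m1); try by cnt.
rewrite IH // !(Int_sum m1); try by move=> i; cnt.
congr (_ + _); apply: eq_bigr => i _.
transitivity (J (fun x => (lin (delta_mx 0 i) x * h x) * QQ N (fun y => lin (delta_mx 0 i) y * g y) x)).
  by apply: Int_eq => x; ring.
rewrite IH; try exact: cl.
by apply: Int_eq => x; ring.
Qed.

Lemma KK_sym N g h : cont g -> cont h -> J (fun x => h x * KK N g x) = J (fun x => KK N h x * g x).
Proof.
move=> cg ch.
have cQ k : cont k -> cont (QQ N k) by move=> ck; exact/sm_cont/is_poly_sm/is_poly_QQ.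
have c1 := cQ _ cg; have c2 := cQ _ ch.
rewrite (@Int_eq _ _ _ _ (fun x => ((cc N)^-1 * 2^-1 ^+ N) * (h x * QQ N g x))); last first.
  by move=> x; rewrite KK_QQ //; ring.
rewrite [RHS](@Int_eq _ _ _ _ (fun x => ((cc N)^-1 * 2^-1 ^+ N) * (QQ N h x * g x))); last first.
  by move=> x; rewrite KK_QQ //; ring.
by rewrite !(IntZ m1) ?QQ_sym //; cnt.
Qed.

(** By invariance, rotating the argument of K_N g amounts to rotating g. *)
Lemma L_KK N a g : sm g -> L a (KK N g) = KK N (L a g).
Proof.
move=> sg; have cg := sm_cont sg; apply/funext => x; apply: L_val.
have H := is_deriveZ (cc N)^-1 (Int_derive_rot hsigma a (cont_uuX N x) sg).
rewrite [X in is_derive _ _ _ X](_ : _ = (cc N)^-1 *: J (fun y => uu x y ^+ N * L a g y)).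
  rewrite (_ : (fun t => _) = ((cc N)^-1 \*: (fun t => J (fun y => uu x y ^+ N * g (rot a t y))))) //.
  by apply/funext => t; rewrite KK_rot // KK.unlock.
by rewrite KK.unlock.
Qed.

Lemma LL_KK N I g : sm g -> LL I (KK N g) = KK N (LL I g).
Proof. by move=> sg; elim: I => //= a I ->; rewrite L_KK //; exact: sm_LL. Qed.

Lemma Lap_KK N g : sm g -> Lap (KK N g) = KK N (Lap g).
Proof.
move=> sg; apply/funext => x; rewrite [in RHS]/Lap KKZ; last by cnt.
rewrite KK_sum; last by move=> a; cnt.
rewrite /Lap; congr (_ * _); apply: eq_bigr => a _.
by rewrite !L_KK //; exact: sm_L.
Qed.

Lemma ccS N : lam N.+1 * cc N.+1 = N.+1%:R * (N%:R + n1 / 2) * cc N.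
Proof. by rewrite lamS /=; have := n_ge2; have := ler0n R N => ? ?; field; lra. Qed.

(** The Laplacian is moved onto the kernel and [Lap_uu] applied. In other words K_N = (1 + Lap /
    lam_(N+1)) K_(N+1): passing from N + 1 to N removes the component of degree N + 1. *)
Lemma KK_step N g x : sm g -> KK N.+1 (Lap g) x = lam N.+1 * (KK N g x - KK N.+1 g x).
Proof.
move=> sg; have cg := sm_cont sg; rewrite KK.unlock.
rewrite (Int_Lap_sym hsigma (sm_uuX N.+1 x) sg).
rewrite (@Int_eq _ _ _ _ (fun y => - lam N.+1 * (uu x y ^+ N.+1 * g y) +
   N.+1%:R * (N%:R + n1 / 2) * (uu x y ^+ N * g y))); last first.
  by move=> y; rewrite Lap_uu; ring.
have c1 := cont_uuM N x cg; have c2 := cont_uuM N.+1 x cg.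
rewrite (IntD m1) ?(IntZ m1) //; try by cnt.
have c0 := lt0r_neq0 (cc_gt0 N); have c1' := lt0r_neq0 (cc_gt0 N.+1).
have -> : N.+1%:R * (N%:R + n1 / 2) = lam N.+1 * cc N.+1 / cc N by rewrite ccS mulfK.
by set A := J _; set B := J _; set C := cc N.+1 in c1' *; field; apply/andP.
Qed.

Lemma KK_diff N g x : sm g -> KK N.+1 g x - KK N g x = - (lam N.+1)^-1 * KK N.+1 (Lap g) x.
Proof.
move=> sg; rewrite KK_step //; have := lt0r_neq0 (lam_gt0 N).
by move: (lam N.+1) => l l0; field.
Qed.

Lemma KK_Lap N g x : sm g -> Lap (KK N.+1 g) x = lam N.+1 * (KK N g x - KK N.+1 g x).
Proof. by move=> sg; rewrite Lap_KK // KK_step. Qed.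

(** Jensen's inequality, from the average of (g - c)^2 with c = K_N g (x). *)
Lemma KK_sqr_le N g x : cont g -> KK N g x ^+ 2 <= KK N (fun y => g y ^+ 2) x.
Proof.
move=> cg; set c := KK N g x.
have : 0 <= KK N (fun y => (g y - c) ^+ 2) x by apply: KK_ge0 => y; exact: sqr_ge0.
rewrite (_ : (fun y => _) = fun y => g y ^+ 2 + ((- 2 * c) * g y + c ^+ 2)); last first.
  by apply/funext => y; ring.
rewrite !KKD ?KKZ ?KK_cst -/c; try by cnt.
by set A := KK _ _ _; lra.
Qed.

Lemma Int_KK N g : cont g -> J (KK N g) = J g.
Proof.
move=> cg; have := KK_sym N cg (@cont_cst R n 1).
rewrite (@Int_eq _ _ _ _ (KK N g)); last by move=> p; rewrite mul1r.
by move=> ->; apply: Int_eq => p; rewrite KK_cst mul1r.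
Qed.

Lemma nrm2_KK N g : cont g -> nrm2 (KK N g) <= nrm2 g.
Proof.
move=> cg; have cK k : cont k -> cont (KK N k) by move=> ck; exact/sm_cont/sm_KK.
have c1 := cK _ cg; have c2 := contX 2 cg.
rewrite /nrm2 -[leRHS](Int_KK N) //; apply: (Int_le m1); [by cnt|exact: cK|].
by move=> x; exact: KK_sqr_le.
Qed.

Lemma cont_KK N g : cont g -> cont (KK N g).
Proof. by move=> cg; exact/sm_cont/sm_KK. Qed.

Lemma KK_uu N x : KK N (fun y => 1 - uu x y) x = n1 / 2 / (N%:R + n%:R - 1).
Proof.
rewrite KKB //; [|exact: cont_cst|exact/sm_cont/sm_uu].
rewrite KK_cst // [X in 1 - X](_ : _ = cc N.+1 / cc N).
  have := @cc_gt0 N => /= c0; have := n_ge2; have := ler0n R N => ? ?.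
  by field; apply/andP; split; apply: lt0r_neq0 => //; lra.
rewrite KK.unlock mulrC; congr (_ * _).
by rewrite -(Int_uu N.+1 x); apply: Int_eq => y; rewrite exprSr.
Qed.

Lemma edot_sub_uu x y : edot (vec y - vec x) (vec y - vec x) = 4 * (1 - uu x y).
Proof.
rewrite edotDl !edotDr !edotNl !edotNr !edot_vec /uu /lin (edotC (vec x)).
by field.
Qed.

Lemma KK_norm N g x : cont g -> `|KK N g x| <= KK N (fun y => `|g y|) x.
Proof.
move=> cg; have cN := cont_norm cg.
have h : KK N g x <= KK N (fun y => `|g y|) x.
  by apply: (KK_le) => // y; exact: ler_norm.
have : KK N (fun y => -1 * g y) x <= KK N (fun y => `|g y|) x.
  apply: (KK_le) => //; first by cnt.
  by move=> y; rewrite mulN1r -normrN; exact: ler_norm.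
by rewrite KKZ // mulN1r => h'; rewrite ler_norml h lerNl h'.
Qed.

Lemma KK_cvg g x : cont g -> KK N g x @[N --> \oo] --> g x.
Proof.
move=> cg; apply/cvgrPdist_le => /= e e0.
have [M hM] := cont_bounded cg.
have M0 : 0 <= M by apply: le_trans (hM x).
have [d d0 hd] : exists2 d : R, 0 < d &
    forall y, edot (vec y - vec x) (vec y - vec x) < d ^+ 2 -> `|g y - g x| <= e / 2.
  have /cvgrPdist_le/(_ _ (divr_gt0 e0 (ltr0Sn _ 1))) := cg x.
  rewrite /= => /nbhs_ballP[d d0 hd]; exists d => // y hy.
  rewrite distrC; apply: hd.
  have : ball (vec x) d (vec y); last by [].
  rewrite -ball_normE /ball_ /= distrC.
  have -> : `|vec y - vec x| = mx_norm (vec y - vec x) by [].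
  rewrite mx_normrE; apply: bigmax_lt => // -[i j] _ /=; rewrite ord1.
  apply: le_lt_trans (coord_le_enorm _ _) _.
  by rewrite -(@ltr_pXn2r _ 2) ?nnegrE ?enorm_ge0 ?(ltW d0) // enorm_sqr.
(* Where |y - x| >= d one has 4 (1 - uu) >= d^2, hence 2 M <= c (1 - uu). *)
pose c := 8 * M / d ^+ 2.
have d2 : 0 < d ^+ 2 by rewrite exprn_gt0.
have c0 : 0 <= c by rewrite divr_ge0 ?mulr_ge0 // ltW.
have key y : `|g y - g x| <= e / 2 + c * (1 - uu x y).
  have u1 := uu_le1 x y.
  have [h|h] := ltP (edot (vec y - vec x) (vec y - vec x)) (d ^+ 2).
    by apply: le_trans (hd y h) _; rewrite lerDl mulr_ge0 // subr_ge0.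
  apply: (@le_trans _ _ (2 * M)).
    by apply: le_trans (ler_normB _ _) _; rewrite mulr_natl lerD.
  apply: (@le_trans _ _ (c * (1 - uu x y))); last by rewrite lerDr divr_ge0 // ltW.
  move: h; rewrite edot_sub_uu /c => h.
  have E : 8 * M / d ^+ 2 * (1 - uu x y) = 2 * M * (4 * (1 - uu x y) / d ^+ 2).
    by field; exact: lt0r_neq0.
  by rewrite E ler_peMr ?mulr_ge0 // ler_pdivlMr // mul1r.
have cu : cont (fun y => 1 - uu x y) by apply: contB; [exact: cont_cst|exact/sm_cont/sm_uu].
have bound N : `|g x - KK N g x| <= e / 2 + c * (n1 / 2 / (N%:R + n%:R - 1)).
  rewrite -{1}(KK_cst N (g x) x) -KKB //; last exact: cont_cst.
  rewrite -(KK_uu N x) -KKZ // -{1}(KK_cst N (e / 2) x) -KKD //; [|exact: cont_cst|exact: contZ].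
  have h1 y : `|g x - g y| <= e / 2 + c * (1 - uu x y) by rewrite distrC.
  apply: le_trans (KK_norm _ _ _) _; first by cnt.
  by apply: (KK_le) => //; cnt.
have [N0 hN0] : exists N0 : nat, c * n1 / e <= N0%:R.
  exists (Num.bound (c * n1 / e)); apply/ltW/archi_boundP.
  have := @n_ge2 => n2; apply: divr_ge0; last exact: ltW.
  by apply: mulr_ge0 => //; lra.
exists N0 => // N /= N0N; apply: le_trans (bound N) _.
have n2 := n_ge2; have NN : N0%:R <= N%:R :> R by rewrite ler_nat.
have Np : 0 < N%:R + n%:R - 1 :> R by have := ler0n R N; lra.
suff : c * (n1 / 2 / (N%:R + n%:R - 1)) <= e / 2 by lra.
rewrite mulrA ler_pdivrMr // mulrA.
have : c * n1 <= N0%:R * e by rewrite -ler_pdivrMr.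
have : N0%:R * e <= N%:R * e by rewrite ler_pM2r.
have : 0 <= n1 * e by rewrite mulr_ge0 // ?ltW //; lra.
lra.
Qed.

(** lam_(N+1) = (N + 1) (N + n - 1) >= N (N + 1), so that sums of these inverses telescope. *)
Lemma inv_lam_le N : (0 < N)%N -> (lam N.+1)^-1 <= N%:R^-1 - N.+1%:R^-1.
Proof.
move=> N0; have N1 : 0 < N%:R :> R by rewrite ltr0n.
have -> : N%:R^-1 - N.+1%:R^-1 = (N%:R * N.+1%:R)^-1 :> R.
  by rewrite -natr1; field; apply/andP; split; apply: lt0r_neq0; lra.
rewrite lef_pV2 ?posrE ?lam_gt0 ?mulr_gt0 ?ltr0n //.
by rewrite lamS // mulrC ler_pM2l ?ltr0n //; have := n_ge2; lra.
Qed.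

Lemma KK_dist_fin N k g x (M : R) : (0 < N)%N -> sm g -> (forall y, `|Lap g y| <= M) ->
  `|KK (N + k) g x - KK N g x| <= M * (N%:R^-1 - (N + k)%:R^-1).
Proof.
move=> N0 sg hM; have M0 : 0 <= M by apply: le_trans (hM x).
elim: k => [|k IH]; first by rewrite addn0 !subrr normr0 mulr0.
rewrite addnS; apply: le_trans (ler_distD (KK (N + k) g x) _ _) _.
suff : `|KK (N + k).+1 g x - KK (N + k) g x| <= M * ((N + k)%:R^-1 - (N + k).+1%:R^-1).
  by move: IH; move: (_^-1) (_^-1) (_^-1) => a b c; rewrite !mulrBr; lra.
rewrite KK_diff // mulNr normrN normrM mulrC; apply: ler_pM => //.
  by apply: (KK_bound) => //; exact/sm_cont/sm_Lap.
by rewrite gtr0_norm ?invr_gt0 ?lam_gt0 // inv_lam_le // addn_gt0 N0.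
Qed.

(** The increments [KK_diff] are summed from N to infinity, and telescope by [inv_lam_le]. *)
Lemma KK_dist N g x (M : R) : (0 < N)%N -> sm g -> (forall y, `|Lap g y| <= M) ->
  `|g x - KK N g x| <= M / N%:R.
Proof.
move=> N0 sg hM; have M0 : 0 <= M by apply: le_trans (hM x).
have : `|KK (k + N) g x - KK N g x| @[k --> \oo] --> `|g x - KK N g x|.
  apply: cvg_norm; apply: cvgB; last exact: cvg_cst.
  by rewrite (cvg_shiftn N (fun k => KK k g x)); exact/KK_cvg/sm_cont.
move=> /cvg_lim <- //; apply: limr_le; first by apply/cvg_ex; eexists; apply: cvg_norm;
  apply: cvgB; [rewrite (cvg_shiftn N (fun k => KK k g x)); exact/KK_cvg/sm_cont|exact: cvg_cst].
apply: nearW => k; rewrite addnC; apply: le_trans (KK_dist_fin k x N0 sg hM) _.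
by rewrite ler_wpM2l // gerBl invr_ge0.
Qed.

(** The diffusion time of one application of K_N, which is 1 + eps N Lap up to O(1 / N^2) by
    [KK_second_order]. *)
Definition eps N : R := (N%:R + n%:R - 1)^-1.

Lemma KK_second_order N g x (M1 M2 : R) : (0 < N)%N -> sm g ->
  (forall y, `|Lap g y| <= M1) -> (forall y, `|Lap (Lap g) y| <= M2) ->
  `|KK N g x - g x - eps N * Lap g x| <= (M2 + n1 * M1) / N%:R ^+ 2.
Proof.
move=> N0 sg h1 h2; have n2 := n_ge2.
have M10 : 0 <= M1 by apply: le_trans (h1 x).
have M20 : 0 <= M2 by apply: le_trans (h2 x).
set C := M2 + _; have C0 : 0 <= C by rewrite addr_ge0 // mulr_ge0 //; lra.
have Np : 0 < N%:R :> R by rewrite ltr0n.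
have step m : (N <= m)%N ->
  `|KK m g x - KK m.+1 g x - (eps m - eps m.+1) * Lap g x| <= C / N%:R * (m%:R^-1 - m.+1%:R^-1).
  move=> Nm; have m0 : (0 < m)%N by exact: leq_trans Nm.
  have mN : N%:R <= m%:R :> R by rewrite ler_nat.
  have -> : KK m g x - KK m.+1 g x = (lam m.+1)^-1 * KK m.+1 (Lap g) x.
    by rewrite -opprB KK_diff // mulNr opprK.
  have -> : (lam m.+1)^-1 * KK m.+1 (Lap g) x - (eps m - eps m.+1) * Lap g x =
    - ((lam m.+1)^-1 * (Lap g x - KK m.+1 (Lap g) x)) +
    ((lam m.+1)^-1 - (eps m - eps m.+1)) * Lap g x by ring.
  (* eps m - eps (m + 1) is 1 / ((m + n - 1) (m + n)). It telescopes, and differs from the inverse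
     of lam_(m+1) by a relative error (n - 1) / (m + n). *)
  have E : (lam m.+1)^-1 - (eps m - eps m.+1) = n1 * ((lam m.+1)^-1 / (m%:R + n%:R)).
    by rewrite /eps lamS // -natr1; field; do ?[apply/andP; split]; apply: lt0r_neq0; lra.
  have l0 := @lam_gt0 m.
  have il : 0 <= (lam m.+1)^-1 by rewrite invr_ge0 ltW.
  have b1 : `|(lam m.+1)^-1 * (Lap g x - KK m.+1 (Lap g) x)| <= (lam m.+1)^-1 * (M2 / N%:R).
    rewrite normrM ger0_norm // ler_wpM2l //.
    apply: le_trans (KK_dist x (ltn0Sn m) (sm_Lap sg) h2) _.
    rewrite ler_wpM2l // lef_pV2 ?posrE ?ltr0n // ler_nat; exact: leq_trans Nm (leqnSn _).
  have b2 : `|((lam m.+1)^-1 - (eps m - eps m.+1)) * Lap g x| <=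
      (lam m.+1)^-1 * (n1 * M1 / N%:R).
    rewrite E normrM ger0_norm; last by rewrite !mulr_ge0 ?invr_ge0 //; lra.
    have i1 : (m%:R + n%:R)^-1 <= N%:R^-1 :> R by rewrite lef_pV2 ?posrE //; lra.
    rewrite [leRHS](_ : _ = n1 * ((lam m.+1)^-1 / N%:R) * M1); last by ring.
    rewrite ler_pM // ?mulr_ge0 //; try lra.
    by rewrite ler_wpM2l ?ler_wpM2l //; lra.
  apply: le_trans (ler_normD _ _) _; rewrite normrN; apply: le_trans (lerD b1 b2) _.
  rewrite -mulrDr -mulrDl -/C mulrC; apply: ler_wpM2l; last exact: inv_lam_le.
  by apply: divr_ge0 => //; exact: ltW.
have fin k : `|KK N g x - KK (k + N) g x - (eps N - eps (k + N)) * Lap g x| <=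
    C / N%:R * (N%:R^-1 - (k + N)%:R^-1).
  elim: k => [|k IH]; first by rewrite add0n !subrr mul0r subrr normr0 mulr0.
  have := step (k + N)%N (leq_addl _ _); move: IH; rewrite addSn.
  set a := KK _ _ _; set b := KK _ _ _; set c := KK _ _ _.
  have -> : a - c - (eps N - eps (k + N).+1) * Lap g x =
    (a - b - (eps N - eps (k + N)) * Lap g x) + (b - c - (eps (k + N) - eps (k + N).+1) * Lap g x).
    by ring.
  move=> u v; apply: le_trans (ler_normD _ _) _; apply: le_trans (lerD u v) _.
  by rewrite -mulrDr addrA subrK.
have cv : `|KK N g x - KK (k + N) g x - (eps N - eps (k + N)) * Lap g x| @[k --> \oo]
    --> `|KK N g x - g x - (eps N - 0) * Lap g x|.
  have c1 : KK (k + N) g x @[k --> \oo] --> g x.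
    by rewrite (cvg_shiftn N (fun k => KK k g x)); exact/KK_cvg/sm_cont.
  have c2 : eps (k + N) @[k --> \oo] --> (0 : R).
    rewrite (cvg_shiftn N eps); apply/cvgrPdist_le => /= e e0.
    exists (Num.bound e^-1) => // k /= ke; have k0 := ler0n R k.
    rewrite sub0r normrN ger0_norm /eps ?invr_ge0; last by lra.
    rewrite -[leRHS]invrK lef_pV2 ?posrE ?invr_gt0 //; last by lra.
    have := archi_boundP (ltW (_ : 0 < e^-1)); rewrite invr_gt0 => /(_ e0) h.
    have : (Num.bound e^-1)%:R <= k%:R :> R by rewrite ler_nat.
    lra.
  apply: cvg_norm; apply: cvgB; first by apply: cvgB; [exact: cvg_cst|exact: c1].
  by apply: cvgM; [apply: cvgB; [exact: cvg_cst|exact: c2]|exact: cvg_cst].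
rewrite subr0 in cv; rewrite -(cvg_lim _ cv) //.
apply: limr_le; first by apply/cvg_ex; eexists; exact: cv.
apply: nearW => k; apply: le_trans (fin k) _.
have -> : C / N%:R ^+ 2 = C / N%:R * N%:R^-1 by rewrite expr2 invfM mulrA.
apply: ler_wpM2l; first by apply: divr_ge0 => //; exact: ltW.
by rewrite gerBl invr_ge0.
Qed.

(** K_N commutes with the fields and contracts L^2. *)
Lemma Gam_KK_le N g : sm g -> J (Gam g (KK N g)) <= J (Gam g g).
Proof.
move=> sg; have sK := sm_KK N (sm_cont sg).
rewrite /Gam !(IntZ m1) ?(Int_sum m1) ?ler_pM2l ?invr_gt0 //; try by move=> *; cnt.
apply: ler_sum => a _; rewrite L_KK //.
have ca : cont (L a g) by cnt.
apply: le_trans (ler_norm _) _; apply: le_trans (CS_sqrt hsigma ca (cont_KK N ca)) _.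
rewrite [leRHS](_ : _ = Num.sqrt (nrm2 (L a g)) * Num.sqrt (nrm2 (L a g))).
  by rewrite ler_wpM2l ?sqrtr_ge0 // ler_wsqrtr // nrm2_KK.
by rewrite -expr2 sqr_sqrtr ?nrm2_ge0 // /nrm2; apply: Int_eq => p; rewrite expr2.
Qed.

Lemma KK_corr_step N g : sm g ->
  J (fun p => g p * KK N.+1 g p) - J (fun p => g p * KK N g p) <= (lam N.+1)^-1 * J (Gam g g).
Proof.
move=> sg; have cg := sm_cont sg.
have cK N' := cont_KK N' cg.
intB' m1.
have sK := sm_KK N.+1 cg.
rewrite (@Int_eq _ _ _ _ (fun p => - (lam N.+1)^-1 * (g p * Lap (KK N.+1 g) p))); last first.
  by move=> p; rewrite -mulrBr KK_diff // Lap_KK //; ring.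
intZ m1.
rewrite (Int_Gam hsigma) // mulrNN ler_pM2l ?invr_gt0 ?lam_gt0 //.
exact: Gam_KK_le.
Qed.

Lemma KK_corr_cvg g : cont g -> J (fun p => g p * KK k g p) @[k --> \oo] --> nrm2 g.
Proof.
move=> cg; have [M hM] := cont_bounded cg.
apply: (Int_lim m1 (M := M * M)).
- by move=> k; apply: contM => //; exact: cont_KK.
- exact: contX.
- by move=> k p; rewrite normrM ler_pM // (KK_bound).
- by move=> p; rewrite expr2; apply: cvgM; [exact: cvg_cst|exact: KK_cvg].
Qed.

(** [KK_corr_step] is summed from N to infinity: the pairing of g with K_m g tends to the squared
    L^2 norm of g. *)
Lemma Nash_KK N g : (0 < N)%N -> sm g ->
  nrm2 g <= J (fun p => g p * KK N g p) + N%:R^-1 * J (Gam g g).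
Proof.
move=> N0 sg; have G0 : 0 <= J (Gam g g) by apply: Int_ge0 => p; exact: Gam_ge0.
have fin k : J (fun p => g p * KK (k + N) g p) <=
    J (fun p => g p * KK N g p) + (N%:R^-1 - (k + N)%:R^-1) * J (Gam g g).
  elim: k => [|k IH]; first by rewrite add0n subrr mul0r addr0.
  have := KK_corr_step (k + N) sg; have := @inv_lam_le (k + N).
  rewrite addn_gt0 N0 orbT => /(_ isT) h1 h2; rewrite addSn.
  have := ler_wpM2r G0 h1; move: IH h2; rewrite !mulrBl; move: (_^-1) (_^-1) (_^-1) (_^-1) => i1 i2 i3 i4; lra.
have cv : J (fun p => g p * KK (k + N) g p) @[k --> \oo] --> nrm2 g.
  by rewrite (cvg_shiftn N (fun k => J (fun p => g p * KK k g p))); exact/KK_corr_cvg/sm_cont.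
rewrite -(cvg_lim _ cv) //; apply: limr_le; first by apply/cvg_ex; eexists; exact: cv.
apply: nearW => k; apply: le_trans (fin k) _.
by rewrite lerD2l ler_wpM2r // gerBl invr_ge0.
Qed.

Lemma KK0 g x : KK 0 g x = J g.
Proof. by rewrite KK.unlock /= invr1 mul1r; apply: Int_eq => y; rewrite expr0 mul1r. Qed.

(** K_0 is the mean. One unit of J (Gam g g) pays for the step from K_0 to K_1, since lam_1 = n - 1
    >= 1, and one for the steps from K_1 to infinity. *)
Lemma Poincare g : sm g -> nrm2 g - J g ^+ 2 <= 2 * J (Gam g g).
Proof.
move=> sg; have G0 : 0 <= J (Gam g g) by apply: Int_ge0 => p; exact: Gam_ge0.
have h1 := Nash_KK (ltn0Sn 0) sg; have := KK_corr_step 0 sg.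
rewrite [J (fun p => g p * KK 0 g p)](@Int_eq _ _ _ _ (fun p => g p * J g)); last first.
  by move=> p; rewrite KK0.
rewrite (IntZr m1) ?sm_cont //; last exact: sm_cont.
have : (lam 1)^-1 * J (Gam g g) <= J (Gam g g).
  by rewrite ler_piMl // invf_le1 ?lam_gt0 // (le_trans _ (@lam_ge 1)) // expr1n.
move: h1; rewrite invr1 mul1r expr2.
set a := J _; set b := J _; set c := J _; lra.
Qed.

Lemma KK_sup_L1 N g x : cont g -> `|KK N g x| <= (cc N)^-1 * J (fun p => `|g p|).
Proof.
move=> cg; rewrite KK.unlock normrM gtr0_norm ?invr_gt0 ?cc_gt0 //.
rewrite ler_pM2l ?invr_gt0 ?cc_gt0 //; have cu := cont_uuM N x cg.
apply: le_trans (Int_norm m1 cu) _; int_le m1.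
move=> p; rewrite normrM ler_piMl // ger0_norm ?exprn_ge0 ?uu_ge0 //.
by rewrite exprn_ile1 ?uu_ge0 ?uu_le1.
Qed.

(** K_N maps L^1 to bounded functions with norm at most the maximum 1 / cc N of its kernel. The free
    N is the parameter over which Nash's inequality optimizes. *)
Lemma Nash N g : (0 < N)%N -> sm g ->
  nrm2 g <= (cc N)^-1 * J (fun p => `|g p|) ^+ 2 + N%:R^-1 * J (Gam g g).
Proof.
move=> N0 sg; apply: le_trans (Nash_KK N0 sg) _; rewrite lerD2r.
have cg := sm_cont sg; have cK := cont_KK N cg.
set B := J (fun p => `|g p|).
rewrite expr2 mulrA.
have -> : (cc N)^-1 * B * B = J (fun p => (cc N)^-1 * B * `|g p|).
  by rewrite (IntZ m1) //; cnt.
apply: (Int_le m1); [by cnt|by cnt|] => p.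
apply: le_trans (ler_norm _) _; rewrite normrM mulrC ler_wpM2r //.
exact: KK_sup_L1.
Qed.

Lemma Bernoulli (a : R) k : 0 <= a -> 1 + k%:R * a <= (1 + a) ^+ k.
Proof.
move=> a0; elim: k => [|k IH]; first by rewrite mul0r addr0 expr0.
rewrite exprS -natr1; apply: (@le_trans _ _ ((1 + a) * (1 + k%:R * a))).
  by have := mulr_ge0 (ler0n R k) (mulr_ge0 a0 a0); lra.
by rewrite ler_wpM2l // addr_ge0.
Qed.

(** Bernoulli's inequality on each factor of the product. The exponent is not sharp, but polynomial
    growth is all that [sup_bound] requires. *)
Lemma inv_cc_le N : (cc N)^-1 <= N.+1%:R ^+ n.
Proof.
have n2 := n_ge2.
elim: N => [|N IH]; first by rewrite /= invr1 expr1n.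
have N0 := ler0n R N; have c0 := @cc_gt0 N.
have d : 0 < N%:R + n1 / 2 :> R by lra.
rewrite /= invfM; set q := (_ / _)^-1.
have -> : N.+2%:R ^+ n = N.+1%:R ^+ n * (1 + N.+1%:R^-1) ^+ n :> R.
  rewrite -exprMn; congr (_ ^+ _); rewrite -[N.+2%:R]natr1 mulrDr mulr1 divff ?pnatr_eq0 //.
have q0 : 0 <= q by rewrite invr_ge0 divr_ge0 //; lra.
apply: ler_pM => //; first by rewrite invr_ge0 ltW.
have i0 : 0 <= N.+1%:R^-1 :> R by rewrite invr_ge0.
apply: le_trans (Bernoulli n i0).
rewrite /q invf_div ler_pdivrMr // mulrDl mul1r.
rewrite (_ : n%:R * N.+1%:R^-1 * _ = n%:R * (N%:R + n1 / 2) / N.+1%:R); last by ring.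
rewrite -lerBlDl ler_pdivlMr ?ltr0n // -[N.+1%:R]natr1.
clear i0 q0; have := mulr_ge0 N0 (ler0n R n).
have : 2 * n%:R <= n%:R * n%:R :> R by rewrite ler_wpM2r.
lra.
Qed.

Lemma KK_sup_L2 N g x : cont g -> KK N g x ^+ 2 <= N.+1%:R ^+ n * nrm2 g.
Proof.
move=> cg; apply: le_trans (KK_sqr_le N x cg) _.
have c2 := contX 2 cg.
apply: le_trans (ler_norm _) _; apply: le_trans (KK_sup_L1 N x c2) _.
apply: ler_pM; [by rewrite invr_ge0 ltW // cc_gt0| |exact: inv_cc_le|].
  by apply: Int_ge0 => p; exact: normr_ge0.
rewrite le_eqVlt; apply/orP; left; apply/eqP; apply: Int_eq => p.
by rewrite ger0_norm // sqr_ge0.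
Qed.

Notation iLap := (fun q : nat => iter q (@Lap R n)).

(** Sobolev's embedding by bootstrap: w measures the growth in m of the sup norm of K_m g, given L^2
    bounds on k Laplacians of g. Each use of [growth_step] spends one more Laplacian to lower w,
    until it is bounded. *)
Definition growth (w : nat -> R) := exists (C : R) (k : nat), 0 <= C /\
  forall g (B : R), sm g -> 0 <= B -> (forall q : nat, (q <= k)%N -> nrm2 (iLap q g) <= B ^+ 2) ->
  forall m x, `|KK m g x| <= C * w m * B.

Lemma sm_iLap (k : nat) g : sm g -> sm (iLap k g).
Proof. by move=> sg; elim: k => //= k IH; exact: sm_Lap. Qed.

Lemma Int_sqr_le g : cont g -> J g ^+ 2 <= nrm2 g.
Proof.
move=> cg; have := Cauchy_Schwarz hsigma (@cont_cst R n 1) cg.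
rewrite (@Int_eq _ _ _ (fun p => 1 * g p) g); last by move=> p; rewrite mul1r.
by rewrite (Int_eq _ (fun p => expr1n R 2)) (Int_cst m1) !mul1r.
Qed.

(** K_m g is the mean plus the increments of [KK_diff], and the hypothesis on w is applied to the
    Laplacian in each of them. The factor 1 / lam_(l+1) is at most 1 / (l + 1)^2. *)
Lemma growth_step (w w' : nat -> R) (A : R) : growth w -> 0 <= A ->
  (forall m, 1 <= w' m) ->
  (forall m, \sum_(l < m) w l.+1 / l.+1%:R ^+ 2 <= A * w' m) -> growth w'.
Proof.
move=> [C [k [C0 h]]] A0 w1 hw; exists (1 + C * A), k.+1; split.
  by rewrite addr_ge0 // mulr_ge0.
move=> g B sg B0 hB m x.
have hL m' y : `|KK m' (Lap g) y| <= C * w m' * B.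
  apply: h => //; first exact: sm_Lap.
  by move=> q qk; rewrite -iterSr; exact: hB.
have : `|KK m g x| <= B + \sum_(l < m) (C * B) * (w l.+1 / l.+1%:R ^+ 2).
  elim: m => [|m IH].
    rewrite big_ord0 addr0 KK0 -(@ler_pXn2r _ 2) ?nnegrE // real_normK ?num_real //.
    by apply: le_trans (hB 0%N isT); exact/Int_sqr_le/sm_cont.
  rewrite big_ord_recr /= addrA.
  have -> : KK m.+1 g x = KK m g x + (KK m.+1 g x - KK m g x) by ring.
  apply: le_trans (ler_normD _ _) _; apply: lerD => //.
  rewrite KK_diff // mulNr normrN normrM gtr0_norm ?invr_gt0 ?lam_gt0 //.
  have l0 := @lam_gt0 m.
  have := hL m.+1 x; set a := `|_| => ha.
  have a0 : 0 <= C * w m.+1 * B by apply: le_trans ha; exact: normr_ge0.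
  apply: (@le_trans _ _ ((lam m.+1)^-1 * (C * w m.+1 * B))).
    by rewrite ler_wpM2l // invr_ge0 ltW.
  rewrite [leRHS](_ : _ = (m.+1%:R ^+ 2)^-1 * (C * w m.+1 * B)); last by ring.
  apply: ler_wpM2r => //; rewrite lef_pV2 ?posrE // ?exprn_gt0 ?ltr0n //.
  exact: (@lam_ge _).
rewrite -mulr_sumr => /le_trans; apply.
have := ler_wpM2l (mulr_ge0 C0 B0) (hw m); have := ler_wpM2r B0 (w1 m); lra.
Qed.

Lemma growth_pow a : growth (fun m => m.+1%:R ^+ a.+2) -> growth (fun m => m.+1%:R ^+ a.+1).
Proof.
move=> h; apply: (growth_step (A := 4) h) => // m; first by rewrite exprn_ege1 // ler1n.
have -> : 4 * m.+1%:R ^+ a.+1 = \sum_(l < m.+1) 4 * m.+1%:R ^+ a :> R.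
  by rewrite sumr_const card_ord -mulr_natl exprS; ring.
rewrite big_ord_recr /= ler_wpDr ?mulr_ge0 ?exprn_ge0 //.
apply: ler_sum => l _; rewrite ler_pdivrMr ?exprn_gt0 ?ltr0n //.
have l0 : 1 <= l.+1%:R :> R by rewrite ler1n.
have l1 : l.+2%:R <= m.+1%:R :> R by rewrite ler_nat; exact: (ltn_ord l).
have l2 : l.+2%:R ^+ a <= m.+1%:R ^+ a :> R by rewrite lerXn2r ?nnegrE.
rewrite -[a.+2]addn2 exprD [leRHS](_ : _ = m.+1%:R ^+ a * (4 * l.+1%:R ^+ 2)); last by ring.
rewrite ler_pM ?exprn_ge0 // -[l.+2%:R]natr1 !exprS expr0; nra.
Qed.

(** At exponent 1 the sum is logarithmic. A square root is a convenient upper bound, whose own sum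
    converges in [growth1]. *)
Lemma growth_sqrt : growth (fun m => m.+1%:R ^+ 1) -> growth (fun m => Num.sqrt m.+1%:R).
Proof.
move=> h; apply: (growth_step (A := 8) h) => // m.
  by rewrite -[X in X <= _]sqrtr1 ler_wsqrtr // ler1n.
elim: m => [|m IH]; first by rewrite big_ord0 mulr_ge0 // sqrtr_ge0.
rewrite big_ord_recr /=; apply: le_trans (lerD IH (lexx _)) _.
set s := Num.sqrt m.+1%:R; set t := Num.sqrt m.+2%:R.
have s2 : s ^+ 2 = m.+1%:R by rewrite sqr_sqrtr.
have t2 : t ^+ 2 = s ^+ 2 + 1 by rewrite sqr_sqrtr // s2 natr1.
have s1 : 1 <= s by rewrite -[X in X <= _]sqrtr1 ler_wsqrtr // ler1n.
have t0 : 0 <= t by rewrite sqrtr_ge0.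
rewrite expr1 -[m.+2%:R]natr1 -s2 -lerBrDl ler_pdivrMr; last by rewrite !exprn_gt0 //; lra.
have ts : s <= t by nra.
have st : t <= 2 * s by nra.
have E : (t - s) * (t + s) = 1 by rewrite -subr_sqr t2; ring.
have u : (t - s) * (3 * s) >= 1.
  by rewrite -[X in X <= _]E ler_wpM2l ?subr_ge0 //; lra.
have s3 : 1 <= s ^+ 3 by rewrite exprn_ege1.
have : (t - s) * (3 * s) * s ^+ 3 >= s ^+ 3 by rewrite ler_peMl //; lra.
have := mulr_ge0 (_ : 0 <= s - 1) (_ : 0 <= s ^+ 2); rewrite subr_ge0 sqr_ge0 => /(_ s1 isT).
rewrite !exprS expr0; nra.
Qed.

Lemma growth1 : growth (fun m => Num.sqrt m.+1%:R) -> growth (fun=> 1).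
Proof.
move=> h; apply: (growth_step (A := 8) h) => // m.
apply: (@le_trans _ _ (8 * (1 - (Num.sqrt m.+1%:R)^-1))); last first.
  by rewrite ler_wpM2l // gerBl invr_ge0 sqrtr_ge0.
elim: m => [|m IH]; first by rewrite big_ord0 sqrtr1 invr1 subrr mulr0.
rewrite big_ord_recr /=; apply: le_trans (lerD IH (lexx _)) _.
set s := Num.sqrt m.+1%:R; set t := Num.sqrt m.+2%:R.
have s2 : s ^+ 2 = m.+1%:R by rewrite sqr_sqrtr.
have t2 : t ^+ 2 = s ^+ 2 + 1 by rewrite sqr_sqrtr // s2 natr1.
have s1 : 1 <= s by rewrite -[X in X <= _]sqrtr1 ler_wsqrtr // ler1n.
have t0 : 0 <= t by rewrite sqrtr_ge0.
have ts : s <= t by nra.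
have st : t <= 3 / 2 * s by nra.
have E : (t - s) * (t + s) = 1 by rewrite -subr_sqr t2; ring.
rewrite -s2 -lerBrDl.
have -> : 8 * (1 - t^-1) - 8 * (1 - s^-1) = 8 * (t - s) / (s * t).
  by field; apply/andP; split; apply: lt0r_neq0; lra.
rewrite ler_pdivlMr ?mulr_gt0 //; try lra.
rewrite mulrAC ler_pdivrMr; last by rewrite !exprn_gt0 //; lra.
have u : (t - s) * (5 / 2 * s) >= 1.
  by rewrite -[X in X <= _]E ler_wpM2l ?subr_ge0 //; lra.
have v : 8 * (t - s) * (s ^+ 2) ^+ 2 = 8 / (5 / 2) * ((t - s) * (5 / 2 * s)) * s ^+ 3.
  by rewrite !exprS expr0; field.
have s3 : 0 < s ^+ 3 by rewrite exprn_gt0 //; lra.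
have w : t * (s * t) <= 9 / 4 * s ^+ 3.
  rewrite !exprS expr0; have : t * t <= 9 / 4 * (s * s) by nra.
  have : 0 < s by lra.
  nra.
rewrite v; apply: le_trans w _; rewrite ler_wpM2r ?ltW //; lra.
Qed.

(** The chain starts at the exponent n given by [KK_sup_L2], goes down to 1, then to a square root
    and to a constant; then m tends to infinity. *)
Lemma sup_bound : exists (C : R) (k : nat), 0 <= C /\ forall g (B : R), sm g -> 0 <= B ->
  (forall q : nat, (q <= k)%N -> nrm2 (iLap q g) <= B ^+ 2) -> forall x, `|g x| <= C * B.
Proof.
have gn : growth (fun m => m.+1%:R ^+ n.-1.+1).
  exists 1, 0%N; split => // g B sg B0 /(_ 0%N isT) /= hB m x; rewrite mul1r.
  rewrite -(@ler_pXn2r _ 2) ?nnegrE ?mulr_ge0 ?exprn_ge0 // real_normK ?num_real //.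
  apply: le_trans (KK_sup_L2 m x (sm_cont sg)) _.
  rewrite exprMn prednK; last by exact: ltnW.
  rewrite ler_pM ?exprn_ge0 ?nrm2_ge0 // -exprM ler_weXn2l ?ler1n //.
  by rewrite leq_pmulr.
have {}gn : growth (fun m => m.+1%:R ^+ 1).
  by elim: n.-1 gn => // a IH /growth_pow /IH.
have [C [k [C0 h]]] := growth1 (growth_sqrt gn).
exists C, k; split => // g B sg B0 hB x.
have c1 : `|KK m g x| @[m --> \oo] --> `|g x| by apply: cvg_norm; exact/KK_cvg/sm_cont.
rewrite -(cvg_lim _ c1) //; apply: limr_le; first by apply/cvg_ex; eexists; exact: c1.
by apply: nearW => m; have := h g B sg B0 hB m x; rewrite mulr1.
Qed.

End Kernel.

(** * Commutation of the Laplacian with the rotation fields *)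

Section Commutation.
Variables (R : realType) (n : nat) (sigma : probability (borel_rV R n) R).
Hypotheses (hn : (2 <= n)%N) (hsigma : uniform_sphere sigma).
Notation V := 'rV[R]_n.
Notation pt := (pt R n).
Notation idx := ('I_n * 'I_n)%type.
Notation is_poly := (alg (fun h : pt -> R => exists v : V, h = lin v)).
Implicit Types (g h : pt -> R) (p q x y : pt) (a b c : idx).

Definition brk a b : 'M[R]_n :=
  skew R a.1 a.2 *m skew R b.1 b.2 - skew R b.1 b.2 *m skew R a.1 a.2.

(** The structure constants of the rotation algebra are totally antisymmetric; this is the exchange
    of a and c. *)
Lemma brk_anti a b c : brk a b c.1 c.2 = - brk c b a.1 a.2.
Proof.
have h (i j : 'I_n) (B : 'M[R]_n) k l : (skew R i j *m B) k l =
   (k == i)%:R * B j l - (k == j)%:R * B i l.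
  rewrite /skew mulmxBl !mxE; congr (_ - _).
    rewrite (bigD1 j) //= big1 ?addr0 ?mxE ?eqxx ?andbT // => r /negPf rj.
    by rewrite mxE rj andbF mul0r.
  rewrite (bigD1 i) //= big1 ?addr0 ?mxE ?eqxx ?andbT // => r /negPf rj.
  by rewrite mxE rj andbF mul0r.
have h' (i j : 'I_n) (B : 'M[R]_n) k l : (B *m skew R i j) k l =
   B k i * (l == j)%:R - B k j * (l == i)%:R.
  rewrite /skew mulmxBr !mxE; congr (_ - _).
    rewrite (bigD1 i) //= big1 ?addr0 ?mxE ?eqxx // => r /negPf rj.
    by rewrite mxE rj mulr0.
  rewrite (bigD1 j) //= big1 ?addr0 ?mxE ?eqxx // => r /negPf rj.
  by rewrite mxE rj mulr0.
have sk k l : skew R b.1 b.2 k l = - skew R b.1 b.2 l k.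
  by rewrite -[in RHS](trmxK (skew R b.1 b.2)) skew_tr !mxE opprK.
have mB (A C : 'M[R]_n) k l : (A - C) k l = A k l - C k l by rewrite !mxE.
rewrite /brk; move: (skew R b.1 b.2) sk => B sk; rewrite !mB !h !h'.
rewrite !(eq_sym a.1) !(eq_sym a.2).
rewrite (sk a.2 c.2) (sk c.1 a.1) (sk c.1 a.2) (sk a.1 c.2); ring.
Qed.

Lemma lskew_mul a (v : V) : lskew a v = - (v *m skew R a.1 a.2).
Proof. by rewrite mul_skew opprB. Qed.

(** The sum over ordered pairs counts every plane twice, hence the factor 1/2. *)
Lemma brk_lskew a b (v : V) :
  lskew a (lskew b v) - lskew b (lskew a v) = 2^-1 *: \sum_c brk a b c.1 c.2 *: lskew c v.
Proof.
have -> : \sum_c brk a b c.1 c.2 *: lskew c v = - (v *m \sum_c brk a b c.1 c.2 *: skew R c.1 c.2).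
  rewrite mulmx_sumr -sumrN; apply: eq_bigr => c _.
  by rewrite lskew_mul -scalemxAr scalerN.
have -> : \sum_c brk a b c.1 c.2 *: skew R c.1 c.2 = brk a b - (brk a b)^T.
  have E (N : 'M[R]_n) : \sum_c N c.1 c.2 *: delta_mx c.1 c.2 = N.
    by rewrite [RHS]matrix_sum_delta pair_bigA.
  have ET : (brk a b)^T = \sum_c brk a b c.1 c.2 *: delta_mx c.2 c.1.
    rewrite -[in LHS](E (brk a b)) linear_sum; apply: eq_bigr => c _.
    by rewrite linearZ /= trmx_delta.
  rewrite ET -[X in _ = X - _]E -sumrB.
  by apply: eq_bigr => c _; rewrite scalerBr.
have -> : (brk a b)^T = - brk a b.
  by rewrite /brk linearB /= !trmx_mul !skew_tr !mulmxN !mulNmx !opprK opprB.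
rewrite opprK mulmxDr; set w := v *m brk a b.
have -> : 2^-1 *: - (w + w) = - w by apply/rowP => k; rewrite !mxE; field.
rewrite /w /brk !lskew_mul; move: (skew R a.1 a.2) (skew R b.1 b.2) => A B.
by rewrite !mulNmx !opprK mulmxBr !mulmxA opprB.
Qed.

(** Both sides are derivations in g, so the case of linear functions suffices. *)
Lemma brk_poly a b g : is_poly g -> forall x,
  L a (L b g) x - L b (L a g) x = 2^-1 * \sum_c brk a b c.1 c.2 * L c g x.
Proof.
move=> pg; have sg := is_poly_sm pg.
elim: pg => {g sg} [_ [v ->]|k|g h pg IHg ph IHh|g h pg IHg ph IHh] x.
- rewrite !L_lin; under eq_bigr do rewrite L_lin.
  rewrite /lin -edotNr -edotDr brk_lskew edotZr; congr (_ * _).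
  rewrite (big_morph _ (fun r s => edotDr r s (vec x)) (id1 := 0)); last by rewrite edotC edot0l.
  by apply: eq_bigr => c _; rewrite edotZr.
- rewrite !L_cst big1 ?mulr0 ?subrr // => c _.
  by rewrite L_cst mulr0.
- have sg := is_poly_sm pg; have sh := is_poly_sm ph.
  have d u e : sm u -> dd (L e u) by move=> su; exact/sm_dd/sm_L.
  rewrite !(LD _ (sm_dd sg) (sm_dd sh)) !LD; try exact: d.
  under eq_bigr do rewrite (LD _ (sm_dd sg) (sm_dd sh)) mulrDr.
  by rewrite big_split mulrDr /= -IHg -IHh; ring.
- have sg := is_poly_sm pg; have sh := is_poly_sm ph.
  have d u e : sm u -> dd (L e u) by move=> su; exact/sm_dd/sm_L.
  have ds u : sm u -> dd u by exact: sm_dd.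
  rewrite !(LM _ (sm_dd sg) (sm_dd sh)) !LD; try by apply: ddM; first [exact: d | exact: ds].
  rewrite !LM; try first [exact: d | exact: ds].
  under eq_bigr do rewrite (LM _ (sm_dd sg) (sm_dd sh)) mulrDr mulrA (mulrCA _ (g x)).
  rewrite big_split mulrDr /= -mulr_suml -mulr_sumr mulrA (mulrCA _ (g x)) -IHg -IHh; ring.
Qed.

(** The commutator of the sum of squares with L b is a sum of [brk a b c] times L a L c + L c L a.
    It changes sign when a and c are exchanged, hence vanishes. *)
Lemma Lap_L_poly b g : is_poly g -> forall x, Lap (L b g) x = L b (Lap g) x.
Proof.
move=> pg x; have sg := is_poly_sm pg.
have pL e u : is_poly u -> is_poly (L e u).
  elim=> {u} [_ [v ->]|k|u h pu IHu ph IHh|u h pu IHu ph IHh].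
  - by rewrite L_lin; apply: alg_base; eexists.
  - by rewrite L_cst; exact: alg_cst.
  - have su := is_poly_sm pu; have sh := is_poly_sm ph.
    by rewrite (LD _ (sm_dd su) (sm_dd sh)); exact: alg_add.
  - have su := is_poly_sm pu; have sh := is_poly_sm ph.
    by rewrite (LM _ (sm_dd su) (sm_dd sh)); apply: alg_add; apply: alg_mul.
have -> : L b (Lap g) x = 2^-1 * \sum_a L b (L a (L a g)) x.
  by rewrite /Lap LZ ?L_sum //; [move=> c; smt|smt].
rewrite /Lap; congr (_ * _); apply/eqP; rewrite -subr_eq0 -sumrB.
rewrite (eq_bigr (fun a => \sum_c 2^-1 * (brk a b c.1 c.2 * (L a (L c g) x + L c (L a g) x)))); last first.
  move=> a _.
  have -> : L a (L a (L b g)) x - L b (L a (L a g)) x =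
     L a (fun y => L a (L b g) y - L b (L a g) y) x + (L a (L b (L a g)) x - L b (L a (L a g)) x).
    by rewrite LB; [ring|smt|smt].
  rewrite brk_poly; last exact: pL.
  have -> : (fun y => L a (L b g) y - L b (L a g) y) =
      (fun y => 2^-1 * \sum_c brk a b c.1 c.2 * L c g y) by apply/funext => y; exact: brk_poly.
  rewrite LZ ?L_sum; [|by move=> c; smt|by smt].
  rewrite -mulrDr -big_split -mulr_sumr; congr (_ * _); apply: eq_bigr => c _ /=.
  by rewrite LZ; [ring|smt].
set S := \sum_a _.
suff : S = - S by move=> h; apply/eqP; lra.
rewrite {1}/S exchange_big /= /S -sumrN; apply: eq_bigr => a _.
rewrite -sumrN; apply: eq_bigr => c _; rewrite brk_anti; ring.
Qed.

(** [sm] gives no commutation rule for derivatives. Both sides commute with K_N, so the polynomial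
    case applied to K_N g gives the identity in the limit. *)
Lemma Lap_L b g : sm g -> Lap (L b g) = L b (Lap g).
Proof.
move=> sg; apply/funext => x.
have c1 := @KK_cvg R n sigma hn hsigma _ x (sm_cont (sm_Lap (sm_L b sg))).
have c2 := @KK_cvg R n sigma hn hsigma _ x (sm_cont (sm_L b (sm_Lap sg))).
suff E : (fun N => KK sigma N (Lap (L b g)) x) = (fun N => KK sigma N (L b (Lap g)) x).
  by rewrite E in c1; exact: (cvg_unique _ c1 c2).
apply/funext => N; have pK := is_poly_KK hsigma N (sm_cont sg).
have := Lap_L_poly b pK x.
rewrite !L_KK // !Lap_KK //; try by smt.
by rewrite L_KK //; smt.
Qed.

Lemma Lap_LL I g : sm g -> Lap (LL I g) = LL I (Lap g).
Proof. by move=> sg; elim: I => //= a I <-; rewrite Lap_L //; exact: sm_LL. Qed.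

End Commutation.

(** * Smooth functions of the ambient space *)

Section Small_o.
Variable R : realType.

Lemma is_derive_epsP (F : R -> R) (x d : R) : is_derive x 1 F d <->
  forall e : R, 0 < e -> exists2 r : R, 0 < r & forall h : R, `|h| < r ->
    `|F (x + h) - F x - h * d| <= e * `|h|.
Proof.
split=> [hF e e0|H].
  have cF : h^-1 *: (F (h *: (1 : R) + x) - F x) @[h --> 0^'] --> d.
    by case: hF => dF <-; exact: dF.
  have /cvgrPdist_le/(_ e e0) := cF; rewrite /= => /nbhs_ballP[r /= r0 hr].
  exists r => // h hr'; have [->|h0] := eqVneq h 0.
    by rewrite addr0 subrr sub0r mul0r oppr0 normr0 mulr0.
  have := hr h; rewrite /ball /= sub0r normrN => /(_ hr' h0).
  rewrite /GRing.scale /= mulr1 (addrC h x) => hh.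
  have -> : F (x + h) - F x - h * d = - (h * (d - h^-1 * (F (x + h) - F x))).
    by rewrite mulrBr mulrA divff // mul1r opprB.
  by rewrite normrN normrM mulrC ler_wpM2r.
have cF : h^-1 *: (F (h *: (1 : R) + x) - F x) @[h --> 0^'] --> d.
  apply/cvgrPdist_le => /= e e0; have [r r0 hr] := H e e0.
  apply/nbhs_ballP; exists r => //= h; rewrite /ball /= sub0r normrN => hr' h0.
  have := hr h hr'; rewrite /GRing.scale /= mulr1 (addrC h x) => hh.
  have -> : d - h^-1 * (F (x + h) - F x) = - (h^-1 * (F (x + h) - F x - h * d)).
    by move: (F (x + h) - F x) => A; field.
  by rewrite normrN normrM normfV ler_pdivrMl ?normr_gt0 // [leRHS]mulrC.
have cF' : cvg (h^-1 *: (F (h *: (1 : R) + x) - F x) @[h --> 0^']) by apply/cvg_ex; exists d.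
by apply: DeriveDef => //; apply/cvg_lim.
Qed.

Lemma is_derive_lip (F : R -> R) (x d : R) : is_derive x 1 F d ->
  exists2 r : R, 0 < r & forall h : R, `|h| < r -> `|F (x + h) - F x| <= (`|d| + 1) * `|h|.
Proof.
move=> /is_derive_epsP/(_ 1 ltr01)[r r0 hr]; exists r => // h /hr; rewrite mul1r.
rewrite -[in X in _ -> X](subrK (h * d) (F (x + h) - F x)).
move: (_ - h * d) => A H; apply: le_trans (ler_normD _ _) _.
by rewrite normrM mulrDl mul1r addrC [`|h| * _]mulrC lerD2l.
Qed.

Lemma continuous_epsP (F : R -> R) (x : R) : {for x, continuous F} <->
  forall e : R, 0 < e -> exists2 r : R, 0 < r & forall y : R, `|y - x| < r -> `|F y - F x| <= e.
Proof.
split=> [cF e e0|H].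
  have /cvgrPdist_le/(_ e e0) := cF; rewrite /= => /nbhs_ballP[r /= r0 hr].
  by exists r => // y hy; rewrite distrC; apply: hr; rewrite /ball /= distrC.
apply/cvgrPdist_le => /= e e0; have [r r0 hr] := H e e0.
by apply/nbhs_ballP; exists r => //= y; rewrite /ball /= distrC => /hr; rewrite distrC.
Qed.

End Small_o.

Section Chain_rule.
Variables (R : realType) (n : nat).
Notation V := 'rV[R]_n.
Implicit Types (h : V -> R) (x y v : V).

Definition e_ (i : 'I_n) : V := delta_mx 0 i.

Lemma coord_mxnorm v i : `|v 0 i| <= `|v|.
Proof.
have -> : `|v| = mx_norm v by [].
by rewrite mx_normrE; apply/bigmax_geP; right => /=; exists (0, i).
Qed.

Lemma mxnorm_le v (M : R) : 0 <= M -> (forall i, `|v 0 i| <= M) -> `|v| <= M.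
Proof.
move=> M0 hv; have -> : `|v| = mx_norm v by [].
by rewrite mx_normrE; apply: bigmax_le => // -[i j] _ /=; rewrite ord1.
Qed.

Lemma partial_epsP h y i (d : R) : derivable h y (e_ i) /\ partial i h y = d <->
  forall e : R, 0 < e -> exists2 r : R, 0 < r & forall s : R, `|s| < r ->
    `|h (y + s *: e_ i) - h y - s * d| <= e * `|s|.
Proof.
split=> [[dh <-] e e0|H].
  have cF : s^-1 *: (h (s *: e_ i + y) - h y) @[s --> 0^'] --> partial i h y by exact: dh.
  have /cvgrPdist_le/(_ e e0) := cF; rewrite /= => /nbhs_ballP[r /= r0 hr].
  exists r => // s hr'; have [->|s0] := eqVneq s 0.
    by rewrite scale0r addr0 subrr sub0r mul0r oppr0 normr0 mulr0.
  have := hr s; rewrite /ball /= sub0r normrN => /(_ hr' s0).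
  rewrite /GRing.scale /= (addrC _ y) => hh.
  have -> : h (y + s *: e_ i) - h y - s * partial i h y =
      - (s * (partial i h y - s^-1 * (h (y + s *: e_ i) - h y))).
    by rewrite mulrBr mulrA divff // mul1r opprB.
  by rewrite normrN normrM mulrC ler_wpM2r.
have cF : s^-1 *: (h (s *: e_ i + y) - h y) @[s --> 0^'] --> d.
  apply/cvgrPdist_le => /= e e0; have [r r0 hr] := H e e0.
  apply/nbhs_ballP; exists r => //= s; rewrite /ball /= sub0r normrN => hr' s0.
  have := hr s hr'; rewrite /GRing.scale /= (addrC _ y) => hh.
  have -> : d - s^-1 * (h (y + s *: e_ i) - h y) = - (s^-1 * (h (y + s *: e_ i) - h y - s * d)).
    by move: (h (y + _) - h y) => A; field.
  by rewrite normrN normrM normfV ler_pdivrMl ?normr_gt0 // [leRHS]mulrC.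
split; first by apply/cvg_ex; exists d.
exact/cvg_lim.
Qed.

Lemma is_derive_line h y i : derivable h y (e_ i) ->
  is_derive (0 : R) 1 (fun s => h (y + s *: e_ i)) (partial i h y).
Proof.
move=> dh; have /partial_epsP H : derivable h y (e_ i) /\ partial i h y = partial i h y by [].
apply/is_derive_epsP => e /H[r r0 hr]; exists r => // s /hr.
by rewrite add0r scale0r addr0.
Qed.

Lemma partial_line h y i (d : R) : is_derive (0 : R) 1 (fun s => h (y + s *: e_ i)) d ->
  derivable h y (e_ i) /\ partial i h y = d.
Proof.
move=> /is_derive_epsP H; apply/partial_epsP => e /H[r r0 hr]; exists r => // s /hr.
by rewrite add0r scale0r addr0.
Qed.

Lemma is_derive_line_at h y i (s : R) : derivable h (y + s *: e_ i) (e_ i) ->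
  is_derive s 1 (fun s => h (y + s *: e_ i)) (partial i h (y + s *: e_ i)).
Proof.
move=> /is_derive_line/is_derive_epsP H; apply/is_derive_epsP => e /H[r r0 hr].
by exists r => // u /hr; rewrite add0r scale0r addr0 -(addrA y) -scalerDl.
Qed.

(* Continuous partial derivatives give a first-order expansion: telescope over
   the coordinates and apply the mean value theorem to each of them. *)
Lemma C1_expansion h x : (\forall y \near x, forall i, derivable h y (e_ i)) ->
  (forall i, {for x, continuous (partial i h)}) ->
  forall e : R, 0 < e -> exists2 r : R, 0 < r & forall v, `|v| < r ->
    `|h (x + v) - h x - \sum_i v 0 i * partial i h x| <= e * \sum_i `|v 0 i|.
Proof.
move=> /nbhs_ballP[r0 /= r00 hr0] ch e e0.
have [r1 r10 hr1] : exists2 r : R, 0 < r & forall y, `|y - x| < r -> forall i,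
    `|partial i h y - partial i h x| <= e.
  have : \forall y \near x, forall i, `|partial i h x - partial i h y| <= e.
    apply: (@filter_forall _ _ _ _ (nbhs_filter x)) => i.
  by have /cvgrPdist_le := ch i; apply.
  move=> /nbhs_ballP[r /= rp hr]; exists r => // y hy i; rewrite distrC; apply: hr.
  by rewrite -ball_normE /ball_ /= distrC.
exists (Num.min r0 r1); first by rewrite lt_min r00.
move=> v; rewrite lt_min => /andP[v0 v1].
pose w (k : nat) : V := \row_i (if (i < k)%N then v 0 i else 0).
have w0 : w 0%N = 0 by apply/rowP => i; rewrite !mxE ltn0.
have wn : w n = v by apply/rowP => i; rewrite !mxE ltn_ord.
have wS (i : 'I_n) : w i.+1 = w i + v 0 i *: e_ i.
  apply/rowP => k; rewrite !mxE eqxx /= ltnS leq_eqVlt.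
  have [->|ki] := eqVneq k i; first by rewrite eqxx ltnn /= mulr1 add0r.
  have -> : (k == i :> nat) = false by apply/negP => /eqP/val_inj kE; rewrite kE eqxx in ki.
  by rewrite /= mulr0 addr0.
have wle (i : 'I_n) (s : R) : `|s| <= `|v 0 i| -> `|w i + s *: e_ i| <= `|v|.
  move=> hs; apply: mxnorm_le => // k; rewrite !mxE eqxx /=.
  have [->|ki] := eqVneq k i.
    by rewrite ltnn add0r mulr1; apply: le_trans hs _; exact: coord_mxnorm.
  rewrite mulr0 addr0; case: ifP => _; first exact: coord_mxnorm.
  by rewrite normr0.
have step (i : 'I_n) : `|h (x + w i.+1) - h (x + w i) - v 0 i * partial i h x| <= e * `|v 0 i|.
  pose F (s : R) := h (x + w i + s *: e_ i).
  have near (s : R) : `|s| <= `|v 0 i| -> `|x + w i + s *: e_ i - x| < Num.min r0 r1.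
    move=> hs; rewrite addrAC (addrAC x) subrr add0r.
    by apply: le_lt_trans (wle i s hs) _; rewrite lt_min v0.
  have dF (s : R) : `|s| <= `|v 0 i| -> is_derive s 1 F (partial i h (x + w i + s *: e_ i)).
    move=> /near; rewrite lt_min => /andP[hs _]; apply: is_derive_line_at.
    by apply: hr0; rewrite -ball_normE /ball_ /= distrC.
  have key (a b : R) : a <= b -> `|a| <= `|v 0 i| -> `|b| <= `|v 0 i| ->
      exists2 c, `|c| <= `|v 0 i| & F b - F a = partial i h (x + w i + c *: e_ i) * (b - a).
    move=> ab ha hb.
    have inab c : c \in `[a, b] -> `|c| <= `|v 0 i|.
      rewrite in_itv /= => /andP[ac cb]; rewrite ler_norml; move: ha hb.
      by rewrite !ler_norml => /andP[a1 _] /andP[_ b2]; rewrite (le_trans a1) // (le_trans cb).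
    have [c||c cab ->] := @MVT_segment R F (fun s => partial i h (x + w i + s *: e_ i)) a b ab.
    - by move=> cab; apply/dF/inab; apply: subset_itv_oo_cc cab.
    - by apply: derivable_within_continuous => c /inab /dF [].
    - by exists c => //; exact: inab.
  have [c hc E] : exists2 c, `|c| <= `|v 0 i| &
      h (x + w i.+1) - h (x + w i) = v 0 i * partial i h (x + w i + c *: e_ i).
    have -> : h (x + w i.+1) = F (v 0 i) by rewrite /F wS addrA.
    have -> : h (x + w i) = F 0 by rewrite /F scale0r addr0.
    have [v0i|v0i] := leP 0 (v 0 i).
      have [||c hc ->] := key 0 (v 0 i) v0i; rewrite ?normr0 //.
      by exists c => //; rewrite subr0 mulrC.
    have [||c hc E] := key (v 0 i) 0 (ltW v0i); rewrite ?normr0 //.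
    by exists c => //; rewrite -opprB E; ring.
  rewrite E -mulrBr normrM mulrC ler_wpM2r //; apply: hr1.
  by have := near c hc; rewrite lt_min => /andP[].
have -> : h (x + v) - h x = \sum_(i < n) (h (x + w i.+1) - h (x + w i)).
  rewrite -(big_mkord xpredT (fun k => h (x + w k.+1) - h (x + w k))).
  by rewrite telescope_sumr // w0 wn addr0.
rewrite -sumrB mulr_sumr; apply: le_trans (ler_norm_sum _ _ _) _.
by apply: ler_sum => i _; exact: step.
Qed.

Lemma is_derive_curve h (c : R -> V) (c' : V) :
  (\forall y \near c 0, forall i, derivable h y (e_ i)) ->
  (forall i, {for c 0, continuous (partial i h)}) ->
  (forall i, is_derive (0 : R) 1 (fun t => c t 0 i) (c' 0 i)) ->
  is_derive (0 : R) 1 (fun t => h (c t)) (\sum_i c' 0 i * partial i h (c 0)).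
Proof.
move=> nh ch dc; apply/is_derive_epsP => e e0.
(* M bounds the speed of the curve and P the gradient of h. Half of e is spent on the expansion of
   h, half on that of the curve. *)
pose M := \sum_i (`|c' 0 i| + 1); pose P := \sum_i `|partial i h (c 0)|.
have M0 : 0 <= M by apply: sumr_ge0 => i _; rewrite addr_ge0.
have P0 : 0 <= P by apply: sumr_ge0 => i _.
have e1 : 0 < e / 2 / (M + 1) by rewrite !divr_gt0 //; lra.
have [r r0 hr] := C1_expansion nh ch e1.
have e2 : 0 < e / 2 / (P + 1) by rewrite !divr_gt0 //; lra.
have [r1 r10 hr1] : exists2 r1 : R, 0 < r1 & forall t : R, `|t| < r1 -> forall i,
    `|c t 0 i - c 0 0 i| <= (`|c' 0 i| + 1) * `|t| /\
    `|c t 0 i - c 0 0 i - t * c' 0 i| <= e / 2 / (P + 1) * `|t|.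
  have : \forall t \near (0 : R), forall i, `|c t 0 i - c 0 0 i| <= (`|c' 0 i| + 1) * `|t| /\
    `|c t 0 i - c 0 0 i - t * c' 0 i| <= e / 2 / (P + 1) * `|t|.
    apply: (@filter_forall _ _ _ _ (nbhs_filter (0 : R))) => i; have [a a0 ha] := is_derive_lip (dc i).
    have /is_derive_epsP/(_ _ e2)[b b0 hb] := dc i.
    apply/nbhs_ballP; exists (Num.min a b); first by rewrite /= lt_min a0.
    move=> t; rewrite /ball /= sub0r normrN lt_min => /andP[ta tb].
    by have := ha t ta; have := hb t tb; rewrite add0r.
  move=> /nbhs_ballP[r1 /= r10 hr1]; exists r1 => // t ht.
  by apply: hr1; rewrite /ball /= sub0r normrN.
exists (Num.min r1 (r / (M + 1))); first by rewrite lt_min r10 divr_gt0 //; lra.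
move=> t; rewrite lt_min add0r => /andP[t1]; rewrite ltr_pdivlMr; last by lra.
move=> t2; set v := c t - c 0.
have vi i : v 0 i = c t 0 i - c 0 0 i by rewrite !mxE.
have ct : c t = c 0 + v by rewrite /v addrC subrK.
have le1 i : `|c' 0 i| + 1 <= M.
  rewrite /M (bigD1 i) //= lerDl; apply: sumr_ge0 => k _; exact: addr_ge0.
have vr : `|v| < r.
  apply: le_lt_trans t2; apply: mxnorm_le => [|i]; first by rewrite mulr_ge0 //; lra.
  rewrite vi; have [/le_trans -> //] := hr1 t t1 i.
  by rewrite mulrC ler_wpM2l //; have := le1 i; lra.
have := hr v vr; rewrite -ct => H.
have -> : h (c t) - h (c 0) - t * \sum_i c' 0 i * partial i h (c 0) =
  (h (c t) - h (c 0) - \sum_i v 0 i * partial i h (c 0)) +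
  \sum_i (v 0 i - t * c' 0 i) * partial i h (c 0).
  have -> : \sum_i (v 0 i - t * c' 0 i) * partial i h (c 0) =
      \sum_i v 0 i * partial i h (c 0) - t * \sum_i c' 0 i * partial i h (c 0).
    by rewrite mulr_sumr -sumrB; apply: eq_bigr => i _; rewrite mulrBl mulrA.
  ring.
apply: le_trans (ler_normD _ _) _.
have -> : e * `|t| = e / 2 * `|t| + e / 2 * `|t| by field.
apply: lerD.
  apply: le_trans H _; apply: (@le_trans _ _ (e / 2 / (M + 1) * (M * `|t|))).
    rewrite ler_wpM2l ?(ltW e1) // /M mulr_suml; apply: ler_sum => i _.
    by rewrite vi; case: (hr1 t t1 i).
  rewrite mulrA ler_wpM2r // -mulrA ler_piMr //; first by lra.
  by rewrite mulrC ler_pdivrMr; lra.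
apply: le_trans (ler_norm_sum _ _ _) _.
apply: (@le_trans _ _ (e / 2 / (P + 1) * `|t| * P)).
  rewrite /P mulr_sumr; apply: ler_sum => i _; rewrite normrM ler_wpM2r // vi.
  by case: (hr1 t t1 i).
have -> : e / 2 / (P + 1) * `|t| * P = e / 2 * (P / (P + 1)) * `|t|.
  by move: (P + 1)^-1 => b; ring.
rewrite ler_wpM2r // ler_piMr //; first by lra.
by rewrite ler_pdivrMr; lra.
Qed.

End Chain_rule.

(** * Radial extensions: ambient partial derivatives and rotation fields *)

Section Radial_extension.
Variables (R : realType) (n : nat).
Notation V := 'rV[R]_n.
Notation pt := (pt R n).
Implicit Types (F : V -> R) (x y : V) (p : pt) (I : seq 'I_n).
Notation D F I := (partials I (radial_ext F)).

Lemma is_derive_mul (u v : R -> R) (x du dv : R) : is_derive x 1 u du -> is_derive x 1 v dv ->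
  is_derive x 1 (fun s => u s * v s) (du * v x + u x * dv).
Proof.
move=> hu hv; have h := is_deriveM hu hv; apply: (is_derive_eq h).
by rewrite addrC; congr (_ + _); exact: mulrC.
Qed.

Lemma near_neq0 x : x != 0 -> \forall y \near x, y != 0.
Proof.
rewrite -enorm_eq0 => x0; have := @cvgr_neq0 _ _ _ _ _ (@enorm R n) _ (@enorm_continuous R n x) x0.
by move=> /(_ (nbhs_filter x)); apply: filterS => y; rewrite enorm_eq0.
Qed.

Lemma vec_neq0 p : vec p != 0.
Proof. by rewrite -edot_eq0 edot_vec oner_neq0. Qed.

Lemma enorm_vec p : enorm (vec p) = 1.
Proof. exact: vec_sphere. Qed.

Lemma enormZ (l : R) x : 0 <= l -> enorm (l *: x) = l * enorm x.
Proof.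
move=> l0; rewrite /enorm edotZl edotZr mulrA -expr2 sqrtrM ?sqr_ge0 //.
by rewrite sqrtr_sqr ger0_norm.
Qed.

Lemma radial_vec F p : radial_ext F (vec p) = F (vec p).
Proof. by rewrite /radial_ext enorm_vec invr1 scale1r. Qed.

Lemma radial_hom F x (l : R) : 0 < l -> radial_ext F (l *: x) = radial_ext F x.
Proof.
move=> l0; rewrite /radial_ext enormZ ?ltW // scalerA invfM mulrAC mulVf ?mul1r //.
exact: lt0r_neq0.
Qed.

Lemma smooth_curve F I (c : R -> V) (c' : V) : smooth_sphere F -> c 0 != 0 ->
  (forall k, is_derive (0 : R) 1 (fun t => c t 0 k) (c' 0 k)) ->
  is_derive (0 : R) 1 (fun t => D F I (c t)) (\sum_k c' 0 k * D F (k :: I) (c 0)).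
Proof.
move=> sF c0 dc; apply: (is_derive_curve (h := D F I)) => //.
  by have := near_neq0 c0; apply: filterS => y y0 i; exact: (sF I y y0).2.
by move=> i; exact: (sF (i :: I) _ c0).1.
Qed.

Lemma sum_delta (i : 'I_n) (u : 'I_n -> R) : \sum_k (i == k)%:R * u k = u i.
Proof.
rewrite (bigD1 i) //= eqxx mul1r big1 ?addr0 // => k.
by rewrite eq_sym => /negPf ->; rewrite mul0r.
Qed.

Lemma is_L_partials F I a p : smooth_sphere F ->
  is_derive (0 : R) 1 (fun t => D F I (vec (rot a t p)))
    (vec p 0 a.1 * D F (a.2 :: I) (vec p) - vec p 0 a.2 * D F (a.1 :: I) (vec p)).
Proof.
move=> sF; have dc k : is_derive (0 : R) 1 (fun t => vec (rot a t p) 0 k)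
    ((\row_k lin (lskew a (e_ R k)) p) 0 k).
  rewrite mxE; have := is_L_lin a (e_ R k) p.
  by rewrite /lin; under eq_fun do rewrite edot_delta.
have := smooth_curve I sF _ dc; rewrite rot0 => /(_ (vec_neq0 p)) H.
apply: is_derive_eq; rewrite -[X in _ = X * _ - _]mulr1.
rewrite (eq_bigr (fun k => (a.2 == k)%:R * (vec p 0 a.1 * D F (k :: I) (vec p)) -
  (a.1 == k)%:R * (vec p 0 a.2 * D F (k :: I) (vec p)))).
  by rewrite sumrB !sum_delta mulr1.
by move=> k _; rewrite mxE lin_lskew !mxE eqxx /=; ring.
Qed.

Lemma cont_partials F I : smooth_sphere F -> cont (D F I \o vec (n:=n)).
Proof.
move=> sF; split=> p; apply: continuous_comp; first exact: initial_continuous.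
exact: (sF I _ (vec_neq0 p)).1.
Qed.

Lemma dd_partials F I : smooth_sphere F -> dd (D F I \o vec (n:=n)).
Proof. by move=> sF; split=> a p; case: (is_L_partials I a p sF). Qed.

Lemma L_partials F I a : smooth_sphere F -> L a (D F I \o vec (n:=n)) =
  fun p => lin (e_ R a.1) p * D F (a.2 :: I) (vec p) - lin (e_ R a.2) p * D F (a.1 :: I) (vec p).
Proof.
move=> sF; apply/funext => p; apply: L_val; rewrite /lin !edot_delta.
exact: is_L_partials.
Qed.

(** By [L_partials], linear functions and ambient partial derivatives together generate an algebra
    stable under the rotation fields. *)
Lemma sm_partials F I : smooth_sphere F -> sm (D F I \o vec (n:=n)).
Proof.
move=> sF; pose B h := (exists v, h = lin v) \/ exists I, h = D F I \o vec (n:=n).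
apply: (@sm_alg _ _ B); last by apply: alg_base; right; exists I.
move=> _ [[v ->]|[{}I ->]]; split=> [||a].
- exact: cont_lin.
- exact/sm_dd/sm_lin.
- by rewrite L_lin; apply: alg_base; left; eexists.
- exact: cont_partials.
- exact: dd_partials.
have bl v : alg B (lin v) by apply: alg_base; left; eexists.
have bp J : alg B (D F J \o vec (n:=n)) by apply: alg_base; right; eexists.
rewrite L_partials //; apply: alg_add; first by apply: alg_mul; [exact: bl|exact: bp].
have -> : (fun p : pt => - (lin (e_ R a.2) p * D F (a.1 :: I) (vec p))) =
    (fun p => (-1) * (lin (e_ R a.2) p * D F (a.1 :: I) (vec p))).
  by apply/funext => p; rewrite mulN1r.
by apply: alg_mul; [exact: alg_cst|apply: alg_mul; [exact: bl|exact: bp]].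
Qed.

Lemma partials_nil F : D F [::] \o vec (n:=n) = F \o vec (n:=n).
Proof. by apply/funext => p; exact: radial_vec. Qed.

Lemma smooth_sm F : smooth_sphere F -> sm (F \o vec (n:=n)).
Proof. by rewrite -partials_nil; exact: sm_partials. Qed.

(** Euler's relation in degree 0, the extension being constant along the ray through p. *)
Lemma Euler F p : smooth_sphere F -> \sum_i vec p 0 i * D F [:: i] (vec p) = 0.
Proof.
move=> sF; pose c (t : R) := (1 + t) *: vec p.
have dc k : is_derive (0 : R) 1 (fun t => c t 0 k) (vec p 0 k).
  have -> : (fun t => c t 0 k) = fun t => (1 + t) * vec p 0 k by apply/funext => t; rewrite mxE.
  by apply: is_derive_eq; rewrite /GRing.scale /= add0r mulr1 mulr0 add0r.
have := @smooth_curve F [::] c (vec p) sF; rewrite /c addr0 scale1r => /(_ (vec_neq0 p) dc) H.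
rewrite -[LHS](@derive_val _ _ _ _ _ _ _ H).
have K : is_derive (0 : R) 1 (fun t => D F [::] ((1 + t) *: vec p)) 0.
  apply: (@near_eq_is_derive _ _ _ (fun _ : R => radial_ext F (vec p))).
  apply/nbhs_ballP; exists 1 => //= t; rewrite /ball /= sub0r normrN => t1.
  by rewrite radial_hom //; move: t1; rewrite ltr_norml; lra.
by rewrite derive_val.
Qed.

Definition ray p i (s : R) : V := (enorm (vec p + s *: e_ R i))^-1 *: (vec p + s *: e_ R i).

Lemma ray0 p i : ray p i 0 = vec p.
Proof. by rewrite /ray scale0r addr0 enorm_vec invr1 scale1r. Qed.

Lemma is_derive_ray p i k :
  is_derive (0 : R) 1 (fun s => ray p i s 0 k) ((i == k)%:R - vec p 0 i * vec p 0 k).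
Proof.
have E (s : R) : ray p i s 0 k =
    (Num.sqrt (1 + s * (2 * vec p 0 i) + s * s))^-1 * (vec p 0 k + s * (i == k)%:R).
  rewrite /ray !mxE eqxx /= (eq_sym k); congr (_^-1 * _); rewrite /enorm; congr Num.sqrt.
  rewrite edotDl !edotDr !edotZr !edotZl edot_vec (edotC (e_ _ _) (vec p)) !edot_delta mxE !eqxx.
  by rewrite /= mulr1; ring.
under eq_fun do rewrite E.
have d1 : is_derive (0 : R) 1 (fun s : R => 1 + s * (2 * vec p 0 i) + s * s) (2 * vec p 0 i).
  by apply: is_derive_eq; rewrite /GRing.scale /=; ring.
have d2 : is_derive (0 : R) 1 (fun s : R => Num.sqrt (1 + s * (2 * vec p 0 i) + s * s)) (vec p 0 i).
  have h : is_derive ((fun s : R => 1 + s * (2 * vec p 0 i) + s * s) 0) 1 (@Num.sqrt R) 2^-1.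
    rewrite /= mul0r mulr0 !addr0 -[X in is_derive _ _ _ X]mulr1.
    have := @is_derive1_sqrt R 1 ltr01; rewrite sqrtr1 mulr1.
    by rewrite mulr1.
  have := @is_derive1_comp _ _ (fun s : R => 1 + s * (2 * vec p 0 i) + s * s) _ _ _ h d1.
  by rewrite mulrA mulVf ?mul1r //; apply: lt0r_neq0.
have d3 : is_derive (0 : R) 1 (fun s : R => (Num.sqrt (1 + s * (2 * vec p 0 i) + s * s))^-1)
    (- vec p 0 i).
  have h : is_derive ((fun s : R => Num.sqrt (1 + s * (2 * vec p 0 i) + s * s)) 0) 1
      (fun y : R => y^-1) (-1).
    rewrite /= mul0r mulr0 !addr0 sqrtr1; apply: is_derive_eq; first exact: is_derive_inv (oner_neq0 _).
    by rewrite expr1n invr1.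
  have := @is_derive1_comp _ _ (fun s : R => Num.sqrt (1 + s * (2 * vec p 0 i) + s * s)) _ _ _ h d2.
  by rewrite mulN1r.
have d4 : is_derive (0 : R) 1 (fun s : R => vec p 0 k + s * (i == k)%:R) (i == k)%:R.
  by apply: is_derive_eq; rewrite /GRing.scale /=; ring.
have d5 := is_derive_mul d3 d4; apply: (is_derive_eq d5).
rewrite !mul0r !addr0 sqrtr1 invr1; ring.
Qed.

Lemma partial_radial (H : V -> R) p i d :
  is_derive (0 : R) 1 (fun s => H (ray p i s)) d -> partial i (radial_ext H) (vec p) = d.
Proof. by move=> dH; have [] := @partial_line R n (radial_ext H) (vec p) i d dH. Qed.

(** [sphere_div] extends the gradient radially once more. Differentiating along the normalized line
    [ray] accounts for this by a tangential projection. *)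
Lemma partial_radial_partials F I p i : smooth_sphere F ->
  partial i (radial_ext (D F I)) (vec p) =
  \sum_k ((i == k)%:R - vec p 0 i * vec p 0 k) * D F (k :: I) (vec p).
Proof.
move=> sF; apply: partial_radial.
have := @smooth_curve F I (ray p i) (\row_k ((i == k)%:R - vec p 0 i * vec p 0 k)) sF.
rewrite ray0 => /(_ (vec_neq0 p)) h; apply: is_derive_eq; first apply: h.
  by move=> k; rewrite mxE; exact: is_derive_ray.
by apply: eq_bigr => k _; rewrite mxE.
Qed.

(** The summand on the left is T i j + T j i, and the sum of T reduces by |x| = 1 and Euler's
    relation. The terms in D1 add up to a multiple of x . D1 = 0. *)
Lemma lap_coord (x D1 : 'I_n -> R) (D2 : 'I_n -> 'I_n -> R) :
  \sum_i x i * x i = 1 -> \sum_i x i * D1 i = 0 ->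
  \sum_i \sum_j (((i == j)%:R * x i - x j) * D1 j + x i * (x i * D2 j j - x j * D2 i j)
    - ((x i - (i == j)%:R * x j) * D1 i + x j * (x i * D2 j i - x j * D2 i i))) =
  2 * \sum_i \sum_k ((i == k)%:R - x i * x k) * D2 k i.
Proof.
move=> xx X0.
pose T i j := x i * x i * D2 j j - x i * x j * D2 i j - x j * D1 j + (i == j)%:R * (x j * D1 j).
have ET i j : ((i == j)%:R * x i - x j) * D1 j + x i * (x i * D2 j j - x j * D2 i j)
  - ((x i - (i == j)%:R * x j) * D1 i + x j * (x i * D2 j i - x j * D2 i i)) = T i j + T j i.
  rewrite /T (eq_sym j); have [->|_] := eqVneq i j.
    by change (true%:R : R) with (1 : R); ring.
  by change (false%:R : R) with (0 : R); ring.
have -> : \sum_i \sum_j (((i == j)%:R * x i - x j) * D1 j + x i * (x i * D2 j j - x j * D2 i j)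
  - ((x i - (i == j)%:R * x j) * D1 i + x j * (x i * D2 j i - x j * D2 i i))) =
    \sum_i \sum_j T i j + \sum_i \sum_j T j i.
  by rewrite -big_split; apply: eq_bigr => i _; rewrite -big_split; apply: eq_bigr => j _; exact: ET.
rewrite [X in X + _]exchange_big /=.
have -> : \sum_j \sum_i T i j = \sum_j (\sum_k ((j == k)%:R - x j * x k) * D2 k j +
    (1 - n%:R) * (x j * D1 j)).
  apply: eq_bigr => j _.
  have -> : \sum_k ((j == k)%:R - x j * x k) * D2 k j =
      D2 j j - \sum_k x j * x k * D2 k j.
    by under eq_bigr do rewrite mulrBl; rewrite sumrB sum_delta.
  rewrite /T big_split /= !sumrB -mulr_suml xx sumr_const card_ord.
  have -> : \sum_i (i == j)%:R * (x j * D1 j) = x j * D1 j.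
    by under eq_bigr do rewrite eq_sym; rewrite sum_delta.
  have -> : \sum_i x i * x j * D2 i j = \sum_k x j * x k * D2 k j.
    by apply: eq_bigr => k _; rewrite (mulrC (x k)).
  by rewrite -[_ *+ n]mulr_natl; ring.
by rewrite big_split /= -mulr_sumr X0 mulr0 addr0 mulr_natl.
Qed.

(** The tangential projection of the constant field Om has divergence - (n - 1) (Om . x), which
    produces the last term. *)
Lemma div_coord (x D1 Om : 'I_n -> R) (w g : R) :
  \sum_i x i * x i = 1 -> \sum_i x i * D1 i = 0 -> \sum_i Om i * x i = w ->
  \sum_i (D1 i * (Om i - w * x i) + g * - ((Om i - x i * w) * x i + w * (1 - x i * x i))) =
  2^-1 * \sum_i \sum_j (Om j * x i - Om i * x j) * (x i * D1 j - x j * D1 i)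
   - (n%:R - 1) * w * g.
Proof.
move=> xx X0 wE.
pose T i j := x i * x i * (Om j * D1 j) - Om j * x j * (x i * D1 i).
have -> : \sum_i \sum_j (Om j * x i - Om i * x j) * (x i * D1 j - x j * D1 i) =
    \sum_i \sum_j T i j + \sum_i \sum_j T j i.
  rewrite -big_split; apply: eq_bigr => i _; rewrite -big_split; apply: eq_bigr => j _ /=.
  by rewrite /T; ring.
rewrite [X in 2^-1 * (_ + X)]exchange_big /=.
have -> : \sum_i \sum_j T i j = \sum_i Om i * D1 i.
  rewrite exchange_big; apply: eq_bigr => j _; rewrite /T sumrB -mulr_suml xx -mulr_sumr X0; ring.
rewrite big_split /=.
rewrite (eq_bigr (fun i => Om i * D1 i - w * (x i * D1 i))); last by move=> i _; ring.
rewrite sumrB -mulr_sumr X0 mulr0 subr0 -mulr_sumr.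
rewrite [X in g * X](eq_bigr (fun i => (2 * w) * (x i * x i) - Om i * x i - w)); last by move=> i _; ring.
rewrite !sumrB -mulr_sumr xx wE sumr_const card_ord -[_ *+ n]mulr_natl; by field.
Qed.

(** With [sphere_div_vec], this carries the equation of the statement over to the operators built on
    rotation fields. *)
Lemma sphere_lap_vec F p : smooth_sphere F -> sphere_lap F (vec p) = Lap (F \o vec (n:=n)) p.
Proof.
move=> sF; pose x i := vec p 0 i; pose D1 i := D F [:: i] (vec p).
pose D2 i j := D F [:: i; j] (vec p).
have xx : \sum_i x i * x i = 1 by rewrite -(edot_vec p).
have -> : sphere_lap F (vec p) = \sum_i \sum_k ((i == k)%:R - x i * x k) * D2 k i.
  rewrite /sphere_lap /sphere_div; apply: eq_bigr => i _.
  have -> : (fun y => sphere_grad F y 0 i) = D F [:: i] by apply/funext => y; rewrite mxE.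
  exact: partial_radial_partials.
have LLe a : L a (L a (F \o vec (n:=n))) p =
  ((a.1 == a.2)%:R * x a.1 - x a.2) * D1 a.2 + x a.1 * (x a.1 * D2 a.2 a.2 - x a.2 * D2 a.1 a.2)
  - ((x a.1 - (a.1 == a.2)%:R * x a.2) * D1 a.1 + x a.2 * (x a.1 * D2 a.2 a.1 - x a.2 * D2 a.1 a.1)).
  rewrite -partials_nil L_partials //.
  have s1 i : sm (lin (e_ R i) : pt -> R) by exact: sm_lin.
  have s2 i : sm (fun p => D F [:: i] (vec p)) by exact: sm_partials.
  rewrite (LB _ (smM (s1 _) (s2 _)) (smM (s1 _) (s2 _))).
  rewrite (LM a (sm_dd (s1 a.1)) (sm_dd (s2 a.2))) (LM a (sm_dd (s1 a.2)) (sm_dd (s2 a.1))) !L_lin.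
  have E i : L a (fun p => D F [:: i] (vec p)) = fun p => lin (e_ R a.1) p * D F [:: a.2; i] (vec p)
    - lin (e_ R a.2) p * D F [:: a.1; i] (vec p) by exact: (@L_partials F [:: i] a sF).
  rewrite !E !lin_lskew /lin !edot_delta !mxE !eqxx !andTb (eq_sym a.2).
  rewrite /x /D1 /D2; change (true%:R : R) with (1 : R).
  move: (_ == _)%:R (vec p 0 a.1) (vec p 0 a.2) (D F [:: a.1] (vec p)) (D F [:: a.2] (vec p)).
  move: (D F [:: a.1; a.1] (vec p)) (D F [:: a.1; a.2] (vec p)).
  move: (D F [:: a.2; a.1] (vec p)) (D F [:: a.2; a.2] (vec p)); intros; ring.
rewrite /Lap (eq_bigr _ (fun a _ => LLe a)).
rewrite (sum_idx (fun i j => ((i == j)%:R * x i - x j) * D1 j + x i * (x i * D2 j j - x j * D2 i j)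
  - ((x i - (i == j)%:R * x j) * D1 i + x j * (x i * D2 j i - x j * D2 i i)))).
rewrite (lap_coord D2 xx (Euler p sF)); by field.
Qed.

Lemma drift_coord (Om y : V) i :
  (Om *m tangent_proj y) 0 i = Om 0 i - edot Om y * y 0 i.
Proof.
rewrite /tangent_proj mulmxBr mulmx1 mulmxA !mxE; congr (_ - _).
by rewrite big_ord1 edotE.
Qed.

Lemma sphere_div_vec F Om p : smooth_sphere F ->
  sphere_div (fun y => F y *: (Om *m tangent_proj y)) (vec p) =
  Gam (lin Om) (F \o vec (n:=n)) p - (n%:R - 1) * lin Om p * F (vec p).
Proof.
move=> sF; pose x i := vec p 0 i; pose D1 i := D F [:: i] (vec p).
have xx : \sum_i x i * x i = 1 by rewrite -(edot_vec p).
pose w := edot Om (vec p).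
have wE : \sum_i Om 0 i * x i = w by [].
have X0 : \sum_i x i * D1 i = 0 by exact: Euler.
have -> : sphere_div (fun y => F y *: (Om *m tangent_proj y)) (vec p) =
  \sum_i (D1 i * (Om 0 i - w * x i) +
    F (vec p) * - ((Om 0 i - x i * w) * x i + w * (1 - x i * x i))).
  apply: eq_bigr => i _; rewrite /radial_ext; under eq_fun do rewrite mxE drift_coord.
  apply: (@partial_radial (fun y => F y * (Om 0 i - edot Om y * y 0 i))).
  have d1 : is_derive (0 : R) 1 (fun s => F (ray p i s)) (D1 i).
    exact: (@is_derive_line R n (radial_ext F) _ i ((sF [::] _ (vec_neq0 p)).2 i)).
  have d2 : is_derive (0 : R) 1 (fun s => ray p i s 0 i) (1 - x i * x i).
    by have := is_derive_ray p i i; rewrite eqxx.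
  have d3 : is_derive (0 : R) 1 (fun s => edot Om (ray p i s)) (Om 0 i - x i * w).
    have -> : (fun s => edot Om (ray p i s)) = \sum_k (fun s => Om 0 k * ray p i s 0 k).
      by apply/funext => s; rewrite fct_sumE.
    have E : Om 0 i - x i * w = \sum_k Om 0 k * ((i == k)%:R - x i * x k).
      rewrite (eq_bigr (fun k => (i == k)%:R * Om 0 k - x i * (Om 0 k * x k))).
        by rewrite sumrB sum_delta -mulr_sumr wE.
      by move=> k _; ring.
    rewrite E; apply: is_derive_sum => k; apply: is_derive_eq.
      have h := is_derive_mul (is_derive_cst (Om 0 k) (0 : R) 1) (is_derive_ray p i k).
      exact: h.
    by rewrite mul0r add0r.
  have d4 := is_derive_mul d3 d2.
  have d5 : is_derive (0 : R) 1 (fun s => Om 0 i - edot Om (ray p i s) * ray p i s 0 i) _ :=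
    is_deriveB (is_derive_cst (Om 0 i) (0 : R) 1) d4.
  have d6 := is_derive_mul d1 d5; apply: (is_derive_eq d6).
  rewrite ray0 -/w -/(x i); move: (F (vec p)) (x i) (Om 0 i) (D1 i) => ? ? ? ?; ring.
rewrite (div_coord _ xx X0 wE) /lin edotC -/w; congr (_ - _).
rewrite /Gam -partials_nil; congr (_ * _).
rewrite -(sum_idx (fun i j => (Om 0 j * x i - Om 0 i * x j) * (x i * D1 j - x j * D1 i))).
by apply: eq_bigr => a _; rewrite L_lin L_partials // lin_lskew /lin !edot_delta.
Qed.

End Radial_extension.

(** * Polynomials on the sphere are smooth in the ambient sense *)

Section Rational.
Variables (R : realType) (n : nat).
Notation V := 'rV[R]_n.
Notation pt := (pt R n).
Implicit Types (q h : V -> R) (y : V).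

(** The radial extension of a polynomial is a polynomial in the coordinates and 1 / |y|. This class
    is stable under partial derivatives away from 0, which gives smoothness of all orders at
    once. *)
Inductive rat_fun : (V -> R) -> Prop :=
| rat_cst c : rat_fun (fun=> c)
| rat_coord i : rat_fun (fun y => y 0 i)
| rat_inv : rat_fun (fun y => (enorm y)^-1)
| rat_add q h : rat_fun q -> rat_fun h -> rat_fun (fun y => q y + h y)
| rat_mul q h : rat_fun q -> rat_fun h -> rat_fun (fun y => q y * h y).

Lemma is_derive_inv_enorm y i : y != 0 ->
  is_derive (0 : R) 1 (fun s => (enorm (y + s *: e_ R i))^-1)
    (-1 * (y 0 i * ((enorm y)^-1 * ((enorm y)^-1 * (enorm y)^-1)))).
Proof.
move=> y0; have e0 : 0 < enorm y by rewrite enorm_gt0.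
have E (s : R) : (enorm (y + s *: e_ R i))^-1 =
    (Num.sqrt (edot y y + s * (2 * y 0 i) + s * s))^-1.
  rewrite /enorm; congr (Num.sqrt _)^-1.
  rewrite edotDl !edotDr !edotZr !edotZl (edotC (e_ _ _) y) !edot_delta mxE !eqxx.
  by rewrite /= mulr1; ring.
under eq_fun do rewrite E.
have d1 : is_derive (0 : R) 1 (fun s : R => edot y y + s * (2 * y 0 i) + s * s) (2 * y 0 i).
  by apply: is_derive_eq; rewrite /GRing.scale /=; ring.
have d2 : is_derive (0 : R) 1 (fun s : R => Num.sqrt (edot y y + s * (2 * y 0 i) + s * s))
    ((2 * enorm y)^-1 * (2 * y 0 i)).
  have h : is_derive ((fun s : R => edot y y + s * (2 * y 0 i) + s * s) 0) 1 (@Num.sqrt R)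
      (2 * enorm y)^-1.
    rewrite /= mul0r mulr0 !addr0; apply: is_derive1_sqrt.
    by rewrite -enorm_sqr exprn_gt0.
  exact: (@is_derive1_comp _ _ (fun s : R => edot y y + s * (2 * y 0 i) + s * s) _ _ _ h d1).
have h : is_derive ((fun s : R => Num.sqrt (edot y y + s * (2 * y 0 i) + s * s)) 0) 1
    (fun y : R => y^-1) (- (enorm y) ^- 2).
  rewrite /= mul0r mulr0 !addr0; apply: is_derive_inv; exact: lt0r_neq0.
have d3 := @is_derive1_comp _ _ (fun s : R => Num.sqrt (edot y y + s * (2 * y 0 i) + s * s))
  _ _ _ h d2.
apply: (is_derive_eq d3); field; exact: lt0r_neq0.
Qed.

Lemma rat_step q : rat_fun q -> (forall y, y != 0 -> {for y, continuous q}) /\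
  forall i, exists2 q', rat_fun q' & forall y, y != 0 ->
    is_derive (0 : R) 1 (fun s => q (y + s *: e_ R i)) (q' y).
Proof.
elim=> {q} [c|k||q h rq [cq IHq] rh [ch IHh]|q h rq [cq IHq] rh [ch IHh]].
- split=> [y _|i]; first exact: cst_continuous.
  by exists (fun=> 0) => [|y _]; [exact: rat_cst|exact: is_derive_cst].
- split=> [y _|i]; first exact: coord_continuous.
  exists (fun=> (k == i)%:R) => [|y _]; first exact: rat_cst.
  have -> : (fun s => (y + s *: e_ R i) 0 k) = fun s => y 0 k + s * (k == i)%:R.
    by apply/funext => s; rewrite !mxE eqxx.
  by apply: is_derive_eq; rewrite /GRing.scale /=; ring.
- split=> [y y0|i].
    by rewrite -enorm_eq0 in y0; exact: (cvgV y0 (@enorm_continuous R n y)).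
  exists (fun y => -1 * (y 0 i * ((enorm y)^-1 * ((enorm y)^-1 * (enorm y)^-1)))).
    apply: rat_mul; first exact: rat_cst.
    apply: rat_mul; first exact: rat_coord.
    do 2 (apply: rat_mul; first exact: rat_inv); exact: rat_inv.
  by move=> y y0; exact: (is_derive_inv_enorm i y0).
- split=> [y y0|i]; first exact: cvgD (cq y y0) (ch y y0).
  have [q' rq' hq'] := IHq i; have [h' rh' hh'] := IHh i.
  exists (fun y => q' y + h' y) => [|y y0]; first exact: rat_add.
  by have := hq' y y0; have := hh' y y0 => d1 d2; exact: is_deriveD.
- split=> [y y0|i]; first exact: cvgM (cq y y0) (ch y y0).
  have [q' rq' hq'] := IHq i; have [h' rh' hh'] := IHh i.
  exists (fun y => q' y * h y + q y * h' y) => [|y y0].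
    by apply: rat_add; exact: rat_mul.
  have d := is_derive_mul (hq' y y0) (hh' y y0).
  by apply: (is_derive_eq d); rewrite scale0r addr0.
Qed.

Lemma rat_partials (I : seq 'I_n) h q : rat_fun q -> (forall y, y != 0 -> h y = q y) ->
  exists2 q', rat_fun q' & forall y, y != 0 -> partials I h y = q' y.
Proof.
move=> rq hq; elim: I => [|i I [q' rq' hq']]; first by exists q.
have [_ /(_ i)[q'' rq'' hq'']] := rat_step rq'; exists q'' => // y y0.
have [_ <-] := partial_line (hq'' y y0).
rewrite /= /partial; apply: near_eq_derive.
by have := near_neq0 y0; apply: filterS => z /hq'.
Qed.

Lemma rat_smooth (F : V -> R) q : rat_fun q ->
  (forall y, y != 0 -> radial_ext F y = q y) -> smooth_sphere F.
Proof.
move=> rq hq I y y0; have [q' rq' hq'] := rat_partials I rq hq.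
have nq : \forall z \near y, q' z = partials I (radial_ext F) z.
  by have := near_neq0 y0; apply: filterS => z /hq'.
have [cq dq] := rat_step rq'; split.
  change (partials I (radial_ext F) @ y --> partials I (radial_ext F) y).
  rewrite (hq' y) //; apply: cvg_trans (cq y y0); apply: near_eq_cvg.
    exact: nbhs_filter.
  exact: nq.
move=> i; apply: (near_eq_derivable nq).
by have [q'' _ hq''] := dq i; have [] := partial_line (hq'' y y0).
Qed.

Lemma sphere_normalize y : y != 0 -> sphere ((enorm y)^-1 *: y).
Proof.
by move=> y0; rewrite /sphere /= enormZ ?invr_ge0 ?enorm_ge0 // mulVf ?enorm_eq0.
Qed.

Lemma poly_smooth (g : pt -> R) : alg (fun u => exists v, u = lin v) g -> smooth_sphere (ext g : V -> R).
Proof.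
move=> ag; suff [q rq hq] : exists2 q, rat_fun q & forall y, y != 0 -> radial_ext (ext g : V -> R) y = q y.
  exact: rat_smooth rq hq.
elim: ag => {g} [_ [v ->]|c|g h _ [q rq hq] _ [r rr hr]|g h _ [q rq hq] _ [r rr hr]].
- exists (fun y => (enorm y)^-1 * edot y v).
    apply: rat_mul; first exact: rat_inv.
    rewrite /edot; elim: (index_enum _) => [|i s IH].
      by under eq_fun do rewrite big_nil; exact: rat_cst.
    under eq_fun do rewrite big_cons; apply: rat_add => //.
    by apply: rat_mul; [exact: rat_coord|exact: rat_cst].
  by move=> y y0; rewrite /radial_ext (ext_mkpt _ (sphere_normalize y0)) /lin vec_mkpt edotZl.
- exists (fun=> c) => [|y y0]; first exact: rat_cst.
  by rewrite /radial_ext (ext_mkpt _ (sphere_normalize y0)).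
- exists (fun y => q y + r y) => [|y y0]; first exact: rat_add.
  rewrite -hq // -hr // /radial_ext; move: (sphere_normalize y0); move: (_ *: y) => z hz.
  by rewrite !(ext_mkpt _ hz).
- exists (fun y => q y * r y) => [|y y0]; first exact: rat_mul.
  rewrite -hq // -hr // /radial_ext; move: (sphere_normalize y0); move: (_ *: y) => z hz.
  by rewrite !(ext_mkpt _ hz).
Qed.

(** Makes the polynomial eigenfunctions of [KK_decomp] admissible as test functions in
    [harmonic_norm]. *)
Lemma poly_harmonic (Y : pt -> R) l : alg (fun u => exists v, u = lin v) Y ->
  (forall p, Lap Y p = - lap_eigenvalue R n l * Y p) -> spherical_harmonic l (ext Y : V -> R).
Proof.
move=> /poly_smooth sY hY; split=> // x hx.
rewrite -[x](vec_mkpt hx) sphere_lap_vec // ext_vec -hY; congr Lap.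
by apply/funext => p; rewrite /= ext_vec.
Qed.

End Rational.

(** * Bounds on words of rotation fields *)

Section Word_bounds.
Variables (R : realType) (n : nat).
Notation pt := (pt R n).
Notation idx := ('I_n * 'I_n)%type.
Implicit Types (g h : pt -> R) (p : pt) (a : idx) (M : R) (k : nat).

Definition bnd k M g := forall I : seq idx, (size I <= k)%N -> forall p, `|LL I g p| <= M.

Lemma bnd_sup k M g p : bnd k M g -> `|g p| <= M.
Proof. by move=> h; exact: (h [::]). Qed.

Lemma bnd_le k l M N g : (k <= l)%N -> M <= N -> bnd l M g -> bnd k N g.
Proof. by move=> kl MN h I hI p; apply: le_trans (h I (leq_trans hI kl) p) MN. Qed.

Lemma bnd_L k M g a : bnd k.+1 M g -> bnd k M (L a g).
Proof. by move=> h I hI p; rewrite -LL_rcons; apply: h; rewrite size_rcons. Qed.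

Lemma bnd_LL k l M g (I : seq idx) : (size I + k <= l)%N -> bnd l M g -> bnd k M (LL I g).
Proof.
by move=> hk h I' hI p; rewrite -LL_cat; apply: h; rewrite size_cat; apply: leq_trans hk; rewrite addnC leq_add2l.
Qed.

Lemma bndS k M g : (forall p, `|g p| <= M) -> (forall a, bnd k M (L a g)) -> bnd k.+1 M g.
Proof.
move=> h0 h I; case/lastP: I => [|I a]; first by move=> _ p; exact: h0.
by rewrite size_rcons ltnS => hI p; rewrite LL_rcons; exact: h.
Qed.

Lemma LL_D g h (I : seq idx) : sm g -> sm h -> LL I (fun p => g p + h p) = fun p => LL I g p + LL I h p.
Proof. by move=> sg sh; elim: I => //= a I ->; rewrite LD //; apply: sm_dd; smt. Qed.

Lemma LL_Z c g (I : seq idx) : sm g -> LL I (fun p => c * g p) = fun p => c * LL I g p.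
Proof. by move=> sg; elim: I => //= a I ->; rewrite LZ //; smt. Qed.

Lemma LL_B g h (I : seq idx) : sm g -> sm h -> LL I (fun p => g p - h p) = fun p => LL I g p - LL I h p.
Proof. by move=> sg sh; elim: I => //= a I ->; rewrite LB //; smt. Qed.

Lemma bndD k M N g h : sm g -> sm h -> bnd k M g -> bnd k N h -> bnd k (M + N) (fun p => g p + h p).
Proof.
move=> sg sh hg hh I hI p; rewrite LL_D //; apply: le_trans (ler_normD _ _) _.
by apply: lerD; [exact: hg|exact: hh].
Qed.

Lemma bndB k M N g h : sm g -> sm h -> bnd k M g -> bnd k N h -> bnd k (M + N) (fun p => g p - h p).
Proof.
move=> sg sh hg hh I hI p; rewrite LL_B //; apply: le_trans (ler_normB _ _) _.
by apply: lerD; [exact: hg|exact: hh].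
Qed.

Lemma bndZ k M c g : sm g -> bnd k M g -> bnd k (`|c| * M) (fun p => c * g p).
Proof. by move=> sg hg I hI p; rewrite LL_Z // normrM ler_wpM2l // hg. Qed.

(** Leibniz' rule: each of the k fields at most doubles the number of terms. *)
Lemma bndM k M N g h : sm g -> sm h -> bnd k M g -> bnd k N h ->
  bnd k (2 ^+ k * (M * N)) (fun p => g p * h p).
Proof.
elim: k g h M N => [|k IH] g h M N sg sh hg hh.
  by case=> // _ p /=; rewrite mul1r normrM ler_pM // ?(bnd_sup p hg) ?(bnd_sup p hh).
apply: bndS => [p|a].
  rewrite normrM; apply: (@le_trans _ _ (M * N)).
    by rewrite ler_pM // ?(bnd_sup p hg) ?(bnd_sup p hh).
  rewrite ler_peMl // ?exprn_ege1 ?ler1n //.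
  by apply: mulr_ge0; [exact: le_trans (normr_ge0 _) (bnd_sup p hg)|exact: le_trans (normr_ge0 _) (bnd_sup p hh)].
rewrite (LM a (sm_dd sg) (sm_dd sh)).
have -> : 2 ^+ k.+1 * (M * N) = 2 ^+ k * (M * N) + 2 ^+ k * (M * N) by rewrite exprS; ring.
apply: bndD; first by smt. by smt.
  by apply: IH; try smt; [exact: bnd_L|apply: bnd_le hh].
by apply: IH; try smt; [apply: bnd_le hg|exact: bnd_L].
Qed.

Lemma bnd_fin (T : finType) k (G : T -> pt -> R) : (forall i, exists2 M, 0 <= M & bnd k M (G i)) ->
  exists2 M, 0 <= M & forall i, bnd k M (G i).
Proof.
move=> H; have [M hM] : exists M : T -> R, forall i, 0 <= M i /\ bnd k (M i) (G i).
  apply: (@fin_all_exists T (fun=> R) (fun i M => 0 <= M /\ bnd k M (G i))) => i.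
  by have [M] := H i; exists M.
exists (\sum_i M i) => [|i]; first by apply: sumr_ge0 => i _; case: (hM i).
apply: bnd_le (hM i).2 => //; rewrite (bigD1 i) //= lerDl; apply: sumr_ge0 => l _.
by case: (hM l).
Qed.

Lemma sm_bnd g k : sm g -> exists2 M, 0 <= M & bnd k M g.
Proof.
elim: k g => [|k IH] g sg; have [M0 hM0] := cont_bounded (sm_cont sg).
  exists `|M0| => // -[] // _ p; exact: le_trans (hM0 p) (ler_norm _).
have [M M1 hM] := @bnd_fin idx k (fun a => L a g) (fun a => IH _ (sm_L a sg)).
exists (`|M0| + M); first exact: addr_ge0.
apply: bndS => [p|a].
  by apply: le_trans (hM0 p) _; apply: le_trans (ler_norm _) _; rewrite lerDl.
by apply: bnd_le (hM a) => //; rewrite lerDr.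
Qed.

(** Only finitely many words have length at most k, so this is a finite intersection. *)
Lemma filter_words (T : Type) (F : set_system T) (FF : Filter F) (J : finType)
    (P : seq J -> T -> Prop) k :
  (forall I, \forall x \near F, P I x) -> \forall x \near F, forall I, (size I <= k)%N -> P I x.
Proof.
elim: k P => [|k IH] P H.
  by near=> x => -[] // _; near: x; exact: H.
have h1 : \forall x \near F, forall (i : J) I, (size I <= k)%N -> P (i :: I) x.
  by apply: filter_forall => i; exact: (IH (fun I => P (i :: I))).
have h0 := H [::]; near=> x => -[_|i I hI]; first by near: x.
by move: i I hI; near: x.
Unshelve. all: by end_near. Qed.

End Word_bounds.

(** * Time-dependent smooth functions *)

Section Smooth_functions.
Variables (R : realType) (n : nat).
Notation V := 'rV[R]_n.
Notation pt := (pt R n).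
Notation idx := ('I_n * 'I_n)%type.
Implicit Types (F G : V -> R) (p : pt) (M : R) (k : nat).
Notation D F I := (partials I (radial_ext F)).

Lemma partials_lin F G (a b : R) I : smooth_sphere F -> smooth_sphere G -> forall y, y != 0 ->
  D (fun x => a * F x + b * G x) I y = a * D F I y + b * D G I y.
Proof.
move=> sF sG; elim: I => // i I IH y y0.
suff h : is_derive (0 : R) 1 (fun s => a * D F I (y + s *: e_ R i) + b * D G I (y + s *: e_ R i))
    (a * D F (i :: I) y + b * D G (i :: I) y).
  have [_ <-] := @partial_line _ _ (fun z => a * D F I z + b * D G I z) _ _ _ h; rewrite /= /partial; apply: near_eq_derive.
  by have := near_neq0 y0; apply: filterS => z /IH.
have d1 := is_deriveZ a (is_derive_line ((sF I y y0).2 i)).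
have d2 := is_deriveZ b (is_derive_line ((sG I y y0).2 i)).
exact: is_deriveD d1 d2.
Qed.

Lemma smooth_lin F G (a b : R) : smooth_sphere F -> smooth_sphere G ->
  smooth_sphere (fun x => a * F x + b * G x).
Proof.
move=> sF sG I y y0.
have E := partials_lin a b _ sF sG.
have nE : \forall z \near y, a * D F I z + b * D G I z = D (fun x => a * F x + b * G x) I z.
  by have := near_neq0 y0; apply: filterS => z /E.
split.
  change (D (fun x => a * F x + b * G x) I z @[z --> y] --> D (fun x => a * F x + b * G x) I y).
  rewrite (E I y) //.
  have c1 : {for y, continuous (fun z => a * D F I z)}.
    exact: cvgM (cvg_cst _) (sF I y y0).1.
  have c2 : {for y, continuous (fun z => b * D G I z)}.
    exact: cvgM (cvg_cst _) (sG I y y0).1.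
  have c3 : (fun z => a * D F I z + b * D G I z) z @[z --> y] --> a * D F I y + b * D G I y.
    by apply: cvgD; [exact: nbhs_filter|exact: c1|exact: c2].
  apply: cvg_trans c3; apply: near_eq_cvg; first exact: nbhs_filter.
  exact: nE.
move=> i; apply: (near_eq_derivable nE).
have d1 := is_deriveZ a (is_derive_line ((sF I y y0).2 i)).
have d2 := is_deriveZ b (is_derive_line ((sG I y y0).2 i)).
by have [] := @partial_line R n (fun z => a * D F I z + b * D G I z) y i _ (is_deriveD d1 d2).
Qed.

(** Each rotation field is a difference of two ambient derivatives with linear coefficients; C
    collects their bounds and Leibniz' constants. *)
Lemma partials_bnd k : exists2 C : R, 0 <= C & forall F I M, smooth_sphere F -> 0 <= M ->
  (forall J : seq 'I_n, (size J <= size I + k)%N -> forall p, `|D F J (vec p)| <= M) ->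
  bnd k (C * M) (D F I \o vec (n:=n)).
Proof.
elim: k => [|k [C C0 IH]].
  exists 1 => // F I M _ _ h -[] // _ p; by rewrite mul1r; apply: h; rewrite addn0.
have [A A0 hA] := @bnd_fin R n 'I_n k (fun i => lin (e_ R i)) (fun i => sm_bnd k (sm_lin (e_ R i))).
exists (1 + (2 ^+ k * (A * C) + 2 ^+ k * (A * C))).
  by rewrite addr_ge0 // addr_ge0 // mulr_ge0 ?exprn_ge0 // mulr_ge0.
move=> F I M sF M0 h; have q0 : 0 <= 2 ^+ k * (A * C) * M.
  by rewrite !mulr_ge0 ?exprn_ge0.
apply: bndS => [p|a].
  have := h I (leq_addr _ _) p; rewrite (mulrDl 1) mul1r mulrDl /=.
  move: q0; move: (2 ^+ k * (A * C) * M) => q; lra.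
rewrite L_partials //.
have hD i : bnd k (C * M) (D F (i :: I) \o vec (n:=n)).
  by apply: IH => // J hJ p; apply: h; rewrite addnS.
apply: (@bnd_le _ _ k k (2 ^+ k * (A * (C * M)) + 2 ^+ k * (A * (C * M)))) => //.
  rewrite (mulrDl 1) mul1r mulrDl !(mulrA A) !(mulrA (2 ^+ k)) ler_wpDl //.
have sD i : sm (fun p => D F (i :: I) (vec p)) by exact: sm_partials.
have sl i : sm (lin (e_ R i) : pt -> R) by exact: sm_lin.
apply: bndB; [exact: smM|exact: smM| |]; [exact: (bndM (sl a.1) (sD a.2) (hA _) (hD _))|].
exact: (bndM (sl a.2) (sD a.1) (hA _) (hD _)).
Qed.

Lemma smooth_bnd k : exists2 C : R, 0 <= C & forall F M, smooth_sphere F -> 0 <= M ->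
  (forall J : seq 'I_n, (size J <= k)%N -> (smooth_seminorm J F <= M%:E)%E) ->
  bnd k (C * M) (F \o vec (n:=n)).
Proof.
have [C C0 h] := partials_bnd k; exists C => // F M sF M0 hM.
rewrite -partials_nil; apply: h => // J hJ p; have := hM J hJ.
move=> /(le_trans _) H; rewrite -lee_fin; apply: H; apply: ereal_sup_ubound.
by exists (vec p) => //; exact: vec_sphere.
Qed.

(** The intrinsic form of [C1_smooth]: u is of class C^1 in time with derivative v, in the topology
    given by all the bounds [bnd k]. *)
Record flow (u v : R -> pt -> R) : Prop := Flow {
  flow_sm : forall t, 0 < t -> sm (u t);
  flow_smd : forall t, 0 < t -> sm (v t);
  flow_diff : forall t k (e : R), 0 < t -> 0 < e -> exists2 d : R, 0 < d & forall h : R, h != 0 ->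
    `|h| < d -> bnd k e (fun p => h^-1 * (u (t + h) p - u t p) - v t p);
  flow_cont : forall t k (e : R), 0 < t -> 0 < e -> exists2 d : R, 0 < d & forall s : R,
    `|s - t| < d -> bnd k e (fun p => v s p - v t p) }.

Lemma smooth_bnd_cvg (S : Type) (FS : set_system S) (FF : Filter FS) (G : S -> V -> R) k (e : R) :
  (forall I, smooth_seminorm I (G s) @[s --> FS] --> 0%E) -> 0 < e ->
  (\forall s \near FS, smooth_sphere (G s)) -> \forall s \near FS, bnd k e (G s \o vec (n:=n)).
Proof.
move=> cG e0 sG; have [C C0 hC] := smooth_bnd k.
have h : \forall s \near FS, forall I : seq 'I_n, (size I <= k)%N ->
    (smooth_seminorm I (G s) <= (e / (C + 1))%:E)%E.
  apply: (@filter_words _ FS FF 'I_n (fun I s => (smooth_seminorm I (G s) <= (e / (C + 1))%:E)%E)) => I.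
  apply: (cG I (fun x => (x <= (e / (C + 1))%:E)%E)) => /=.
  suff : ereal_nbhs (0%E : \bar R) (fun x => (x < (e / (C + 1))%:E)%E).
    by apply: filterS => x /ltW.
  by apply: open_ereal_lt'; rewrite lte_fin divr_gt0 //; lra.
near=> s; have hs : smooth_sphere (G s) by near: s.
have e1 : 0 <= e / (C + 1) by rewrite divr_ge0 ?ltW //; lra.
apply: (@bnd_le _ _ k k (C * (e / (C + 1)))) => //.
  by rewrite mulrCA ger_pMr // ler_pdivrMr; lra.
by apply: hC => //; near: s.
Unshelve. all: by end_near. Qed.

Lemma C1_smooth_flow (f : R -> V -> R) : C1_smooth f ->
  flow (fun t => f t \o vec (n:=n)) (fun t => time_deriv f t \o vec (n:=n)).
Proof.
move=> [sf sv df cv]; split=> [t t0|t t0|t k e t0 e0|t k e t0 e0].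
- exact/smooth_sm/sf.
- exact/smooth_sm/sv.
- have H : \forall h \near 0^', bnd k e ((fun x => h^-1 * (f (t + h) x - f t x) - time_deriv f t x)
     \o vec (n:=n)).
    apply: smooth_bnd_cvg => //; first exact: df.
    have : \forall h \near 0^', 0 < t + h.
      apply/nbhs_ballP; exists t => //= h; rewrite /ball /= sub0r normrN ltr_norml => ht _; lra.
    apply: filterS => h th.
    have -> : (fun x => h^-1 * (f (t + h) x - f t x) - time_deriv f t x) =
        (fun x => h^-1 * (1 * f (t + h) x + (-1) * f t x) + (-1) * time_deriv f t x).
      by apply/funext => x; rewrite mul1r !mulN1r.
    by apply: smooth_lin; [apply: smooth_lin; exact: sf|exact: sv].
  move: H => /nbhs_ballP[d /= d0 hd]; exists d => // h h0 hh.
  by apply: hd => //; rewrite /ball /= sub0r normrN.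
- have H : \forall s \near t, bnd k e ((fun x => time_deriv f s x - time_deriv f t x) \o vec (n:=n)).
    apply: (@smooth_bnd_cvg R (nbhs t) (nbhs_filter t) (fun s x => time_deriv f s x - time_deriv f t x)) => //.
      exact: cv.
    have : \forall s \near t, 0 < s.
      apply/nbhs_ballP; exists t => //= s; rewrite /ball /= ltr_norml => ht; lra.
    apply: filterS => s s0.
    have -> : (fun x => time_deriv f s x - time_deriv f t x) =
        (fun x => 1 * time_deriv f s x + (-1) * time_deriv f t x).
      by apply/funext => x; rewrite mul1r !mulN1r.
    by apply: smooth_lin; exact: sv.
  move: H => /nbhs_ballP[d /= d0 hd]; exists d => // s hs.
  by apply: hd => //; rewrite /ball /= distrC.
Qed.

Variables (u v : R -> pt -> R).
Hypothesis uv : flow u v.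

Lemma flow_is_derive (I : seq idx) (t : R) p : 0 < t ->
  is_derive t 1 (fun s => LL I (u s) p) (LL I (v t) p).
Proof.
move=> t0; apply/is_derive_epsP => e e0.
have [d d0 hd] := flow_diff uv (size I) t0 e0.
exists (Num.min d t); first by rewrite lt_min d0.
move=> h; rewrite lt_min => /andP[h1 h2]; have [->|h0] := eqVneq h 0.
  by rewrite addr0 subrr sub0r mul0r oppr0 normr0 mulr0.
have th : 0 < t + h by move: h2; rewrite ltr_norml; lra.
have := hd h h0 h1 I (leqnn _) p.
have s1 := flow_sm uv t0; have s2 := flow_sm uv th; have s3 := flow_smd uv t0.
rewrite LL_B; [|by smt|by smt]; rewrite LL_Z; last by smt.
rewrite LL_B // => H.
have -> : LL I (u (t + h)) p - LL I (u t) p - h * LL I (v t) p =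
   h * (h^-1 * (LL I (u (t + h)) p - LL I (u t) p) - LL I (v t) p).
  by rewrite mulrBr mulrA divff // mul1r.
by rewrite normrM mulrC ler_wpM2r.
Qed.

Lemma flow_bnd (t : R) k : 0 < t -> exists M d : R, [/\ 0 <= M, 0 < d, d <= t &
  forall s : R, `|s - t| < d -> bnd k M (u s) /\ bnd k M (v s)].
Proof.
move=> t0; have [d1 d10 h1] := flow_diff uv k t0 ltr01.
have [d2 d20 h2] := flow_cont uv k t0 ltr01.
have s1 := flow_sm uv t0; have s2 := flow_smd uv t0.
have [A A0 hA] := sm_bnd k s1; have [B B0 hB] := sm_bnd k s2.
exists (1 + B + A + d1 * (1 + B)), (Num.min d1 (Num.min d2 t)); split.
- by rewrite !addr_ge0 // mulr_ge0 ?addr_ge0 // ltW.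
- by rewrite !lt_min d10 d20.
- by rewrite !ge_min lexx !orbT.
move=> s; rewrite !lt_min => /and3P[r1 r2 r3].
have s0 : 0 < s by move: r3; rewrite ltr_norml; lra.
have s3 := flow_sm uv s0; have s4 := flow_smd uv s0.
have d1B : 0 <= d1 * (1 + B) by rewrite mulr_ge0 ?addr_ge0 // ltW.
split.
  have [->|st] := eqVneq s t; first by apply: bnd_le hA => //; lra.
  have h0 : s - t != 0 by rewrite subr_eq0.
  have H := h1 _ h0 r1; rewrite (_ : t + (s - t) = s) in H; last by ring.
  have -> : u s = fun p => (s - t) * (((s - t)^-1 * (u s p - u t p) - v t p) + v t p) + u t p.
    by apply/funext => p; rewrite subrK mulrA divff // mul1r subrK.
  apply: (@bnd_le _ _ k k (`|s - t| * (1 + B) + A)) => //.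
    have : `|s - t| * (1 + B) <= d1 * (1 + B) by rewrite ler_wpM2r ?addr_ge0 // ltW.
    lra.
  apply: bndD => //; first by smt.
  by apply: bndZ; [smt|apply: bndD => //; smt].
have -> : v s = fun p => (v s p - v t p) + v t p by apply/funext => p; rewrite subrK.
apply: (@bnd_le _ _ k k (1 + B)) => //; first by lra.
by apply: bndD => //; [smt|exact: h2].
Qed.

End Smooth_functions.

(** * Harmonic decomposition and Sobolev norms *)

Section Harmonics.
Variables (R : realType) (n : nat) (sigma : probability (borel_rV R n) R).
Hypotheses (hn : (2 <= n)%N) (hsigma : uniform_sphere sigma).
Notation V := 'rV[R]_n.
Notation pt := (pt R n).
Notation J := (Int sigma).
Let m1 := sigma_mass hsigma.
Notation is_poly := (alg (fun h : pt -> R => exists v : V, h = lin v)).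
Notation lam := (lap_eigenvalue R n).
Notation KK := (KK sigma).
Notation nrm2 := (nrm2 sigma).
Notation iLap := (fun q : nat => iter q (@Lap R n)).
Implicit Types (g h Y : pt -> R) (p q : pt) (F : V -> R).

Definition eigen (l : nat) g := sm g /\ forall x, Lap g x = - lam l * g x.

Lemma eigenZ c l g : eigen l g -> eigen l (fun x => c * g x).
Proof.
move=> [sg eg]; split=> [|x]; first by smt.
by rewrite LapZ // eg; ring.
Qed.

(** Induction on N. As Lap K_(N+1) g = lam_(N+1) (K_N g - K_(N+1) g), subtracting suitable multiples
    of the components of K_N g from K_(N+1) g leaves an eigenfunction of degree N + 1. No basis of
    harmonics has to be constructed. *)
Lemma KK_decomp N g : sm g -> exists Y : nat -> pt -> R,
  (forall l, is_poly (Y l) /\ eigen l (Y l)) /\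
  forall x, KK N g x = \sum_(l < N.+1) Y l x.
Proof.
move=> sg; elim: N => [|N [Y [hY eY]]].
  exists (fun l => if l is 0%N then fun=> J g else fun=> 0); split; last first.
    by move=> x; rewrite big_ord1 KK0.
  by case=> [|l]; (split; first exact: alg_cst); split; try exact: sm_cst; move=> x;
    rewrite /Lap big1 ?mulr0 ?lam0 ?oppr0 ?mul0r // => a _; rewrite !L_cst.
(* By [KK_step], a component of degree l is multiplied by 1 - lam l / lam_(N+1) in the passage from
   N + 1 to N. This is the inverse factor. *)
pose c l := lam N.+1 / (lam N.+1 - lam l).
pose Z l x := c l * Y l x.
have sY l : sm (Y l) by case: (hY l) => _ [].
have sZ l : sm (Z l) by rewrite /Z; have := sY l => sl; smt.
have pZ l : is_poly (Z l) by apply: alg_mul; [exact: alg_cst|case: (hY l)].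
have eZ l : eigen l (Z l) by apply: eigenZ; case: (hY l).
pose W x := KK N.+1 g x - \sum_(l < N.+1) Z l x.
have sK := sm_KK hsigma N.+1 (sm_cont sg).
have sS : sm (fun x => \sum_(l < N.+1) Z l x) by smt; exact: sZ.
exists (fun l => if (l <= N)%N then Z l else if l == N.+1 then W else fun=> 0); split; last first.
  move=> x; rewrite big_ord_recr /= ltnn eqxx.
  rewrite (eq_bigr (fun l : 'I_N.+1 => Z l x)); first by rewrite /W addrC subrK.
  by move=> l _; rewrite -ltnS ltn_ord.
move=> l; case: leqP => // Nl; case: eqVneq => [->|_]; last first.
  split; first exact: alg_cst.
  split; first exact: sm_cst.
  by move=> x; rewrite /Lap big1 ?mulr0 // => a _; rewrite !L_cst.
split.
  rewrite /W; have -> : (fun x => KK N.+1 g x - \sum_(l < N.+1) Z l x) =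
     (fun x => KK N.+1 g x + -1 * \sum_(l < N.+1) Z l x).
    by apply/funext => x; rewrite mulN1r.
  apply: alg_add; first exact: (is_poly_KK hsigma N.+1 (sm_cont sg)).
  apply: alg_mul; first exact: alg_cst.
  by apply: is_poly_sum => k; exact: pZ.
split=> [|x]; first by rewrite /W; smt.
rewrite /W LapB // KK_Lap // Lap_sum // eY.
have -> : \sum_(k < N.+1) Lap (Z k) x = - \sum_(k < N.+1) lam k * Z k x.
  by rewrite -sumrN; apply: eq_bigr => k _; case: (eZ k) => _ ->; ring.
rewrite opprK.
have -> : \sum_(k < N.+1) Y k x = \sum_(k < N.+1) (1 - lam k / lam N.+1) * Z k x.
  apply: eq_bigr => k _; rewrite /Z /c.
  have d : lam N.+1 - lam k != 0.
    rewrite subr_eq0; apply/eqP => /(lam_inj hn).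
    by move=> E; have := ltn_ord k; rewrite -E ltnn.
  by have l0 := lt0r_neq0 (@lam_gt0 R n hn N); move: (lam _) (lam _) d l0 => a b d l0; field; apply/andP.
have -> : \sum_(k < N.+1) (1 - lam k / lam N.+1) * Z k x =
   \sum_(k < N.+1) Z k x - (lam N.+1)^-1 * \sum_(k < N.+1) lam k * Z k x.
  by rewrite mulr_sumr -sumrB; apply: eq_bigr => k _; ring.
have l0 := lt0r_neq0 (@lam_gt0 R n hn N).
move: l0; set s := \sum_(k < N.+1) Z k x; set t := \sum_(k < N.+1) lam k * Z k x.
by move: (lam N.+1) => r r0; field.
Qed.

Lemma eigen_orth l k g h : eigen l g -> eigen k h -> l != k -> J (fun x => g x * h x) = 0.
Proof.
move=> [sg eg] [sh eh] lk.
have := Int_Lap_sym hsigma sg sh.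
rewrite (@Int_eq _ _ _ _ (fun x => - lam k * (g x * h x))); last by move=> x; rewrite eh; ring.
rewrite [RHS](@Int_eq _ _ _ _ (fun x => - lam l * (g x * h x))); last by move=> x; rewrite eg; ring.
rewrite !(IntZ m1); try by cnt.
move=> /eqP; rewrite -subr_eq0 -mulrBl mulf_eq0 => /orP[|/eqP //].
rewrite opprK addrC subr_eq0 => /eqP /(lam_inj hn) E; by rewrite E eqxx in lk.
Qed.

Lemma nrm2_eigen_sum (c : nat -> R) (Y : nat -> pt -> R) N : (forall l, eigen l (Y l)) ->
  nrm2 (fun x => \sum_(l < N) c l * Y l x) = \sum_(l < N) c l ^+ 2 * nrm2 (Y l).
Proof.
move=> eY; have sY l : sm (Y l) by case: (eY l).
elim: N => [|N IH].
  rewrite big_ord0; apply: (@etrans _ _ (J (fun=> 0))); last by rewrite (Int_cst m1) mul0r.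
  by apply: Int_eq => x; rewrite big_ord0 expr0n.
rewrite big_ord_recr /= -IH.
set S := fun x => \sum_(l < N) c l * Y l x.
have cS : cont S by rewrite /S; apply: cont_sum => l; have := sY l => sl; cnt.
have cY l := sm_cont (sY l).
have o : J (fun x => S x * Y N x) = 0.
  rewrite (@Int_eq _ _ _ _ (fun x => \sum_(l < N) c l * (Y l x * Y N x))); last first.
    by move=> x; rewrite mulr_suml; apply: eq_bigr => l _; rewrite mulrA.
  have cl l : cont (fun x => Y l x * Y N x) by have := cY l => cYl; cnt.
  rewrite (Int_sum m1); last by move=> l; have := cl l => cll; cnt.
  rewrite big1 // => l _; rewrite (IntZ m1) //.
  by rewrite (eigen_orth (eY l) (eY N)) ?mulr0 // neq_ltn ltn_ord.
have -> : nrm2 (fun x => \sum_(l < N.+1) c l * Y l x) =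
   J (fun x => S x ^+ 2 + ((2 * c N) * (S x * Y N x) + c N ^+ 2 * Y N x ^+ 2)).
  by apply: Int_eq => x; rewrite big_ord_recr /= -/(S x); ring.
intD m1.
intD m1.
rewrite !(IntZ m1); [|by cnt|by cnt].
by rewrite o mulr0 add0r.
Qed.

Lemma iLap_KK k N g : sm g -> iLap k (KK N g) = KK N (iLap k g).
Proof.
move=> sg; elim: k => //= k ->; rewrite Lap_KK //.
exact: sm_iLap.
Qed.

(** The k-th Laplacian of the decomposition is again an orthogonal sum, and its L^2 norm is at most
    that of Lap^k g because K_N is a contraction. One term of the sum is kept. *)
Lemma KK_decomp_bound N g : sm g -> exists Y : nat -> pt -> R,
  [/\ forall l, is_poly (Y l) /\ eigen l (Y l),
      forall x, KK N g x = \sum_(l < N.+1) Y l x &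
      forall l k, (l <= N)%N -> lam l ^+ (2 * k) * nrm2 (Y l) <= nrm2 (iLap k g)].
Proof.
move=> sg; have [Y [hY eY]] := KK_decomp N sg; exists Y; split=> // l k lN.
have E x : iLap k (KK N g) x = \sum_(l < N.+1) (- lam l) ^+ k * Y l x.
  elim: k x => [|k IH] x.
    by rewrite /= eY; apply: eq_bigr => i _; rewrite expr0 mul1r.
  rewrite iterS (_ : iter k _ _ = (fun x => \sum_(l < N.+1) (- lam l) ^+ k * Y l x)); last first.
    by apply/funext => y; exact: IH.
  have sY i : sm (Y i) by case: (hY i) => _ [].
  rewrite Lap_sum; last by move=> i; have := sY i => si; smt.
  apply: eq_bigr => i _; rewrite LapZ //.
  by case: (hY i) => _ [_ ->]; rewrite exprS; ring.
apply: (@le_trans _ _ (nrm2 (iLap k (KK N g)))); last first.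
  by rewrite iLap_KK // nrm2_KK //; exact/sm_cont/sm_iLap.
have -> : nrm2 (iLap k (KK N g)) = nrm2 (fun x => \sum_(l < N.+1) (- lam l) ^+ k * Y l x).
  by apply: Int_eq => x; rewrite E.
rewrite (nrm2_eigen_sum (fun l => (- lam l) ^+ k) _ (fun l => proj2 (hY l))).
have lN' : (l < N.+1)%N by [].
rewrite (bigD1 (Ordinal lN')) //=.
have -> : (- lam l) ^+ k ^+ 2 = lam l ^+ (2 * k) by rewrite -exprM mulnC exprM sqrrN -exprM.
rewrite lerDl.
by apply: sumr_ge0 => i _; rewrite mulr_ge0 ?sqr_ge0 ?nrm2_ge0.
Qed.

Let lge (l : nat) : 0 <= lam l := @lam_ge0 R n hn l.

Lemma sphere_int_vec F : sphere_int sigma F = J (F \o vec (n:=n)).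
Proof. exact: Int_vec. Qed.

Lemma sum_inv_sqr N : \sum_(l < N) (1 + l%:R ^+ 2)^-1 <= 3 - 3 / (N%:R + 1) :> R.
Proof.
elim: N => [|N IH]; first by rewrite big_ord0 add0r divr1 subrr.
rewrite big_ord_recr /=; apply: le_trans (lerD IH (lexx _)) _.
have N0 : 0 <= N%:R :> R by [].
have q0 : 0 <= N%:R ^+ 2 :> R by exact: sqr_ge0.
(* This is 2 N^2 - 3 N + 1, the numerator of the gap to the telescoping term. It is negative between
   1/2 and 1, so N being an integer matters. *)
have N1 : 0 <= (2 * N%:R - 1) * (N%:R - 1) :> R.
  case: N {IH N0 q0} => [|N]; first by rewrite mulr0 !sub0r mulrNN mulr1.
  by rewrite -[N.+1%:R]natr1 addrK mulr_ge0 //; have : 0 <= N%:R :> R by []; lra.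
have -> : 3 - 3 / (N.+1%:R + 1) = 3 - 3 / (N%:R + 1) + 3 / ((N%:R + 1) * (N%:R + 2)) :> R.
  by rewrite -[N.+1%:R]natr1; field; rewrite !gt_eqF //; lra.
rewrite lerD2l -subr_ge0.
have -> : 3 / ((N%:R + 1) * (N%:R + 2)) - (1 + N%:R ^+ 2)^-1 =
   (2 * N%:R - 1) * (N%:R - 1) / ((N%:R + 1) * (N%:R + 2) * (1 + N%:R ^+ 2)) :> R.
  field; rewrite !gt_eqF //; try lra.
by rewrite divr_ge0 // mulr_ge0 //; lra.
Qed.

Lemma sum_inv_lam N : \sum_(l < N) (1 + lam l)^-1 <= 3 :> R.
Proof.
apply: (@le_trans _ _ (\sum_(l < N) (1 + l%:R ^+ 2)^-1)).
  apply: ler_sum => l _; rewrite lef_pV2 ?posrE; first by rewrite lerD2l (@lam_ge R n hn).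
    by have := lge l; lra.
  have q0 : 0 <= l%:R ^+ 2 :> R by exact: sqr_ge0.
  lra.
apply: le_trans (sum_inv_sqr N) _; rewrite gerBl divr_ge0 //.
Qed.

Lemma powD_le (a : R) k : 0 <= a -> (1 + a) ^+ k <= 2 ^+ k * (1 + a ^+ k).
Proof.
move=> a0; have ak : 0 <= a ^+ k by exact: exprn_ge0.
have [a1|a1] := leP a 1.
  apply: (@le_trans _ _ (2 ^+ k)); first by rewrite lerXn2r ?nnegrE //; lra.
  by rewrite ler_peMr ?exprn_ge0 //; lra.
apply: (@le_trans _ _ ((2 * a) ^+ k)); first by rewrite lerXn2r ?nnegrE //; lra.
by rewrite exprMn ler_wpM2l ?exprn_ge0 //; lra.
Qed.

Lemma iLap_eigen k g Y l : sm g -> eigen l Y ->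
  J (fun p => iLap k g p * Y p) = (- lam l) ^+ k * J (fun p => g p * Y p).
Proof.
move=> sg [sY eY]; elim: k => [|k IH]; first by rewrite mul1r.
have sk := sm_iLap k sg.
rewrite -(Int_Lap_sym hsigma sk sY) exprS -mulrA -IH.
intZ' m1.
by apply: Int_eq => p; rewrite eY /=; ring.
Qed.

Lemma eigen_coef k g Y l : sm g -> eigen l Y -> nrm2 Y <= 1 ->
  (1 + lam l) ^+ (2 * k) * J (fun p => g p * Y p) ^+ 2 <= 4 ^+ k * (nrm2 g + nrm2 (iLap k g)).
Proof.
move=> sg eY Y1; have sY := eY.1.
have CS h : sm h -> J (fun p => h p * Y p) ^+ 2 <= nrm2 h.
  move=> sh; apply: le_trans (Cauchy_Schwarz hsigma (sm_cont sh) (sm_cont sY)) _.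
  by rewrite -/(nrm2 h) -/(nrm2 Y) ler_piMr // nrm2_ge0.
have h0 := CS _ sg; have := CS _ (sm_iLap k sg); rewrite (iLap_eigen _ sg eY) exprMn -exprM.
have -> : (- lam l) ^+ (k * 2) = lam l ^+ (2 * k).
  by rewrite mulnC !exprM sqrrN.
move=> hk; apply: le_trans (ler_wpM2r (sqr_ge0 _) (powD_le (2 * k) (lge l))) _.
have -> : 2 ^+ (2 * k) = 4 ^+ k :> R by rewrite exprM; congr (_ ^+ _); ring.
by rewrite -mulrA ler_wpM2l ?exprn_ge0 // mulrDl mul1r lerD.
Qed.

Lemma harmonic_eigen F l : spherical_harmonic l F -> eigen l (F \o vec (n:=n)).
Proof.
move=> [sF hF]; split; first exact: smooth_sm.
by move=> p; rewrite -sphere_lap_vec // hF //; exact: vec_sphere.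
Qed.

Lemma harmonic_le l (T : (V -> R) -> R) Y : is_poly Y -> eigen l Y -> nrm2 Y <= 1 ->
  (`|T (ext Y : V -> R)|%:E <= harmonic_norm sigma l T)%E.
Proof.
move=> pY [sY eY] Y1; apply: ereal_sup_ubound; exists (ext Y : V -> R) => //; split.
  exact: poly_harmonic.
rewrite sphere_int_vec; have -> : (fun x => (ext Y x : R) ^+ 2) \o vec (n:=n) = fun p => Y p ^+ 2.
  by apply/funext => p; rewrite /= ext_vec.
exact: Y1.
Qed.

Lemma harmonic_ge0 l (T : (V -> R) -> R) : (0 <= harmonic_norm sigma l T)%E.
Proof.
apply: (@le_trans _ _ `|T (ext (fun _ : pt => 0) : V -> R)|%:E); first by rewrite lee_fin.
apply: harmonic_le; first exact: alg_cst.
  split=> [|p]; first exact: sm_cst.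
  rewrite mulr0 /Lap big1 ?mulr0 // => a _.
  by rewrite !L_cst.
rewrite /nrm2; have -> : (fun _ : pt => (0 : R) ^+ 2) = (fun=> 0) by apply/funext => p; rewrite expr0n.
by rewrite (Int_cst m1) mul0r.
Qed.

Let term_ge0 s (T : (V -> R) -> R) l : (0 <= ((1 + lam l) `^ s)%:E * harmonic_norm sigma l T ^+ 2)%E.
Proof.
apply: mule_ge0; first by rewrite lee_fin powR_ge0.
by rewrite expe2; apply: mule_ge0; exact: harmonic_ge0.
Qed.

Lemma Hs_coef s (T : (V -> R) -> R) (eta : R) l Y : 0 <= eta -> (Hs_norm sigma s T <= eta%:E)%E ->
  is_poly Y -> eigen l Y -> nrm2 Y <= 1 ->
  (1 + lam l) `^ s * T (ext Y : V -> R) ^+ 2 <= eta ^+ 2.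
Proof.
move=> eta0 hT pY eY Y1.
set S := (\sum_(0 <= l <oo) ((1 + lam l) `^ s)%:E * harmonic_norm sigma l T ^+ 2)%E.
have S0 : (0 <= S)%E by apply: nneseries_ge0 => k _ _; exact: term_ge0.
have HS : (S <= (eta ^+ 2)%:E)%E.
  have := @gt0_ler_poweR R 2 (ler0n _ _) (S `^ 2^-1)%E eta%:E.
  rewrite !in_itv /= poweR_ge0 lee_fin eta0 !leey => /(_ isT isT hT).
  rewrite -poweRrM mulVf ?pnatr_eq0 // poweRe1 //.
  by rewrite -[X in powR _ X]/(2%:R) powR_mulrn.
have hl : (((1 + lam l) `^ s)%:E * harmonic_norm sigma l T ^+ 2 <= S)%E.
  apply: le_trans (@nneseries_lim_ge _ _ xpredT 0 l.+1 _); last by move=> k _ _; exact: term_ge0.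
  rewrite big_nat_recr //=; apply: leeDr; apply: sume_ge0 => k _; exact: term_ge0.
rewrite -lee_fin; apply: le_trans HS; apply: le_trans hl; rewrite EFinM.
apply: lee_wpmul2l; first by rewrite lee_fin powR_ge0.
have -> : (T (ext Y : V -> R) ^+ 2)%:E = (`|T (ext Y : V -> R)|%:E ^+ 2)%E.
  by rewrite expe2 -EFinM -expr2 real_normK // num_real.
rewrite lee_sqr ?harmonic_ge0 ?lee_fin //; exact: harmonic_le.
Qed.

(** Homogeneity reduces this to a normalized Y. Dividing by the square root of nrm2 Y + e, with e >
    0, also covers Y = 0. *)
Lemma Hs_coef_nrm2 s (T : (V -> R) -> R) (eta : R) l Y : 0 <= eta -> (Hs_norm sigma s T <= eta%:E)%E ->
  (forall c : R, T (ext (fun p => c * Y p) : V -> R) = c * T (ext Y : V -> R)) ->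
  is_poly Y -> eigen l Y ->
  (1 + lam l) `^ s * T (ext Y : V -> R) ^+ 2 <= eta ^+ 2 * nrm2 Y.
Proof.
move=> eta0 hT TZ pY eY; have Y0 := nrm2_ge0 sigma Y.
suff h (e : R) : 0 < e -> (1 + lam l) `^ s * T (ext Y : V -> R) ^+ 2 <= eta ^+ 2 * (nrm2 Y + e).
  apply/ler_addgt0Pl => e e0; have E1 : 0 < eta ^+ 2 + 1 by have := sqr_ge0 eta; lra.
  apply: le_trans (h (e / (eta ^+ 2 + 1)) (divr_gt0 e0 E1)) _.
  rewrite mulrDr addrC lerD2r mulrCA ger_pMr // ler_pdivrMr //; lra.
move=> e0; have Ye : 0 < nrm2 Y + e by lra.
pose c := (Num.sqrt (nrm2 Y + e))^-1.
have c2 : c ^+ 2 = (nrm2 Y + e)^-1 by rewrite exprVn sqr_sqrtr // ltW.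
have := @Hs_coef s T eta l (fun p => c * Y p) eta0 hT (alg_mul (alg_cst _ c) pY) (eigenZ c eY).
have -> : nrm2 (fun p => c * Y p) = c ^+ 2 * nrm2 Y.
  rewrite /nrm2 -(IntZ m1); last by apply: contX; exact: sm_cont eY.1.
  by apply: Int_eq => p; rewrite exprMn.
rewrite TZ exprMn c2 mulrCA mulrC ler_pdivrMr // mul1r => H.
have YYe : nrm2 Y <= nrm2 Y + e by lra.
by have := H YYe; rewrite ler_pdivrMl // (mulrC (nrm2 Y + e)).
Qed.

(** K_N g is a finite sum of harmonics with rapidly decreasing norms, and on each of them T is
    controlled by its H^s norm; [sum_inv_lam] bounds the total. T' is T read on functions of [pt],
    where linearity can be expressed. *)
Lemma Hs_dual s : exists (C : R) (k : nat), 0 <= C /\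
  forall (T : (V -> R) -> R) (T' : (pt -> R) -> R) (B eta : R), 0 <= eta ->
    (Hs_norm sigma s T <= eta%:E)%E ->
    (forall g, cont g -> T (ext g : V -> R) = T' g) ->
    (forall g h, cont g -> cont h -> T' (fun p => g p + h p) = T' g + T' h) ->
    (forall (c : R) g, cont g -> T' (fun p => c * g p) = c * T' g) ->
    (forall g (M : R), cont g -> (forall p, `|g p| <= M) -> `|T' g| <= B * M) ->
    forall g, sm g -> `|T' g| <= C * eta * Num.sqrt (nrm2 g + nrm2 (iLap k g)).
Proof.
(* m dominates |s|, and the additional unit in k supplies the summable factor 1 / (1 + lam l). *)
pose m := Num.bound `|s|; have [k kE] : exists k, k = m.+1 by exists m.+1.
exists (3 * 2 ^+ k), k; split; first by rewrite mulr_ge0 ?exprn_ge0.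
move=> T T' B eta eta0 hT TT' TD TZ TB g sg.
set A := nrm2 g + nrm2 (iLap k g).
have A0 : 0 <= A by rewrite addr_ge0 ?nrm2_ge0.
have lam1 l : 1 <= 1 + lam l by have := lge l; lra.
have coef l Y : is_poly Y -> eigen l Y -> (1 + lam l) ^+ (2 * k) * nrm2 Y <= 4 ^+ k * A ->
    `|T' Y| <= eta * 2 ^+ k * Num.sqrt A * (1 + lam l)^-1.
  move=> pY eY hY; have cY := sm_cont eY.1.
  have TYZ (c : R) : T (ext (fun p => c * Y p) : V -> R) = c * T (ext Y : V -> R).
    by rewrite !TT' ?TZ //; cnt.
  have := Hs_coef_nrm2 eta0 hT TYZ pY eY; rewrite TT' // => H.
  have l0 : 0 < 1 + lam l by have := lam1 l; lra.
  have ps : ((1 + lam l) ^+ (2 * m))^-1 <= (1 + lam l) `^ s.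
    rewrite -(powR_mulrn _ (ltW l0)) -powRN; apply: ler_powR => //.
    rewrite lerNl; apply: le_trans (_ : `|s| <= _); first by rewrite -normrN ler_norm.
    apply: le_trans (ltW (archi_boundP (normr_ge0 s))) _.
    by rewrite /m ler_nat leq_pmull.
  have a0 : 0 <= eta * 2 ^+ k * Num.sqrt A * (1 + lam l)^-1.
    apply: mulr_ge0; last by rewrite invr_ge0 ltW.
    by rewrite !mulr_ge0 ?exprn_ge0 ?sqrtr_ge0.
  rewrite -(ler_pXn2r (n := 2)) ?nnegrE // real_normK ?num_real //.
  rewrite !exprMn sqr_sqrtr // -exprM mulnC exprM.
  have -> : 2 ^+ 2 = 4 :> R by ring.
  have : ((1 + lam l) ^+ (2 * m))^-1 * T' Y ^+ 2 <= eta ^+ 2 * nrm2 Y.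
    by apply: le_trans H; rewrite ler_wpM2r // sqr_ge0.
  rewrite ler_pdivrMl ?exprn_gt0 // => H1; apply: le_trans H1 _.
  rewrite exprVn ler_pdivlMr ?exprn_gt0 //.
  have -> : (1 + lam l) ^+ (2 * m) * (eta ^+ 2 * nrm2 Y) * (1 + lam l) ^+ 2 =
      eta ^+ 2 * ((1 + lam l) ^+ (2 * k) * nrm2 Y).
    by rewrite kE mulnS exprD; ring.
  by rewrite -mulrA ler_wpM2l ?sqr_ge0.
have T0 : T' (fun=> 0) = 0.
  have -> : (fun _ : pt => 0 : R) = (fun=> 0 * 0) by apply/funext => p; rewrite mul0r.
  by rewrite (TZ 0 (fun=> 0)) ?mul0r //; exact: cont_cst.
have TKK N : `|T' (KK N g)| <= 3 * 2 ^+ k * eta * Num.sqrt A.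
  have [Y [hY hs hb]] := KK_decomp_bound N sg.
  have -> : KK N g = (fun x => \sum_(l < N.+1) Y l x) by apply/funext => x; rewrite hs.
  have TS (r : seq 'I_N.+1) : T' (fun x => \sum_(l <- r) Y l x) = \sum_(l <- r) T' (Y l).
    elim: r => [|l r IH].
      by rewrite big_nil -[RHS]T0; congr T'; apply/funext => x; rewrite big_nil.
    rewrite big_cons -IH -TD; last by apply: cont_sum => i; exact: sm_cont (hY i).2.1.
      by congr T'; apply/funext => x; rewrite big_cons.
    exact: sm_cont (hY l).2.1.
  rewrite TS; apply: le_trans (ler_norm_sum _ _ _) _.
  apply: (@le_trans _ _ (\sum_(l < N.+1) eta * 2 ^+ k * Num.sqrt A * (1 + lam l)^-1)).
    apply: ler_sum => l _; apply: coef; [exact: (hY l).1|exact: (hY l).2|].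
    apply: le_trans (ler_wpM2r (nrm2_ge0 sigma _) (powD_le (2 * k) (lge l))) _.
    have -> : 2 ^+ (2 * k) = 4 ^+ k :> R by rewrite exprM; congr (_ ^+ _); ring.
    rewrite -mulrA ler_wpM2l ?exprn_ge0 // mulrDl mul1r lerD //.
      by have := hb l 0 (ltn_ord l); rewrite muln0 mul1r.
    exact: hb l k (ltn_ord l).
  rewrite -mulr_sumr.
  have -> : 3 * 2 ^+ k * eta * Num.sqrt A = eta * 2 ^+ k * Num.sqrt A * 3 by ring.
  by rewrite ler_wpM2l ?sum_inv_lam // !mulr_ge0 ?exprn_ge0 ?sqrtr_ge0.
have [M hM] := cont_bounded (sm_cont (sm_Lap sg)).
(* T' is continuous for uniform convergence, so the bound passes from K_N g to g. B only influences
   how large N must be, not the constant. *)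
apply/ler_addgt0Pr => e e0.
pose D := `|B * M| + 1.
have D0 : 0 < D by rewrite /D; have := normr_ge0 (B * M); lra.
pose N := (Num.bound (D / e)).+1.
have cg := sm_cont sg; have cK := sm_cont (sm_KK hsigma N cg).
have E : T' g = T' (KK N g) + T' (fun p => g p + (-1) * KK N g p).
  rewrite TD ?TZ //; last by cnt.
  ring.
rewrite E; apply: le_trans (ler_normD _ _) _; apply: lerD; first exact: TKK.
apply: (@le_trans _ _ (B * (M / N%:R))).
  apply: TB; first by cnt.
  by move=> p; rewrite mulN1r; exact: (KK_dist hn hsigma (N := N)).
rewrite mulrA ler_pdivrMr //; apply: le_trans (ler_norm _) _.
apply: (@le_trans _ _ D); first by rewrite /D lerDl.
rewrite mulrC -ler_pdivrMr //; apply: ltW; apply: lt_le_trans (archi_boundP _) _.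
  by rewrite divr_ge0 ?ltW.
by rewrite ler_nat leqnSn.
Qed.

(** Moving k Laplacians from the harmonic onto w makes its coefficient of degree l decrease like (1
    + lam l)^-k. *)
Lemma Hs_dist_le s : exists (C : R) (k : nat), 0 <= C /\ forall F G (w : pt -> R),
  (forall p, w p = F (vec p) - G (vec p)) -> sm w ->
  (Hs_dist sigma s F G <= (C * Num.sqrt (nrm2 w + nrm2 (iLap k w)))%:E)%E.
Proof.
(* Then s <= 2 k - 1, so that (1 + lam l)^(2 k) beats the weight (1 + lam l)^s by a summable
   factor. *)
have [k kE] : exists k, k = (Num.bound `|s|).+1 by eexists.
exists (2 * 2 ^+ k), k; split; first by rewrite mulr_ge0 ?exprn_ge0.
move=> F G w hw sw; set A := nrm2 w + nrm2 (iLap k w).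
have A0 : 0 <= A by rewrite addr_ge0 ?nrm2_ge0.
have l0 l : 0 < 1 + lam l by have := lge l; lra.
pose B : R := 4 ^+ k * A; have B0 : 0 <= B by rewrite mulr_ge0 ?exprn_ge0.
pose D x : R := F x - G x.
have hH l : (harmonic_norm sigma l (distr_of_fun sigma D) ^+ 2 <=
    (B / (1 + lam l) ^+ (2 * k))%:E)%E.
  have b0 : 0 <= B / (1 + lam l) ^+ (2 * k) by rewrite divr_ge0 // exprn_ge0 // ltW.
  rewrite -[X in X%:E](sqr_sqrtr b0).
  have -> : (Num.sqrt (B / (1 + lam l) ^+ (2 * k)) ^+ 2)%:E =
     ((Num.sqrt (B / (1 + lam l) ^+ (2 * k)))%:E ^+ 2)%E by rewrite expe2 -EFinM -expr2.
  rewrite lee_sqr ?harmonic_ge0 ?lee_fin ?sqrtr_ge0 //.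
  apply: ge_ereal_sup => _ [Y [hY Y1] <-]; rewrite lee_fin.
  rewrite -(ler_pXn2r (n := 2)) ?nnegrE ?sqrtr_ge0 // sqr_sqrtr // real_normK ?num_real //.
  rewrite ler_pdivlMr ?exprn_gt0 // mulrC.
  have -> : distr_of_fun sigma D Y = J (fun p => w p * Y (vec p)).
    by rewrite /distr_of_fun sphere_int_vec; apply: Int_eq => p; rewrite hw.
  apply: eigen_coef => //; first exact: harmonic_eigen.
  by move: Y1; rewrite sphere_int_vec.
have S3 : (\sum_(0 <= l <oo) ((1 + lam l) `^ s)%:E *
    harmonic_norm sigma l (distr_of_fun sigma D) ^+ 2 <= (3 * B)%:E)%E.
  apply: lime_le; first by apply: is_cvg_nneseries => l _ _; exact: term_ge0.
  near=> N; rewrite big_mkord.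
  apply: (@le_trans _ _ (\sum_(l < N) (B * (1 + lam l)^-1)%:E)%E).
    apply: lee_sum => l _.
    apply: (@le_trans _ _ (((1 + lam l) `^ s)%:E * (B / (1 + lam l) ^+ (2 * k))%:E)%E).
      by apply: lee_wpmul2l; [rewrite lee_fin powR_ge0|exact: hH].
    rewrite -EFinM lee_fin mulrCA ler_wpM2l // ler_pdivrMr ?exprn_gt0 //.
    have -> : (1 + lam l)^-1 * (1 + lam l) ^+ (2 * k) = (1 + lam l) ^+ (2 * k).-1.
      have {1}-> : (2 * k = (2 * k).-1.+1)%N by rewrite kE.
      by rewrite exprS mulrA mulVf ?mul1r //; exact: lt0r_neq0.
    rewrite -(powR_mulrn _ (ltW (l0 l))); apply: ler_powR.
      by have := lge l; lra.
    apply: le_trans (ler_norm s) _; apply: le_trans (ltW (archi_boundP (normr_ge0 s))) _.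
    by rewrite ler_nat kE; move: (Num.bound _) => b; lia.
  by rewrite sumEFin lee_fin -mulr_sumr mulrC ler_wpM2r // sum_inv_lam.
rewrite /Hs_dist /Hs_norm -/D.
apply: (@le_trans _ _ ((3 * B)%:E `^ 2^-1)%E).
  apply: gt0_ler_poweR => //; rewrite !in_itv /= leey andbT.
    by apply: nneseries_ge0 => l _ _; exact: term_ge0.
  by rewrite lee_fin mulr_ge0.
rewrite poweR_EFin lee_fin powR12_sqrt ?mulr_ge0 //.
have r0 : 0 <= 2 * 2 ^+ k * Num.sqrt A by rewrite !mulr_ge0 ?exprn_ge0 ?sqrtr_ge0.
rewrite -(ler_pXn2r (n := 2)) ?nnegrE ?sqrtr_ge0 ?r0 //.
rewrite sqr_sqrtr ?mulr_ge0 // !exprMn sqr_sqrtr // -exprM mulnC exprM /B.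
have -> : 2 ^+ 2 = 4 :> R by ring.
by rewrite mulrA ler_wpM2r // ler_wpM2r ?exprn_ge0 //; lra.
Unshelve. all: by end_near. Qed.

(** All 2 k Laplacians are moved onto one factor by symmetry, then Cauchy-Schwarz. *)
Lemma nrm2_iLap_interp k g : sm g ->
  nrm2 (iLap k g) <= Num.sqrt (nrm2 g) * Num.sqrt (nrm2 (iLap (2 * k)%N g)).
Proof.
move=> sg; have E j h : sm h -> J (fun p => iLap j g p * iLap k h p) = J (fun p => g p * iLap (k + j)%N h p).
  elim: j h => [|j IH] h sh; first by rewrite addn0.
  have s1 := sm_iLap j sg; have s2 := sm_iLap k sh.
  rewrite /= -(Int_Lap_sym hsigma s1 s2) -iterS iterSr IH; last by smt.
  by rewrite -iterSr addnS.
have -> : nrm2 (iLap k g) = J (fun p => g p * iLap (2 * k)%N g p).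
  by rewrite mul2n -addnn -E //; apply: Int_eq => p; rewrite expr2.
apply: le_trans (ler_norm _) _; apply: CS_sqrt => //; first exact: sm_cont.
exact/sm_cont/sm_iLap.
Qed.

End Harmonics.

(** * Positivity *)

Section Scheme.
Variables (R : realType) (n : nat) (sigma : probability (borel_rV R n) R).
Hypotheses (hn : (2 <= n)%N) (hsigma : uniform_sphere sigma).
Notation n1 := (n%:R - 1).
Notation V := 'rV[R]_n.
Notation pt := (pt R n).
Notation idx := ('I_n * 'I_n)%type.
Notation J := (Int sigma).
Let m1 := sigma_mass hsigma.
Implicit Types (g : pt -> R) (x y p : pt) (N : nat) (v w : V) (a : idx).
Notation KK := (KK sigma).
Notation eps := (eps R n).

Lemma eps_gt0 N : 0 < eps N.
Proof. have n2 := n_ge2 R hn; rewrite invr_gt0; have := ler0n R N; lra. Qed.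

Lemma enorm_lskew a v : enorm (lskew a v) <= n%:R * (2 * enorm v).
Proof.
apply: enorm_le_coord => [|i]; first by rewrite mulr_ge0 ?enorm_ge0.
rewrite !mxE eqxx /=; apply: le_trans (ler_normB _ _) _.
have c j (b : bool) : `|v 0 j * b%:R| <= enorm v.
  case: b; first by rewrite mulr1 coord_le_enorm.
  by rewrite mulr0 normr0 enorm_ge0.
by rewrite mulr_natl mulr2n lerD.
Qed.

Lemma bnd_lin k v : bnd k ((n%:R * 2) ^+ k * enorm v) (lin v : pt -> R).
Proof.
have n2 := n_ge2 R hn.
have n0 : 1 <= n%:R * 2 :> R by lra.
elim: k v => [|k IH] v; first by case=> // _ p; rewrite mul1r; exact: lin_le.
apply: bndS => [p|a].
  by apply: le_trans (lin_le v p) _; rewrite ler_peMl ?enorm_ge0 // exprn_ege1.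
rewrite L_lin; apply: bnd_le (IH _) => //.
by rewrite exprSr -!mulrA ler_wpM2l ?exprn_ge0 ?enorm_lskew //; lra.
Qed.

Lemma Gam_le (M N : R) g h p : bnd 1 M g -> bnd 1 N h -> `|Gam g h p| <= n%:R ^+ 2 * (M * N).
Proof.
move=> hg hh; have M0 : 0 <= M := le_trans (normr_ge0 _) (bnd_sup p hg).
rewrite /Gam normrM; apply: (@le_trans _ _ (1 * \sum_(a : idx) M * N)).
  apply: ler_pM => //; first by rewrite ger0_norm // invf_le1 //; lra.
  apply: le_trans (ler_norm_sum _ _ _) _; apply: ler_sum => a _.
  by rewrite normrM ler_pM //; [exact: (hg [:: a])|exact: (hh [:: a])].
by rewrite mul1r sumr_const card_prod card_ord -[leLHS]mulr_natl natrM expr2.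
Qed.

Lemma Lap_le (M : R) g p : bnd 2 M g -> `|Lap g p| <= n%:R ^+ 2 * M.
Proof.
move=> hg; have M0 : 0 <= M := le_trans (normr_ge0 _) (bnd_sup p hg).
rewrite /Lap normrM; apply: (@le_trans _ _ (1 * \sum_(a : idx) M)).
  apply: ler_pM => //; first by rewrite ger0_norm // invf_le1 //; lra.
  apply: le_trans (ler_norm_sum _ _ _) _; apply: ler_sum => a _.
  exact: (hg [:: a; a]).
by rewrite mul1r sumr_const card_prod card_ord -[leLHS]mulr_natl natrM expr2.
Qed.

(** By [Lap_LL] the word may act before the Laplacian, which then adds only two fields and the
    constant of [Lap_le]. *)
Lemma bnd_Lap k (M : R) g : sm g -> bnd k.+2 M g -> bnd k (n%:R ^+ 2 * M) (Lap g).
Proof.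
move=> sg hg I hI p; have E : LL I (Lap g) = Lap (LL I g) by rewrite (Lap_LL hn hsigma).
rewrite E; apply: Lap_le; apply: bnd_LL hg.
by rewrite addn2 !ltnS.
Qed.

Lemma KK_dist2 N x : KK N (fun y => 4 * (1 - uu x y)) x = 2 * n1 * eps N.
Proof.
have n2 := n_ge2 R hn.
rewrite KKZ //; last by apply: contB; [exact: cont_cst|exact/sm_cont/sm_uu].
by rewrite (KK_uu hn hsigma) /eps; field; have := ler0n R N; lra.
Qed.

(* [C1 N v] is the commutator of [KK N] with the multiplication by [lin v]:
   the integral operator with kernel [v . (y - x)] times that of [KK N]. *)
Definition C1 N v g x := KK N (fun y => lin v y * g y) x - lin v x * KK N g x.
Definition C2 N v w g x := C1 N v (fun y => lin w y * g y) x - lin w x * C1 N v g x.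

Lemma C1_ker N v g x : cont g -> C1 N v g x = KK N (fun y => (lin v y - lin v x) * g y) x.
Proof.
move=> cg; rewrite /C1 -KKZ // -KKB //; try by cnt.
by congr (KK N _ x); apply/funext => y; ring.
Qed.

Lemma C2_ker N v w g x : cont g ->
  C2 N v w g x = KK N (fun y => (lin v y - lin v x) * (lin w y - lin w x) * g y) x.
Proof.
move=> cg; rewrite /C2 !C1_ker //; try by cnt.
rewrite -KKZ // -?KKB //; try by cnt.
by congr (KK N _ x); apply/funext => y; ring.
Qed.

Lemma sm_C1 N v g : sm g -> sm (C1 N v g).
Proof.
move=> sg; have s1 : sm (KK N g) by apply: (sm_KK hsigma); exact: sm_cont.
have s2 : sm (KK N (fun y => lin v y * g y)) by apply: (sm_KK hsigma); cnt.
by apply: smB => //; smt.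
Qed.

Lemma sm_C2 N v w g : sm g -> sm (C2 N v w g).
Proof.
move=> sg; apply: smB; first by apply: sm_C1; smt.
by apply: smM; [smt|exact: sm_C1].
Qed.

Lemma L_C1 N v g a : sm g -> L a (C1 N v g) = fun x => C1 N (lskew a v) g x + C1 N v (L a g) x.
Proof.
move=> sg; have s1 : sm (KK N g) by apply: (sm_KK hsigma); exact: sm_cont.
have sv : sm (fun y => lin v y * g y) by smt.
have s2 : sm (KK N (fun y => lin v y * g y)) by apply: (sm_KK hsigma); exact: sm_cont.
have s3 : sm (fun x => lin v x * KK N g x) by smt.
rewrite /C1 (LB a s2 s3) (LM a (sm_dd (sm_lin v)) (sm_dd s1)) !(L_KK hsigma) //.
rewrite (LM a (sm_dd (sm_lin v)) (sm_dd sg)) L_lin; apply/funext => x.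
rewrite KKD //; try by cnt.
ring.
Qed.

Lemma L_C2 N v w g a : sm g -> L a (C2 N v w g) =
  fun x => C2 N (lskew a v) w g x + C2 N v (lskew a w) g x + C2 N v w (L a g) x.
Proof.
move=> sg; have sw : sm (fun y => lin w y * g y) by smt.
have s1 := sm_C1 N v sw; have s2 := sm_C1 N v sg.
have s3 : sm (fun x => lin w x * C1 N v g x) by smt.
rewrite /C2 (LB a s1 s3) (LM a (sm_dd (sm_lin w)) (sm_dd s2)) !L_C1 // L_lin.
rewrite (LM a (sm_dd (sm_lin w)) (sm_dd sg)) L_lin; apply/funext => x.
have -> : C1 N v (fun p => lin (lskew a w) p * g p + lin w p * L a g p) x =
   C1 N v (fun p => lin (lskew a w) p * g p) x + C1 N v (fun p => lin w p * L a g p) x.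
  rewrite /C1 KKD //; try by cnt.
  have -> : KK N (fun y => lin v y * (lin (lskew a w) y * g y + lin w y * L a g y)) x =
    KK N (fun y => lin v y * (lin (lskew a w) y * g y)) x + KK N (fun y => lin v y * (lin w y * L a g y)) x.
    rewrite -KKD //; try by cnt.
    by congr (KK N _ x); apply/funext => y; ring.
  ring.
ring.
Qed.

Lemma lin_sub_le v x y : `|lin v y - lin v x| <= enorm v * enorm (vec y - vec x).
Proof.
have -> : lin v y - lin v x = edot (vec y - vec x) v by rewrite edotDl edotNl.
by rewrite mulrC edot_le.
Qed.

Lemma C2_bound N v w g x (B : R) : cont g -> (forall y, `|g y| <= B) ->
  `|C2 N v w g x| <= 2 * n1 * eps N * (enorm v * enorm w * B).
Proof.
move=> cg hg; rewrite C2_ker //; have cu : cont (uu x) by exact/sm_cont/sm_uu.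
apply: le_trans (KK_norm hn hsigma _ _ _) _; first by cnt.
have -> : 2 * n1 * eps N * (enorm v * enorm w * B) =
   KK N (fun y => (enorm v * enorm w * B) * (4 * (1 - uu x y))) x.
  by rewrite KKZ ?KK_dist2 1?mulrC //; cnt.
apply: (KK_le hn hsigma); [by cnt|by cnt|move=> y].
rewrite -edot_sub_uu -enorm_sqr !normrM.
have -> : enorm v * enorm w * B * enorm (vec y - vec x) ^+ 2 =
  (enorm v * enorm (vec y - vec x)) * (enorm w * enorm (vec y - vec x)) * B by ring.
apply: ler_pM; [exact: mulr_ge0|exact: normr_ge0| |exact: hg].
by apply: ler_pM; [exact: normr_ge0|exact: normr_ge0|exact: lin_sub_le|exact: lin_sub_le].
Qed.

Lemma Gam_uuS N v x y : Gam (fun y => uu x y ^+ N.+1) (lin v) y =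
  N.+1%:R / 2 * (uu x y ^+ N * (lin v x - lin v y * lin (vec x) y)).
Proof.
pose u (s : R) : R := (1 + s) / 2.
have du (s : R) : is_derive s 1 u 2^-1.
  have -> : u = (fun s => 2^-1 *: (1 + s)) by apply/funext => r; rewrite /u mulrC.
  apply: is_derive_eq; rewrite /GRing.scale /=; ring.
have h1 (s : R) : is_derive s 1 (fun s => u s ^+ N.+1) (N.+1%:R * u s ^+ N * 2^-1).
  exact: is_derive_pow.
rewrite -[LHS]/(Gam (fun q => (fun s => u s ^+ N.+1) (lin (vec x) q)) (lin v) y).
rewrite (@Gam_comp R n _ (fun s => N.+1%:R * u s ^+ N * 2^-1) (lin (vec x))) //; last exact: sm_lin.
rewrite Gam_lin -/(lin v x) -/(uu x y); ring.
Qed.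

(* The first moment [v . (y - x)] of the kernel is, up to a second moment, a
   derivative of [uu x y ^+ N.+1], so that one integration by parts gains a factor [1 / N]. *)
Lemma C1_bound : exists2 C : R, 0 <= C & forall N v g x (B : R), sm g -> bnd 1 B g ->
  `|C1 N v g x| <= C * eps N * (enorm v * B).
Proof.
have n2 := n_ge2 R hn.
pose D : R := n%:R - 1 + n%:R ^+ 2 * (n%:R * 2).
have D0 : 0 <= D by rewrite /D addr_ge0 ?mulr_ge0 ?exprn_ge0 //; lra.
exists (2 * n%:R * D + n1); first by rewrite addr_ge0 ?mulr_ge0 //; lra.
move=> N v g x B sg hB; have cg := sm_cont sg; have su : sm (uu x) by exact: sm_uu.
have N0 := ler0n R N.
(* q is - div (g grad (lin v)), since Lap (lin v) = - (n - 1) lin v. *)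
pose q y := n1 * (lin v y * g y) - Gam (lin v) g y.
have sq : sm q by apply: smB; smt.
have qb y : `|q y| <= D * (enorm v * B).
  apply: le_trans (ler_normB _ _) _.
  have -> : D * (enorm v * B) = n1 * (enorm v * B) + n%:R ^+ 2 * (n%:R * 2) * (enorm v * B).
    by rewrite /D; ring.
  apply: lerD.
    rewrite normrM ger0_norm; last by lra.
    rewrite ler_wpM2l //; first by lra.
    by rewrite normrM; apply: ler_pM => //; [exact: lin_le|exact: (bnd_sup y hB)].
  apply: le_trans (Gam_le y (@bnd_lin 1 v) hB) _.
  by rewrite expr1 !mulrA.
(* v . (y - x) = - (v . x - (v . y) (x . y)) + (1 - x . y) (v . y). The first bracket arises from
   differentiating the kernel, and 1 - x . y is a second moment. *)
have E : C1 N v g x = - (2 / N.+1%:R * KK N (fun y => uu x y * q y) x) +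
    KK N (fun y => (1 - uu x y) * (2 * lin v y * g y)) x.
  have parts : J (fun y => uu x y ^+ N * ((lin v x - lin v y * lin (vec x) y) * g y)) =
      2 / N.+1%:R * J (fun y => uu x y ^+ N * (uu x y * q y)).
    have sN := sm_uuX N.+1 x.
    have H : J (fun y => g y * Gam (fun y => uu x y ^+ N.+1) (lin v) y) =
        J (fun y => uu x y ^+ N.+1 * q y).
      have s1 : sm (fun y => uu x y ^+ N.+1 * g y) by smt.
      have H1 := Int_Gam hsigma s1 (sm_lin v).
      have -> : J (fun y => uu x y ^+ N.+1 * q y) = J (fun y =>
          - (uu x y ^+ N.+1 * g y * Lap (lin v) y) - uu x y ^+ N.+1 * Gam g (lin v) y).
        by apply: Int_eq => y; rewrite /q Lap_lin (GamC g); ring.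
      intB m1.
      rewrite (IntN m1) ?H1 ?opprK; last by cnt.
      intB' m1.
      by apply: Int_eq => y; rewrite (GamMl _ sN sg); ring.
    have -> : J (fun y => uu x y ^+ N * (uu x y * q y)) = J (fun y => uu x y ^+ N.+1 * q y).
      by apply: Int_eq => y; rewrite exprSr mulrA.
    rewrite -H; intZ' m1.
    apply: Int_eq => y; rewrite Gam_uuS; field.
    by apply: lt0r_neq0; lra.
  have KE : KK N (fun y => (lin v x - lin v y * lin (vec x) y) * g y) x =
      2 / N.+1%:R * KK N (fun y => uu x y * q y) x.
    by rewrite KK.unlock parts mulrCA.
  rewrite -KE C1_ker // -[X in X + _]mulN1r -KKZ; last by cnt.
  rewrite -KKD //; try by cnt.
    by congr (KK N _ x); apply/funext => y; rewrite /uu; field.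
  exact: hsigma.
rewrite E; apply: le_trans (ler_normD _ _) _; rewrite normrN.
have -> : (2 * n%:R * D + n1) * eps N * (enorm v * B) =
  2 * n%:R * D * eps N * (enorm v * B) + n1 * eps N * (enorm v * B) by ring.
apply: lerD.
  rewrite normrM ger0_norm ?divr_ge0 //.
  have i0 : 2 / N.+1%:R <= 2 * n%:R * eps N.
    rewrite /eps ler_pdivlMr; last by lra.
    rewrite mulrAC ler_pdivrMr ?ltr0n // -[N.+1%:R]natr1.
    have : 0 <= n1 * N%:R :> R by rewrite mulr_ge0 //; lra.
    have -> : 2 * n%:R * (N%:R + 1) = 2 * (n1 * N%:R) + 2 * (N%:R + n%:R) :> R by ring.
    lra.
  have -> : 2 * n%:R * D * eps N * (enorm v * B) = 2 * n%:R * eps N * (D * (enorm v * B)) by ring.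
  apply: ler_pM => //.
  apply: (KK_bound hn hsigma) => [|y]; first by cnt.
  rewrite normrM -[leRHS]mul1r; apply: ler_pM => //.
  by rewrite ger0_norm ?uu_ge0 ?uu_le1.
apply: le_trans (KK_norm hn hsigma _ _ _) _; first by cnt.
have -> : n1 * eps N * (enorm v * B) = KK N (fun y => (2 * (enorm v * B)) * (1 - uu x y)) x.
  rewrite KKZ //; last by cnt.
  by rewrite (KK_uu hn hsigma) /eps; field; lra.
apply: (KK_le hn hsigma); [by cnt|by cnt|move=> y].
have u1 : 0 <= 1 - uu x y by rewrite subr_ge0 uu_le1.
rewrite normrM ger0_norm // mulrC ler_wpM2r //.
rewrite !normrM ger0_norm // -mulrA ler_wpM2l //.
by apply: ler_pM => //; [exact: lin_le|exact: (bnd_sup y hB)].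
Qed.

(** Commuting a field with [C1 N v] produces [C1 N (lskew a v)], of the same kind. [C1_bound] costs
    one derivative, but the word left in the error term is one shorter. *)
Lemma LL_C1 k : exists2 C : R, 0 <= C & forall N v g (B : R) I p, (size I <= k)%N -> sm g -> bnd k B g ->
  `|LL I (C1 N v g) p - C1 N v (LL I g) p| <= C * eps N * (enorm v * B).
Proof.
elim: k => [|k [C C0 IH]].
  by exists 0 => // N v g B [|] //= p _ _ _; rewrite subrr normr0 !mul0r.
have [D D0 hD] := C1_bound.
exists ((C + D) * (n%:R * 2) + C); first by rewrite addr_ge0 // mulr_ge0 ?addr_ge0 //; lra.
move=> N v g B I p; case/lastP: I => [|I a] hI sg hB.
  rewrite subrr normr0 mulr_ge0 ?mulr_ge0 ?enorm_ge0 ?(ltW (eps_gt0 N)) //.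
    by rewrite addr_ge0 // mulr_ge0 ?addr_ge0 //; lra.
  exact: le_trans (normr_ge0 _) (bnd_sup p hB).
rewrite size_rcons ltnS in hI.
have B0 : 0 <= B := le_trans (normr_ge0 _) (bnd_sup p hB).
have e0 := ltW (eps_gt0 N).
rewrite !LL_rcons L_C1 // LL_D; [|exact: sm_C1|by apply: sm_C1; smt].
have b2 := IH N v (L a g) B I p hI (sm_L a sg) (bnd_L a hB).
have hk : bnd k B g by apply: bnd_le hB.
have b1 := IH N (lskew a v) g B I p hI sg hk.
have b3 : `|C1 N (lskew a v) (LL I g) p| <= D * eps N * (enorm (lskew a v) * B).
  apply: hD; first by smt.
  by apply: bnd_LL hB; rewrite addn1.
have ls : enorm (lskew a v) * B <= n%:R * 2 * (enorm v * B).
  by rewrite mulrA ler_wpM2r // -mulrA enorm_lskew.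
have -> : LL I (C1 N (lskew a v) g) p + LL I (C1 N v (L a g)) p - C1 N v (LL I (L a g)) p =
  (LL I (C1 N (lskew a v) g) p - C1 N (lskew a v) (LL I g) p) + C1 N (lskew a v) (LL I g) p +
  (LL I (C1 N v (L a g)) p - C1 N v (LL I (L a g)) p) by ring.
apply: le_trans (ler_normD _ _) _; rewrite !mulrDl; apply: lerD => //.
apply: le_trans (ler_normD _ _) _; apply: le_trans (lerD b1 b3) _.
rewrite -!mulrDl; apply: le_trans (ler_wpM2l _ ls) _; last by rewrite mulrACA -!mulrA mulrCA.
by rewrite mulr_ge0 ?addr_ge0.
Qed.

Lemma LL_C2 k : exists2 C : R, 0 <= C & forall N v w g (B : R), sm g -> bnd k B g ->
  bnd k (C * eps N * (enorm v * enorm w * B)) (C2 N v w g).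
Proof.
have n2 := n_ge2 R hn.
elim: k => [|k [C C0 IH]].
  exists (2 * n1); first by lra.
  move=> N v w g B sg hB [|] // _ p; apply: C2_bound; first exact: sm_cont.
  by move=> y; exact: (bnd_sup y hB).
exists (2 * n1 + C * (n%:R * 2 + n%:R * 2 + 1)).
  by apply: addr_ge0; [lra|rewrite mulr_ge0 //; lra].
move=> N v w g B sg hB; have e0 := ltW (eps_gt0 N); apply: bndS => [p|a].
  have B0 : 0 <= B := le_trans (normr_ge0 _) (bnd_sup p hB).
  apply: le_trans (C2_bound _ _ _ _ (sm_cont sg) (fun y => bnd_sup y hB)) _.
  rewrite ler_wpM2r ?mulr_ge0 ?enorm_ge0 // ler_wpM2r // lerDl ?mulr_ge0 ?addr_ge0 //; lra.
rewrite L_C2 //; have hk : bnd k B g by apply: bnd_le hB.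
have hs1 := sm_C2 N (lskew a v) w sg; have hs2 := sm_C2 N v (lskew a w) sg.
have hs3 := sm_C2 N v w (sm_L a sg).
have b1 := IH N (lskew a v) w g B sg hk; have b2 := IH N v (lskew a w) g B sg hk.
have b3 := IH N v w (L a g) B (sm_L a sg) (bnd_L a hB).
move=> I hI p; have B0 : 0 <= B := le_trans (normr_ge0 _) (bnd_sup p hB).
have := bndD (smD hs1 hs2) hs3 (bndD hs1 hs2 b1 b2) b3 hI p.
move=> /le_trans; apply.
have l1 := enorm_lskew a v; have l2 := enorm_lskew a w.
have -> : C * eps N * (enorm (lskew a v) * enorm w * B) + C * eps N * (enorm v * enorm (lskew a w) * B)
  + C * eps N * (enorm v * enorm w * B) = (C * eps N * B) * (enorm (lskew a v) * enorm w +
   enorm v * enorm (lskew a w) + enorm v * enorm w) by ring.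
have -> : (2 * n1 + C * (n%:R * 2 + n%:R * 2 + 1)) * eps N * (enorm v * enorm w * B) =
  2 * n1 * eps N * (enorm v * enorm w * B) +
  (C * eps N * B) * (n%:R * (2 * enorm v) * enorm w + enorm v * (n%:R * (2 * enorm w)) +
   enorm v * enorm w) by ring.
rewrite ler_wpDl ?mulr_ge0 ?enorm_ge0 //; try lra.
rewrite ler_wpM2l ?mulr_ge0 // lerD2r lerD //.
  by rewrite ler_wpM2r ?enorm_ge0.
by rewrite ler_wpM2l ?enorm_ge0.
Qed.

(* The positive operator with kernel [(1 + b v . (y - x)) ^ 2] times that of [KK N]. *)
Definition MM N (b : R) v g x := KK N g x + 2 * b * C1 N v g x + b ^+ 2 * C2 N v v g x.

Lemma MM_ker N b v g x : cont g ->
  MM N b v g x = KK N (fun y => (1 + b * (lin v y - lin v x)) ^+ 2 * g y) x.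
Proof.
move=> cg; rewrite /MM C1_ker // C2_ker // -!KKZ; try by cnt.
rewrite -!KKD //; try by cnt.
by congr (KK N _ x); apply/funext => y; ring.
Qed.

Lemma sm_MM N b v g : sm g -> sm (MM N b v g).
Proof.
move=> sg; have s1 := sm_C1 N v sg; have s2 := sm_C2 N v v sg.
have s0 : sm (KK N g) by apply: (sm_KK hsigma); exact: sm_cont.
by apply: smD; smt.
Qed.

Lemma MM_ge0 N b v g x : cont g -> (forall y, 0 <= g y) -> 0 <= MM N b v g x.
Proof.
move=> cg g0; rewrite MM_ker //; apply: KK_ge0 => // y.
by rewrite mulr_ge0 // sqr_ge0.
Qed.

(** By positivity |MM g| <= B MM 1, and MM 1 = 1 + O(eps N) because both moments of the kernel are
    O(eps N). *)
Lemma MM_sup (b0 A : R) : 0 <= b0 -> 0 <= A -> exists2 C : R, 0 <= C &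
  forall N b v g x (B : R), `|b| <= b0 -> enorm v <= A -> cont g -> (forall y, `|g y| <= B) ->
  `|MM N b v g x| <= (1 + C * eps N) * B.
Proof.
have n2 := n_ge2 R hn.
move=> b00 A0; have [D D0 hD] := C1_bound.
exists (2 * b0 * (D * A) + b0 ^+ 2 * (2 * n1 * (A * A))).
  rewrite addr_ge0 // !mulr_ge0 ?exprn_ge0 //; lra.
move=> N b v g x B hb hv cg hg; have e0 := ltW (eps_gt0 N).
have B0 : 0 <= B := le_trans (normr_ge0 _) (hg x).
have v0 := enorm_ge0 v.
have MB : `|MM N b v g x| <= B * MM N b v (fun=> 1) x.
  rewrite !MM_ker //; last by cnt.
  apply: le_trans (KK_norm hn hsigma _ _ _) _; first by cnt.
  rewrite -KKZ //; last by cnt.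
  apply: (KK_le hn hsigma); [by cnt|by cnt|move=> y].
  by rewrite normrM mulr1 ger0_norm ?sqr_ge0 // [leRHS]mulrC ler_wpM2l ?sqr_ge0 ?hg.
apply: le_trans MB _; rewrite mulrC ler_wpM2r // /MM (KK_cst hn hsigma).
have c1 : `|C1 N v (fun=> 1) x| <= D * eps N * (enorm v * 1).
  apply: hD; first by smt.
  apply: bndS => [p|a]; first by rewrite normr1.
  by rewrite L_cst => -[] // _ p; rewrite normr0.
have c2 : `|C2 N v v (fun=> 1) x| <= 2 * n1 * eps N * (enorm v * enorm v * 1).
  by apply: C2_bound => [|y]; [cnt|rewrite normr1].
rewrite -addrA lerD2l [leRHS]mulrDl; apply: lerD.
  apply: le_trans (ler_norm _) _; rewrite !normrM (ger0_norm (ler0n _ _)) -!mulrA ler_wpM2l //.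
  apply: (@le_trans _ _ (b0 * (D * eps N * (enorm v * 1)))); first by apply: ler_pM.
  rewrite ler_wpM2l // mulr1 -mulrA ler_wpM2l // mulrC ler_wpM2r //.
apply: le_trans (ler_norm _) _; rewrite !normrM -expr2.
apply: (@le_trans _ _ (b0 ^+ 2 * (2 * n1 * eps N * (enorm v * enorm v * 1)))).
  by apply: ler_pM => //; rewrite ler_pXn2r ?nnegrE.
rewrite mulr1 -!(mulrA (b0 ^+ 2)) ler_wpM2l ?exprn_ge0 //.
have -> : 2 * n1 * (A * A) * eps N = 2 * n1 * eps N * (A * A) by ring.
by apply: ler_wpM2l; [rewrite mulr_ge0 //; lra|exact: ler_pM].
Qed.

(** Fields commute with [MM] up to terms of size eps N that involve no additional derivative of g.
    Hence the factor 1 + C eps N at every order, which can be iterated. *)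
Lemma MM_bnd k (b0 A : R) : 0 <= b0 -> 0 <= A -> exists2 C : R, 0 <= C &
  forall N b v g (B : R), `|b| <= b0 -> enorm v <= A -> sm g -> bnd k B g ->
  bnd k ((1 + C * eps N) * B) (MM N b v g).
Proof.
move=> b00 A0; have n2 := n_ge2 R hn.
have [C C0 hC] := MM_sup b00 A0.
have [D1 D10 h1] := LL_C1 k; have [D2 D20 h2] := LL_C2 k.
pose E1 := 2 * b0 * (D1 * A); pose E2 := b0 ^+ 2 * ((D2 + 2 * n1) * (A * A)).
have E10 : 0 <= E1 by rewrite /E1 !mulr_ge0.
have E20 : 0 <= E2 by rewrite /E2 !mulr_ge0 ?exprn_ge0 //; lra.
exists (C + E1 + E2); first by rewrite !addr_ge0.
move=> N b v g B hb hv sg hB I hI p.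
have B0 : 0 <= B := le_trans (normr_ge0 _) (bnd_sup p hB).
have e0 := ltW (@eps_gt0 N); have v0 := enorm_ge0 v.
have sK : sm (KK N g) by apply: (sm_KK hsigma); exact: sm_cont.
have s1 := sm_C1 N v sg; have s2 := sm_C2 N v v sg.
have sI := sm_LL I sg.
have E : LL I (MM N b v g) p = MM N b v (LL I g) p +
   2 * b * (LL I (C1 N v g) p - C1 N v (LL I g) p) +
   b ^+ 2 * (LL I (C2 N v v g) p - C2 N v v (LL I g) p).
  rewrite /MM (@LL_D _ _ (fun x => KK N g x + 2 * b * C1 N v g x)); [|by smt|by smt].
  rewrite LL_D //; last by smt.
  rewrite (LL_Z _ _ s1) (LL_Z _ _ s2) (LL_KK hsigma) //; ring.
have b1 : `|2 * b * (LL I (C1 N v g) p - C1 N v (LL I g) p)| <= E1 * eps N * B.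
  rewrite normrM; apply: (@le_trans _ _ (2 * b0 * (D1 * eps N * (A * B)))); last by rewrite /E1 le_eqVlt; apply/orP; left; apply/eqP; ring.
  apply: ler_pM => //; first by rewrite normrM ger0_norm // ler_wpM2l.
  apply: le_trans (h1 N v g B I p hI sg hB) _.
  by rewrite ler_wpM2l ?mulr_ge0 // ler_wpM2r.
have b2 : `|b ^+ 2 * (LL I (C2 N v v g) p - C2 N v v (LL I g) p)| <= E2 * eps N * B.
  rewrite normrM; apply: (@le_trans _ _ (b0 ^+ 2 * ((D2 + 2 * n1) * eps N * (A * A * B)))); last by rewrite /E2 le_eqVlt; apply/orP; left; apply/eqP; ring.
  apply: ler_pM => //; first by rewrite normrX ler_pXn2r ?nnegrE.
  apply: le_trans (ler_normB _ _) _.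
  apply: (@le_trans _ _ (D2 * eps N * (enorm v * enorm v * B) + 2 * n1 * eps N * (enorm v * enorm v * B))).
    apply: lerD; first exact: (h2 N v v g B sg hB I hI p).
    by apply: (C2_bound) => [|y]; [exact: sm_cont|exact: hB].
  rewrite -!mulrDl; apply: ler_wpM2l; first by rewrite mulr_ge0 ?addr_ge0 //; lra.
  by rewrite ler_wpM2r // ler_pM.
have b3 : `|MM N b v (LL I g) p| <= (1 + C * eps N) * B.
  by apply: hC => // [|y]; [exact: sm_cont|exact: hB].
rewrite E; apply: le_trans (ler_normD _ _) _; apply: le_trans (lerD (ler_normD _ _) b2) _.
apply: le_trans (lerD (lerD b3 b1) (lexx _)) _.
by rewrite le_eqVlt; apply/orP; left; apply/eqP; ring.
Qed.

(** The terms of order 0 in the expansion of tau (MM - 1) / eps N for b = 1 / (4 tau): with F = lin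
    v they are tau (2 b Lap F + 2 b^2 Gam F F). *)
Definition potential (tau : R) v x : R :=
  - (n1 / 2) * lin v x + (8 * tau)^-1 * (edot v v - lin v x * lin v x).

(** An explicit step of length h for g' = tau Lap g + Gam (lin v) g. The first-order term of [MM] is
    4 b eps N Gam (lin v) g, so that b = 1 / (4 tau) gives the drift its coefficient 1; the unwanted
    terms of order 0 are subtracted. *)
Definition SS N (h tau : R) v g x :=
  g x - h * tau / eps N * g x - h * (potential tau v x * g x)
  + h * tau / eps N * MM N (4 * tau)^-1 v g x.

Lemma sm_potential tau v : sm (potential tau v).
Proof. by apply: smD; smt. Qed.

Lemma sm_SS N h tau v g : sm g -> sm (SS N h tau v g).
Proof.
move=> sg; have sV := sm_potential tau v; have sM := sm_MM N (4 * tau)^-1 v sg.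
by apply: smD; smt.
Qed.

Lemma potential_bnd k (tm A : R) : 0 < tm -> 0 <= A -> exists2 C : R, 0 <= C &
  forall tau v, tm <= tau -> enorm v <= A -> bnd k C (potential tau v).
Proof.
move=> tm0 A0; have n2 := n_ge2 R hn.
pose l : R := (n%:R * 2) ^+ k * A; have l0 : 0 <= l by rewrite mulr_ge0 // exprn_ge0 // mulr_ge0.
have c0 : 0 <= n1 / 2 :> R by rewrite divr_ge0 //; lra.
have d0 : 0 <= (8 * tm)^-1 by rewrite invr_ge0; lra.
have f0 : 0 <= A * A + 2 ^+ k * (l * l) by rewrite addr_ge0 ?mulr_ge0 ?exprn_ge0.
exists (n1 / 2 * l + (8 * tm)^-1 * (A * A + 2 ^+ k * (l * l))).
  by rewrite addr_ge0 // mulr_ge0.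
move=> tau v ht hv; have v0 := enorm_ge0 v.
have hl : bnd k l (lin v : pt -> R).
  by apply: bnd_le (@bnd_lin k v) => //; rewrite ler_wpM2l // exprn_ge0 // mulr_ge0.
have hc : bnd k (A * A) (fun _ : pt => edot v v).
  have vv : 0 <= edot v v <= A * A by rewrite edot_ge0 -enorm_sqr expr2 ler_pM.
  have hk (j : nat) : bnd j (A * A) (fun _ : pt => edot v v).
    case: j => [|j]; first by case=> // _ p; rewrite /= ger0_norm; case/andP: vv.
    apply: bndS => [p|a]; first by rewrite ger0_norm; case/andP: vv.
    rewrite L_cst; elim: j => [|j IH]; first by case=> // _ p; rewrite /= normr0 mulr_ge0.
    by apply: bndS => [p|b]; [rewrite normr0 mulr_ge0|rewrite L_cst; exact: IH].
  exact: hk.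
have i0 : 0 <= (8 * tau)^-1 by rewrite invr_ge0; lra.
have s1 : sm (fun x : pt => edot v v - lin v x * lin v x) by smt.
have hq : bnd k (A * A + 2 ^+ k * (l * l)) (fun x : pt => edot v v - lin v x * lin v x).
  by apply: bndB => //; [smt|smt|apply: bndM => //; smt].
have := bndD (smZ (- (n1 / 2)) (sm_lin v)) (smZ (8 * tau)^-1 s1)
  (bndZ (- (n1 / 2)) (sm_lin v) hl) (bndZ (8 * tau)^-1 s1 hq).
apply: bnd_le => //; rewrite normrN !ger0_norm // lerD2l ler_wpM2r //.
by rewrite lef_pV2 ?posrE //; lra.
Qed.

(** The growth C eps N of [MM] enters with the weight h tau / eps N, so the constant depends neither
    on N nor on h. *)
Lemma SS_bnd k (tm tM A : R) : 0 < tm -> 0 <= A -> exists2 C : R, 0 <= C &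
  forall N h tau v g (B : R), 0 <= h -> tm <= tau -> tau <= tM -> enorm v <= A ->
  h * tau / eps N <= 1 -> sm g -> bnd k B g -> bnd k ((1 + C * h) * B) (SS N h tau v g).
Proof.
move=> tm0 A0; have b00 : 0 <= (4 * tm)^-1 by rewrite invr_ge0; lra.
have [C C0 hC] := MM_bnd k b00 A0; have [D D0 hD] := potential_bnd k tm0 A0.
exists (2 ^+ k * D + C * `|tM|); first by rewrite addr_ge0 ?mulr_ge0 ?exprn_ge0.
move=> N h tau v g B h0 t1 t2 hv th sg hB I hI p.
have B0 : 0 <= B := le_trans (normr_ge0 _) (bnd_sup p hB).
have e0 := @eps_gt0 N; have tau0 : 0 < tau by lra.
have th0 : 0 <= h * tau / eps N by rewrite divr_ge0 ?mulr_ge0 // ltW.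
have hb : `|(4 * tau)^-1| <= (4 * tm)^-1.
  rewrite ger0_norm ?invr_ge0; last by lra.
  by rewrite lef_pV2 ?posrE; lra.
have sV := sm_potential tau v; have sM := sm_MM N (4 * tau)^-1 v sg.
have E : LL I (SS N h tau v g) p = (1 - h * tau / eps N) * LL I g p
   - h * LL I (fun x => potential tau v x * g x) p + h * tau / eps N * LL I (MM N (4 * tau)^-1 v g) p.
  have sVg : sm (fun x => potential tau v x * g x) by smt.
  rewrite /SS (@LL_D _ _ (fun x => g x - h * tau / eps N * g x - h * (potential tau v x * g x)));
    [|by smt|by smt].
  rewrite (@LL_B _ _ (fun x => g x - h * tau / eps N * g x)); [|by smt|by smt].
  rewrite LL_B //; last by smt.
  rewrite (LL_Z _ _ sg) (LL_Z _ _ sVg) (LL_Z _ _ sM); ring.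
have b1 : `|LL I (fun x => potential tau v x * g x) p| <= 2 ^+ k * (D * B).
  exact: (bndM sV sg (hD _ _ t1 hv) hB hI p).
have b2 : `|LL I (MM N (4 * tau)^-1 v g) p| <= (1 + C * eps N) * B.
  exact: (hC _ _ _ _ _ hb hv sg hB I hI p).
rewrite E; apply: le_trans (ler_normD _ _) _; apply: le_trans (lerD (ler_normB _ _) (lexx _)) _.
rewrite !normrM (ger0_norm h0) (@ger0_norm _ (1 - h * tau / eps N)) ?subr_ge0 //.
have ie0 : 0 <= (eps N)^-1 by rewrite invr_ge0; exact: ltW.
rewrite (ger0_norm (ltW tau0)) (ger0_norm ie0).
have b0 := hB I hI p.
apply: le_trans (lerD (lerD (ler_wpM2l _ b0) (ler_wpM2l h0 b1)) (ler_wpM2l th0 b2)) _; first by lra.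
have -> : (1 - h * tau / eps N) * B + h * (2 ^+ k * (D * B)) + h * tau / eps N * ((1 + C * eps N) * B)
  = (1 + (2 ^+ k * D + C * tau) * h) * B by field; exact: lt0r_neq0.
rewrite ler_wpM2r // lerD2l ler_wpM2r // lerD2l ler_wpM2l //.
exact: le_trans t2 (ler_norm _).
Qed.

Lemma SS_ge0 (tm A : R) : 0 < tm -> 0 <= A -> exists2 C : R, 0 <= C &
  forall N h tau v g x, 0 <= h -> tm <= tau -> enorm v <= A ->
  h * tau / eps N <= 2^-1 -> C * h <= 2^-1 -> sm g -> (forall y, 0 <= g y) -> 0 <= SS N h tau v g x.
Proof.
move=> tm0 A0; have [D D0 hD] := potential_bnd 0 tm0 A0.
exists D => // N h tau v g x h0 t1 hv th Dh sg g0.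
have e0 := @eps_gt0 N; have tau0 : 0 < tau by lra.
have th0 : 0 <= h * tau / eps N by rewrite divr_ge0 ?mulr_ge0 // ltW.
have -> : SS N h tau v g x = (1 - h * tau / eps N - h * potential tau v x) * g x +
   h * tau / eps N * MM N (4 * tau)^-1 v g x by rewrite /SS; ring.
apply: addr_ge0; last by rewrite mulr_ge0 // (MM_ge0) //; exact: sm_cont.
rewrite mulr_ge0 //; have : h * potential tau v x <= h * D.
  by rewrite ler_wpM2l // (le_trans (ler_norm _)) // (bnd_sup x (hD tau v t1 hv)).
move: (h * tau / _) th th0 => th; lra.
Qed.

Lemma KK_second N g x (B : R) : (0 < N)%N -> sm g -> bnd 4 B g ->
  `|KK N g x - g x - eps N * Lap g x| <= (n%:R ^+ 2 * n%:R ^+ 2 + n1 * n%:R ^+ 2) * n%:R ^+ 2 * eps N ^+ 2 * B.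
Proof.
move=> N0 sg hB; have n2 := n_ge2 R hn.
have B0 : 0 <= B := le_trans (normr_ge0 _) (bnd_sup x hB).
have h1 : bnd 2 (n%:R ^+ 2 * B) (Lap g) by apply: (bnd_Lap).
have h2 y : `|Lap (Lap g) y| <= n%:R ^+ 2 * (n%:R ^+ 2 * B) by apply: Lap_le.
apply: le_trans (KK_second_order hn hsigma x N0 sg (fun y => bnd_sup y h1) h2) _.
have N1 : 1 <= N%:R :> R by rewrite ler1n.
rewrite ler_pdivrMr ?exprn_gt0 //; last by lra.
set D := n%:R ^+ 2 * n%:R ^+ 2 + n1 * n%:R ^+ 2.
have -> : n%:R ^+ 2 * (n%:R ^+ 2 * B) + n1 * (n%:R ^+ 2 * B) = D * B :> R by rewrite /D; ring.
have -> : D * n%:R ^+ 2 * eps N ^+ 2 * B * N%:R ^+ 2 = D * B * (n%:R * N%:R * eps N) ^+ 2 by ring.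
rewrite ler_peMr //.
  rewrite mulr_ge0 // addr_ge0 // !mulr_ge0 ?exprn_ge0 //; lra.
apply: exprn_ege1; rewrite /eps ler_pdivlMr ?mul1r; last by lra.
have : 0 <= n1 * (N%:R - 1) :> R by rewrite mulr_ge0 //; lra.
have -> : n1 * (N%:R - 1) = n%:R * N%:R - (N%:R + n%:R - 1) :> R by ring.
lra.
Qed.

(** [MM] combines K_N applied to g, F g and F^2 g, where F = lin v. The expansion 1 + eps N Lap of
    each gives the generator and the potential; the remainders are O(eps N ^2), of which the weight
    h tau / eps N leaves O(h eps N). *)
Lemma SS_consistent (tm tM A : R) : 0 < tm -> 0 <= A -> exists2 C : R, 0 <= C &
  forall N h tau v g x (B : R), (0 < N)%N -> 0 <= h -> tm <= tau -> tau <= tM -> enorm v <= A ->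
  sm g -> bnd 4 B g ->
  `|SS N h tau v g x - g x - h * (tau * Lap g x + Gam (lin v) g x)| <= C * h * eps N * B.
Proof.
move=> tm0 A0; have n2 := n_ge2 R hn.
pose D : R := (n%:R ^+ 2 * n%:R ^+ 2 + n1 * n%:R ^+ 2) * n%:R ^+ 2.
have D0 : 0 <= D.
  apply: mulr_ge0; last exact: exprn_ge0.
  by rewrite addr_ge0 // !mulr_ge0 ?exprn_ge0 //; lra.
pose b0 := (4 * tm)^-1; have b00 : 0 <= b0 by rewrite invr_ge0; lra.
pose l : R := (n%:R * 2) ^+ 4 * A; have l0 : 0 <= l by rewrite mulr_ge0 // exprn_ge0 // mulr_ge0.
pose c1 : R := 2 ^+ 4 * l; have c10 : 0 <= c1 by rewrite mulr_ge0 ?exprn_ge0.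
pose Ct : R := D * (1 + 2 * b0 * (c1 + A) + b0 ^+ 2 * (c1 * c1 + 2 * A * c1 + A * A)).
have Ct0 : 0 <= Ct.
  by rewrite mulr_ge0 // !addr_ge0 ?mulr_ge0 ?addr_ge0 ?mulr_ge0 ?exprn_ge0.
exists (`|tM| * Ct); first by rewrite mulr_ge0.
move=> N h tau v g x B N0 h0 t1 t2 hv sg hB.
have B0 : 0 <= B := le_trans (normr_ge0 _) (bnd_sup x hB).
have e0 := @eps_gt0 N; have tau0 : 0 < tau by lra.
set b := (4 * tau)^-1.
have hb : `|b| <= b0.
  rewrite ger0_norm /b ?invr_ge0; last by lra.
  by rewrite lef_pV2 ?posrE; lra.
pose F := lin v : pt -> R; have sF : sm F by exact: sm_lin.
have sFg : sm (fun y => F y * g y) by smt.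
have sFFg : sm (fun y => F y * (F y * g y)) by smt.
pose Rm u := KK N u x - u x - eps N * Lap u x.
have hl : bnd 4 l F.
  by apply: bnd_le (@bnd_lin 4 v) => //; rewrite ler_wpM2l // exprn_ge0 // mulr_ge0.
have h1 : bnd 4 (c1 * B) (fun y => F y * g y) by rewrite /c1 -mulrA; exact: bndM.
have h2 : bnd 4 (c1 * (c1 * B)) (fun y => F y * (F y * g y)) by rewrite {1}/c1 -mulrA; exact: bndM.
have r0 : `|Rm g| <= D * eps N ^+ 2 * B by exact: KK_second.
have r1 : `|Rm (fun y => F y * g y)| <= D * eps N ^+ 2 * (c1 * B) by exact: KK_second.
have r2 : `|Rm (fun y => F y * (F y * g y))| <= D * eps N ^+ 2 * (c1 * (c1 * B)) by exact: KK_second.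
have Fx : `|F x| <= A := le_trans (lin_le v x) hv.
have GE : Gam F (fun y => F y * g y) x = F x * Gam F g x + g x * (edot v v - F x * F x).
  by rewrite GamC (GamMl _ sF sg) (GamC g) /F Gam_lin.
have L1 := LapM sF sg x; have L2 := LapM sF sFg x.
have LF : Lap F x = - n1 * F x by exact: Lap_lin.
have E : SS N h tau v g x - g x - h * (tau * Lap g x + Gam F g x) =
  h * tau / eps N * (Rm g + 2 * b * (Rm (fun y => F y * g y) - F x * Rm g) +
    b ^+ 2 * (Rm (fun y => F y * (F y * g y)) - 2 * F x * Rm (fun y => F y * g y) + F x ^+ 2 * Rm g)).
  rewrite /SS /MM /C2 /C1 /potential -/F -/b /Rm L2 L1 GE LF.
  move: (KK N _ x) (KK N _ x) (KK N _ x) (Lap g x) (Gam F g x) (F x) (g x) (edot v v) => k1 k2 k3 lg gg f gx vv.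
  rewrite /b; field; rewrite ?lt0r_neq0 //; lra.
rewrite E normrM; have th0 : 0 <= h * tau / eps N by rewrite divr_ge0 ?mulr_ge0 // ltW.
rewrite ger0_norm //.
apply: (@le_trans _ _ (h * tau / eps N * (Ct * eps N ^+ 2 * B))).
  rewrite ler_wpM2l //.
  set q := D * eps N ^+ 2 in r0 r1 r2 *.
  have -> : Ct * eps N ^+ 2 * B = q * B + 2 * b0 * (q * (c1 * B) + A * (q * B)) +
     b0 ^+ 2 * (q * (c1 * (c1 * B)) + 2 * A * (q * (c1 * B)) + A ^+ 2 * (q * B)).
    by rewrite /Ct /q; ring.
  apply: le_trans (ler_normD _ _) _; apply: lerD.
    apply: le_trans (ler_normD _ _) _; apply: lerD => //.
    rewrite normrM; apply: ler_pM => //; first by rewrite normrM ger0_norm // ler_wpM2l.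
    apply: le_trans (ler_normB _ _) _; apply: lerD => //.
    by rewrite normrM ler_pM.
  rewrite normrM; apply: ler_pM => //; first by rewrite normrX ler_pXn2r ?nnegrE.
  apply: le_trans (ler_normD _ _) _; apply: lerD; last first.
    by rewrite normrM ler_pM // normrX ler_pXn2r ?nnegrE.
  apply: le_trans (ler_normB _ _) _; apply: lerD => //.
  by rewrite !normrM ler_pM // ?mulr_ge0 // ger0_norm // ler_wpM2l.
have -> : h * tau / eps N * (Ct * eps N ^+ 2 * B) = tau * (Ct * h * eps N * B).
  by field; exact: lt0r_neq0.
have -> : `|tM| * Ct * h * eps N * B = `|tM| * (Ct * h * eps N * B) by ring.
apply: ler_wpM2r; last exact: le_trans t2 (ler_norm _).
by apply: mulr_ge0 => //; apply: mulr_ge0; [exact: mulr_ge0|exact: ltW].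
Qed.

End Scheme.

(** P is propagated through the supremum of the times up to which it holds. The step d may depend on
    t without uniform lower bound, as happens in [flow_weak_ge0]. *)
Lemma real_induction (R : realType) (P : R -> Prop) (a b : R) : a <= b -> P a ->
  (forall t, a <= t -> t < b -> P t -> exists2 d : R, 0 < d & forall s, t < s -> s < t + d -> P s) ->
  (forall t, a < t -> t <= b -> (forall s, a <= s -> s < t -> P s) -> P t) -> P b.
Proof.
move=> ab Pa step lim.
pose S := [set t : R | a <= t <= b /\ forall s, a <= s -> s <= t -> P s].
have Sa : S a by split; [rewrite lexx|move=> s h1 h2; have -> : s = a by apply/eqP; rewrite eq_le h1 h2].
have hS : has_sup S by split; [exists a|exists b => t [/andP[]]].
pose c := sup S.
have ac : a <= c by apply: ub_le_sup => //; case: hS.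
have cb : c <= b by apply: sup_le_ub; [exists a|move=> t [/andP[]]].
have below s : a <= s -> s < c -> P s.
  move=> sa sc; have cs : 0 < c - s by rewrite subr_gt0.
  have [t [_ ht] st] := sup_adherent cs hS.
  by apply: ht => //; move: st; rewrite -/c; lra.
have Pc : P c.
  have [<-//|nac] := eqVneq a c; apply: lim => //; by rewrite lt_neqAle nac.
have [bc|ncb] := eqVneq c b; first by rewrite -bc.
have {}cb : c < b by rewrite lt_neqAle ncb.
have [d d0 hd] := step c ac cb Pc.
pose t := Num.min b (c + d / 2).
have tb : t <= b by rewrite /t ge_min lexx.
have tc : c < t by rewrite /t lt_min cb; lra.
have td : t < c + d by rewrite /t gt_min; apply/orP; right; lra.
have St : S t.
  split; first by rewrite tb andbT; lra.
  move=> s sa st; have [sc|sc|->//] := ltgtP s c; first exact: below.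
  by apply: hd => //; lra.
have : t <= c by apply: ub_le_sup => //; case: hS.
lra.
Qed.

(** * Nonnegativity for the linear equation with given coefficients *)

Section Linear_flow.
Variables (R : realType) (n : nat) (sigma : probability (borel_rV R n) R).
Hypotheses (hn : (2 <= n)%N) (hsigma : uniform_sphere sigma).
Notation V := 'rV[R]_n.
Notation pt := (pt R n).
Notation J := (Int sigma).
Let m1 := sigma_mass hsigma.
Implicit Types (g psi : pt -> R) (x y p : pt).
Notation eps := (eps R n).
Variables (u v : R -> pt -> R).
Hypothesis uv : flow u v.

Lemma flow_cont_at (t : R) : 0 < t -> cont (u t).
Proof. by move=> t0; exact/sm_cont/(flow_sm uv). Qed.

Lemma flow_Int (t : R) psi : 0 < t -> cont psi ->
  is_derive t 1 (fun s => J (fun p => u s p * psi p)) (J (fun p => v t p * psi p)).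
Proof.
move=> t0 cpsi; have [M [d [M0 d0 dt hM]]] := flow_bnd uv 0 t0.
have [N hN] := cont_bounded cpsi.
have st (s : R) : `|s - t| < d -> 0 < s by rewrite ltr_norml; lra.
apply: (Int_derive m1 (M := M * N) (e := d)
  (W := fun s p => u s p * psi p) (dW := fun s p => v s p * psi p)) => //.
- by move=> s /st s0; apply: contM => //; exact: flow_cont_at.
- move=> s p /st s0; have h := flow_is_derive uv [::] p s0.
  have h2 := is_derive_mul h (is_derive_cst (psi p) s 1).
  by apply: (is_derive_eq h2); rewrite mulr0 addr0.
- move=> s p hs; rewrite normrM; apply: ler_pM => //.
  exact: (bnd_sup p (hM s hs).2).
Qed.

Lemma bnd_iLap k psi (B : R) : sm psi -> bnd (2 * k) B psi ->
  forall p, `|iter k (@Lap R n) psi p| <= (n%:R ^+ 2) ^+ k * B.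
Proof.
move=> spsi hB; suff H j : (j <= k)%N ->
    bnd (2 * (k - j)) ((n%:R ^+ 2) ^+ j * B) (iter j (@Lap R n) psi).
  move=> p; have := H k (leqnn k); rewrite subnn; exact: bnd_sup.
elim: j => [|j IH] hj; first by rewrite subn0 mul1r.
rewrite iterS exprS -mulrA; apply: (bnd_Lap hn hsigma); first exact: sm_iLap.
have -> : (2 * (k - j.+1)).+2 = (2 * (k - j))%N by lia.
by apply: IH; exact: ltnW.
Qed.

Lemma sqrt_nrm2_iLap k psi (B : R) : sm psi -> bnd (2 * k) B psi -> 0 <= B ->
  Num.sqrt (nrm2 sigma psi + nrm2 sigma (iter k (@Lap R n) psi)) <= (1 + (n%:R ^+ 2) ^+ k) * B.
Proof.
move=> spsi hB B0; have N0 : 0 <= (n%:R ^+ 2) ^+ k :> R by rewrite !exprn_ge0.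
have h (w : pt -> R) (M : R) : sm w -> 0 <= M -> (forall p, `|w p| <= M) -> nrm2 sigma w <= M ^+ 2.
  move=> sw M0 hw; rewrite -[leRHS]mulr1 -(Int_cst m1).
  apply: (Int_le m1); [by apply: contX; exact: sm_cont|exact: cont_cst|].
  by move=> p; rewrite -[leLHS]real_normK ?num_real // ler_pXn2r ?nnegrE.
have b1 := h psi B spsi B0 (fun p => bnd_sup p hB).
have b2 := h _ _ (sm_iLap k spsi) (mulr_ge0 N0 B0) (bnd_iLap spsi hB).
have r0 : 0 <= (1 + (n%:R ^+ 2) ^+ k) * B by rewrite mulr_ge0 // addr_ge0.
rewrite -(ler_pXn2r (n := 2)) ?nnegrE ?sqrtr_ge0 ?r0 // sqr_sqrtr ?addr_ge0 ?nrm2_ge0 //.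
apply: le_trans (lerD b1 b2) _; move: N0; move: ((n%:R ^+ 2) ^+ k) => c c0.
have -> : ((1 + c) * B) ^+ 2 = B ^+ 2 + (c * B) ^+ 2 + 2 * c * B ^+ 2 by ring.
by rewrite lerDl mulr_ge0 ?sqr_ge0 ?mulr_ge0.
Qed.

Variables (tt : R -> R) (aa : R -> V) (tm tM A T : R).
Hypothesis pde : forall t : R, 0 < t -> forall p, v t p =
  tt t * Lap (u t) p - Gam (lin (aa t)) (u t) p + (n%:R - 1) * lin (aa t) p * u t p.

(** The drift terms of the equation form - div (u grad (lin a)), because Lap (lin a) = - (n - 1) lin
    a. *)
Lemma weak_form (t : R) psi : 0 < t -> sm psi ->
  J (fun p => v t p * psi p) = J (fun p => u t p * (tt t * Lap psi p + Gam (lin (aa t)) psi p)).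
Proof.
move=> t0 sp; have su := flow_sm uv t0; have sl : sm (lin (aa t) : pt -> R) by exact: sm_lin.
have sup : sm (fun p => u t p * psi p) by smt.
have H1 : J (fun p => Lap (u t) p * psi p) = J (fun p => u t p * Lap psi p).
  by rewrite (Int_Lap_sym hsigma).
have H2 : J (Gam (lin (aa t)) (fun p => u t p * psi p)) =
    (n%:R - 1) * J (fun p => lin (aa t) p * (u t p * psi p)).
  have := Int_Gam hsigma sup sl; rewrite (GamC (lin _)) => /(congr1 -%R); rewrite opprK => <-.
  rewrite -(IntN m1); last by cnt.
  intZ' m1.
  by apply: Int_eq => p; rewrite Lap_lin; ring.
have E2 : Gam (lin (aa t)) (fun p => u t p * psi p) =
    fun p => u t p * Gam (lin (aa t)) psi p + psi p * Gam (lin (aa t)) (u t) p.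
  by apply/funext => p; rewrite GamC (GamMl _ su sp) (GamC psi) (GamC (u t)).
rewrite E2 (IntD m1) in H2; [|by cnt|by cnt].
have -> : J (fun p => v t p * psi p) = tt t * J (fun p => Lap (u t) p * psi p)
   - J (fun p => psi p * Gam (lin (aa t)) (u t) p) + (n%:R - 1) * J (fun p => lin (aa t) p * (u t p * psi p)).
  intZ' m1.
  intZ' m1.
  intB' m1.
  intD' m1.
  by apply: Int_eq => p; rewrite pde //; ring.
have -> : J (fun p => u t p * (tt t * Lap psi p + Gam (lin (aa t)) psi p)) =
   tt t * J (fun p => u t p * Lap psi p) + J (fun p => u t p * Gam (lin (aa t)) psi p).
  intZ' m1.
  intD' m1.
  by apply: Int_eq => p; ring.
rewrite H1 -H2; ring.
Qed.

Hypothesis tm0 : 0 < tm.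
Hypothesis A0 : 0 <= A.
Hypothesis htt : forall t : R, 0 < t -> t <= T -> tm <= tt t <= tM.
Hypothesis haa : forall t : R, 0 < t -> t <= T -> enorm (aa t) <= A.
Variable K : nat.
(** Weak nonnegativity at time 0, with an error measured by K derivatives of the test function. This
    is why the backward scheme must be stable in C^K and not only in sup norm. *)
Hypothesis hinit : forall e : R, 0 < e -> exists2 d : R, 0 < d & forall t : R, 0 < t -> t < d ->
  forall psi (B : R), 0 <= B -> sm psi -> (forall p, 0 <= psi p) -> bnd K B psi ->
  - (e * B) <= J (fun p => u t p * psi p).

(* Duality: the backward equation is solved approximately by the positive operators [SS]. *)
Lemma flow_weak_ge0 psi : 0 < T -> sm psi -> (forall p, 0 <= psi p) -> 0 <= J (fun p => u T p * psi p).
Proof.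
move=> T0 spsi psi0.
(* K derivatives for the initial bound, 4 more for the consistency of the scheme. *)
pose K' := (K + 4)%N.
have [C C0 hC] := SS_bnd hn hsigma K' tM tm0 A0.
have [D D0 hD] := SS_ge0 hn hsigma tm0 A0.
have [E E0 hE] := SS_consistent hn hsigma tM tm0 A0.
have [B B0 hB] := sm_bnd K' spsi.
suff H (e : R) : 0 < e -> - ((e + e * T) * expR (C * T) * B) <= J (fun p => u T p * psi p).
  pose Q := (1 + T) * expR (C * T) * B + 1.
  have Q0 : 0 < Q by have : 0 <= (1 + T) * expR (C * T) * B; [rewrite !mulr_ge0 ?expR_ge0 //; lra|rewrite /Q; lra].
  rewrite leNgt; apply/negP => neg; pose q := - J (fun p => u T p * psi p).
  have q0 : 0 < q by rewrite /q; lra.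
  have := H (q / (2 * Q)); rewrite divr_gt0 ?mulr_gt0 // => /(_ isT).
  rewrite -[J _]opprK -/q lerN2.
  have -> : (q / (2 * Q) + q / (2 * Q) * T) * expR (C * T) * B = q * ((Q - 1) / (2 * Q)).
    by rewrite /Q; field; apply: lt0r_neq0.
  apply/negP; rewrite -ltNge gtr_pMr // ltr_pdivrMr ?mulr_gt0 // mul1r; lra.
move=> e0; have [d d0 hd] := hinit e0.
pose a := Num.min (d / 2) T.
have a0 : 0 < a by rewrite lt_min T0; lra.
have ad : a < d by rewrite gt_min; apply/orP; left; lra.
have aT : a <= T by rewrite ge_min lexx orbT.
(* e pays for the error at time a, e (t - a) for the consistency errors accumulated since, and the
   exponential for the growth of test functions under the scheme. *)
pose bd (t : R) := (e + e * (t - a)) * expR (C * (t - a)).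
have bd0 (t : R) : a <= t -> 0 <= bd t.
  by move=> ta; rewrite mulr_ge0 ?expR_ge0 // addr_ge0 // ?mulr_ge0 ?subr_ge0 //; lra.
pose P (t : R) := forall g (M : R), 0 <= M -> sm g -> (forall p, 0 <= g p) -> bnd K' M g ->
  - (bd t * M) <= J (fun p => u t p * g p).
have PT : P T.
  apply: (@real_induction R P a T) => //.
  - move=> g M M0 sg g0 hM; rewrite /bd subrr !mulr0 addr0 expR0 mulr1.
    by apply: hd => //; apply: bnd_le hM => //; exact: leq_addr.
  - move=> t ta tT Pt; have t0 : 0 < t by lra.
    have su := flow_sm uv t0; have sv := flow_smd uv t0.
    have [F hF] := cont_bounded (sm_cont su).
    have /andP[ht1 ht2] := htt t0 (ltW tT); have ha := haa t0 (ltW tT).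
    have tM0 : 0 < tM by exact: lt_le_trans tm0 (le_trans ht1 ht2).
    (* N makes the consistency error smaller than e / 2. It depends on t through the bound F on u t,
       so no uniform time step is available. *)
    pose N := (Num.bound (2 * E * `|F| / e)).+1.
    have eN : E * eps N * `|F| <= e / 2.
      have n2 := n_ge2 R hn; have N0 : 0 < N%:R :> R by rewrite ltr0n.
      have : eps N <= N%:R^-1 by rewrite lef_pV2 ?posrE //; lra.
      have : 2 * E * `|F| / e < N%:R.
        apply: lt_le_trans (archi_boundP _) _; last by rewrite ler_nat.
        by rewrite divr_ge0 ?mulr_ge0 //; lra.
      rewrite ltr_pdivrMr // => b1 b2.
      apply: (@le_trans _ _ (E * N%:R^-1 * `|F|)); first by rewrite ler_wpM2r // ler_wpM2l.
      by rewrite mulrAC ler_pdivrMr //; lra.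
    have e2 : 0 < e / 2 by lra.
    have [d1 d10 hd1] := flow_diff uv 0 t0 e2.
    have epN := @eps_gt0 R n hn N.
    (* Three constraints: u differs from its linearization by at most e / 2 per unit of time, and
       the two conditions for the positivity of [SS]. *)
    exists (Num.min d1 (Num.min (eps N / (2 * tM)) (2 * (D + 1))^-1)).
      by rewrite !lt_min d10 divr_gt0 ?mulr_gt0 //= invr_gt0; lra.
    move=> s ts sd g M M0 sg g0 hM.
    pose h := s - t; have h0 : 0 < h by rewrite /h; lra.
    have sE : s = t + h by rewrite /h addrC subrK.
    have s0 : 0 < s by lra.
    have : h < Num.min d1 (Num.min (eps N / (2 * tM)) (2 * (D + 1))^-1) by rewrite /h; lra.
    rewrite !lt_min => /and3P[h1 h2 h3].
    have th : h * tt t / eps N <= 2^-1.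
      rewrite ler_pdivrMr //; apply: (@le_trans _ _ (h * tM)).
        by rewrite ler_wpM2l // ltW.
      move: h2; rewrite ltr_pdivlMr; last by lra.
      lra.
    have Dh : D * h <= 2^-1.
      apply: (@le_trans _ _ (D * (2 * (D + 1))^-1)); first by rewrite ler_wpM2l // ltW.
      by rewrite ler_pdivrMr; lra.
    set Sg := SS sigma N h (tt t) (aa t) g.
    have sS : sm Sg by exact: (sm_SS hsigma).
    have S0 p : 0 <= Sg p by apply: hD => //; exact: ltW.
    have th1 : h * tt t / eps N <= 1 by lra.
    have bS : bnd K' ((1 + C * h) * M) Sg by apply: hC => //; exact: ltW.
    have Ch0 : 0 <= C * h by rewrite mulr_ge0 // ltW.
    have M1 : 0 <= (1 + C * h) * M by rewrite mulr_ge0 //; lra.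
    have Pg := Pt Sg _ M1 sS S0 bS.
    have b4 : bnd 4 M g by apply: bnd_le hM => //; exact: leq_addl.
    have c1 : J (fun p => u t p * Sg p) <= J (fun p => u t p * g p) + h * J (fun p => v t p * g p)
        + h * (e / 2 * M).
      rewrite weak_form //; intZ' m1.
      intD' m1.
      have -> : h * (e / 2 * M) = J (fun=> h * (e / 2 * M)) by rewrite (Int_cst m1) mulr1.
      intD' m1.
      int_le m1 => p.
      rewrite -lerBlDl.
      have -> : u t p * Sg p - (u t p * g p + h * (u t p * (tt t * Lap g p + Gam (lin (aa t)) g p))) =
        u t p * (Sg p - g p - h * (tt t * Lap g p + Gam (lin (aa t)) g p)) by ring.
      apply: le_trans (ler_norm _) _; rewrite normrM.
      have b := hE N h (tt t) (aa t) g p M isT (ltW h0) ht1 ht2 ha sg b4.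
      apply: (@le_trans _ _ (`|F| * (E * h * eps N * M))).
        by apply: ler_pM => //; exact: le_trans (hF p) (ler_norm _).
      have -> : `|F| * (E * h * eps N * M) = (h * M) * (E * eps N * `|F|) by ring.
      have -> : h * (e / 2 * M) = (h * M) * (e / 2) by ring.
      by rewrite ler_wpM2l // mulr_ge0 // ltW.
    have c2 : J (fun p => u t p * g p) + h * J (fun p => v t p * g p) <=
        J (fun p => u s p * g p) + h * (e / 2 * M).
      have su' := flow_sm uv s0.
      intZ' m1.
      intD' m1.
      have -> : h * (e / 2 * M) = J (fun=> h * (e / 2 * M)) by rewrite (Int_cst m1) mulr1.
      intD' m1.
      int_le m1 => p.
      have hh : `|h| < d1 by rewrite gtr0_norm.
      have := bnd_sup p (hd1 h (lt0r_neq0 h0) hh); rewrite -sE => b.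
      have -> : u t p * g p + h * (v t p * g p) = u s p * g p +
          h * (- (h^-1 * (u s p - u t p) - v t p) * g p).
        by field; exact: lt0r_neq0.
      rewrite lerD2l ler_wpM2l //; first exact: ltW.
      apply: le_trans (ler_norm _) _; rewrite normrM normrN; apply: ler_pM => //.
      exact: bnd_sup hM.
    have c3 : bd t * ((1 + C * h) * M) + h * (e * M) <= bd s * M.
      have -> : bd t * ((1 + C * h) * M) + h * (e * M) = (bd t * (1 + C * h) + h * e) * M by ring.
      rewrite ler_wpM2r //.
      have ex : 1 + C * h <= expR (C * h) by exact: expR_ge1Dx.
      have eta0 : 0 <= C * (t - a) by rewrite mulr_ge0 // subr_ge0.
      have bs : bd s = bd t * expR (C * h) + h * e * expR (C * (s - a)).
        by rewrite /bd sE (_ : C * (t + h - a) = C * (t - a) + C * h) ?expRD; ring.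
      rewrite bs lerD //; first by rewrite ler_wpM2l // bd0.
      rewrite ler_peMr ?mulr_ge0 ?(ltW h0) ?(ltW e0) //.
      apply: le_trans (expR_ge1Dx _); rewrite lerDl mulr_ge0 // subr_ge0; lra.
    move: Pg c1 c2 c3.
    move: (bd t * _) (bd s * _) (J _) (J _) (h * J _) (J _) => x1 x2 x3 x4 x5 x6.
    have -> : h * (e * M) = h * (e / 2 * M) + h * (e / 2 * M) by field.
    lra.
  (* The bound is closed in t: otherwise the differentiable function G would already be negative
     slightly before t, against [Ps]. *)
  - move=> t ta tT Ps g M M0 sg g0 hM; have t0 : 0 < t by lra.
    pose G (s : R) := J (fun p => u s p * g p) + bd s * M.
    rewrite -subr_ge0 opprK -/(G t).
    have dG : exists dg, is_derive t 1 G dg.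
      have d1 := flow_Int t0 (sm_cont sg).
      have d2 : derivable bd t 1 by apply: ex_derive.
      have d3 : is_derive t 1 bd ('D_1 bd t) by exact: derivableP.
      have d4 := is_derive_mul d3 (is_derive_cst M t 1).
      by eexists; exact: is_deriveD d1 d4.
    have [dg hG] := dG; have [r r0 hr] := is_derive_lip hG.
    rewrite leNgt; apply/negP => Gt.
    pose h := Num.min (r / 2) (Num.min (t - a) (- G t / (2 * (`|dg| + 1)))).
    have q0 := normr_ge0 dg.
    have h0 : 0 < h by rewrite !lt_min divr_gt0 //= subr_gt0 ta divr_gt0 //; lra.
    have hr1 : h < r by rewrite gt_min; apply/orP; left; lra.
    have h2 : h <= t - a by rewrite !ge_min lexx orbT.
    have h3 : h <= - G t / (2 * (`|dg| + 1)) by rewrite !ge_min lexx !orbT.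
    have := hr (- h); rewrite normrN gtr0_norm // => /(_ hr1).
    have Gs : 0 <= G (t - h).
      have s1 : a <= t - h by lra.
      have s2 : t - h < t by lra.
      by have := Ps _ s1 s2 g M M0 sg g0 hM; rewrite /G; lra.
    move: h3; rewrite ler_pdivlMr; last by lra.
    rewrite ler_norml; move: (G t) (G (t - h)) Gt Gs => x y x0 y0.
    move: (`|dg| + 1) => z; rewrite mulrCA (mulrC z); lra.
have := PT psi B B0 spsi psi0 hB; apply: le_trans; rewrite lerN2 ler_wpM2r //.
have Ta : T - a <= T by lra.
apply: ler_pM; [|exact: expR_ge0| |].
- by rewrite addr_ge0 ?mulr_ge0 //; lra.
- by rewrite lerD2l ler_wpM2l //; lra.
- by rewrite ler_expR ler_wpM2l.
Qed.

(** The kernels at x are nonnegative smooth test functions that concentrate at x. *)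
Lemma flow_ge0 x : 0 < T -> 0 <= u T x.
Proof.
move=> T0; have cu := flow_cont_at T0.
have H := @KK_cvg R n sigma hn hsigma (u T) x cu; rewrite -(cvg_lim _ H) //.
apply: limr_ge; first by apply/cvg_ex; eexists; exact: H.
apply: nearW => N; rewrite KK.unlock mulr_ge0 ?invr_ge0 ?(ltW (@cc_gt0 R n hn N)) //.
have -> : J (fun y => uu x y ^+ N * u T y) = J (fun y => u T y * uu x y ^+ N).
  by apply: Int_eq => y; rewrite mulrC.
by apply: flow_weak_ge0 => // [|y]; [exact: sm_uuX|rewrite exprn_ge0 // uu_ge0].
Qed.

End Linear_flow.

(** * Uniform constants for the coefficients, and Gronwall's inequality *)

Section Coefficients.
Variable R : realType.
Implicit Types (g nu tau j : R -> R).

Lemma lipschitz_onP g (A : set R) : A !=set0 -> [lipschitz g r | r in A] ->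
  exists2 K : R, 0 <= K & forall x y, A x -> A y -> `|g x - g y| <= K * `|x - y|.
Proof.
move=> A0; rewrite /lipschitz_on => /(filterI (nbhs_pinfty_ge (num_real 0))) H.
have [K [K0 hK]] := filter_ex H; exists K => // x y Ax Ay.
exact: (hK (x, y)).
Qed.

Lemma bounded_onP g (A : set R) : [bounded g r | r in A] -> exists M : R, forall x, A x -> `|g x| <= M.
Proof.
by move=> H; have [M hM] := @filter_ex _ (pinfty_nbhs R) _ _ H; exists M => x Ax; exact: hM.
Qed.

Lemma lipschitz_nonneg_continuous g (K : R) : (forall x y : R, 0 <= x -> 0 <= y -> `|g x - g y| <= K * `|x - y|) ->
  continuous (fun x : R => g `|x|).
Proof.
move=> hg x; apply/continuous_epsP => e e0.
exists (e / (`|K| + 1)) => [|y yx]; first by rewrite divr_gt0 // ltr_wpDl.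
apply: le_trans (hg _ _ (normr_ge0 _) (normr_ge0 _)) _.
have h : `| `|y| - `|x| | <= `|y - x| by exact: ler_dist_dist.
apply: (@le_trans _ _ ((`|K| + 1) * `|y - x|)).
  apply: (@le_trans _ _ ((`|K| + 1) * `| `|y| - `|x| |)); last by rewrite ler_wpM2l // ltW.
  by rewrite ler_wpM2r //; apply: le_trans (ler_norm _) _; rewrite lerDl.
by move: yx; rewrite ltr_pdivlMr // mulrC => /ltW.
Qed.

(** At r = 0 the quotient is 0 by the convention on division, so [coef_b] also covers that case. *)
Record coef nu tau (Cb CM Lt Lb : R) : Prop := Coef {
  coef_pos : forall r : R, 0 <= r -> 0 <= nu r /\ 0 < tau r;
  coef_Cb0 : 0 <= Cb;
  coef_b : forall r : R, 0 <= r -> 0 <= nu r / r <= Cb;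
  coef_M : forall r : R, 0 <= r -> tau r <= CM;
  coef_t : forall r s : R, 0 <= r -> 0 <= s -> `|tau r - tau s| <= Lt * `|r - s|;
  coef_bl : forall r s : R, 0 < r -> 0 < s -> `|nu r / r - nu s / s| <= Lb * `|r - s| }.

Lemma admissible_coef nu tau : admissible_coefficients nu tau ->
  exists Cb CM Lt Lb : R, coef nu tau Cb CM Lt Lb.
Proof.
move=> [h1 [h2 h2'] [h3 h3'] _ _].
have [Cb hCb] := bounded_onP h2'; have [CM hCM] := bounded_onP h3'.
have [|Lt _ hLt] := lipschitz_onP _ h3; first by exists 0; rewrite /= in_itv /= lexx.
have [|Lb _ hLb] := lipschitz_onP _ h2; first by exists 1; rewrite /= in_itv /= ltr01.
have pI (r : R) : 0 < r -> [set` `]0, +oo[ ] r by move=> r0; rewrite /= in_itv /= r0.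
have nI (r : R) : 0 <= r -> [set` `[0, +oo[ ] r by move=> r0; rewrite /= in_itv /= r0.
exists `|Cb|, CM, Lt, Lb; split => //.
- move=> r r0; have nr := (h1 r r0).1; rewrite divr_ge0 //=.
  have [r1|r1] := eqVneq r 0; first by rewrite r1 invr0 mulr0.
  have r2 : 0 < r by rewrite lt_neqAle eq_sym r1.
  apply: le_trans (ler_norm _) _; apply: le_trans (hCb r (pI r r2)) _; exact: ler_norm.
- by move=> r r0; apply: le_trans (ler_norm _) _; exact: hCM (nI r r0).
- by move=> r s r0 s0; apply: hLt; exact: nI.
- by move=> r s r0 s0; apply: hLb; exact: pI.
Qed.

Variables (nu tau : R -> R) (Cb CM Lt Lb : R).
Hypothesis hc : coef nu tau Cb CM Lt Lb.

Lemma coef_CM0 : 0 <= CM.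
Proof. by apply: le_trans (coef_M hc (lexx 0)); have [_ /ltW] := coef_pos hc (lexx (0 : R)). Qed.

(** Positivity of tau bounds it from below only on bounded intervals, by compactness; hence the role
    of bounds on the flux. *)
Lemma coef_tau_min (r0 : R) : 0 <= r0 -> exists2 tm : R, 0 < tm & forall r, 0 <= r -> r <= r0 -> tm <= tau r.
Proof.
move=> r00; have ct := lipschitz_nonneg_continuous (coef_t hc).
have [c] := EVT_min r00 (continuous_subspaceT ct).
rewrite in_itv /= => /andP[c0 _] H; exists (tau `|c|) => [|r r1 r2].
  by rewrite (coef_pos hc _).2.
by have := H r; rewrite in_itv /= r1 r2 (ger0_norm r1); exact.
Qed.

End Coefficients.

(** y(t) e^(c (t - a)) is nonincreasing, by the mean value theorem. *)
Lemma gronwall (R : realType) (y dy : R -> R) (c a b : R) : a <= b ->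
  (forall t, a <= t -> t <= b -> is_derive t 1 y (dy t)) ->
  (forall t, a <= t -> t <= b -> dy t <= - c * y t) -> y b <= y a * expR (- c * (b - a)).
Proof.
move=> ab hy hdy.
pose z (t : R) := y t * expR (c * (t - a)).
have de (t : R) : is_derive t 1 (fun s : R => expR (c * (s - a))) (expR (c * (t - a)) * c).
  have h : is_derive t 1 (fun s : R => c * (s - a)) c.
    by apply: is_derive_eq; rewrite /GRing.scale /=; ring.
  exact: (@is_derive1_comp _ _ (fun s : R => c * (s - a)) _ _ _ (is_derive_expR _) h).
have dz (t : R) : a <= t -> t <= b -> is_derive t 1 z (dy t * expR (c * (t - a)) + y t * (expR (c * (t - a)) * c)).
  by move=> ta tb; exact: is_derive_mul (hy t ta tb) (de t).
have zb : z b <= z a.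
  have [t|t|c' ] := @MVT_segment R z (fun t => dy t * expR (c * (t - a)) + y t * (expR (c * (t - a)) * c)) a b ab.
  - by rewrite in_itv /= => /andP[ta tb]; apply: dz; exact: ltW.
  - apply: derivable_within_continuous => x; rewrite in_itv /= => /andP[xa xb].
    by case: (dz x xa xb).
  rewrite in_itv /= => /andP[ta tb] E; rewrite -subr_le0 E; apply: mulr_le0_ge0; last by rewrite subr_ge0.
  have H := hdy c' ta tb.
  have -> : dy c' * expR (c * (c' - a)) + y c' * (expR (c * (c' - a)) * c) =
    (dy c' - - c * y c') * expR (c * (c' - a)) by ring.
  by apply: mulr_le0_ge0; [rewrite subr_le0|exact: expR_ge0].
move: zb; rewrite /z subrr mulr0 expR0 mulr1 => H.
by rewrite mulNr expRN -ler_pdivrMr ?invr_gt0 ?expR_gt0 // invrK.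
Qed.

(** * Regularity of solutions *)

Section Sobolev_sums.
Variables (R : realType) (n : nat) (sigma : probability (borel_rV R n) R).
Hypotheses (hn : (2 <= n)%N) (hsigma : uniform_sphere sigma).
Notation V := 'rV[R]_n.
Notation pt := (pt R n).
Notation idx := ('I_n * 'I_n)%type.
Notation J := (Int sigma).
Notation nrm2 := (nrm2 sigma).
Let m1 := sigma_mass hsigma.
Implicit Types (g h : pt -> R) (p : pt) (w : V) (m : nat) (a b : idx).

(** The squared Sobolev norm of order m, summed over all words of length at most m. [HH m g h] below
    is twice the associated scalar product, hence the time derivative of [GG m] along a flow. *)
Fixpoint GG m g : R := if m is m'.+1 then nrm2 g + \sum_a GG m' (L a g) else nrm2 g.
Fixpoint HH m g h : R :=
  2 * J (fun p => g p * h p) + if m is m'.+1 then \sum_a HH m' (L a g) (L a h) else 0.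

Lemma GG_ge0 m g : 0 <= GG m g.
Proof.
elim: m g => [|m IH] g /=; first exact: nrm2_ge0.
by rewrite addr_ge0 ?nrm2_ge0 // sumr_ge0.
Qed.

Lemma GG_nrm2 m g : nrm2 g <= GG m g.
Proof. by case: m => [|m] //=; rewrite lerDl sumr_ge0 // => a _; exact: GG_ge0. Qed.

Lemma GG_L m g a : GG m (L a g) <= GG m.+1 g.
Proof.
rewrite /= (bigD1 a) //=; set s := \sum_(_ | _) _; have : 0 <= s.
  by apply: sumr_ge0 => b _; exact: GG_ge0.
have := nrm2_ge0 sigma g; lra.
Qed.

Lemma GG_leS m g : GG m g <= GG m.+1 g.
Proof.
elim: m g => [|m IH] g; first exact: (GG_nrm2 1).
by rewrite [leLHS]/= [leRHS]/=; rewrite lerD2l; apply: ler_sum => a _; exact: IH.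
Qed.

Lemma nrm2Z (c : R) g : cont g -> nrm2 (fun p => c * g p) = c ^+ 2 * nrm2 g.
Proof.
by move=> cg; rewrite /nrm2 -(IntZ m1); [apply: Int_eq => p; rewrite exprMn|cnt].
Qed.

Lemma nrm2D g h : cont g -> cont h -> nrm2 (fun p => g p + h p) <= 2 * nrm2 g + 2 * nrm2 h.
Proof.
move=> cg ch; rewrite /nrm2 -(IntZ m1); last by cnt.
intZ' m1.
intD' m1.
int_le m1 => p.
rewrite -subr_ge0; have -> : 2 * g p ^+ 2 + 2 * h p ^+ 2 - (g p + h p) ^+ 2 = (g p - h p) ^+ 2 by ring.
exact: sqr_ge0.
Qed.

Lemma GGZ m (c : R) g : sm g -> GG m (fun p => c * g p) = c ^+ 2 * GG m g.
Proof.
elim: m g => [|m IH] g sg /=; first by rewrite nrm2Z //; exact: sm_cont.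
rewrite nrm2Z ?mulrDr ?mulr_sumr; last exact: sm_cont.
by congr (_ + _); apply: eq_bigr => a _; rewrite LZ // IH //; smt.
Qed.

Lemma GGD m g h : sm g -> sm h -> GG m (fun p => g p + h p) <= 2 * GG m g + 2 * GG m h.
Proof.
elim: m g h => [|m IH] g h sg sh /=; first by apply: nrm2D; exact: sm_cont.
have H : \sum_a GG m (L a (fun p => g p + h p)) <= 2 * \sum_a GG m (L a g) + 2 * \sum_a GG m (L a h).
  rewrite !mulr_sumr -big_split; apply: ler_sum => a _ /=.
  by rewrite (LD a (sm_dd sg) (sm_dd sh)); apply: IH; smt.
have := nrm2D (sm_cont sg) (sm_cont sh); move: H; move: (\sum_a _) (\sum_a _) (\sum_a _).
by move=> x y z; lra.
Qed.

Lemma GG_sum (T : Type) (r : seq T) (F : T -> pt -> R) m : (forall i, sm (F i)) ->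
  GG m (fun p => \sum_(i <- r) F i p) <= 2 ^+ size r * \sum_(i <- r) GG m (F i).
Proof.
move=> sF; elim: r => [|i r IH].
  under eq_fun do rewrite big_nil.
  rewrite big_nil mulr0 (_ : (fun=> 0) = fun _ : pt => (0 : R) * 0); last by apply/funext => p; rewrite mul0r.
  by rewrite (@GGZ m 0 (fun=> 0)) ?expr0n ?mul0r //; smt.
under eq_fun do rewrite big_cons.
have sS : sm (fun p => \sum_(i <- r) F i p) by apply: sm_sum.
apply: le_trans (GGD m (sF i) sS) _; rewrite big_cons /= exprS.
have G0 := GG_ge0 m (F i).
have e1 : 1 <= 2 ^+ size r :> R by rewrite exprn_ege1 // ler1n.
rewrite mulrDr -!mulrA; apply: lerD; rewrite ler_wpM2l //.
by rewrite ler_peMl.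
Qed.

Lemma GG_sum_idx m (F : idx -> pt -> R) : (forall i, sm (F i)) ->
  GG m (fun p => \sum_i F i p) <= 2 ^+ (n * n) * \sum_i GG m (F i).
Proof.
move=> sF; have := GG_sum (index_enum idx) m sF.
suff -> : size (index_enum idx) = (n * n)%N by [].
by rewrite -[size _]count_predT -sum1_count sum1_card card_prod card_ord.
Qed.

Lemma GG_Lap m g : sm g -> GG m (Lap g) <= 2 ^+ (n * n) * GG m.+2 g.
Proof.
move=> sg; have sS : sm (fun p => \sum_a L a (L a g) p) by smt.
rewrite /Lap GGZ //; apply: (@le_trans _ _ (1 * GG m (fun p => \sum_a L a (L a g) p))).
  by rewrite ler_wpM2r ?GG_ge0 //; lra.
rewrite mul1r; apply: le_trans (GG_sum_idx m _) _; first by move=> a; smt.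
rewrite ler_wpM2l ?exprn_ge0 //=; apply: ler_wpDl; first exact: nrm2_ge0.
by apply: ler_sum => a _; exact: GG_L.
Qed.

Lemma GG_lin m : exists2 C : R, 0 <= C & forall w g, sm g ->
  GG m (fun p => lin w p * g p) <= C * enorm w ^+ 2 * GG m g.
Proof.
elim: m => [|m [C C0 IH]].
  exists 1 => // w g sg; rewrite mul1r /= /nrm2 -(IntZ m1); last by cnt.
  int_le m1 => p.
  rewrite exprMn ler_wpM2r ?sqr_ge0 // -[leLHS]real_normK ?num_real //.
  by rewrite ler_pXn2r ?nnegrE ?enorm_ge0 // lin_le.
exists (1 + (n * n)%:R * (2 * (C * (n%:R * 2) ^+ 2)) + 2 * C).
  by rewrite !addr_ge0 ?mulr_ge0 ?exprn_ge0 ?mulr_ge0.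
move=> w g sg; have w0 := sqr_ge0 (enorm w); have G0 := GG_ge0 m.+1 g.
have n0 : nrm2 (fun p => lin w p * g p) <= enorm w ^+ 2 * nrm2 g.
  rewrite /nrm2 -(IntZ m1); last by cnt.
  int_le m1 => p.
  rewrite exprMn ler_wpM2r ?sqr_ge0 // -[leLHS]real_normK ?num_real //.
  by rewrite ler_pXn2r ?nnegrE ?enorm_ge0 // lin_le.
have H a : GG m (L a (fun p => lin w p * g p)) <=
    2 * (C * (n%:R * 2) ^+ 2) * (enorm w ^+ 2 * GG m.+1 g) + 2 * C * (enorm w ^+ 2 * GG m (L a g)).
  rewrite (LM a (sm_dd (sm_lin w)) (sm_dd sg)) L_lin.
  apply: le_trans (GGD m _ _) _; [by smt|by smt|].
  have -> : 2 * C * (enorm w ^+ 2 * GG m (L a g)) = 2 * (C * enorm w ^+ 2 * GG m (L a g)) by ring.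
  have -> : 2 * (C * (n%:R * 2) ^+ 2) * (enorm w ^+ 2 * GG m.+1 g) =
    2 * (C * (n%:R * 2 * enorm w) ^+ 2 * GG m.+1 g) by ring.
  apply: lerD; apply: ler_wpM2l => //; last by apply: IH; smt.
  apply: le_trans (IH (lskew a w) g sg) _.
  apply: ler_pM; [by rewrite mulr_ge0 ?sqr_ge0|exact: GG_ge0| |exact: GG_leS].
  apply: ler_wpM2l => //.
  by rewrite ler_pXn2r ?nnegrE ?mulr_ge0 ?enorm_ge0 // -mulrA enorm_lskew.
rewrite [leLHS]/=; apply: le_trans (lerD n0 (ler_sum _ (fun a _ => H a))) _.
rewrite big_split /= sumr_const card_prod card_ord -[_ *+ _]mulr_natl -!mulr_sumr.
set D := 2 * (C * _); set S := \sum_a _; set N := (n * n)%:R.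
have -> : (1 + N * D + 2 * C) * enorm w ^+ 2 * (nrm2 g + S) =
  enorm w ^+ 2 * nrm2 g + N * (D * (enorm w ^+ 2 * (nrm2 g + S))) + 2 * C * (enorm w ^+ 2 * S)
  + (enorm w ^+ 2 * S + 2 * C * (enorm w ^+ 2 * nrm2 g)) by ring.
have S0 : 0 <= S by apply: sumr_ge0 => a _; exact: GG_ge0.
have N0 := nrm2_ge0 sigma g; rewrite addrA lerDl.
by move: w0; move: (enorm w ^+ 2) => W w0; rewrite addr_ge0 ?mulr_ge0.
Qed.

Lemma GG_drift m : exists2 C : R, 0 <= C & forall w g, sm g ->
  GG m (fun p => Gam (lin w) g p - (n%:R - 1) * (lin w p * g p)) <= C * enorm w ^+ 2 * GG m.+1 g.
Proof.
have [C C0 hC] := GG_lin m; have n2 := n_ge2 R hn.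
exists (2 * (2 ^+ (n * n) * (C * (n%:R * 2) ^+ 2)) + 2 * ((n%:R - 1) ^+ 2 * C)).
  by rewrite addr_ge0 // !mulr_ge0 ?exprn_ge0 ?mulr_ge0 //; lra.
move=> w g sg; have w0 := sqr_ge0 (enorm w).
have E : (fun p => Gam (lin w) g p - (n%:R - 1) * (lin w p * g p)) =
   fun p => 2^-1 * (\sum_a lin (lskew a w) p * L a g p) + (- (n%:R - 1)) * (lin w p * g p).
  apply/funext => p; rewrite /Gam mulNr; congr (_ * _ - _).
  by apply: eq_bigr => a _; rewrite L_lin.
have sS : sm (fun p => \sum_a lin (lskew a w) p * L a g p) by smt.
have sw : sm (fun p => lin w p * g p) by smt.
rewrite E; apply: le_trans (GGD m _ _) _; [by smt|by smt|].
move: (enorm_ge0 w) (fun a => enorm_lskew a w) (fun g' sg' => hC w g' sg') (fun a g' sg' => hC (lskew a w) g' sg').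
have -> : (2 * (2 ^+ (n * n) * (C * (n%:R * 2) ^+ 2)) + 2 * ((n%:R - 1) ^+ 2 * C)) * enorm w ^+ 2 * GG m.+1 g =
  2 * (2 ^+ (n * n) * (C * (n%:R * 2 * enorm w) ^+ 2 * GG m.+1 g)) +
  2 * ((n%:R - 1) ^+ 2 * (C * enorm w ^+ 2 * GG m.+1 g)) by ring.
move=> W0 hl hC1 hC2; apply: lerD; apply: ler_wpM2l => //; rewrite GGZ // ?sqrrN.
  apply: (@le_trans _ _ (1 * GG m (fun p => \sum_a lin (lskew a w) p * L a g p))).
    by rewrite ler_wpM2r ?GG_ge0 //; lra.
  rewrite mul1r; apply: le_trans (GG_sum_idx m _) _; first by move=> a; smt.
  apply: ler_wpM2l; first exact: exprn_ge0.
  apply: (@le_trans _ _ (\sum_a C * (n%:R * 2 * enorm w) ^+ 2 * GG m (L a g))).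
    apply: ler_sum => a _; apply: le_trans (hC2 a _ (sm_L a sg)) _.
    apply: ler_wpM2r; first exact: GG_ge0.
    apply: ler_wpM2l => //.
    by rewrite ler_pXn2r ?nnegrE ?mulr_ge0 ?enorm_ge0 // -mulrA.
  rewrite -mulr_sumr; apply: ler_wpM2l; first by rewrite mulr_ge0 ?sqr_ge0.
  by rewrite /= lerDr; exact: nrm2_ge0.
apply: ler_wpM2l; first exact: sqr_ge0.
apply: le_trans (hC1 _ sg) _.
by apply: ler_wpM2l; [rewrite mulr_ge0|exact: GG_leS].
Qed.

(** The Laplacian commutes with the fields, so each word contributes an integration by parts without
    remainder. *)
Lemma HH_Lap m g : sm g -> HH m g (Lap g) = - (GG m.+1 g - nrm2 g).
Proof.
have base h : sm h -> 2 * J (fun p => h p * Lap h p) = - \sum_a nrm2 (L a h).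
  move=> sh; rewrite (Int_Gam hsigma) //.
  have -> : J (Gam h h) = 2^-1 * \sum_a nrm2 (L a h).
    rewrite /Gam; intZ m1.
    rewrite (Int_sum m1); last by move=> a; cnt.
    congr (_ * _); apply: eq_bigr => a _; rewrite /nrm2; apply: Int_eq => p; by rewrite expr2.
  by rewrite mulrN mulrA divff ?mul1r.
elim: m g => [|m IH] g sg.
  by rewrite /= addr0 base // addrC addKr.
have E : \sum_a HH m (L a g) (L a (Lap g)) = - (\sum_a GG m.+1 (L a g) - \sum_a nrm2 (L a g)).
  rewrite -sumrB -sumrN; apply: eq_bigr => a _.
  by rewrite -(IH (L a g) (sm_L a sg)) (Lap_L hn hsigma).
rewrite [LHS]/= E base // [in RHS](_ : GG m.+2 g = nrm2 g + \sum_a GG m.+1 (L a g)) //.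
by move: (\sum_a _) (\sum_a _) => x y; ring.
Qed.

Lemma HH_le m g h (d : R) : 0 < d -> sm g -> sm h -> `|HH m g h| <= d * GG m h + d^-1 * GG m g.
Proof.
move=> d0; have base q k : sm q -> sm k -> `|2 * J (fun p => q p * k p)| <= d * nrm2 k + d^-1 * nrm2 q.
  move=> sq sk; intZ' m1.
  apply: le_trans (Int_norm m1 _) _; first by cnt.
  rewrite /nrm2 -(IntZ m1); last by cnt.
  intZ' m1.
  intD' m1.
  int_le m1 => p.
  rewrite normrM ger0_norm // normrM -(real_normK (num_real (k p))) -(real_normK (num_real (q p))).
  move: `|k p| `|q p| => x y; rewrite -subr_ge0.
  have -> : d * x ^+ 2 + d^-1 * y ^+ 2 - 2 * (y * x) = d * (x - d^-1 * y) ^+ 2.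
    by field; exact: lt0r_neq0.
  by rewrite mulr_ge0 ?sqr_ge0 // ltW.
elim: m g h => [|m IH] g h sg sh /=; first by rewrite addr0; exact: base.
apply: le_trans (ler_normD _ _) _; apply: le_trans (lerD (base g h sg sh) (ler_norm_sum _ _ _)) _.
have H : \sum_a `|HH m (L a g) (L a h)| <= d * \sum_a GG m (L a h) + d^-1 * \sum_a GG m (L a g).
  rewrite !mulr_sumr -big_split; apply: ler_sum => a _ /=; apply: IH; smt.
apply: le_trans (lerD (lexx _) H) _.
by rewrite le_eqVlt; apply/orP; left; apply/eqP; ring.
Qed.

Lemma HHD m g h k : sm g -> sm h -> sm k -> HH m g (fun p => h p + k p) = HH m g h + HH m g k.
Proof.
have base q h' k' : sm q -> sm h' -> sm k' ->
    J (fun p => q p * (h' p + k' p)) = J (fun p => q p * h' p) + J (fun p => q p * k' p).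
  by move=> sq sh sk; rewrite -(IntD m1); [apply: Int_eq => p; ring|cnt|cnt].
elim: m g h k => [|m IH] g h k sg sh sk /=; first by rewrite base //; ring.
rewrite base // (eq_bigr (fun a => HH m (L a g) (L a h) + HH m (L a g) (L a k))).
  by rewrite big_split /=; move: (\sum_a _) (\sum_a _) => x y; ring.
by move=> a _; rewrite (LD a (sm_dd sh) (sm_dd sk)) IH //; smt.
Qed.

Lemma HHZ m (c : R) g h : sm g -> sm h -> HH m g (fun p => c * h p) = c * HH m g h.
Proof.
have base q h' : sm q -> sm h' -> J (fun p => q p * (c * h' p)) = c * J (fun p => q p * h' p).
  by move=> sq sh; rewrite -(IntZ m1); [apply: Int_eq => p; ring|cnt].
elim: m g h => [|m IH] g h sg sh /=; first by rewrite base //; ring.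
rewrite base // (eq_bigr (fun a => c * HH m (L a g) (L a h))).
  by rewrite -mulr_sumr mulrDr mulrCA.
by move=> a _; rewrite LZ // IH //; smt.
Qed.

(* Interpolation, started by Nash's inequality for [m = 0]. *)
Lemma GG_interp m (rho e : R) : 0 < e -> exists2 C : R, 0 <= C & forall g, sm g ->
  J (fun p => `|g p|) <= rho -> GG m g <= e * GG m.+1 g + C.
Proof.
elim: m e => [|m IH] e e0.
  pose N := (Num.bound e^-1).+1.
  exists ((cc R n N)^-1 * rho ^+ 2) => [|g sg hg].
    by rewrite mulr_ge0 ?sqr_ge0 // invr_ge0 ltW // (@cc_gt0 R n hn).
  have j0 : 0 <= J (fun p => `|g p|) by apply: Int_ge0.
  have H := Nash hn hsigma (ltn0Sn (Num.bound e^-1)) sg; apply: le_trans H _.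
  rewrite -/N addrC; apply: lerD; last first.
    apply: ler_wpM2l; first by rewrite invr_ge0; apply: ltW; exact: (@cc_gt0 R n hn).
    by apply: lerXn2r; rewrite ?nnegrE // (le_trans j0).
  have -> : J (Gam g g) = 2^-1 * \sum_a nrm2 (L a g).
    rewrite /Gam; intZ m1.
    rewrite (Int_sum m1); last by move=> a; cnt.
    by congr (_ * _); apply: eq_bigr => a _; rewrite /nrm2; apply: Int_eq => p; rewrite expr2.
  have S0 : 0 <= \sum_a nrm2 (L a g) by apply: sumr_ge0 => a _; exact: nrm2_ge0.
  have eN : N%:R^-1 <= e.
    rewrite -[leRHS]invrK lef_pV2 ?posrE ?invr_gt0 //.
    apply: le_trans (ltW (archi_boundP _)) _; first by rewrite invr_ge0 ltW.
    by rewrite ler_nat /N.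
  apply: ler_pM => //=; first by rewrite mulr_ge0.
  have := nrm2_ge0 sigma g; move: S0; move: (\sum_a _) (nrm2 g) => x y; lra.
(* d turns the Laplacian term into e / 2 times the norm of order m + 2. e' makes the lower-order
   term at most half of the norm of order m + 1, which is then absorbed. *)
pose d := e / 2 / 2 ^+ (n * n).
have d0 : 0 < d by rewrite !divr_gt0.
pose e' := (2 * (1 + d^-1))^-1.
have D0 : 0 < 1 + d^-1 by rewrite addr_gt0 // invr_gt0.
have e'0 : 0 < e' by rewrite invr_gt0 mulr_gt0.
have [C C0 hC] := IH e' e'0.
exists (2 * ((1 + d^-1) * C)) => [|g sg hg]; first by rewrite !mulr_ge0 // ltW.
have h1 := HH_Lap m sg; have := HH_le m d0 sg (sm_Lap sg).
rewrite h1 normrN => /(le_trans (ler_norm _)) h2.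
have h3 : d * GG m (Lap g) <= e / 2 * GG m.+2 g.
  apply: le_trans (ler_wpM2l (ltW d0) (GG_Lap m sg)) _.
  by rewrite mulrA /d divfK ?gt_eqF.
have h4 := hC g sg hg; have h5 := GG_nrm2 m g.
have h6 : (1 + d^-1) * GG m g <= 2^-1 * GG m.+1 g + (1 + d^-1) * C.
  apply: le_trans (ler_wpM2l (ltW D0) h4) _; rewrite mulrDr lerD2r mulrA.
  apply: ler_wpM2r; first exact: GG_ge0.
  rewrite /e' le_eqVlt; apply/orP; left; apply/eqP; move: D0; move: (1 + d^-1) => x x0; field.
  exact: lt0r_neq0.
rewrite mulrDl mul1r in h6.
have h7 : e / 2 * GG m.+2 g = e * GG m.+2 g / 2 by rewrite mulrAC.
rewrite h7 in h3; move: h2 h3 h5 h6.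
move: (GG m.+1 g) (GG m.+2 g) (GG m g) (nrm2 g) (d * _) (d^-1 * _) (_ * C) (e * _); clear; move=> *; lra.
Qed.

Lemma GG_iLap m k g : sm g -> GG m (iter k (@Lap R n) g) <= (2 ^+ (n * n)) ^+ k * GG (m + 2 * k) g.
Proof.
elim: k m g => [|k IH] m g sg; first by rewrite mul1r muln0 addn0.
rewrite iterS exprS -mulrA; apply: le_trans (GG_Lap m (sm_iLap k sg)) _.
apply: ler_wpM2l; first exact: exprn_ge0.
by apply: le_trans (IH _ _ sg) _; rewrite (_ : (m.+2 + 2 * k = m + 2 * k.+1)%N) //; lia.
Qed.

Section Flow.
Variables u v : R -> pt -> R.

Lemma flow_L a : flow u v -> flow (fun t => L a (u t)) (fun t => L a (v t)).
Proof.
move=> uv; split=> [t t0|t t0|t k e t0 e0|t k e t0 e0].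
- exact/sm_L/(flow_sm uv).
- exact/sm_L/(flow_smd uv).
- have [d d0 hd] := flow_diff uv k.+1 t0 e0; exists (Num.min d t) => [|h h0]; first by rewrite lt_min d0.
  rewrite lt_min => /andP[hd' ht]; have := bnd_L a (hd h h0 hd').
  have su := flow_sm uv t0; have sv := flow_smd uv t0.
  have sh : sm (u (t + h)) by apply: (flow_sm uv); move: ht; rewrite ltr_norml; lra.
  congr (bnd _ _); apply/funext => p.
  have s1 : sm (fun p => u (t + h) p - u t p) by smt.
  have s2 : sm (fun p => h^-1 * (u (t + h) p - u t p)) by smt.
  by rewrite (LB a s2 sv) (LZ _ _ s1) (LB a sh su).
- have [d d0 hd] := flow_cont uv k.+1 t0 e0; exists (Num.min d t) => [|s]; first by rewrite lt_min d0.
  rewrite lt_min => /andP[hd' ht]; have := bnd_L a (hd s hd').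
  have sv := flow_smd uv t0.
  have sh : sm (v s) by apply: (flow_smd uv); move: ht; rewrite ltr_norml; lra.
  by congr (bnd _ _); apply/funext => p; rewrite (LB a sh sv).
Qed.

Lemma flow_Int_comp (F dF : R -> R) (D : set R) (t : R) : flow u v -> 0 < t ->
  (forall x, D x -> is_derive x 1 F (dF x)) ->
  (forall M : R, exists C : R, forall x, D x -> `|x| <= M -> `|dF x| <= C) ->
  (forall s p, 0 < s -> D (u s p)) ->
  is_derive t 1 (fun s => J (fun p => F (u s p))) (J (fun p => dF (u t p) * v t p)).
Proof.
move=> uv t0 hF hC hD; have [M [d [M0 d0 dt hM]]] := flow_bnd uv 0 t0.
have [C {}hC] := hC M.
have st (s : R) : `|s - t| < d -> 0 < s by rewrite ltr_norml; lra.
apply: (Int_derive m1 (M := C * M) (e := d)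
  (W := fun s p => F (u s p)) (dW := fun s p => dF (u s p) * v s p)) => //.
- move=> s /st s0; apply: cont_comp; last exact/sm_cont/(flow_sm uv).
  move=> p; have [h _] := hF _ (hD s p s0); exact/differentiable_continuous/derivable1_diffP.
- move=> s p /st s0; have h := flow_is_derive uv [::] p s0.
  have h2 := @is_derive1_comp _ _ (u ^~ p) _ _ _ (hF _ (hD s p s0)) h.
  exact: h2.
- move=> s p hs; rewrite normrM; have s0 := st s hs; apply: ler_pM => //.
    by apply: hC; [exact: hD|exact: (bnd_sup p (hM s hs).1)].
  exact: (bnd_sup p (hM s hs).2).
Qed.

End Flow.

Lemma is_derive_bigsum (I : Type) (r : seq I) (y dy : I -> R -> R) (t : R) :
  (forall i, is_derive t 1 (y i) (dy i t)) ->
  is_derive t 1 (fun s => \sum_(i <- r) y i s) (\sum_(i <- r) dy i t).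
Proof.
move=> h; elim: r => [|i r IH].
  by under eq_fun do rewrite big_nil; rewrite big_nil; exact: is_derive_cst.
under eq_fun do rewrite big_cons.
by rewrite big_cons; exact: is_deriveD.
Qed.

Lemma flow_GG m (u v : R -> pt -> R) (t : R) : flow u v -> 0 < t ->
  is_derive t 1 (fun s => GG m (u s)) (HH m (u t) (v t)).
Proof.
have base u' v' : flow u' v' -> 0 < t ->
    is_derive t 1 (fun s => nrm2 (u' s)) (2 * J (fun p => u' t p * v' t p)).
  move=> uv t0; have := @flow_Int_comp u' v' (fun x => x ^+ 2) (fun x => 2 * x) setT t uv t0.
  have -> : J (fun p => 2 * u' t p * v' t p) = 2 * J (fun p => u' t p * v' t p).
    have su := flow_sm uv t0; have sv := flow_smd uv t0.
    by rewrite -(IntZ m1); [apply: Int_eq => p; rewrite mulrA|cnt].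
  apply => //.
    move=> x _; have h := is_derive_mul (is_derive_id x (1 : R)) (is_derive_id x (1 : R)).
    by apply: (is_derive_eq h); ring.
  by move=> M; exists (2 * M) => x _ hx; rewrite normrM ger0_norm // ler_wpM2l.
elim: m u v => [|m IH] u v uv t0 /=; first by rewrite addr0; exact: base.
apply: is_deriveD; first exact: base.
apply: (@is_derive_bigsum _ _ (fun a s => GG m (L a (u s))) (fun a s => HH m (L a (u s)) (L a (v s)))).
by move=> a; exact: (IH _ _ (flow_L a uv) t0).
Qed.

(** Diffusion controls one more derivative than the drift uses, and [GG_interp] bounds what remains
    by the L^1 norm alone. No bound near t = 0 enters: the value at time 1 starts Gronwall's
    inequality. *)
Lemma flow_GG_bounded (u v : R -> pt -> R) (T : R -> R) (w : R -> V) (tm tM A rho : R) :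
  flow u v -> 0 < tm ->
  (forall t, 0 < t -> tm <= T t /\ T t <= tM) -> (forall t, 0 < t -> enorm (w t) <= A) ->
  (forall t p, 0 < t -> v t p = T t * Lap (u t) p - Gam (lin (w t)) (u t) p
     + (n%:R - 1) * lin (w t) p * u t p) ->
  (forall t, 0 < t -> J (fun p => `|u t p|) <= rho) ->
  forall m, exists M : R, forall t, 1 <= t -> GG m (u t) <= M.
Proof.
move=> uv tm0 hT hw pde hrho m.
have [C C0 hC] := GG_drift m.
have A0 : 0 <= A by apply: le_trans (enorm_ge0 (w 1)) (hw 1 ltr01).
have tM0 : 0 < tM by have [h1 h2] := hT 1 ltr01; apply: lt_le_trans tm0 (le_trans h1 h2).
pose B := C * A ^+ 2 + 1; have B0 : 0 < B by rewrite ltr_wpDl ?mulr_ge0 ?sqr_ge0.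
(* Young's parameter for the drift, which takes half of the dissipation tm GG (m + 1). The
   lower-order terms, of total weight K, take a quarter by interpolation, and the last quarter is
   the decay rate c. *)
pose d := tm / 2 / B; have d0 : 0 < d by rewrite !divr_gt0.
pose K := tM + d^-1; have K0 : 0 < K by rewrite addr_gt0 // invr_gt0.
have [D D0 hD] := @GG_interp m rho (tm / 4 / K) (divr_gt0 (divr_gt0 tm0 (ltr0n R 4)) K0).
pose c := tm / 4; have c0 : 0 < c by rewrite divr_gt0.
have key (t : R) : 0 < t -> HH m (u t) (v t) <= - c * (GG m (u t) - K * D / c).
  move=> t0; have su := flow_sm uv t0; have [T1 T2] := hT t t0.
  pose Dr p := Gam (lin (w t)) (u t) p - (n%:R - 1) * (lin (w t) p * u t p).
  have sD : sm Dr by rewrite /Dr; smt.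
  have -> : v t = fun p => T t * Lap (u t) p + (-1) * Dr p.
    by apply/funext => p; rewrite pde // /Dr; ring.
  have s1 := sm_Lap su.
  have s2 : sm (fun p => T t * Lap (u t) p) by smt.
  have s3 : sm (fun p => (-1) * Dr p) by smt.
  rewrite (HHD m su s2 s3) (HHZ m _ su s1) (HHZ m _ su sD) HH_Lap // mulN1r.
  have h1 := HH_le m d0 su sD; have h2 := hC (w t) (u t) su.
  have h3 : d * GG m Dr <= tm / 2 * GG m.+1 (u t).
    apply: le_trans (ler_wpM2l (ltW d0) h2) _; rewrite mulrA; apply: ler_wpM2r; first exact: GG_ge0.
    rewrite /d mulrAC ler_pdivrMr //; apply: ler_wpM2l; first by rewrite divr_ge0 // ltW.
    rewrite /B ler_wpDr //; apply: ler_wpM2l => //.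
    by apply: lerXn2r; rewrite ?nnegrE ?enorm_ge0 // hw.
  have h4 : K * GG m (u t) <= c * GG m.+1 (u t) + K * D.
    apply: le_trans (ler_wpM2l (ltW K0) (hD _ su (hrho t t0))) _.
    by rewrite mulrDr lerD2r mulrA -/c mulrC (mulrC K) divfK ?gt_eqF // mulrC.
  have h5 : T t * nrm2 (u t) <= tM * GG m (u t).
    by apply: ler_pM => //; [exact: le_trans (ltW tm0) T1|exact: nrm2_ge0|exact: GG_nrm2].
  have h6 : tm * GG m.+1 (u t) <= T t * GG m.+1 (u t) by apply: ler_wpM2r => //; exact: GG_ge0.
  have h7 : c * GG m (u t) <= c * GG m.+1 (u t) by apply: ler_wpM2l; [exact: ltW|exact: GG_leS].
  have -> : - c * (GG m (u t) - K * D / c) = K * D - c * GG m (u t) by field; exact: lt0r_neq0.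
  have h8 : - HH m (u t) Dr <= d * GG m Dr + d^-1 * GG m (u t) by apply: le_trans h1; rewrite -normrN; exact: ler_norm.
  rewrite /K mulrDl in h4; rewrite mulrN mulrBr.
  have h9 : c * GG m.+1 (u t) = tm * GG m.+1 (u t) / 4 by rewrite /c mulrAC.
  have h10 : tm / 2 * GG m.+1 (u t) = tm * GG m.+1 (u t) / 2 by rewrite mulrAC.
  move: h3 h4 h5 h6 h7 h8 h9 h10.
  move: (tm * _) (tm / 2 * _) (c * GG m.+1 _) (c * GG m _) (T t * GG _ _) (T t * nrm2 _) (HH _ _ _)
    (d * _) (d^-1 * _) (tM * GG _ _) (K * D).
  clear; move=> *; lra.
exists (GG m (u 1) + K * D / c) => t t1.
have := @gronwall R (fun s => GG m (u s) - K * D / c) (fun s => HH m (u s) (v s)) c 1 t t1.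
have E0 : expR (- c * (t - 1)) <= 1.
  rewrite expR_le1 mulNr oppr_le0; apply: mulr_ge0; first exact: ltW.
  by rewrite subr_ge0.
have G0 := GG_ge0 m (u 1); have Q0 : 0 <= K * D / c by rewrite divr_ge0 ?mulr_ge0 // ltW.
move=> H; have {H} H : GG m (u t) - K * D / c <= (GG m (u 1) - K * D / c) * expR (- c * (t - 1)).
  apply: H => s s1 s2; last by apply: key; apply: lt_le_trans s1.
  have h := flow_GG m uv (lt_le_trans ltr01 s1).
  have h2 := is_deriveB h (is_derive_cst (K * D / c) s (1 : R)).
  by apply: (is_derive_eq h2); rewrite subr0.
have H2 : (GG m (u 1) - K * D / c) * expR (- c * (t - 1)) <= GG m (u 1).
  apply: (@le_trans _ _ (GG m (u 1) * expR (- c * (t - 1)))).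
    by apply: ler_wpM2r; [exact: expR_ge0|rewrite gerBl].
  by apply: ler_piMr.
by rewrite -lerBlDr; apply: le_trans H H2.
Qed.

End Sobolev_sums.

(** * A priori properties of solutions: equation, mass, positivity, regularity *)

Section Solution.
Variables (R : realType) (n : nat) (sigma : probability (borel_rV R n) R).
Hypotheses (hn : (2 <= n)%N) (hsigma : uniform_sphere sigma).
Notation V := 'rV[R]_n.
Notation pt := (pt R n).
Notation J := (Int sigma).
Let m1 := sigma_mass hsigma.
Implicit Types (g psi : pt -> R) (p : pt) (F : V -> R).

Definition flx g : V := \row_i J (fun p => vec p 0 i * g p).

Lemma flux_vec F : flux sigma F = flx (F \o vec (n:=n)).
Proof. by apply/rowP => i; rewrite !mxE (sphere_int_vec sigma). Qed.

Lemma flx_coord g i : flx g 0 i = J (fun p => g p * lin (e_ R i) p).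
Proof. by rewrite mxE; apply: Int_eq => p; rewrite /lin edot_delta mulrC. Qed.

Lemma lin_sum (w : V) p : lin w p = \sum_i w 0 i * lin (e_ R i) p.
Proof. by rewrite {1}/lin {1}/edot; apply: eq_bigr => i _; rewrite /lin edot_delta mulrC. Qed.

Lemma Int_flx g (w : V) : cont g -> J (fun p => g p * lin w p) = edot (flx g) w.
Proof.
move=> cg; rewrite /edot (@Int_eq _ _ _ _ (fun p => \sum_i w 0 i * (g p * lin (e_ R i) p))).
  rewrite (Int_sum m1); last by move=> i; cnt.
  apply: eq_bigr => i _; intZ m1.
  by rewrite flx_coord mulrC.
by move=> p; rewrite lin_sum mulr_sumr; apply: eq_bigr => i _; rewrite mulrCA.
Qed.

Lemma linZ (c : R) (w : V) p : lin (c *: w) p = c * lin w p.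
Proof. by rewrite /lin edotZr. Qed.

Lemma Gam_linZ (c : R) (w : V) g p : Gam (lin (c *: w)) g p = c * Gam (lin w) g p.
Proof.
rewrite -GamZl; last exact: sm_lin.
by congr (Gam _ _ _); apply/funext => q; rewrite linZ.
Qed.

Variables (nu tau : R -> R).

(** The field vanishes when the flux does, so that one formula covers both cases of [Qop]. *)
Definition drift g : V := (nu (enorm (flx g)) / enorm (flx g)) *: flx g.

Lemma Qop_vec F p : smooth_sphere F -> Qop sigma nu tau F (vec p) =
  tau (enorm (flx (F \o vec (n:=n)))) * Lap (F \o vec (n:=n)) p
  - Gam (lin (drift (F \o vec (n:=n)))) (F \o vec (n:=n)) p
  + (n%:R - 1) * lin (drift (F \o vec (n:=n))) p * F (vec p).
Proof.
move=> sF; rewrite /Qop flux_vec /drift; set j := flx _; have [->|j0] := eqVneq j 0.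
  rewrite enorm0.
  by rewrite sphere_lap_vec // Gam_linZ linZ invr0 mulr0 !mul0r mulr0 mul0r subr0 addr0.
rewrite sphere_lap_vec // sphere_div_vec // !Gam_linZ !linZ; ring.
Qed.

Variable f0 : {measure set (borel_rV R n) -> \bar R}.
Variable rho : R.
Hypothesis hrho : 0 < rho.
Hypothesis hmass : f0 (@sphere R n) = rho%:E.
Variable f : R -> V -> R.
Hypothesis hf : solution sigma nu tau f0 f.
Notation u := (fun t => f t \o vec (n:=n)).
Notation v := (fun t => time_deriv f t \o vec (n:=n)).

Lemma solution_flow : flow u v.
Proof. by apply: C1_smooth_flow; case: hf. Qed.

Lemma solution_pde (t : R) : 0 < t -> forall p, v t p =
  tau (enorm (flx (u t))) * Lap (u t) p - Gam (lin (drift (u t))) (u t) p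
  + (n%:R - 1) * lin (drift (u t)) p * u t p.
Proof.
move=> t0 p; case: hf => [[sf _ _ _] heq _]; rewrite /= heq //; last exact: vec_sphere.
by apply: Qop_vec; exact: sf.
Qed.

(** [Hs_dual] for the difference between f t and the datum. The sup bound M of u t, which may blow
    up as t tends to 0, does not enter the estimate. *)
Lemma solution_init : exists k : nat, forall e : R, 0 < e -> exists2 d : R, 0 < d &
  forall t : R, 0 < t -> t < d -> forall psi, sm psi ->
  `|J (fun p => u t p * psi p) - Int f0 psi| <= e * Num.sqrt (nrm2 sigma psi + nrm2 sigma (iter k (@Lap R n) psi)).
Proof.
have [_ _ [s hs]] := hf; have [C [k [C0 hC]]] := Hs_dual hn hsigma s; exists k => e e0.
have e1 : 0 < e / (C + 1) by rewrite divr_gt0 // ltr_wpDl.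
have := hs (fun x => (x < (e / (C + 1))%:E)%E) => /=.
have op : ereal_nbhs (0%E : \bar R) (fun x => (x < (e / (C + 1))%:E)%E).
  by apply: open_ereal_lt'; rewrite lte_fin.
move=> /(_ op) /nbhs_ballP[d /= d0 hd]; exists d => // t t0 td psi spsi.
have cu : cont (u t) := flow_cont_at solution_flow t0.
have [M hM] := cont_bounded cu.
have H : (Hs_norm sigma s (fun h => (distr_of_fun sigma (f t) h - distr_of_measure f0 h)%R)
    <= (e / (C + 1))%:E)%E.
  by apply/ltW/hd => //; rewrite /ball /= sub0r normrN gtr0_norm.
have := hC _ (fun g => J (fun p => u t p * g p) - Int f0 g) (M + rho) _ (ltW e1) H.
move=> /(_ _ _ _ _ psi spsi) HH.
apply: le_trans (HH _ _ _ _) _.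
- move=> g cg; congr (_ - _).
    by rewrite /distr_of_fun (sphere_int_vec sigma); apply: Int_eq => p; rewrite /= ext_vec.
  by rewrite /distr_of_measure Int_vec; apply: Int_eq => p; rewrite /= ext_vec.
- move=> g h cg ch; rewrite (IntD hmass) //.
  have -> : J (fun p => u t p * (g p + h p)) = J (fun p => u t p * g p) + J (fun p => u t p * h p).
    by rewrite -(IntD m1); [apply: Int_eq => p; ring|cnt|cnt].
  ring.
- move=> c g cg; rewrite (IntZ hmass) //.
  have -> : J (fun p => u t p * (c * g p)) = c * J (fun p => u t p * g p).
    by rewrite -(IntZ m1); [apply: Int_eq => p; ring|cnt].
  ring.
- move=> g N cg hN; apply: le_trans (ler_normB _ _) _; rewrite mulrDl; apply: lerD.
    rewrite -[leRHS]mulr1; apply: (Int_bound m1); first by cnt.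
    by move=> p; rewrite normrM ler_pM.
  by rewrite mulrC; exact: (Int_bound hmass).
apply: ler_wpM2r; first exact: sqrtr_ge0.
clear HH H hs hd hC; rewrite mulrCA ger_pMr // ler_pdivrMr; lra.
Qed.

Lemma solution_init_bnd : exists K : nat, forall e : R, 0 < e -> exists2 d : R, 0 < d &
  forall t : R, 0 < t -> t < d -> forall psi (B : R), 0 <= B -> sm psi -> bnd K B psi ->
  `|J (fun p => u t p * psi p) - Int f0 psi| <= e * B.
Proof.
have [k hk] := solution_init; exists (2 * k)%N => e e0.
pose c : R := 1 + (n%:R ^+ 2) ^+ k; have c0 : 0 < c by rewrite ltr_wpDr ?exprn_ge0.
have [d d0 hd] := hk (e / c) (divr_gt0 e0 c0); exists d => // t t0 td psi B B0 sp hB.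
apply: le_trans (hd t t0 td psi sp) _.
apply: (@le_trans _ _ (e / c * (c * B))); last by rewrite mulrA divfK // lt0r_neq0.
rewrite ler_wpM2l ?divr_ge0 ?(ltW e0) ?(ltW c0) //; exact: sqrt_nrm2_iLap.
Qed.

Lemma bnd_cst k (c : R) : bnd k `|c| (fun _ : pt => c).
Proof.
elim: k c => [|k IH] c; first by case.
by apply: bndS => // a; rewrite L_cst; apply: bnd_le (IH 0) => //; rewrite normr0.
Qed.

(** Testing with 1 makes the weak form vanish, and the limit at time 0 identifies the constant. *)
Lemma solution_mass (t : R) : 0 < t -> J (u t) = rho.
Proof.
move=> t0; have uv := solution_flow.
have dJ (s : R) : 0 < s -> is_derive s 1 (fun s => J (fun p => u s p * 1)) 0.
  move=> s0; have := flow_Int hsigma uv s0 (@cont_cst R n 1).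
  rewrite (weak_form hsigma uv solution_pde s0 (@sm_cst R n 1)).
  have -> : J (fun p => u s p * (tau (enorm (flx (u s))) * Lap (fun=> 1) p +
     Gam (lin (drift (u s))) (fun=> 1) p)) = 0; last by [].
  rewrite (@Int_eq _ _ _ _ (fun=> 0)) ?(Int_cst m1) ?mul0r // => p.
  rewrite GamC Gam_cstl /Lap big1 ?mulr0 ?addr0 ?mulr0 // => a _.
  by rewrite !L_cst.
have E1 (s : R) : J (fun p => u s p * 1) = J (u s) by apply: Int_eq => p; rewrite mulr1.
have cst (a b : R) : 0 < a -> a < b -> J (u a) = J (u b).
  move=> a0 ab; have [x||c _] := @MVT_segment R (fun s => J (fun p => u s p * 1)) (fun=> 0) a b (ltW ab).
  - by rewrite in_itv /= => /andP[ax _]; apply: dJ; exact: lt_trans ax.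
  - apply: derivable_within_continuous => x; rewrite in_itv /= => /andP[ax _].
    by case: (dJ x (lt_le_trans a0 ax)).
  by rewrite mul0r !E1 => /eqP; rewrite subr_eq0 => /eqP.
have [K hK] := solution_init_bnd.
apply/eqP; rewrite -subr_eq0 -normr_le0; apply/ler_addgt0Pr => e e0; rewrite add0r.
have [d d0 hd] := hK e e0.
pose s := Num.min (d / 2) t.
have s0 : 0 < s by rewrite lt_min divr_gt0.
have sd : s < d by rewrite gt_min; apply/orP; left; lra.
have -> : J (u t) = J (u s).
  have [->//|ts] := eqVneq t s; apply/esym/cst => //.
  by rewrite lt_neqAle eq_sym ts /= ge_min lexx orbT.
have := hd s s0 sd (fun=> 1) 1 ler01 (@sm_cst R n 1).
by rewrite E1 (Int_cst hmass) mul1r mulr1; apply; have := @bnd_cst K 1; rewrite normr1.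
Qed.

Lemma flx_le g (M : R) : cont g -> (forall p, 0 <= g p) -> J g = M -> enorm (flx g) <= M.
Proof.
move=> cg g0 gM; have [->|j0] := eqVneq (flx g) 0.
  rewrite enorm0.
  by rewrite -gM; exact: Int_ge0.
have e0 : 0 < enorm (flx g) by rewrite enorm_gt0.
rewrite -(ler_pM2l e0) -expr2 enorm_sqr -Int_flx // -gM -(IntZ m1) //.
int_le m1 => p.
by rewrite mulrC ler_wpM2r //; apply: le_trans (ler_norm _) (lin_le _ _).
Qed.

(** The natural bound rho on the flux needs positivity, whose proof needs bounded coefficients. This
    cruder bound breaks the circle: near 0 the flux is close to that of the datum, and elsewhere it
    is continuous on a compact interval. *)
Lemma solution_flux_bounded (T : R) : 0 < T -> exists2 M : R, 0 <= M & forall t : R, 0 < t -> t <= T ->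
  enorm (flx (u t)) <= M.
Proof.
move=> T0; have uv := solution_flow; have [K hK] := solution_init_bnd.
suff H i : exists2 M : R, 0 <= M & forall t : R, 0 < t -> t <= T -> `|flx (u t) 0 i| <= M.
  have [M hM] : exists M : 'I_n -> R, forall i, 0 <= M i /\ forall t : R, 0 < t -> t <= T -> `|flx (u t) 0 i| <= M i.
    apply: (@fin_all_exists _ (fun=> R) (fun i M => 0 <= M /\ forall t : R, 0 < t -> t <= T -> `|flx (u t) 0 i| <= M)) => i.
    by have [M] := H i; exists M.
  pose S := \sum_i M i; have S0 : 0 <= S by apply: sumr_ge0 => i _; case: (hM i).
  exists (n%:R * S); first exact: mulr_ge0.
  move=> t t0 tT; apply: enorm_le_coord => // i; apply: le_trans ((hM i).2 t t0 tT) _.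
  by rewrite /S (bigD1 i) //= lerDl; apply: sumr_ge0 => l _; case: (hM l).
have [B B0 hB] := sm_bnd K (sm_lin (e_ R i) : sm (_ : pt -> R)).
have [d d0 hd] := hK 1 ltr01.
have small (t : R) : 0 < t -> t < d -> `|flx (u t) 0 i| <= `|Int f0 (lin (e_ R i))| + B.
  move=> t0 td; rewrite flx_coord; have := hd t t0 td _ B B0 (sm_lin (e_ R i)) hB; rewrite mul1r.
  move: (Int f0 _) (J _) => y x h; have -> : x = y + (x - y) by ring.
  by apply: le_trans (ler_normD _ _) _; rewrite lerD2l.
pose a := Num.min (d / 2) T; have a0 : 0 < a by rewrite lt_min T0 divr_gt0.
have ad : a < d by rewrite gt_min; apply/orP; left; lra.
have aT : a <= T by rewrite ge_min lexx orbT.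
pose G (t : R) := J (fun p => u t p * lin (e_ R i) p).
have cG : {within `[a, T], continuous G}.
  apply: derivable_within_continuous => t; rewrite in_itv /= => /andP[ta _].
  by case: (flow_Int hsigma uv (lt_le_trans a0 ta) (cont_lin (e_ R i))).
have [c1 _ h1] := EVT_max aT cG; have [c2 _ h2] := EVT_min aT cG.
exists (`|Int f0 (lin (e_ R i))| + B + `|G c1| + `|G c2|); first by rewrite !addr_ge0.
move=> t t0 tT; have [td|td] := ltP t d.
  apply: le_trans (small t t0 td) _.
  by have := normr_ge0 (G c1); have := normr_ge0 (G c2); lra.
have tI : t \in `[a, T] by rewrite in_itv /= tT andbT; lra.
have := h1 t tI; have := h2 t tI; rewrite flx_coord -/(G t) => x1 x2.
have := ler_norm (G c1); have := ler_norm (- G c2); rewrite normrN => x3 x4.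
have := normr_ge0 (Int f0 (lin (e_ R i))); have := normr_ge0 (G c1); have := normr_ge0 (G c2) => x5 x6 x7.
rewrite ler_norml; apply/andP; split; lra.
Qed.

Variables (Cb CM Lt Lb : R).
Hypothesis hc : coef nu tau Cb CM Lt Lb.

Lemma drift_le g : enorm (drift g) <= Cb * enorm (flx g).
Proof.
have [] := andP (coef_b hc (enorm_ge0 (flx g))) => b0 b1.
by rewrite /drift enormZ // ler_wpM2r // enorm_ge0.
Qed.

(** With the flux bounded up to time t, tau is bounded from below and the drift from above, and the
    equation is linear with known coefficients. The datum is a nonnegative measure, which gives the
    weak lower bound at time 0. *)
Lemma solution_ge0 (t : R) p : 0 < t -> 0 <= u t p.
Proof.
move=> t0; have [M M0 hM] := solution_flux_bounded t0.
have [tm tm0 htm] := coef_tau_min hc M0; have [K hK] := solution_init_bnd.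
refine (@flow_ge0 R n sigma hn hsigma u v solution_flow (fun s => tau (enorm (flx (u s))))
  (fun s => drift (u s)) tm CM (Cb * M) t solution_pde tm0 _ _ _ K _ p t0).
- exact: mulr_ge0 (coef_Cb0 hc) M0.
- by move=> s s0 st; rewrite htm ?enorm_ge0 ?hM //= (coef_M hc) ?enorm_ge0.
- move=> s s0 st; apply: le_trans (drift_le _) _; rewrite ler_wpM2l ?(coef_Cb0 hc) //; exact: hM.
move=> e e0; have [d d0 hd] := hK e e0; exists d => // s s0 sd psi B B0 sp psi0 hB.
have := hd s s0 sd psi B B0 sp hB; rewrite ler_norml => /andP[h _].
have I0 : 0 <= Int f0 psi by exact: Int_ge0.
by apply: (le_trans h); rewrite lerBlDr lerDl.
Qed.

Lemma solution_flux_le (t : R) : 0 < t -> enorm (flx (u t)) <= rho.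
Proof.
move=> t0; apply: flx_le; [exact: (flow_cont_at solution_flow t0)| |exact: solution_mass].
by move=> p; exact: solution_ge0.
Qed.

(** The coordinates of the flux are tests against linear functions, which converge to those of the
    datum. *)
Lemma solution_flux0 : measure_flux f0 != 0 -> exists2 t : R, 0 < t & flx (u t) != 0.
Proof.
move=> j0; have [i ji] : exists i, measure_flux f0 0 i != 0.
  apply/existsP; rewrite -negb_forall; apply: contra j0 => /forallP h.
  by apply/eqP/rowP => i; rewrite [RHS]mxE; apply/eqP; exact: h.
have [K hK] := solution_init_bnd.
have [B B0 hB] := sm_bnd K (sm_lin (e_ R i) : sm (_ : pt -> R)).
have E : measure_flux f0 0 i = Int f0 (lin (e_ R i)).
  by rewrite mxE Int_vec; apply: Int_eq => p; rewrite /= /lin edot_delta.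
rewrite E in ji; have q0 : 0 < `|Int f0 (lin (e_ R i))| by rewrite normr_gt0.
pose e := `|Int f0 (lin (e_ R i))| / (B + 1).
have e0 : 0 < e by rewrite divr_gt0 // ltr_wpDl.
have [d d0 hd] := hK e e0; exists (d / 2); first by rewrite divr_gt0.
have d2 : 0 < d / 2 by rewrite divr_gt0.
have d3 : d / 2 < d by lra.
apply/eqP => h; have := hd (d / 2) d2 d3 _ B B0 (sm_lin (e_ R i)) hB.
rewrite -flx_coord h mxE sub0r normrN leNgt => /negP; apply.
rewrite /e mulrAC ltr_pdivrMr ?ltr_wpDl // ltr_pM2l //; lra.
Qed.

Lemma solution_iLap_bounded k : exists M : R, forall t, 1 <= t ->
  nrm2 sigma (iter k (@Lap R n) (u t)) <= M.
Proof.
have uv := solution_flow.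
have [tm tm0 htm] := coef_tau_min hc (ltW hrho).
have [M hM] : exists M : R, forall t, 1 <= t -> GG sigma (2 * k) (u t) <= M.
  apply: (@flow_GG_bounded R n sigma hn hsigma u v (fun t => tau (enorm (flx (u t))))
    (fun t => drift (u t)) tm CM (Cb * rho) rho) => //.
  - move=> t t0; split; last by apply: (coef_M hc); exact: enorm_ge0.
    apply: htm; first exact: enorm_ge0.
    exact: (solution_flux_le t0).
  - move=> t t0; apply: le_trans (drift_le _) _.
    apply: ler_wpM2l; first exact: coef_Cb0 hc.
    exact: (solution_flux_le t0).
  - by move=> t p t0; exact: (solution_pde t0).
  - move=> t t0; rewrite (_ : Int sigma _ = J (u t)).
      by rewrite (solution_mass t0).
    by apply: Int_eq => p; rewrite ger0_norm // (solution_ge0).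
exists ((2 ^+ (n * n)) ^+ k * M) => t t1.
have su := flow_sm uv (lt_le_trans ltr01 t1).
have HI := @GG_iLap R n sigma hn hsigma 0 k _ su; rewrite add0n in HI; apply: (le_trans HI).
by apply: ler_wpM2l; [rewrite !exprn_ge0|exact: hM].
Qed.

Lemma solution_sup_bounded : exists2 M : R, 0 <= M & forall t p, 1 <= t -> `|f t (vec p)| <= M.
Proof.
have [C [k [C0 hC]]] := sup_bound hn hsigma.
have [B [B0 hB]] : exists B : R, 0 <= B /\ forall q t, (q <= k)%N -> 1 <= t ->
    nrm2 sigma (iter q (@Lap R n) (u t)) <= B ^+ 2.
  elim: k {hC} => [|k [B [B0 hB]]].
    have [M hM] := solution_iLap_bounded 0.
    exists (Num.sqrt M); split; first exact: sqrtr_ge0.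
    move=> q t; rewrite leqn0 => /eqP -> t1; rewrite sqr_sqrtr; first exact: hM.
    exact: le_trans (nrm2_ge0 _ _) (hM t t1).
  have [M hM] := solution_iLap_bounded k.+1.
  exists (Num.sqrt (B ^+ 2 + Num.max 0 M)); split; first exact: sqrtr_ge0.
  have M0 : 0 <= Num.max 0 M by rewrite le_max lexx.
  move=> q t; rewrite sqr_sqrtr ?addr_ge0 ?sqr_ge0 // leq_eqVlt => /predU1P[-> t1|qk t1].
    by apply: le_trans (hM t t1) _; rewrite ler_wpDl ?sqr_ge0 // le_max lexx orbT.
  by apply: le_trans (hB q t qk t1) _; rewrite lerDl.
exists (C * B) => [|t p t1]; first exact: mulr_ge0.
have su := flow_sm solution_flow (lt_le_trans ltr01 t1).
by apply: (hC (u t) B su B0) => q qk; exact: hB.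
Qed.

End Solution.

Lemma ctsM (R : realType) (f g : R -> R) : continuous f -> continuous g -> continuous (fun x => f x * g x).
Proof. by move=> cf cg x; exact: (@continuousM _ _ f g x (cf x) (cg x)). Qed.

Lemma ctsD (R : realType) (f g : R -> R) : continuous f -> continuous g -> continuous (fun x => f x + g x).
Proof. by move=> cf cg x; exact: (@continuousD _ _ _ f g x (cf x) (cg x)). Qed.

Lemma ctsZ (R : realType) (c : R) (f : R -> R) : continuous f -> continuous (fun x => c * f x).
Proof. by move=> cf; apply: (@ctsM R (fun=> c) f) => // x; exact: cst_continuous. Qed.

Lemma ctsX (R : realType) (f : R -> R) k : continuous f -> continuous (fun x => f x ^+ k).
Proof.
move=> ch; elim: k => [|k IH]; first by under eq_fun do rewrite expr0; move=> x; exact: cst_continuous.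
by under eq_fun do rewrite exprS; exact: ctsM.
Qed.

Lemma cts_id (R : realType) : continuous (fun x : R => x).
Proof. by move=> x; exact: cvg_id. Qed.

(** * The order parameter *)

Section Exponential_series.
Variable R : realType.
Implicit Types (x K e : R) (N : nat).

Definition exp_poly N x : R := \sum_(m < N) (m`!%:R)^-1 * x ^+ m.

Lemma exp_poly_cvg x : exp_poly ^~ x @ \oo --> expR x.
Proof.
have -> : exp_poly ^~ x = series (exp_coeff x).
  by apply/funext => N; rewrite /exp_poly /series /= big_mkord; apply: eq_bigr => m _; rewrite exp_coeffE.
exact: is_cvg_series_exp_coeff.
Qed.

Lemma exp_poly_dist N M x K : `|x| <= K -> (N <= M)%N ->
  `|exp_poly M x - exp_poly N x| <= exp_poly M K - exp_poly N K.
Proof.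
move=> xK; elim: M => [|M IH]; first by rewrite leqn0 => /eqP ->; rewrite !subrr normr0.
rewrite leq_eqVlt => /predU1P[->|]; first by rewrite !subrr normr0.
rewrite ltnS => /IH {}IH; rewrite /exp_poly !big_ord_recr /= -!/(exp_poly _ _).
rewrite addrAC [leRHS]addrAC; apply: le_trans (ler_normD _ _) _; apply: lerD => //.
rewrite normrM ger0_norm ?invr_ge0 // ler_wpM2l ?invr_ge0 //.
by rewrite normrX; apply: lerXn2r; rewrite ?nnegrE // (le_trans _ xK).
Qed.

Lemma expR_approx K e : 0 < e -> exists N, forall x, `|x| <= K -> `|expR x - exp_poly N x| <= e.
Proof.
move=> e0; have := @exp_poly_cvg K; move/cvgrPdist_le => /(_ e e0) [N _ hN].
exists N => x xK; have cx : (fun M => `|exp_poly M x - exp_poly N x|) @ \oo --> `|expR x - exp_poly N x|.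
  by apply: cvg_norm; apply: cvgB; [exact: exp_poly_cvg|exact: cvg_cst].
have cK : (fun M => exp_poly M K - exp_poly N K) @ \oo --> expR K - exp_poly N K.
  by apply: cvgB; [exact: exp_poly_cvg|exact: cvg_cst].
apply: le_trans (le_trans (ler_norm _) (hN N (leqnn N))).
rewrite -(cvg_lim _ cx) // -(cvg_lim _ cK) //; apply: ler_lim.
- by apply/cvg_ex; eexists; exact: cx.
- by apply/cvg_ex; eexists; exact: cK.
by near=> M; apply: exp_poly_dist => //; near: M; exists N.
Unshelve. all: by end_near. Qed.

End Exponential_series.

Section Segment_integral.
Variable R : realType.
Implicit Types (h g : R -> R) (c : R).
Notation T := (fun h => \int[@lebesgue_measure R]_(x in `[0, pi]) h x).

Lemma segment_integrable h : continuous h ->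
  lebesgue_measure.-integrable `[0, pi] (EFin \o h).
Proof.
by move=> ch; apply: continuous_compact_integrable; [exact: segment_compact|exact: continuous_subspaceT].
Qed.

Lemma Teq h g : (forall x, h x = g x) -> T h = T g.
Proof. by move=> /funext ->. Qed.

Lemma segmentD h g : continuous h -> continuous g -> T (fun x => h x + g x) = T h + T g.
Proof. by move=> ch cg; apply: RintegralD => //; exact: segment_integrable. Qed.

Lemma segmentZ c h : continuous h -> T (fun x => c * h x) = c * T h.
Proof. by move=> ch; apply: RintegralZl => //; exact: segment_integrable. Qed.

Lemma segment_FTC (F dF : R -> R) : (forall x : R, is_derive x 1 F (dF x)) -> continuous dF ->
  T dF = F pi - F 0.
Proof.
move=> hF cF; rewrite /Rintegral (@continuous_FTC2 _ dF F 0 pi (pi_gt0 R)) //.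
- exact: continuous_subspaceT.
- have cc x : {for x, continuous F}.
    by have [h _] := hF x; exact/differentiable_continuous/derivable1_diffP.
  split; last 2 first.
  + exact/cvg_at_right_filter/cc.
  + exact/cvg_at_left_filter/cc.
  by move=> x _; have [] := hF x.
by move=> x _; rewrite derive1E; have [_ ->] := hF x.
Qed.

End Segment_integral.

Section Order_parameter.
Variables (R : realType) (n : nat) (sigma : probability (borel_rV R n) R).
Hypotheses (hn : (2 <= n)%N) (hsigma : uniform_sphere sigma).
Notation V := 'rV[R]_n.
Notation pt := (pt R n).
Notation J := (Int sigma).
Let m1 := sigma_mass hsigma.
Notation T := (fun h => \int[@lebesgue_measure R]_(x in `[0, pi]) h x).
Implicit Types (w : V) (p : pt) (m : nat) (h : R -> R).

(** The Laplacian of a power of lin w has integral 0. Weighted integrals of powers of the cosine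
    obey the same recursion ([cos_moment]), and matching the two replaces polar coordinates on the
    sphere. *)
Lemma lin_moment w m : edot w w = 1 ->
  (m + n)%:R * J (fun p => lin w p ^+ m.+2) = m.+1%:R * J (fun p => lin w p ^+ m).
Proof.
move=> w1; have sw := sm_lin w.
have E p : Lap (fun q => lin w q ^+ m.+2) p =
    m.+2%:R * (m.+1%:R * lin w p ^+ m - (m + n)%:R * lin w p ^+ m.+2).
  have H := @Lap_comp R n (fun x => x ^+ m.+2) (fun x => m.+2%:R * x ^+ m.+1)
    (fun x => m.+2%:R * (m.+1%:R * x ^+ m)) (lin w).
  have d1 q : is_derive (lin w q) 1 (fun x => x ^+ m.+2) (m.+2%:R * lin w q ^+ m.+1).
    have h := is_derive_pow m.+1 (is_derive_id (lin w q) (1 : R)).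
    by apply: (is_derive_eq h); rewrite /= mulr1.
  have d2 q : is_derive (lin w q) 1 (fun x => m.+2%:R * x ^+ m.+1) (m.+2%:R * (m.+1%:R * lin w q ^+ m)).
    have h := is_derive_pow m (is_derive_id (lin w q) (1 : R)).
    have h2 := is_deriveZ m.+2%:R h.
    by apply: (is_derive_eq h2); rewrite /= mulr1.
  rewrite (H d1 d2 sw).
  rewrite Lap_lin Gam_lin w1 natrD !exprS -[m.+2]addn2 -[m.+1]addn1 !natrD; ring.
have := Int_Lap hsigma (smX m.+2 sw); rewrite (_ : J _ = J (fun p => m.+2%:R * (m.+1%:R * lin w p ^+ m - (m + n)%:R * lin w p ^+ m.+2))); last exact: Int_eq.
intZ m1.
intB m1.
intZ m1.
intZ m1.
by move/eqP; rewrite mulf_eq0 pnatr_eq0 /= subr_eq0 => /eqP ->.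
Qed.

Lemma lin_mean w : J (lin w) = 0.
Proof.
have := Int_Lap hsigma (sm_lin w); rewrite (_ : J _ = J (fun p => - (n%:R - 1) * lin w p)); last by apply: Int_eq => p; exact: Lap_lin.
intZ m1.
have n2 := n_ge2 R hn.
by move/eqP; rewrite mulf_eq0 oppr_eq0 subr_eq0 => /orP[/eqP h|/eqP //]; lra.
Qed.

Let wt (x : R) := sin x ^+ (n - 2).

Lemma cont_wt : continuous wt.
Proof. exact/ctsX/continuous_sin. Qed.

Lemma cont_cosM h : continuous h -> continuous (fun x => h (cos x) * wt x).
Proof.
move=> ch; apply: (@ctsM R (h \o cos)); last exact: cont_wt.
by move=> x; apply: (@continuous_comp _ _ _ cos h); [exact: continuous_cos|exact: ch].
Qed.

(** Integrates the derivative of cos^(m+1) sin^(n-1), which vanishes at both ends. *)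
Lemma cos_moment m :
  (m + n)%:R * T (fun x => cos x ^+ m.+2 * wt x) = m.+1%:R * T (fun x => cos x ^+ m * wt x).
Proof.
pose F (x : R) := cos x ^+ m.+1 * sin x ^+ (n - 2).+1.
pose dF x := (m + n)%:R * (cos x ^+ m.+2 * wt x) + - m.+1%:R * (cos x ^+ m * wt x).
have c1 : continuous (fun x => cos x ^+ m.+2 * wt x) by apply: (@cont_cosM (fun x => x ^+ m.+2)); apply: ctsX; exact: cts_id.
have c2 : continuous (fun x => cos x ^+ m * wt x) by apply: (@cont_cosM (fun x => x ^+ m)); apply: ctsX; exact: cts_id.
have hF (x : R) : is_derive x 1 F (dF x).
  have h1 := is_derive_pow m (is_derive_cos x).
  have h2 := is_derive_pow (n - 2) (is_derive_sin x).
  have h := is_derive_mul h1 h2; apply: (is_derive_eq h); rewrite /dF /wt /=.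
  have -> : (m + n)%:R = m.+1%:R + (n - 2).+1%:R :> R by rewrite -natrD; congr _%:R; lia.
  have := cos2Dsin2 x; rewrite !exprS; move: (cos x) (sin x) => c s.
  move: (c ^+ m) (s ^+ (n - 2)) (m.+1%:R : R) ((n-2).+1%:R : R) => cm sk a b cs.
  have -> : a * cm * - s * (s * sk) = - a * cm * sk * (s ^+ 2) by ring.
  by rewrite (_ : s ^+ 2 = 1 - c * c); [ring|rewrite -cs; ring].
have := segment_FTC hF; rewrite /F sin0 sinpi !exprS !mul0r !mulr0 subrr => H.
have {H} : T dF = 0.
  by apply: H; apply: ctsD; exact: ctsZ.
rewrite segmentD; [|exact: ctsZ|exact: ctsZ].
rewrite (segmentZ _ c1) (segmentZ _ c2) mulNr => /eqP; rewrite subr_eq0 => /eqP; exact.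
Qed.

Lemma cos_mean : T (fun x => cos x * wt x) = 0.
Proof.
have c1 : continuous (fun x => cos x * wt x) by apply: (@cont_cosM id); exact: cts_id.
have hF (x : R) : is_derive x 1 (fun y => sin y ^+ (n - 2).+1) ((n - 2).+1%:R * (cos x * wt x)).
  have h2 := is_derive_pow (n - 2) (is_derive_sin x).
  by apply: (is_derive_eq h2); rewrite /wt /=; ring.
have := segment_FTC hF; rewrite sin0 sinpi !exprS !mul0r subrr => H.
have {H} : T (fun x => (n - 2).+1%:R * (cos x * wt x)) = 0.
  by apply: H; exact: ctsZ.
by rewrite (segmentZ _ c1) => /eqP; rewrite mulf_eq0 pnatr_eq0 /= => /eqP.
Qed.

(** Same two-step recursion and, up to the factor T wt, same first two values 1 and 0. *)
Lemma moments_eq w m : edot w w = 1 ->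
  T (fun x => cos x ^+ m * wt x) = T wt * J (fun p => lin w p ^+ m).
Proof.
move=> w1; suff : T (fun x => cos x ^+ m * wt x) = T wt * J (fun p => lin w p ^+ m) /\
  T (fun x => cos x ^+ m.+1 * wt x) = T wt * J (fun p => lin w p ^+ m.+1) by case.
elim: m => [|m [IH1 IH2]].
  split.
    rewrite (Teq (g := wt)); last by move=> x; rewrite expr0 mul1r.
    have E : J (fun p => lin w p ^+ 0) = 1 * 1 by rewrite -(Int_cst m1); apply: Int_eq => p; rewrite expr0.
    by rewrite E !mulr1.
  rewrite (Teq (g := fun x => cos x * wt x)); last by move=> x; rewrite expr1.
  by rewrite cos_mean (_ : J _ = 0) ?mulr0 // -[RHS](lin_mean w); apply: Int_eq => p; rewrite expr1.
split => //; have n0 : (m + n)%:R != 0 :> R by rewrite pnatr_eq0; lia.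
by apply: (mulfI n0); rewrite cos_moment IH1 mulrCA [RHS]mulrCA lin_moment.
Qed.

(** Both sides are continuous for uniform convergence on [-1, 1], so the case of monomials
    suffices. *)
Lemma segment_functional w h : edot w w = 1 -> continuous h ->
  (forall e : R, 0 < e -> exists N (a : nat -> R), forall x, `|x| <= 1 ->
     `|h x - \sum_(m < N) a m * x ^+ m| <= e) ->
  T (fun x => h (cos x) * wt x) = T wt * J (fun p => h (lin w p)).
Proof.
move=> w1 ch hh.
have W0 : 0 <= T wt.
  by apply: Rintegral_ge0 => x; rewrite /= in_itv /= => /andP[x0 xp]; rewrite exprn_ge0 // sin_ge0_pi // x0.
apply/eqP; rewrite -subr_eq0 -normr_le0; apply/ler_addgt0Pl => e e0; rewrite addr0.
have e'0 : 0 < e / (2 * (T wt + 1)) by rewrite divr_gt0 // mulr_gt0 // ltr_wpDl.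
have [N [a ha]] := hh _ e'0; pose P x := \sum_(m < N) a m * x ^+ m.
have cP k : continuous (fun x : R => \sum_(m < k) a m * x ^+ m).
  elim: k => [|k IH]; first by under eq_fun do rewrite big_ord0; move=> x; exact: cst_continuous.
  under eq_fun do rewrite big_ord_recr /=; apply: ctsD; first exact: IH.
  by apply: ctsZ; apply: ctsX; exact: cts_id.
have hP k : T (fun x => (\sum_(m < k) a m * cos x ^+ m) * wt x) =
    T wt * J (fun p => \sum_(m < k) a m * lin w p ^+ m).
  elim: k => [|k IH].
    rewrite (Teq (g := fun=> 0)); last by move=> x; rewrite big_ord0 mul0r.
    rewrite (_ : J _ = J (fun=> 0)); last by apply: Int_eq => p; rewrite big_ord0.
    by rewrite (Int_cst m1) mul0r mulr0 Rintegral_cst // mul0r.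
  rewrite (Teq (g := fun x => (\sum_(m < k) a m * cos x ^+ m) * wt x + a k * (cos x ^+ k * wt x))); last first.
    by move=> x; rewrite big_ord_recr mulrDl /= -mulrA.
  rewrite (_ : J _ = J (fun p => \sum_(m < k) a m * lin w p ^+ m + a k * lin w p ^+ k)); last first.
    by apply: Int_eq => p; rewrite big_ord_recr.
  have c2 : continuous (fun x => cos x ^+ k * wt x) by apply: (@cont_cosM (fun x => x ^+ k)); apply: ctsX; exact: cts_id.
  rewrite segmentD; [|exact: (cont_cosM (cP k))|exact: ctsZ].
  rewrite IH (segmentZ _ c2) (moments_eq k w1); intD m1.
  by rewrite mulrDr mulrCA; intZ m1.
have cJ : cont (fun p => h (lin w p)) by apply: cont_comp; [move=> p; exact: ch|cnt].
have cJ2 : cont (fun p => P (lin w p)) by rewrite /P; cnt.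
have b1 : `|T (fun x => h (cos x) * wt x) - T (fun x => P (cos x) * wt x)| <= e / (2 * (T wt + 1)) * T wt.
  have cd : continuous (fun x => h x - P x) by move=> x; exact: (@continuousB _ _ _ h P x (ch x) (cP N x)).
  rewrite -(segmentZ _ cont_wt).
  have -> : T (fun x => h (cos x) * wt x) - T (fun x => P (cos x) * wt x) = T (fun x => (h (cos x) - P (cos x)) * wt x).
    rewrite -RintegralB //; [by apply: eq_Rintegral => x _; rewrite mulrBl| |]; apply: segment_integrable.
      exact: cont_cosM ch.
    exact: cont_cosM (cP N).
  apply: le_trans (le_normr_Rintegral _ _) _ => //; first exact/segment_integrable/(cont_cosM cd).
  apply: le_Rintegral => //.
  - apply: segment_integrable => x.
    apply: (@continuous_comp _ _ _ (fun x => (h (cos x) - P (cos x)) * wt x) Num.norm); last exact: norm_continuous.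
    exact: (cont_cosM cd).
  - by apply: segment_integrable; apply: ctsZ; exact: cont_wt.
  move=> x; rewrite /= in_itv /= => /andP[x0 xp].
  have s0 : 0 <= wt x by rewrite exprn_ge0 // sin_ge0_pi // x0.
  rewrite normrM (ger0_norm s0) ler_wpM2r // ha //.
  by rewrite ler_norml cos_geN1 cos_le1.
have b2 : `|J (fun p => h (lin w p)) - J (fun p => P (lin w p))| <= e / (2 * (T wt + 1)).
  rewrite -(IntB m1) // -[leRHS]mulr1; apply: (Int_bound m1); first by cnt.
  move=> p; apply: ha; apply: le_trans (lin_le w p) _.
  by rewrite /enorm w1 sqrtr1.
rewrite -/P in hP; have hN := hP N.
have -> : T (fun x => h (cos x) * wt x) - T wt * J (fun p => h (lin w p)) =
  (T (fun x => h (cos x) * wt x) - T (fun x => P (cos x) * wt x)) -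
  T wt * (J (fun p => h (lin w p)) - J (fun p => P (lin w p))).
  by rewrite mulrBr hN opprB addrA subrK.
apply: le_trans (ler_normB _ _) _; rewrite normrM (ger0_norm W0).
apply: le_trans (lerD b1 (ler_wpM2l W0 b2)) _.
move: W0; move: (T wt) => W W0.
have -> : e / (2 * (W + 1)) * W + W * (e / (2 * (W + 1))) = e * (W / (W + 1)) by field; apply: lt0r_neq0; lra.
apply: ler_piMr; first exact: ltW.
by rewrite ler_pdivrMr; lra.
Qed.

(** Wallis' recursion in steps of two, from the values pi and 2. *)
Lemma wt_int_gt0 : 0 < T wt.
Proof.
rewrite /wt; move: (n - 2)%N => k; suff : 0 < T (fun x => sin x ^+ k) /\ 0 < T (fun x => sin x ^+ k.+1) by case.
have cs m : continuous (fun x : R => sin x ^+ m) by exact/ctsX/continuous_sin.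
elim: k => [|k [IH1 IH2]].
  split.
    rewrite (Teq (g := fun=> 1)); last by move=> x; rewrite expr0.
    by rewrite (segment_FTC (F := id)) ?subr0 ?pi_gt0 // => x; exact: cst_continuous.
  rewrite (Teq (g := sin)); last by move=> x; rewrite expr1.
  have dc (x : R) : is_derive x 1 (fun x => - cos x) (sin x).
    by have h := is_deriveN (is_derive_cos x); apply: (is_derive_eq h); rewrite opprK.
  rewrite (segment_FTC dc); last exact: continuous_sin.
  by rewrite cospi cos0; lra.
split => //.
pose dF (x : R) := k.+2%:R * sin x ^+ k.+2 + - k.+1%:R * sin x ^+ k.
have hF (x : R) : is_derive x 1 (fun y => - cos y * sin y ^+ k.+1) (dF x).
  have h1 := is_deriveN (is_derive_cos x); have h2 := is_derive_pow k (is_derive_sin x).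
  have h := is_derive_mul h1 h2; apply: (is_derive_eq h); rewrite /dF /= (_ : (- cos) x = - cos x) //.
  have := cos2Dsin2 x; rewrite !exprS -[k.+2]addn1 natrD; move: (cos x) (sin x) => c s.
  move: (s ^+ k) (k.+1%:R : R) => sk a H1.
  have -> : - c * (a * sk * c) = - a * sk * (c ^+ 2) by ring.
  by rewrite (_ : c ^+ 2 = 1 - s * s); [ring|rewrite -H1; ring].
have := segment_FTC hF; rewrite sin0 sinpi !exprS !mul0r !mulr0 subrr => H.
have {H} : T dF = 0 by apply: H; apply: ctsD; exact: ctsZ.
rewrite segmentD; [|exact: ctsZ|exact: ctsZ].
rewrite !segmentZ // mulNr => /eqP; rewrite subr_eq0 => /eqP H.
by rewrite -(@pmulr_rgt0 _ k.+2%:R) ?ltr0n // H mulr_gt0.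
Qed.

Lemma cont_expM (k : R) : continuous (fun x : R => expR (k * x)).
Proof.
move=> x; apply: (@continuous_comp _ _ _ (fun x => k * x) expR); last exact: continuous_expR.
by apply: ctsZ; exact: cts_id.
Qed.

Lemma expM_approx (k e : R) : 0 < e -> exists N (a : nat -> R), forall x, `|x| <= 1 ->
  `|expR (k * x) - \sum_(m < N) a m * x ^+ m| <= e.
Proof.
move=> e0; have [N hN] := expR_approx `|k| e0.
exists N, (fun m => (m`!%:R)^-1 * k ^+ m) => x x1.
have := hN (k * x); rewrite /exp_poly.
under eq_bigr do rewrite exprMn mulrA; apply.
by rewrite normrM ler_piMr.
Qed.

Lemma exp_functional (k : R) w : edot w w = 1 ->
  T (fun x => expR (k * cos x) * wt x) = T wt * J (fun p => expR (k * lin w p)).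
Proof.
by move=> w1; apply: (segment_functional w1 (@cont_expM k)) => e; exact: expM_approx.
Qed.

Lemma order_paramE k w : edot w w = 1 ->
  order_param n k = J (fun p => lin w p * expR (k * lin w p)) / J (fun p => expR (k * lin w p)).
Proof.
move=> w1; have ce := @cont_expM k.
have cxe : continuous (fun x : R => x * expR (k * x)) by apply: ctsM => //; exact: cts_id.
rewrite /order_param.
have -> : \int[lebesgue_measure]_(theta in `[0, pi]) (expR (k * cos theta) * sin theta ^+ (n - 2)) =
    T wt * J (fun p => expR (k * lin w p)) by exact: exp_functional.
have -> : \int[lebesgue_measure]_(theta in `[0, pi]) (cos theta * expR (k * cos theta) * sin theta ^+ (n - 2)) =
    T wt * J (fun p => lin w p * expR (k * lin w p)).
  apply: (segment_functional w1 cxe) => e e0; have [N [a ha]] := expM_approx k e0.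
  exists N.+1, (fun m => if m is m'.+1 then a m' else 0) => x x1.
  rewrite big_ord_recl /= mul0r add0r.
  have -> : \sum_(i < N) a i * x ^+ (bump 0 i) = x * \sum_(i < N) a i * x ^+ i.
    by rewrite mulr_sumr; apply: eq_bigr => i _; rewrite /bump /= add1n exprS mulrCA.
  by rewrite -mulrBr normrM (le_trans _ (ha x x1)) // ler_piMl.
by rewrite -mulf_div divff ?mul1r // gt_eqF // wt_int_gt0.
Qed.

Definition ZZ (k : R) w : R := J (fun p => expR (k * lin w p)).

Lemma lin1_le w p : edot w w = 1 -> `|lin w p| <= 1.
Proof. by move=> w1; apply: le_trans (lin_le w p) _; rewrite /enorm w1 sqrtr1. Qed.

Lemma sm_gibbs (k : R) w : sm (fun p => expR (k * lin w p)).
Proof. by apply: sm_expR; smt. Qed.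

Lemma gibbs_ge (k : R) w p : edot w w = 1 -> expR (- `|k|) <= expR (k * lin w p).
Proof.
move=> w1; rewrite ler_expR; apply: le_trans (lerNnormlW _) => //.
by rewrite normrM ler_piMr ?lin1_le.
Qed.

Lemma ZZ_gt0 (k : R) w : 0 < ZZ k w.
Proof.
have [M hM] := cont_bounded (sm_cont (sm_lin w)).
apply: (@lt_le_trans _ _ (expR (- (`|k| * M)))); first exact: expR_gt0.
rewrite -[leLHS]mulr1 -(Int_cst m1); apply: (Int_le m1); [by cnt|exact: sm_cont (sm_gibbs k w)|].
move=> p; rewrite ler_expR; apply: le_trans (lerNnormlW (lexx _)).
by rewrite lerN2 normrM ler_wpM2l.
Qed.

Lemma order_param_lt1 (k : R) w : edot w w = 1 -> order_param n k < 1.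
Proof.
move=> w1; have Z0 := ZZ_gt0 k w; have sg := sm_gibbs k w; have cl := cont_lin w.
rewrite (order_paramE k w1) ltr_pdivrMr // mul1r -subr_gt0; intB' m1.
apply: (@lt_le_trans _ _ (J (fun p => (1 - lin w p) * expR (- `|k|)))).
  rewrite (IntZr m1) ?(IntB m1) //; [|by cnt..].
  by rewrite (Int_cst m1) lin_mean subr0 mulr1 mul1r expR_gt0.
int_le m1 => p.
have -> : expR (k * lin w p) - lin w p * expR (k * lin w p) = (1 - lin w p) * expR (k * lin w p) by ring.
apply: ler_wpM2l; last exact: gibbs_ge.
rewrite subr_ge0.
exact: le_trans (ler_norm _) (lin1_le _ w1).
Qed.

(* Integrating by parts, [(n - 1) J (l e^(k l)) = k J ((1 - l^2) e^(k l))] for [l = lin w]. *)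
Lemma order_param_gt0 (k : R) w : edot w w = 1 -> 0 < k -> 0 < order_param n k.
Proof.
move=> w1 k0; have Z0 := ZZ_gt0 k w; have sg := sm_gibbs k w; have sl := sm_lin w; have n2 := n_ge2 R hn.
rewrite (order_paramE k w1) divr_gt0 //.
have H := Int_Gam hsigma sg sl; move: H.
rewrite (_ : J (fun p => expR (k * lin w p) * Lap (lin w) p) = - (n%:R - 1) * J (fun p => lin w p * expR (k * lin w p))); last first.
  by rewrite -(IntZ m1); [apply: Int_eq => p; rewrite Lap_lin; ring|cnt].
have E p : Gam (fun p => expR (k * lin w p)) (lin w) p = k * ((1 - lin w p ^+ 2) * expR (k * lin w p)).
  have sk : sm (fun p => k * lin w p) by smt.
  have H' := @Gam_comp R n expR expR (fun p => k * lin w p) (lin w) (fun q => is_derive_expR _) sk p.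
  by rewrite H' GamZl // Gam_lin w1 expr2; ring.
rewrite (Int_eq _ E); intZ m1.
move/eqP; rewrite mulNr eqr_opp => /eqP H.
rewrite -(@pmulr_rgt0 _ (n%:R - 1)); last by lra.
rewrite H pmulr_rgt0 //.
have mom : J (fun p => 1 - lin w p ^+ 2) = 1 - n%:R^-1.
  intB m1; rewrite (Int_cst m1) mulr1; congr (_ - _).
  have := @lin_moment w 0 w1; rewrite add0n mul1r (_ : J (fun p => lin w p ^+ 0) = 1 * 1); last first.
    by rewrite -(Int_cst m1); apply: Int_eq => p; rewrite expr0.
  by rewrite mulr1 => h; apply: (@mulfI _ n%:R); rewrite ?h ?divff // gt_eqF //; lra.
apply: (@lt_le_trans _ _ (J (fun p => (1 - lin w p ^+ 2) * expR (- `|k|)))).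
  rewrite (IntZr m1); last by cnt.
  rewrite mom mulr_gt0 ?expR_gt0 // subr_gt0 invf_lt1; lra.
int_le m1 => p.
apply: ler_wpM2l; last exact: gibbs_ge.
by rewrite subr_ge0 -(real_normK (num_real _)) exprn_ile1 // lin1_le.
Qed.

Lemma is_derive_ZZ (k : R) w : edot w w = 1 -> is_derive k 1 (ZZ ^~ w) (ZZ k w * order_param n k).
Proof.
move=> w1; have Z0 := ZZ_gt0 k w.
rewrite (order_paramE k w1) mulrCA divff ?mulr1; last exact: lt0r_neq0.
have H := @Int_derive R n sigma 1 m1 (fun t p => expR (t * lin w p)) (fun t p => lin w p * expR (t * lin w p)) (expR (`|k| + 1)) 1 k ltr01.
apply: H.
- by move=> t _; exact: sm_cont (sm_gibbs t w).
- move=> t p _; have h := is_derive_mul (is_derive_id t (1 : R)) (is_derive_cst (lin w p) t (1 : R)).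
  have h2 := @is_derive1_comp _ _ (fun s : R => s * lin w p) _ _ _ (is_derive_expR _) h.
  by apply: (is_derive_eq h2); rewrite mulr0 addr0 mul1r mulrC.
move=> t p tk; rewrite normrM (gtr0_norm (expR_gt0 _)).
rewrite -[leRHS]mul1r; apply: ler_pM; rewrite ?expR_ge0 ?lin1_le //.
rewrite ler_expR; apply: le_trans (ler_norm _) _; rewrite normrM.
apply: le_trans (ler_piMr _ (lin1_le _ w1)) _ => //.
by have := ler_normD (t - k) k; rewrite subrK; lra.
Qed.

Lemma continuous_order_param w : edot w w = 1 -> continuous (fun k : R => order_param n k).
Proof.
move=> w1 k; pose Z1 (t : R) := J (fun p => lin w p * expR (t * lin w p)).
have E : (fun t : R => order_param n t) = fun t => Z1 t / ZZ t w by apply/funext => t; exact: order_paramE.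
have d1 : is_derive k 1 Z1 (J (fun p => lin w p * (lin w p * expR (k * lin w p)))).
  have H := @Int_derive R n sigma 1 m1 (fun t p => lin w p * expR (t * lin w p)) (fun t p => lin w p * (lin w p * expR (t * lin w p))) (expR (`|k| + 1)) 1 k ltr01.
  apply: H.
  - by move=> t _; have := sm_cont (sm_gibbs t w); have := cont_lin w; exact: contM.
  - move=> t p _; have h := is_derive_mul (is_derive_id t (1 : R)) (is_derive_cst (lin w p) t (1 : R)).
    have h2 := is_deriveZ (lin w p) (@is_derive1_comp _ _ (fun s : R => s * lin w p) _ _ _ (is_derive_expR _) h).
    by apply: (is_derive_eq h2); rewrite /GRing.scale /= mulr0 addr0 mul1r; ring.
  move=> t p tk; rewrite !normrM (gtr0_norm (expR_gt0 _)).
  have l1 := lin1_le p w1; rewrite mulrA -[leRHS]mul1r; apply: ler_pM; rewrite ?mulr_ge0 ?expR_ge0 //.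
    by rewrite mulr_ile1.
  rewrite ler_expR; apply: le_trans (ler_norm _) _; rewrite normrM.
  apply: le_trans (ler_piMr _ l1) _ => //.
  by have := ler_normD (t - k) k; rewrite subrK; lra.
have c1 : {for k, continuous Z1} by have [h _] := d1; exact/differentiable_continuous/derivable1_diffP.
have c2 : {for k, continuous (ZZ ^~ w)}.
  by have [h _] := is_derive_ZZ k w1; exact/differentiable_continuous/derivable1_diffP.
rewrite E; apply: (@continuousM _ _ Z1 (fun t => (ZZ t w)^-1) k c1).
by apply: (@continuousV _ _ (ZZ ^~ w) k) => //; rewrite gt_eqF // ZZ_gt0.
Qed.

(** Both are the same integral over [0, pi], so no rotation carrying w to w' has to be
    constructed. *)
Lemma ZZ_unit (k : R) w w' : edot w w = 1 -> edot w' w' = 1 -> ZZ k w = ZZ k w'.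
Proof.
move=> w1 w1'; apply: (@mulfI _ (T wt)); first by rewrite gt_eqF // wt_int_gt0.
by rewrite /ZZ -!exp_functional.
Qed.

End Order_parameter.

Lemma is_derive_near (R : realType) (F G : R -> R) (x d e : R) : 0 < e ->
  (forall y, `|y - x| < e -> F y = G y) -> is_derive x 1 F d -> is_derive x 1 G d.
Proof.
move=> e0 FG /is_derive_epsP H; apply/is_derive_epsP => e' /H[r r0 hr].
exists (Num.min r e) => [|h]; first by rewrite lt_min r0.
rewrite lt_min => /andP[h1 h2]; rewrite -!FG; [exact: hr| |].
  by rewrite subrr normr0.
by rewrite addrC addKr.
Qed.

Lemma ctsB_at (R : realType) (f g : R -> R) x : {for x, continuous f} -> {for x, continuous g} ->
  {for x, continuous (fun y => f y - g y)}.
Proof. by move=> cf cg; exact: (@continuousB _ _ _ f g x cf cg). Qed.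

(** * The equilibrium free energy *)

Section Ratio.
Variables (R : realType) (nu tau : R -> R).
Hypothesis hcoef : admissible_coefficients nu tau.
Notation k := (Defs.ratio nu tau).

Lemma ratio_ge0 (r : R) : 0 <= r -> 0 <= k r.
Proof. by case: hcoef => h _ _ _ _ r0; have [a b] := h r r0; rewrite divr_ge0 // ltW. Qed.

Lemma ratio_lt (r s : R) : 0 <= r -> r < s -> k r < k s.
Proof.
case: hcoef => _ _ _ h _ r0 rs; apply: h => //; rewrite in_itv /= ?r0 ?andbT //.
by rewrite (le_trans r0) // ltW.
Qed.

Lemma ratio_le (r s : R) : 0 <= r -> r <= s -> k r <= k s.
Proof. by move=> r0; rewrite le_eqVlt => /predU1P[->//|rs]; exact/ltW/ratio_lt. Qed.

Lemma ratio_bound (m : R) : 0 <= m -> exists2 B : R, 0 <= B & forall r, 0 < r -> r <= m -> k r <= B * r.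
Proof.
move=> m0; have [Cb [CM [Lt [Lb hc]]]] := admissible_coef hcoef.
have [tm tm0 htm] := coef_tau_min hc m0; have Cb0 := coef_Cb0 hc.
exists (Cb / tm) => [|r r0 rm]; first by rewrite divr_ge0 // ltW.
have /andP[_ h] := coef_b hc (ltW r0); have [nr tr] := coef_pos hc (ltW r0).
rewrite /ratio ler_pdivrMr //; have h2 := htm r (ltW r0) rm.
apply: (@le_trans _ _ (Cb * r)); first by rewrite -ler_pdivrMr.
have -> : Cb / tm * r * tau r = Cb * r * (tau r / tm) by ring.
apply: ler_peMr; first by rewrite mulr_ge0 // ltW.
by rewrite ler_pdivlMr // mul1r.
Qed.

(** The bound on nu r / r concerns r > 0 only. The value at 0 follows by monotonicity: k 0 < k h <=
    B h for all small h. *)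
Lemma ratio0 : k 0 = 0.
Proof.
apply/eqP; rewrite eq_le ratio_ge0 // andbT leNgt; apply/negP => k0.
have [B B0 hB] := ratio_bound (@ler01 R).
pose h := Num.min 1 (k 0 / (B + 1)); have B1 : 0 < B + 1 by rewrite ltr_wpDl.
have h0 : 0 < h by rewrite lt_min ltr01 divr_gt0.
have := ratio_lt (lexx 0) h0; have h1 : h <= 1 by rewrite /h ge_min lexx.
have := hB h h0 h1.
have : h * (B + 1) <= k 0 by rewrite -ler_pdivlMr // ge_min lexx orbT.
rewrite mulrDr mulr1 [h * B]mulrC; lra.
Qed.

Lemma ratio_gt0 (r : R) : 0 < r -> 0 < k r.
Proof. by move=> r0; rewrite -[ltLHS]ratio0; exact: ratio_lt. Qed.

Lemma ratio_derive : exists dk : R -> R, forall r : R, 0 < r -> is_derive r 1 k (dk r) /\ 0 <= dk r.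
Proof.
case: (hcoef) => _ _ _ _ [dk [hdk _]]; exists dk => r r0.
have H : is_derive r 1 k (dk r).
  apply/is_derive_epsP => e e0; have := hdk r (ltW r0).
  rewrite /is_derive_nonneg => /cvgrPdist_le /(_ e e0).
  rewrite /= /within /dnbhs /= => /nbhs_ballP[d /= d0 hd].
  exists (Num.min d r) => [|h]; first by rewrite lt_min d0.
  rewrite lt_min => /andP[h1 h2]; have [->|h0] := eqVneq h 0.
    by rewrite addr0 subrr mul0r subr0 normr0 mulr0.
  have := hd h; rewrite /ball /= sub0r normrN => /(_ h1 h0) H.
  have {H} := H (ltW (_ : 0 < r + h)).
  have rh : 0 < r + h by move: h2; rewrite ltr_norml; lra.
  move=> /(_ rh) H; rewrite -[X in `|X|]opprK normrN.
  have -> : - (k (r + h) - k r - h * dk r) = (dk r - h^-1 * (k (r + h) - k r)) * h.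
    by rewrite mulrBl mulrAC mulVf // mul1r; ring.
  by rewrite normrM ler_wpM2r.
split => //; rewrite leNgt; apply/negP => d0.
have e0 : 0 < - dk r / 2 by rewrite divr_gt0 // oppr_gt0.
move/is_derive_epsP/(_ _ e0) : H => [d d1 hd].
have h0 : 0 < d / 2 by rewrite divr_gt0.
have := hd (d / 2); rewrite ger0_norm ?(ltW h0) //.
have hd2 : d / 2 < d by lra.
move=> /(_ hd2); have := ratio_lt (ltW r0) (_ : r < r + d / 2).
rewrite ltrDl => /(_ h0); rewrite ler_norml => h3 /andP[_].
have : 0 < d / 2 * - dk r by rewrite mulr_gt0 // oppr_gt0.
rewrite mulrN; move: h3; have -> : - dk r / 2 * (d / 2) = - (d / 2 * dk r) / 2 by ring.
move: (d / 2 * _) (k _) (k _) => x y z; clear; lra.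
Qed.

Lemma continuous_ratio : continuous (fun x : R => k `|x|).
Proof.
move=> x; have [->|x0] := eqVneq x 0.
  apply/continuous_epsP => e e0; have [B B0 hB] := ratio_bound (@ler01 R).
  exists (Num.min 1 (e / (B + 1))) => [|y]; first by rewrite lt_min ltr01 divr_gt0 // ltr_wpDl.
  rewrite subr0 normr0 ratio0 subr0 lt_min => /andP[y1 y2].
  rewrite ger0_norm ?ratio_ge0 //.
  have [->|y0] := eqVneq y 0; first by rewrite normr0 ratio0 ltW.
  have y0' : 0 < `|y| by rewrite normr_gt0.
  apply: le_trans (hB _ y0' (ltW y1)) _; move: y2; rewrite ltr_pdivlMr ?ltr_wpDl // mulrC mulrDl mul1r.
  by move: (ltW y0'); lra.
have x0' : 0 < `|x| by rewrite normr_gt0.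
have := @continuous_comp R R R Num.norm k x (@norm_continuous _ _ x); apply.
by have [dk /(_ _ x0')[[h _] _]] := ratio_derive; exact/differentiable_continuous/derivable1_diffP.
Qed.

(* An antiderivative of the ratio on [0, +oo), also differentiable at 0. *)
Definition Phi (x : R) : R := \int[@lebesgue_measure R]_(t in `[(-1), x]) k `|t|.

Lemma is_derive_Phi (r : R) : 0 <= r -> is_derive r 1 Phi (k r).
Proof.
move=> r0; have ru : r < r + 1 by rewrite ltrDl.
have hi : lebesgue_measure.-integrable `[(-1), r + 1] (EFin \o (fun x : R => k `|x|)).
  apply: continuous_compact_integrable; first exact: segment_compact.
  exact/continuous_subspaceT/continuous_ratio.
have r1 : -1 < r by lra.
have [d1 d2] := continuous_FTC1_closed ru hi r1 (@continuous_ratio r).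
by apply: DeriveDef => //; rewrite -derive1E d2 ger0_norm.
Qed.

End Ratio.

(* [k = nu / tau], [c] the order parameter, [lnZ] the logarithm of the partition function. *)
Record thermo (R : realType) (k c lnZ Phi j : R -> R) (kappa_max : \bar R) : Prop := Thermo {
  th_k0 : k 0 = 0;
  th_klt : forall r s : R, 0 <= r -> r < s -> k r < k s;
  th_dk : exists dk : R -> R, forall r : R, 0 < r -> is_derive r 1 k (dk r) /\ 0 <= dk r;
  th_kc : continuous (fun x : R => k `|x|);
  th_Phi : forall r : R, 0 <= r -> is_derive r 1 Phi (k r);
  th_c0 : forall x : R, 0 < x -> 0 < c x;
  th_c1 : forall x : R, c x < 1;
  th_cc : continuous c;
  th_lnZ : forall x : R, is_derive x 1 lnZ (c x);
  th_max : forall r : R, 0 <= r -> ((k r)%:E < kappa_max)%E;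
  th_jK : forall r : R, 0 <= r -> j (k r) = r;
  th_j : forall x : R, 0 <= x -> (x%:E < kappa_max)%E -> 0 <= j x /\ k (j x) = x;
  th_jc : forall x : R, 0 < x -> (x%:E < kappa_max)%E ->
    derivable (fun u : R => j u / c u) x 1 /\ 0 < derive1 (fun u : R => j u / c u) x }.

Section Thermodynamics.
Variables (R : realType) (k c lnZ Phi j : R -> R) (kappa_max : \bar R).
Hypothesis ht : thermo k c lnZ Phi j kappa_max.
Variable rho : R.
Hypothesis hrho : 0 < rho.
Notation q := (fun u : R => j u / c u).
Implicit Types (r s kappa : R).
Let c_gt0 := th_c0 ht.
Let c_lt1 := th_c1 ht.
Let c_cont := th_cc ht.
Let ratio_max := th_max ht.
Let jK := th_jK ht.
Let k_lt := th_klt ht.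

Let k_le r s : 0 <= r -> r <= s -> k r <= k s.
Proof. by move=> r0; rewrite le_eqVlt => /predU1P[->//|rs]; exact/ltW/k_lt. Qed.

Let k_gt0 r : 0 < r -> 0 < k r.
Proof. by move=> r0; rewrite -[ltLHS](th_k0 ht); exact: k_lt. Qed.

Lemma j_gt0 kappa : 0 < kappa -> (kappa%:E < kappa_max)%E -> 0 < j kappa /\ k (j kappa) = kappa.
Proof.
move=> k0 kM; have [h1 h2] := th_j ht (ltW k0) kM; split => //.
rewrite lt_neqAle h1 andbT eq_sym; apply/eqP => E.
by move: h2; rewrite E (th_k0 ht) => h2; rewrite h2 ltxx in k0.
Qed.

Lemma q_gt0 kappa : 0 < kappa -> (kappa%:E < kappa_max)%E -> 0 < q kappa.
Proof. by move=> k0 kM; rewrite divr_gt0 ?(j_gt0 k0 kM).1 ?c_gt0. Qed.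

Lemma q_cont kappa : 0 < kappa -> (kappa%:E < kappa_max)%E -> {for kappa, continuous q}.
Proof. by move=> k0 /(th_jc ht k0)[h _]; exact/differentiable_continuous/derivable1_diffP. Qed.

Lemma q_lt a b : 0 < a -> a < b -> (b%:E < kappa_max)%E -> q a < q b.
Proof.
move=> a0 ab bM; have hM x : x <= b -> (x%:E < kappa_max)%E.
  by move=> xb; apply: le_lt_trans bM; rewrite lee_fin.
have [x||d] := @MVT R q (fun x => 'D_1 q x) a b ab.
- rewrite in_itv /= => /andP[ax xb]; have [h _] := th_jc ht (lt_trans a0 ax) (hM x (ltW xb)).
  exact: DeriveDef.
- apply: continuous_in_subspaceT => y; rewrite inE /= in_itv /= => /andP[ay yb].
  by apply: q_cont; [exact: lt_le_trans ay|exact: hM].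
rewrite in_itv /= => /andP[ax xb] E; rewrite -subr_gt0 E mulr_gt0 ?subr_gt0 //.
by rewrite -derive1E; have [_] := th_jc ht (lt_trans a0 ax) (hM d (ltW xb)).
Qed.

(** The default of self-consistency: it vanishes when rho times the Gibbs state of parameter k r has
    a flux of norm r. *)
Definition GG0 r : R := r - rho * c (k r).

Lemma GG0E r : 0 < r -> GG0 r = c (k r) * (q (k r) - rho).
Proof.
move=> r0; have c0 := c_gt0 (k_gt0 r0).
by rewrite /GG0 jK ?(ltW r0) //; move: c0; move: (c _) => x x0; field; exact: lt0r_neq0.
Qed.

Lemma GG0_le r : 0 < r -> GG0 r <= r.
Proof.
move=> r0; have c0 := c_gt0 (k_gt0 r0).
by rewrite /GG0 gerBl mulr_ge0 // ltW.
Qed.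

(* The free energy of the equilibrium with flux of norm [r], with [VV' = k' GG0]. *)
Definition VV r : R := r * k `|r| - rho * lnZ (k `|r|) - Phi r.

Lemma VV_cont r : 0 <= r -> {for r, continuous VV}.
Proof.
move=> r0; have ck := th_kc ht.
have c1 : continuous (fun x : R => x * k `|x|) by apply: ctsM => //; exact: cts_id.
have c2 : continuous (fun x : R => - rho * lnZ (k `|x|)).
  apply: ctsZ => x; apply: (@continuous_comp _ _ _ (fun x : R => k `|x|) lnZ); first exact: ck.
  by have [h _] := th_lnZ ht (k `|x|); exact/differentiable_continuous/derivable1_diffP.
have -> : VV = fun x => (x * k `|x| + - rho * lnZ (k `|x|)) - Phi x.
  by apply/funext => x; rewrite /VV mulNr.
apply: (@ctsB_at R (fun x => x * k `|x| + - rho * lnZ (k `|x|)) (Phi) r).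
  exact: (ctsD c1 c2).
by have [h _] := th_Phi ht r0; exact/differentiable_continuous/derivable1_diffP.
Qed.

Lemma VV_derive (dk : R -> R) r : 0 < r -> is_derive r 1 k (dk r) -> is_derive r 1 VV (dk r * GG0 r).
Proof.
move=> r0 hk; pose W x := x * k x - rho * lnZ (k x) - Phi x.
have hW : is_derive r 1 W (dk r * GG0 r).
  have h1 := is_derive_mul (is_derive_id r (1 : R)) hk.
  have h2 := is_deriveZ rho (@is_derive1_comp _ _ k _ _ _ (th_lnZ ht (k r)) hk).
  have h := is_deriveB (is_deriveB h1 h2) (th_Phi ht (ltW r0)).
  by apply: (is_derive_eq h); rewrite /GRing.scale /= /GG0; ring.
apply: (is_derive_near r0 _ hW) => y yr; rewrite /W /VV ger0_norm //.
by move: yr; rewrite ltr_norml; lra.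
Qed.

(** The mean value theorem for V - M k, of derivative k' (GG0 - M). Increments of V are compared
    with those of k rather than r, because k' is only known to be nonnegative. *)
Lemma VV_mean a b (M : R) : 0 <= a -> a < b -> exists d p : R, [/\ a < d, d < b, 0 <= p &
  VV b - VV a - M * (k b - k a) = p * (GG0 d - M)].
Proof.
move=> a0 ab; have [dk hdk] := th_dk ht.
pose W x := VV x - M * k `|x|.
have cW x : 0 <= x -> {for x, continuous W}.
  move=> x0; apply: (@ctsB_at R VV (fun x => M * k `|x|)); first exact: VV_cont.
  by apply: ctsZ; exact: (th_kc ht).
have hW (x : R) : 0 < x -> is_derive x 1 W (dk x * (GG0 x - M)).
  move=> x0; have [dx _] := hdk x x0.
  have h := is_deriveB (VV_derive x0 dx) (is_deriveZ M dx).
  apply: (is_derive_near x0 (F := fun x => VV x - M * k x)).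
    move=> y yx; rewrite /W ger0_norm //; move: yx; rewrite ltr_norml; lra.
  by apply: (is_derive_eq h); rewrite /GRing.scale /=; ring.
have [x||d] := @MVT R W (fun x => dk x * (GG0 x - M)) a b ab.
- by rewrite in_itv /= => /andP[ax xb]; apply: hW; exact: le_lt_trans ax.
- apply: continuous_in_subspaceT => y; rewrite inE /= in_itv /= => /andP[ay yb].
  by apply: cW; exact: le_trans ay.
rewrite in_itv /= => /andP[ad db] E; exists d, (dk d * (b - a)); split => //.
  by apply: mulr_ge0; [have [] := hdk d (le_lt_trans a0 ad)|rewrite subr_ge0 ltW].
by rewrite mulrAC -E /W !ger0_norm ?(le_trans a0 (ltW ab)) //; ring.
Qed.

Lemma VV_comparison a b (M : R) : 0 <= a -> a <= b -> (forall r, a < r -> r < b -> GG0 r <= M) ->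
  VV b - VV a <= M * (k b - k a).
Proof.
move=> a0; rewrite le_eqVlt => /predU1P[<-|ab hM]; first by rewrite !subrr mulr0.
have [d [p [ad db p0 E]]] := VV_mean M a0 ab.
by rewrite -subr_le0 E; apply: mulr_ge0_le0; rewrite // subr_le0 hM.
Qed.

Lemma VV_comparison_ge a b (M : R) : 0 <= a -> a <= b -> (forall r, a < r -> r < b -> M <= GG0 r) ->
  M * (k b - k a) <= VV b - VV a.
Proof.
move=> a0; rewrite le_eqVlt => /predU1P[<-|ab hM]; first by rewrite !subrr mulr0.
have [d [p [ad db p0 E]]] := VV_mean M a0 ab.
by rewrite -subr_ge0 E; apply: mulr_ge0; rewrite // subr_ge0 hM.
Qed.

Lemma VV_le r : 0 <= r -> VV r - VV 0 <= r * k r.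
Proof.
move=> r0; have := @VV_comparison 0 r r (lexx 0) r0; rewrite (th_k0 ht) subr0; apply.
by move=> s s0 sr; apply: le_trans (GG0_le s0) (ltW sr).
Qed.

Variable rho_c : \bar R.
Hypothesis hrho_c : (j x / c x)%:E @[x --> 0^'+] --> rho_c.

Lemma near0_witness (P : R -> Prop) kappa : 0 < kappa -> (\forall x \near (0 : R)^'+, P x) ->
  exists x : R, [/\ 0 < x, x < kappa & P x].
Proof.
move=> k0 hP; near (0 : R)^'+ => x; exists x; split; first by near: x; exact: nbhs_right_gt.
  by near: x; exact: nbhs_right_lt.
by near: x.
Unshelve. all: by end_near. Qed.

Lemma q_gt_below (m : R) kappa : (m%:E < rho_c)%E -> 0 < kappa -> (kappa%:E < kappa_max)%E -> m < q kappa.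
Proof.
move=> mc k0 kM; have H : \forall x \near (0 : R)^'+, m < q x.
  have H : \forall x \near (0 : R)^'+, (m%:E < (q x)%:E)%E := hrho_c (open_ereal_gt' mc).
  by apply: filterS H => x; rewrite lte_fin.
have [x [x0 xk mx]] := near0_witness k0 H.
exact: lt_trans mx (q_lt x0 xk kM).
Qed.

Lemma ereal_gap (m : R) : (m%:E < rho_c)%E -> exists2 m' : R, m < m' & (m'%:E < rho_c)%E.
Proof.
case: rho_c => [r| |] //; last by move=> _; exists (m + 1); rewrite ?ltry // ltrDl.
by rewrite lte_fin => mr; exists ((m + r) / 2); rewrite ?lte_fin; lra.
Qed.

Lemma GG0_q r (m : R) : 0 < m -> 0 < r -> m <= q (k r) -> r * (1 - rho / m) <= GG0 r.
Proof.
move=> m0 r0 mq; have c0 := c_gt0 (k_gt0 r0).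
have -> : r * (1 - rho / m) = r - rho * (r / m) by ring.
rewrite lerD2l lerN2; apply: ler_wpM2l; first exact: ltW.
move: mq; rewrite jK ?(ltW r0) // ler_pdivlMr // => H.
by rewrite ler_pdivlMr // mulrC.
Qed.

Lemma GG0_q_le r (m : R) : 0 < m -> 0 < r -> q (k r) <= m -> GG0 r <= r * (1 - rho / m).
Proof.
move=> m0 r0 mq; have c0 := c_gt0 (k_gt0 r0).
have -> : r * (1 - rho / m) = r - rho * (r / m) by ring.
rewrite lerD2l lerN2; apply: ler_wpM2l; first exact: ltW.
move: mq; rewrite jK ?(ltW r0) // ler_pdivrMr // => H.
by rewrite ler_pdivrMr // mulrC.
Qed.

(** For m strictly between rho and rho_c one has j / c >= m, that is c (k r) <= r / m. *)
Lemma GG0_subcritical : (rho%:E < rho_c)%E -> exists2 d : R, 0 < d & forall r, 0 < r -> d * r <= GG0 r.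
Proof.
move=> /ereal_gap[m rm mc]; have m0 := lt_trans hrho rm.
exists (1 - rho / m) => [|r r0]; first by rewrite subr_gt0 ltr_pdivrMr // mul1r.
rewrite mulrC; apply: GG0_q => //; apply: ltW; apply: q_gt_below => //; first exact: k_gt0.
exact/ratio_max/ltW.
Qed.

(** Were j / c at most rho_c at kappa, it would be below rho_c at kappa / 2, whereas an increasing
    function lies above its limit at 0. *)
Lemma q_critical kappa : rho%:E = rho_c -> 0 < kappa -> (kappa%:E < kappa_max)%E -> rho < q kappa.
Proof.
move=> E k0 kM; rewrite ltNge; apply/negP => H.
have h0 : 0 < kappa / 2 by rewrite divr_gt0.
have h1 : kappa / 2 < kappa by lra.
have hM : ((kappa / 2)%:E < kappa_max)%E by apply: lt_trans kM; rewrite lte_fin.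
have h2 := lt_le_trans (q_lt h0 h1 kM) H.
by have := @q_gt_below (q (kappa / 2)) (kappa / 2); rewrite -E lte_fin ltxx => /(_ h2 h0 hM).
Qed.

Lemma GG0_critical (e : R) : rho%:E = rho_c -> 0 < e -> exists2 g : R, 0 < g & forall r, e <= r -> g <= GG0 r.
Proof.
move=> E e0; have k0 := k_gt0 e0; have kM := ratio_max (ltW e0).
have qe := q_critical E k0 kM; have q0 := lt_trans hrho qe.
have g0 : 0 < 1 - rho / q (k e) by rewrite subr_gt0 ltr_pdivrMr // mul1r.
exists (e * (1 - rho / q (k e))) => [|r er]; first exact: mulr_gt0.
have r0 := lt_le_trans e0 er.
apply: (@le_trans _ _ (r * (1 - rho / q (k e)))); first by apply: ler_wpM2r => //; exact: ltW.
apply: GG0_q => //; move: er; rewrite le_eqVlt => /predU1P[<-//|er].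
by apply/ltW/q_lt => //; [exact: (k_lt (ltW e0) er)|exact: (ratio_max (ltW r0))].
Qed.

Lemma GG0_critical_ge0 r : (rho%:E <= rho_c)%E -> 0 < r -> 0 <= GG0 r.
Proof.
rewrite le_eqVlt => /predU1P[E r0|h r0].
  by have [g g0 /(_ r (lexx r))] := GG0_critical E r0; apply: le_trans; exact: ltW.
have [d d0 /(_ r r0)] := GG0_subcritical h; apply: le_trans.
by rewrite mulr_ge0 // ltW.
Qed.

Lemma VV_min0 r : (rho%:E <= rho_c)%E -> 0 <= r -> VV 0 <= VV r.
Proof.
move=> hr r0; rewrite -subr_ge0.
by have := @VV_comparison_ge 0 r 0 (lexx 0) r0; rewrite mul0r; apply=> s s0 _; exact: GG0_critical_ge0.
Qed.

Section Supercritical.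
Hypothesis hsup : (rho_c < rho%:E)%E.

Lemma q_small : exists m r1 : R, [/\ 0 < m, m < rho, 0 < r1 & forall r, 0 < r -> r <= r1 -> q (k r) <= m].
Proof.
have [m rm mc] : exists2 m : R, m < rho & (rho_c < m%:E)%E.
  move: hsup; case: rho_c => [r| |] //; last by move=> _; exists (rho - 1); rewrite ?ltNyr //; lra.
  by rewrite lte_fin => mr; exists ((rho + r) / 2); rewrite ?lte_fin; lra.
have H : \forall x \near (0 : R)^'+, q x < m.
  have H : \forall x \near (0 : R)^'+, ((q x)%:E < m%:E)%E := hrho_c (open_ereal_lt' mc).
  by apply: filterS H => x; rewrite lte_fin.
have [x [x0 xk xm]] := near0_witness (k_gt0 hrho) H.
have xM : (x%:E < kappa_max)%E by apply: lt_trans (ratio_max (ltW hrho)); rewrite lte_fin.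
have [j0 kj] := j_gt0 x0 xM; exists m, (j x); split => //; first exact: lt_trans (q_gt0 x0 xM) xm.
move=> r r0 rj; apply: ltW; apply: le_lt_trans xm.
have : k r <= x by rewrite -kj; exact: (k_le (ltW r0) rj).
rewrite le_eqVlt => /predU1P[->//|h]; apply: ltW; apply: q_lt => //; exact: k_gt0.
Qed.

Lemma equilibrium : exists kappa : R, [/\ 0 < kappa, (kappa%:E < kappa_max)%E & q kappa = rho].
Proof.
have [m [r1 [m0 mr r10 hm]]] := q_small.
have kr := k_gt0 r10; have q1 : q (k r1) < rho by apply: le_lt_trans mr; exact: hm.
have kM := ratio_max (ltW hrho); have k0 := k_gt0 hrho.
(* j (k rho) = rho, and c < 1. *)
have q2 : rho < q (k rho).
  by rewrite /= jK ?(ltW hrho) // ltr_pdivlMr ?c_gt0 // gtr_pMr.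
have k12 : k r1 < k rho.
  rewrite ltNge; apply/negP; rewrite le_eqVlt => /predU1P[E|h].
    by move: q2; rewrite E => /lt_trans /(_ q1); rewrite ltxx.
  by have := lt_trans (q_lt k0 h (ratio_max (ltW r10))) (lt_trans q1 q2); rewrite ltxx.
have cq : {within `[k r1, k rho], continuous q}.
  apply: continuous_in_subspaceT => x; rewrite inE /= in_itv /= => /andP[ax xb].
  by apply: q_cont; [exact: lt_le_trans ax|apply: le_lt_trans kM; rewrite lee_fin].
have [|x] := IVT (ltW k12) cq (v := rho).
  by rewrite ge_min (ltW q1) le_max (ltW q2) orbT.
rewrite in_itv /= => /andP[ax xb] E; exists x; split => //; first exact: lt_le_trans ax.
by apply: le_lt_trans kM; rewrite lee_fin.
Qed.

Variable ks : R.
Hypotheses (ks0 : 0 < ks) (ksM : (ks%:E < kappa_max)%E) (qks : q ks = rho).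
Notation rs := (j ks).

Lemma rs_gt0 : 0 < rs.
Proof. by have [] := j_gt0 ks0 ksM. Qed.

Lemma krs : k rs = ks.
Proof. by have [] := j_gt0 ks0 ksM. Qed.

Lemma q_inj kappa : 0 < kappa -> (kappa%:E < kappa_max)%E -> q kappa = rho -> kappa = ks.
Proof.
move=> k0 kM E; have [h|h|//] := ltgtP kappa ks.
  by have := q_lt k0 h ksM; rewrite E qks ltxx.
by have := q_lt ks0 h kM; rewrite E qks ltxx.
Qed.

Lemma GG0_neg r : 0 < r -> r < rs -> GG0 r < 0.
Proof.
move=> r0 h; rewrite GG0E //; have c0 := c_gt0 (k_gt0 r0).
rewrite pmulr_rlt0 // subr_lt0 -qks; apply: q_lt => //; first exact: k_gt0.
by rewrite -krs; exact: (k_lt (ltW r0) h).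
Qed.

Lemma GG0_pos r : rs < r -> 0 < GG0 r.
Proof.
move=> h; have r0 := lt_trans rs_gt0 h; rewrite GG0E //; have c0 := c_gt0 (k_gt0 r0).
rewrite pmulr_rgt0 // subr_gt0 -qks; apply: q_lt => //; last exact: (ratio_max (ltW r0)).
by rewrite -[ltLHS]krs; exact: (k_lt (ltW rs_gt0) h).
Qed.

Lemma VV_min r : 0 <= r -> VV rs <= VV r.
Proof.
move=> r0; have [h|h] := leP r rs.
  rewrite -subr_le0; have := @VV_comparison r rs 0 r0 h; rewrite mul0r; apply.
  by move=> s s1 s2; apply: ltW; apply: GG0_neg => //; exact: le_lt_trans s1.
rewrite -subr_ge0; have := @VV_comparison_ge rs r 0 (ltW rs_gt0) (ltW h); rewrite mul0r; apply.
by move=> s s1 s2; apply: ltW; exact: GG0_pos.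
Qed.

(** V is nonincreasing up to r1, and from r1 to the midpoint r2 of r1 and rs it decreases by at
    least - M times the increment of k, where M < 0 bounds GG0 there. *)
Lemma VV_gap (r1 : R) : 0 < r1 -> r1 < rs -> exists2 eta : R, 0 < eta &
  forall r, 0 <= r -> r <= r1 -> VV rs + eta <= VV r.
Proof.
move=> r10 r1s; pose r2 := (r1 + rs) / 2.
have [h1 h2] : r1 < r2 /\ r2 < rs by rewrite /r2; split; lra.
have r20 := lt_trans r10 h1.
have k20 := k_gt0 r20; have q2 : q (k r2) < rho.
  by rewrite -qks; apply: q_lt => //; rewrite -krs; exact: (k_lt (ltW r20) h2).
have qq0 := q_gt0 k20 (ratio_max (ltW r20)).
pose M := r1 * (1 - rho / q (k r2)).
have M0 : M < 0 by rewrite /M pmulr_rlt0 // subr_lt0 ltr_pdivlMr // mul1r.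
have k12 : 0 < k r2 - k r1 by rewrite subr_gt0; exact: (k_lt (ltW r10) h1).
exists (- M * (k r2 - k r1)) => [|r r0 rr1]; first by rewrite mulr_gt0 // oppr_gt0.
have a1 : VV r1 <= VV r.
  rewrite -subr_le0; have := @VV_comparison r r1 0 r0 rr1; rewrite mul0r; apply.
  by move=> s s1 s2; apply/ltW/GG0_neg; [exact: le_lt_trans s1|exact: lt_trans r1s].
have a2 : VV rs <= VV r2 by apply: VV_min; exact: ltW.
have a3 : VV r2 - VV r1 <= M * (k r2 - k r1).
  apply: VV_comparison; [exact: ltW|exact: ltW|move=> s s1 s2].
  have s0 := lt_trans r10 s1; have ks1 := k_lt (ltW s0) s2.
  apply: le_trans (GG0_q_le qq0 s0 _) _; first by apply/ltW/q_lt; [exact: k_gt0|done|exact: (ratio_max (ltW r20))].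
  rewrite /M; apply: ler_wnM2r; last exact: ltW.
  by rewrite subr_le0 ler_pdivlMr // mul1r ltW.
by rewrite mulNr; move: a1 a2 a3; move: (M * _) (VV _) (VV _) (VV _) (VV _) => *; lra.
Qed.

(** Near ks the positive derivative of j / c gives a linear bound. Farther away, monotonicity keeps
    the difference above g, and |kappa - ks| <= kb makes this linear too. Only the derivative at ks
    itself gives the local slope. *)
Lemma q_slope (kb : R) : ks < kb -> (kb%:E < kappa_max)%E -> exists2 m : R, 0 < m &
  forall kappa, 0 < kappa -> kappa <= kb -> m * `|kappa - ks| <= `|q kappa - rho|.
Proof.
move=> skb kbM; have [dq0 dq1] := th_jc ht ks0 ksM.
pose d := derive1 q ks; have dd : is_derive ks 1 q d by apply: DeriveDef => //; rewrite -derive1E.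
have d0 : 0 < d / 2 by rewrite divr_gt0.
move/is_derive_epsP/(_ _ d0) : dd => [e e0 he].
pose e' := Num.min (e / 2) (Num.min (ks / 2) (kb - ks)).
have e'0 : 0 < e' by rewrite !lt_min !divr_gt0 //= subr_gt0.
have [e'1 e'2 e'3] : [/\ e' <= e / 2, e' <= ks / 2 & e' <= kb - ks].
  by rewrite /e' !ge_min !lexx !orbT.
have near x : `|x - ks| <= e' -> d / 2 * `|x - ks| <= `|q x - rho|.
  move=> xe; have := he (x - ks); rewrite (_ : ks + (x - ks) = x); last by ring.
  have lt : `|x - ks| < e by lra.
  move=> /(_ lt); rewrite qks => H.
  have : `|(x - ks) * d| <= `|q x - rho| + `|q x - rho - (x - ks) * d|.
    rewrite -[X in `|X| <= _](subKr (q x - rho)); exact: ler_normB.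
  rewrite normrM (ger0_norm (ltW dq1)) -/d; move: H.
  have -> : d / 2 * `|x - ks| = `|x - ks| * d / 2 by ring.
  by move: (`|x - ks| * d) (`|_ - _|) `|q x - rho| => *; lra.
have q1 : ks - e' < ks by lra.
have q1' : 0 < ks - e' by lra.
have q2 : ks < ks + e' by lra.
have q2M : ((ks + e')%:E < kappa_max)%E by apply: le_lt_trans kbM; rewrite lee_fin; lra.
pose g := Num.min (rho - q (ks - e')) (q (ks + e') - rho).
have g0 : 0 < g by rewrite lt_min !subr_gt0 -qks q_lt //= q_lt.
have kb0 : 0 < kb by lra.
exists (Num.min (d / 2) (g / kb)) => [|x x0 xb]; first by rewrite lt_min d0 divr_gt0.
have xM : (x%:E < kappa_max)%E by apply: le_lt_trans kbM; rewrite lee_fin.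
have [xe|xe] := leP `|x - ks| e'.
  by apply: le_trans (near x xe); apply: ler_wpM2r => //; rewrite ge_min lexx.
apply: (@le_trans _ _ g); last first.
  have [h|h] := leP ks x.
    move: xe; rewrite ger0_norm ?subr_ge0 // => xe.
    have := q_lt (lt_trans ks0 q2) (_ : ks + e' < x) xM; rewrite addrC -ltrBrDr => /(_ xe).
    rewrite [e' + ks]addrC => H; apply: le_trans (ler_norm _).
    by rewrite ge_min; apply/orP; right; rewrite lerD2r ltW.
  move: xe; rewrite ltr0_norm ?subr_lt0 // opprB => xe.
  have h3 : x < ks - e' by lra.
  have := q_lt x0 h3 (lt_trans _ ksM); rewrite lte_fin => /(_ q1) H.
  rewrite distrC; apply: le_trans (ler_norm _).
  by rewrite ge_min; apply/orP; left; rewrite lerD2l lerN2 ltW.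
apply: (@le_trans _ _ (g / kb * kb)); last by rewrite divfK // gt_eqF.
apply: ler_pM => //; first by rewrite le_min !divr_ge0 // ltW.
  by rewrite ge_min lexx orbT.
by rewrite ler_norml; lra.
Qed.

(** V r - V rs is at most |q - rho| |k r - ks| with q taken at k r: along the way V is compared with
    k, and |GG0| <= |q - rho| since c < 1. By [q_slope] both factors are O(|GG0 r|), because c stays
    away from 0 for r >= ra. *)
Lemma GG0_coercive (ra rb : R) : 0 < ra -> exists2 C : R, 0 <= C & forall r, ra <= r -> r <= rb ->
  `|k r - ks| <= C * `|GG0 r| /\ VV r - VV rs <= C * GG0 r ^+ 2.
Proof.
move=> ra0; pose kb := k (Num.max rb rs + 1).
have mb0 : 0 < Num.max rb rs + 1 by rewrite ltr_wpDl // le_max (ltW rs_gt0) orbT.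
have kbM : (kb%:E < kappa_max)%E by exact: (ratio_max (ltW mb0)).
have rb1 : rb <= Num.max rb rs + 1 by rewrite ler_wpDr // le_max lexx.
have rs1 : rs < Num.max rb rs + 1 by rewrite ltr_pwDr // le_max lexx orbT.
have skb : ks < kb by rewrite -[ltLHS]krs; exact: (k_lt (ltW rs_gt0) rs1).
have kb0 := lt_trans ks0 skb.
have [m m0 hm] := q_slope skb kbM.
(* A lower bound for c (k r) = r / q (k r) when ra <= r <= rb. *)
pose c1 := ra / q kb; have qb := q_gt0 kb0 kbM; have c10 : 0 < c1 by rewrite divr_gt0.
have hq r : ra <= r -> r <= rb -> `|q (k r) - rho| <= c1^-1 * `|GG0 r|.
  move=> ar rb'; have r0 := lt_le_trans ra0 ar; have k0 := k_gt0 r0; have c0 := c_gt0 k0.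
  rewrite GG0E // normrM (gtr0_norm c0) mulrA ler_peMl // mulrC ler_pdivlMr // mul1r /c1.
  rewrite ler_pdivrMr //; apply: le_trans ar _.
  have E : r = c (k r) * q (k r) by rewrite /= jK ?(ltW r0) // mulrCA divff ?mulr1 // gt_eqF.
  rewrite {1}E; apply: ler_wpM2l; first exact: ltW.
  have : k r <= kb by apply: (k_le (ltW r0) (le_trans rb' rb1)).
  by rewrite le_eqVlt => /predU1P[->//|h]; apply/ltW/q_lt.
have hk r : ra <= r -> r <= rb -> `|k r - ks| <= (m * c1)^-1 * `|GG0 r|.
  move=> ar rb'; have r0 := lt_le_trans ra0 ar; have k0 := k_gt0 r0.
  rewrite invfM -mulrA; apply: (@le_trans _ _ (m^-1 * `|q (k r) - rho|)).
    by rewrite mulrC ler_pdivlMr // mulrC hm // k_le // ?(ltW r0) // (le_trans rb').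
  by apply: ler_wpM2l; [rewrite invr_ge0 ltW|exact: hq].
exists (Num.max (m * c1)^-1 (c1^-1 * (m * c1)^-1)) => [|r ar rb'].
  by rewrite le_max invr_ge0 mulr_ge0 // ltW.
have r0 := lt_le_trans ra0 ar; split.
  by apply: le_trans (hk r ar rb') _; apply: ler_wpM2r => //; rewrite le_max lexx.
apply: (@le_trans _ _ (c1^-1 * (m * c1)^-1 * GG0 r ^+ 2)); last first.
  by apply: ler_wpM2r; [exact: sqr_ge0|rewrite le_max lexx orbT].
have -> : c1^-1 * (m * c1)^-1 * GG0 r ^+ 2 = (c1^-1 * `|GG0 r|) * ((m * c1)^-1 * `|GG0 r|).
  by rewrite -(real_normK (num_real (GG0 r))); ring.
apply: (@le_trans _ _ (`|q (k r) - rho| * `|k r - ks|)); last first.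
  by apply: ler_pM => //; [exact: hq|exact: hk].
have GGs s : 0 < s -> `|GG0 s| <= `|q (k s) - rho|.
  move=> s0; have c0 := c_gt0 (k_gt0 s0).
  by rewrite GG0E // normrM (gtr0_norm c0) ler_piMl // ltW // c_lt1.
have [h|h] := leP rs r.
  have kk : ks <= k r by rewrite -[leLHS]krs; exact: (k_le (ltW rs_gt0) h).
  rewrite [`|k r - ks|]ger0_norm ?subr_ge0 // -[X in k r - X]krs.
  apply: VV_comparison; [exact: (ltW rs_gt0)|exact: h|move=> s s1 s2].
  have s0 := lt_trans rs_gt0 s1; apply: le_trans (ler_norm _) _; apply: le_trans (GGs s s0) _.
  have ks1 := k_lt (ltW s0) s2.
  have a1 : rho < q (k s).
    by rewrite -qks; apply: q_lt => //; [rewrite -[ltLHS]krs; exact: (k_lt (ltW rs_gt0) s1)|exact: (ratio_max (ltW s0))].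
  have a2 : q (k s) < q (k r) by apply: q_lt => //; [exact: k_gt0|exact: (ratio_max (ltW r0))].
  by rewrite !ger0_norm ?lerD2r ?(ltW a2) // subr_ge0 ltW // (lt_trans a1).
have kk : k r <= ks by rewrite -[leRHS]krs; exact: (k_le (ltW r0) (ltW h)).
rewrite distrC [X in _ <= _ * X]distrC [`|ks - k r|]ger0_norm ?subr_ge0 // -[X in X - k r]krs.
have := @VV_comparison_ge r rs (- `|rho - q (k r)|) (ltW r0) (ltW h).
rewrite mulNr => H; rewrite -[leLHS]opprB lerNl; apply: H => s s1 s2.
have s0 := lt_trans r0 s1; apply: le_trans (lerNnormlW (lexx `|GG0 s|)).
rewrite lerN2; apply: le_trans (GGs s s0) _.
have kr1 := k_lt (ltW r0) s1.
have a1 : q (k s) < rho.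
  by rewrite -qks; apply: q_lt => //; [exact: k_gt0|rewrite -krs; exact: (k_lt (ltW s0) s2)].
have a2 : q (k r) < q (k s) by apply: q_lt => //; [exact: k_gt0|exact: (ratio_max (ltW s0))].
by rewrite distrC !ger0_norm ?lerD2l ?lerN2 ?(ltW a2) // subr_ge0 ltW // (lt_trans a2).
Qed.

End Supercritical.

End Thermodynamics.

Section Thermo_sphere.
Variables (R : realType) (n : nat) (sigma : probability (borel_rV R n) R).
Hypotheses (hn : (2 <= n)%N) (hsigma : uniform_sphere sigma).
Variables (nu tau : R -> R) (kappa_max : \bar R) (j : R -> R).
Hypothesis hcoef : admissible_coefficients nu tau.
Hypothesis hj : is_inverse_ratio nu tau kappa_max j.
Hypothesis hjc : forall kappa : R, 0 < kappa -> (kappa%:E < kappa_max)%E ->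
  derivable (fun u : R => j u / order_param n u) kappa 1 /\
  0 < derive1 (fun u : R => j u / order_param n u) kappa.

Definition unit_vec : 'rV[R]_n := e_ R (Ordinal (leq_trans (isT : 0 < 2)%N hn)).

Lemma unit_vec1 : edot unit_vec unit_vec = 1.
Proof. by rewrite /unit_vec edot_delta !mxE !eqxx. Qed.

Lemma thermo_sphere : thermo (Defs.ratio nu tau) (@order_param R n)
  (fun x => ln (ZZ sigma x unit_vec)) (Phi nu tau) j kappa_max.
Proof.
have u1 := unit_vec1; case: (hj) => hj1 hj2; split => //.
- exact: ratio0 hcoef.
- exact: ratio_lt hcoef.
- exact: ratio_derive hcoef.
- exact: continuous_ratio hcoef.
- exact: is_derive_Phi hcoef.
- by move=> x; exact: (order_param_gt0 hn hsigma u1).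
- by move=> x; exact: (order_param_lt1 hn hsigma x u1).
- exact: (continuous_order_param hn hsigma u1).
- move=> x; have Z0 := ZZ_gt0 hsigma x unit_vec.
  have h := @is_derive1_comp _ _ (fun t => ZZ sigma t unit_vec) _ _ _ (is_derive1_ln Z0) (is_derive_ZZ hn hsigma x u1).
  by apply: (is_derive_eq h); rewrite mulKf ?gt_eqF.
- by move=> r /hj2[].
- by move=> r /hj2[].
Qed.

End Thermo_sphere.

(** * Entropy dissipation *)

Section Relative_entropy.
Variable R : realType.
Implicit Types (x g B : R).

(** The affine terms make the integrand of the relative entropy nonnegative pointwise, also for
    densities of different masses such as f + delta and the Gibbs state. *)
Definition rel_ent x g : R := x * ln x - x * ln g - x + g.

Lemma ln_le_sub1 x : 0 < x -> ln x <= x - 1.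
Proof. by move=> x0; have := @le_ln1Dx R (x - 1); rewrite (_ : 1 + (x - 1) = x); [apply; lra|ring]. Qed.

Lemma rel_ent_le x g : 0 < x -> 0 < g -> rel_ent x g <= (x - g) ^+ 2 / g.
Proof.
move=> x0 g0; have h := ln_le_sub1 (divr_gt0 x0 g0); rewrite ln_div ?posrE // in h.
have : x * (ln x - ln g) <= x * (x / g - 1) by rewrite ler_wpM2l // ltW.
have -> : (x - g) ^+ 2 / g = x * (x / g - 1) - x + g by field; exact: lt0r_neq0.
by rewrite /rel_ent mulrBr; lra.
Qed.

(* [rel_ent x g >= (sqrt x - sqrt g)^2]. *)
Lemma rel_ent_ge x g B : 0 < x -> 0 < g -> x <= B -> g <= B -> (x - g) ^+ 2 / (4 * B) <= rel_ent x g.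
Proof.
have root (y : R) : 0 < y -> exists2 s : R, 0 < s & y = s ^+ 2.
  by move=> y0; exists (Num.sqrt y); rewrite ?sqrtr_gt0 // sqr_sqrtr // ltW.
move=> x0 g0 xB gB; have [s s0 xE] := root x x0; have [q q0 gE] := root g g0.
have lx : ln x = 2 * ln s by rewrite xE lnXn // mulr_natl.
have lg : ln g = 2 * ln q by rewrite gE lnXn // mulr_natl.
have h := ln_le_sub1 (divr_gt0 q0 s0); rewrite ln_div ?posrE // in h.
have h1 : (s - q) ^+ 2 <= rel_ent x g.
  have h2 : 2 * s ^+ 2 * (ln q - ln s) <= 2 * s ^+ 2 * (q / s - 1).
    by apply: ler_wpM2l => //; rewrite mulr_ge0 // sqr_ge0.
  rewrite /rel_ent lx lg xE gE.
  have h3 : 2 * s ^+ 2 * (q / s - 1) = 2 * s * q - 2 * s ^+ 2 by field; exact: lt0r_neq0.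
  rewrite h3 in h2; rewrite -subr_ge0.
  have -> : s ^+ 2 * (2 * ln s) - s ^+ 2 * (2 * ln q) - s ^+ 2 + q ^+ 2 - (s - q) ^+ 2 =
    2 * s * q - 2 * s ^+ 2 - 2 * s ^+ 2 * (ln q - ln s) by ring.
  by rewrite subr_ge0.
apply: le_trans h1; have B0 : 0 < B by exact: lt_le_trans xB.
rewrite ler_pdivrMr ?mulr_gt0 //.
have -> : (x - g) ^+ 2 = (s - q) ^+ 2 * (s + q) ^+ 2 by rewrite xE gE; ring.
apply: ler_wpM2l; first exact: sqr_ge0.
have h4 : (s + q) ^+ 2 <= 2 * (x + g).
  by rewrite xE gE -subr_ge0 (_ : _ - _ = (s - q) ^+ 2) ?sqr_ge0 //; ring.
lra.
Qed.

Lemma slack1 (a b c d : R) : a <= b + c -> c <= d -> - b <= - a + d.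
Proof. lra. Qed.

Lemma slack2 (x y z s1 s2 e : R) : x <= y + s1 -> - z <= s2 -> s1 + s2 <= e -> x - z <= y + e.
Proof. lra. Qed.

Lemma slack3 (h x a b c g e : R) : x - a <= h -> a <= b -> b + c <= e -> - c <= g -> x - e <= h + g.
Proof. lra. Qed.

Lemma slack4 (h x a b c g e : R) : h <= x + a -> a <= b -> b + c <= e -> g <= c -> h + g <= x + e.
Proof. lra. Qed.

Lemma sqrD_le (a b : R) : (a + b) ^+ 2 <= 2 * a ^+ 2 + 2 * b ^+ 2.
Proof. by rewrite -subr_ge0 (_ : _ - _ = (a - b) ^+ 2) ?sqr_ge0 //; ring. Qed.

Lemma sqrD_ge (a b : R) : a ^+ 2 / 2 - b ^+ 2 <= (a + b) ^+ 2.
Proof.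
rewrite -subr_ge0 (_ : _ - _ = (a / 2 + b) ^+ 2 * 2 + 0 * b); last by field.
by rewrite mul0r addr0 mulr_ge0 // sqr_ge0.
Qed.

End Relative_entropy.

(** * Decay from an energy known up to arbitrarily small errors *)

Section Free_energy_decay.
Variables (R : realType) (D U : R -> R) (c c1 C Us T0 : R).
Hypotheses (c0 : 0 < c) (c10 : 0 < c1) (C0 : 0 <= C).
(** E stands for a regularized free energy, different for each e. D and U do not depend on e, so
    that e can go to 0 in conclusions about them. *)
Hypothesis hE : forall e : R, 0 < e -> exists E dE : R -> R, forall t : R, T0 <= t ->
  [/\ is_derive t 1 E (dE t), dE t <= - c * D t + e, c1 * D t - e <= E t - U t & E t - U t <= C * D t + e].
Hypothesis D0 : forall t : R, T0 <= t -> 0 <= D t.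
Hypothesis U0 : forall t : R, T0 <= t -> Us <= U t.

Lemma derive_ge_growth (y dy : R -> R) (m a b : R) : a <= b ->
  (forall t : R, a <= t -> t <= b -> is_derive t 1 y (dy t)) ->
  (forall t : R, a <= t -> t <= b -> m <= dy t) -> m * (b - a) <= y b - y a.
Proof.
move=> ab hy hm; have [x||d] := @MVT_segment R y dy a b ab.
- by rewrite in_itv /= => /andP[xa xb]; apply: hy; exact: ltW.
- apply: derivable_within_continuous => x; rewrite in_itv /= => /andP[xa xb].
  by case: (hy x xa xb).
rewrite in_itv /= => /andP[da db] ->; apply: ler_wpM2r; first by rewrite subr_ge0.
exact: hm.
Qed.

Lemma free_energy_le (s t : R) : T0 <= s -> s <= t -> c1 * D t + U t <= C * D s + U s.
Proof.
move=> Ts st; apply/ler_addgt0Pr => e e0.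
(* The error counts twice, from the comparison of E with U at both ends, and t - s times through the
   derivative of E. *)
have N0 : 0 < 2 + (t - s) by lra.
have [E [dE h]] := hE (divr_gt0 e0 N0).
have H : - (e / (2 + (t - s))) * (t - s) <= - E t - - E s.
  apply: (@derive_ge_growth (fun x => - E x) (fun x => - dE x)) => // x sx xt.
    by have [h1 _ _ _] := h x (le_trans Ts sx); exact: is_deriveN.
  have [_ h2 _ _] := h x (le_trans Ts sx); rewrite lerN2; apply: le_trans h2 _.
  by rewrite mulNr gerDr oppr_le0 mulr_ge0 ?(ltW c0) // D0 // (le_trans Ts).
have [_ _ a1 _] := h t (le_trans Ts st); have [_ _ _ a2] := h s Ts.
have : e / (2 + (t - s)) * 2 + e / (2 + (t - s)) * (t - s) = e by rewrite -mulrDr divfK // gt_eqF.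
move: H a1 a2; rewrite mulNr; move: (e / _) => e'; move: (e' * (t - s)) (c1 * _) (C * _) => x y z; lra.
Qed.

(** U - Us <= C2 D bounds the whole excess of energy by a multiple of D, up to errors; its
    dissipation then gives Gronwall's inequality with rate c / C3. *)
Lemma free_energy_exp (T C2 : R) : T0 <= T -> 0 <= C2 -> (forall t : R, T <= t -> U t - Us <= C2 * D t) ->
  exists K l : R, [/\ 0 <= K, 0 < l & forall t : R, T <= t -> D t <= K * expR (- l * t)].
Proof.
move=> TT C20 hU; pose C3 := C + C2 + 1; have C30 : 0 < C3 by rewrite ltr_wpDl // addr_ge0.
pose l := c / C3; have l0 : 0 < l by rewrite divr_gt0.
exists (c1^-1 * (C3 * D T * expR (l * T))), l; split => //.
  by rewrite !mulr_ge0 ?invr_ge0 ?expR_ge0 ?(ltW c10) ?(ltW C30) ?D0.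
move=> t Tt.
have -> : c1^-1 * (C3 * D T * expR (l * T)) * expR (- l * t) = c1^-1 * (C3 * (D T * expR (- l * (t - T)))).
  rewrite (_ : - l * (t - T) = l * T + - l * t); last by ring.
  by rewrite expRD; ring.
rewrite ler_pdivlMl //.
apply/ler_addgt0Pr => e e0; pose N := 3 + l^-1.
have N0 : 0 < N by rewrite addr_gt0 // invr_gt0.
have d0 := divr_gt0 e0 N0; have [E [dE h]] := hE d0.
(* m is the level towards which E decays: Us shifted by the errors of the comparison, d, and of the
   dissipation, d / l. In total e is spent as 3 d + d / l. *)
set d := e / N in d0 h; pose m := d + d / l + Us.
have G : E t - m <= (E T - m) * expR (- l * (t - T)).
  apply: (@gronwall R (fun x => E x - m) dE) => // x Tx xt; have [h1 h2 h3 h4] := h x (le_trans TT Tx).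
    by have h5 := is_deriveB h1 (is_derive_cst m x (1 : R)); apply: (is_derive_eq h5); rewrite subr0.
  apply: le_trans h2 _; have hx := hU x Tx; have Dx := D0 (le_trans TT Tx).
  have q1 : E x - Us - d <= C3 * D x.
    have -> : C3 * D x = C * D x + C2 * D x + D x by rewrite /C3; ring.
    lra.
  have q2 : l * (E x - Us - d) <= c * D x.
    apply: le_trans (ler_wpM2l (ltW l0) q1) _; rewrite /l mulrA divfK ?gt_eqF //.
  have q3 : - l * (E x - m) = - (l * (E x - Us - d)) + d by rewrite /m; field; exact: lt0r_neq0.
  by rewrite q3 mulNr; apply: lerD => //; rewrite lerN2.
have [_ _ a1 _] := h t (le_trans TT Tt); have [_ _ _ a2] := h T TT.
have Ut := U0 (le_trans TT Tt); have hT := hU T (lexx T); have DT := D0 TT.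
have x0 := expR_ge0 (- l * (t - T)).
have x1 : expR (- l * (t - T)) <= 1 by rewrite expR_le1 mulNr oppr_le0 mulr_ge0 ?(ltW l0) // subr_ge0.
have q1 : E T - m <= C3 * D T + d.
  have dl : 0 <= d / l by rewrite divr_ge0 // ltW.
  have -> : C3 * D T = C * D T + C2 * D T + D T by rewrite /C3; ring.
  rewrite /m; lra.
have q2 : (E T - m) * expR (- l * (t - T)) <= C3 * (D T * expR (- l * (t - T))) + d.
  by apply: le_trans (ler_wpM2r x0 q1) _; rewrite mulrDl -mulrA lerD2l ler_piMr // ltW.
have q3 : d * 3 + d / l = e by rewrite -mulrDr /d divfK // gt_eqF.
by have := le_trans G q2; rewrite /m => G'; lra.
Qed.

(* A quantity growing at rate [a0 - C3 D] grows linearly once the dissipated free energy is added. *)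
Lemma no_growth (L dL : R -> R) (a0 C3 Lm : R) : 0 < a0 -> 0 <= C3 ->
  (forall t : R, T0 <= t -> is_derive t 1 L (dL t)) -> (forall t : R, T0 <= t -> a0 - C3 * D t <= dL t) ->
  (forall t : R, T0 <= t -> L t <= Lm) -> False.
Proof.
move=> a00 C30 hL hdL hLm; pose K := C3 / c; have K0 : 0 <= K by rewrite divr_ge0 // ltW.
pose e := a0 / 2 / (K + 1); have K1 : 0 < K + 1 by rewrite ltr_wpDl.
have e0 : 0 < e by rewrite !divr_gt0.
have Ke : K * e <= a0 / 2.
  apply: (@le_trans _ _ ((K + 1) * e)); first by rewrite ler_wpM2r ?(ltW e0) // lerDl.
  by rewrite /e mulrC divfK // gt_eqF.
have [E [dE h]] := hE e0; pose W (t : R) := L t - K * E t.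
have grow (t : R) : T0 <= t -> a0 / 2 * (t - T0) <= W t - W T0.
  move=> Tt; apply: (@derive_ge_growth W (fun x => dL x - K * dE x)) => // x Tx xt.
    have [h1 _ _ _] := h x Tx; have h2 := is_deriveB (hL x Tx) (is_deriveZ K h1).
    exact: (is_derive_eq h2).
  have [_ h2 _ _] := h x Tx; have h3 := ler_wpM2l K0 h2; have h4 := hdL x Tx.
  have h5 : K * (- c * D x + e) = - (C3 * D x) + K * e by rewrite /K; field; exact: lt0r_neq0.
  by rewrite h5 in h3; move: h3 h4 Ke; move: (K * _) (K * e) (C3 * _) => p q s; lra.
have top (t : R) : T0 <= t -> W t <= Lm - K * (Us - e).
  move=> Tt; have [_ _ h3 _] := h t Tt; have u0 := U0 Tt; have l0 := hLm t Tt.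
  have d0 : 0 <= c1 * D t by rewrite mulr_ge0 ?(ltW c10) // D0.
  rewrite /W; apply: lerB => //; apply: ler_wpM2l => //; lra.
pose B := Lm - K * (Us - e) - W T0; pose t := T0 + (`|B| + 1) / (a0 / 2).
have a20 : 0 < a0 / 2 by rewrite divr_gt0.
have tT : T0 <= t by rewrite lerDl divr_ge0 ?addr_ge0 // ltW.
have := grow t tT; have := top t tT; have := ler_norm B.
have -> : t - T0 = (`|B| + 1) / (a0 / 2) by rewrite /t addrC addKr.
have -> : a0 / 2 * ((`|B| + 1) / (a0 / 2)) = `|B| + 1 by field; exact: lt0r_neq0.
have : B = Lm - K * (Us - e) - W T0 by [].
by move=> *; lra.
Qed.

End Free_energy_decay.

Lemma double_bound (R : realType) (x B r : R) : 0 <= r -> x <= B * r -> 2 * x * r <= 2 * B * r ^+ 2.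
Proof.
move=> r0 h; rewrite expr2 [leRHS]mulrA; apply: ler_wpM2r => //.
by rewrite -[leRHS]mulrA ler_wpM2l.
Qed.

(** * Gibbs states: entropy, dissipation and stationarity *)

Section Gibbs.
Variables (R : realType) (n : nat) (sigma : probability (borel_rV R n) R).
Hypotheses (hn : (2 <= n)%N) (hsigma : uniform_sphere sigma).
Notation V := 'rV[R]_n.
Notation pt := (pt R n).
Notation J := (Int sigma).
Notation nrm2 := (nrm2 sigma).
Let m1 := sigma_mass hsigma.
Implicit Types (u : pt -> R) (p : pt) (w : V).

Definition ZW w : R := J (fun p => expR (lin w p)).
Definition gibbs w p : R := expR (lin w p) / ZW w.

Lemma sm_exp_lin w : sm (fun p => expR (lin w p)).
Proof. by apply: sm_expR; smt. Qed.

Lemma ZW_gt0 w : 0 < ZW w.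
Proof.
have := ZZ_gt0 hsigma 1 w; rewrite /ZZ; congr (0 < J _).
by apply/funext => p; rewrite mul1r.
Qed.

Lemma exp_lin_bounds (K : R) w p : enorm w <= K -> expR (- K) <= expR (lin w p) /\ expR (lin w p) <= expR K.
Proof.
by move=> wK; have := le_trans (lin_le w p) wK; rewrite ler_norml !ler_expR => /andP[].
Qed.

Lemma ZW_bounds (K : R) w : enorm w <= K -> expR (- K) <= ZW w /\ ZW w <= expR K.
Proof.
move=> wK; have s := sm_exp_lin w; split.
  rewrite -[leLHS]mulr1 -(Int_cst m1); int_le m1 => p.
  by have [] := exp_lin_bounds p wK.
rewrite -[leRHS]mulr1 -(Int_cst m1); int_le m1 => p.
by have [] := exp_lin_bounds p wK.
Qed.

Lemma sm_gibbsw w : sm (gibbs w).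
Proof. by have := smZ (ZW w)^-1 (sm_exp_lin w); congr sm; apply/funext => p; rewrite /gibbs mulrC. Qed.

Lemma gibbs_gt0 w p : 0 < gibbs w p.
Proof. by rewrite divr_gt0 ?expR_gt0 ?ZW_gt0. Qed.

Lemma gibbs_bounds (K : R) w p : enorm w <= K -> expR (- (2 * K)) <= gibbs w p /\ gibbs w p <= expR (2 * K).
Proof.
move=> wK; have [a1 a2] := exp_lin_bounds p wK; have [b1 b2] := ZW_bounds wK; have Z0 := ZW_gt0 w.
split.
  rewrite ler_pdivlMr // mulr_natl mulr2n opprD expRD.
  apply: le_trans a1; rewrite -mulrA ler_piMr ?expR_ge0 //.
  by apply: le_trans (ler_wpM2l (expR_ge0 _) b2) _; rewrite -expRD addNr expR0.
rewrite ler_pdivrMr // mulr_natl mulr2n expRD; apply: le_trans a2 _.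
rewrite -mulrA ler_peMr ?expR_ge0 //.
by apply: le_trans (ler_wpM2l (expR_ge0 _) b1); rewrite -expRD addrN expR0.
Qed.

Lemma gibbs_mass w : J (gibbs w) = 1.
Proof.
have s := sm_exp_lin w; rewrite /gibbs (IntZr m1); last by cnt.
by rewrite -/(ZW w) divff // gt_eqF // ZW_gt0.
Qed.

Section Fixed_time.
Variables (u : pt -> R) (w : V) (rho M K d : R).
Hypotheses (su : sm u) (u0 : forall p, 0 <= u p) (uM : forall p, u p <= M) (umass : J u = rho).
Hypotheses (rho0 : 0 < rho) (wK : enorm w <= K) (d0 : 0 < d) (d1 : d <= 1).
Let g p := u p + d.
Let qq p := ln (g p) - lin w p.
Let D := nrm2 (fun p => u p - rho * gibbs w p).

Let g0 p : 0 < g p.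
Proof. by have d0' := d0; have := u0 p; rewrite /g; lra. Qed.

Let sg : sm g.
Proof. by rewrite /g; smt. Qed.

Let sq : sm qq.
Proof. by have sl := sm_ln g0 sg; rewrite /qq; smt. Qed.

(** With the weight e^(- lin w), the state rho gibbs is the orthogonal projection of u on the
    multiples of e^(lin w): the cross term is the difference of the masses, which is 0. *)
Lemma weighted_dist (a : R) :
  J (fun p => expR (- lin w p) * (u p - rho * gibbs w p) ^+ 2) <=
  J (fun p => expR (- lin w p) * (u p - a * expR (lin w p)) ^+ 2).
Proof.
have sG := sm_gibbsw w.
pose b := rho / ZW w - a; have Z0 := ZW_gt0 w.
have E p : expR (- lin w p) * (u p - a * expR (lin w p)) ^+ 2 =
   expR (- lin w p) * (u p - rho * gibbs w p) ^+ 2 + (2 * b * (u p - rho * gibbs w p) + b ^+ 2 * expR (lin w p)).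
  rewrite expRN /b /gibbs; have e0 := expR_gt0 (lin w p).
  by move: e0 Z0; move: (expR _) (ZW w) => e z e0 z0; field; rewrite !gt_eqF.
rewrite [leRHS](Int_eq _ E); intD m1.
rewrite lerDl; intD m1.
intZ m1.
intB m1.
intZ m1.
rewrite gibbs_mass umass mulr1 subrr mulr0 add0r.
by apply: Int_ge0 => p; rewrite mulr_ge0 ?sqr_ge0 ?expR_ge0.
Qed.

Lemma Gam_log p : g p * Gam qq qq p = (g p)^-1 * expR (lin w p) ^+ 2 *
  Gam (fun p => g p * expR (- lin w p)) (fun p => g p * expR (- lin w p)) p.
Proof.
have HE : (fun p => g p * expR (- lin w p)) = fun p => expR (qq p).
  by apply/funext => x; rewrite /qq expRD lnK // posrE; exact: g0.
have H1 k x : Gam (fun p => expR (qq p)) k x = expR (qq x) * Gam qq k x.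
  exact: (@Gam_comp R n expR expR qq k (fun q => is_derive_expR _) sq x).
rewrite HE H1 GamC H1 /qq expRD lnK ?posrE // expRN.
have e0 := expR_gt0 (lin w p); have := g0 p; move: e0.
by move: (expR _) (g p) (Gam _ _ _) => e x y e0 x0; field; rewrite !gt_eqF.
Qed.

(** Poincare's inequality for H = g e^(- lin w), whose gradient is compared with the dissipation by
    [Gam_log]. All weights are within powers of e^K of 1 because |w| <= K. *)
Lemma D_le_dissipation : D <= 4 * expR (4 * K) * (M + 1) * J (fun p => g p * Gam qq qq p) + 2 * expR (2 * K) * d ^+ 2.
Proof.
pose H p := g p * expR (- lin w p); pose a := J H.
have sG := sm_gibbsw w.
have sH : sm H by rewrite /H; smt.
have eK : 0 <= expR K by exact: expR_ge0.
have bN p : expR (- K) <= expR (- lin w p) /\ expR (- lin w p) <= expR K.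
  have := le_trans (lin_le w p) wK; rewrite ler_norml => /andP[b1 b2].
  by rewrite !ler_expR; split; lra.
have h1 : D <= expR K * J (fun p => expR (- lin w p) * (u p - rho * gibbs w p) ^+ 2).
  intZ' m1.
  int_le m1 => p.
  rewrite mulrA ler_peMl ?sqr_ge0 //; have [b1 _] := bN p.
  by apply: le_trans (ler_wpM2l eK b1); rewrite -expRD addrN expR0.
have h2 : J (fun p => expR (- lin w p) * (u p - a * expR (lin w p)) ^+ 2) <=
    expR K * (2 * J (fun p => (H p - a) ^+ 2) + 2 * d ^+ 2).
  have -> : expR K * (2 * J (fun p => (H p - a) ^+ 2) + 2 * d ^+ 2) =
      J (fun p => expR K * (2 * (H p - a) ^+ 2 + 2 * d ^+ 2)).
    intZ m1.
    intD m1.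
    by rewrite (IntZ m1); [rewrite (Int_cst m1) mulr1|cnt].
  int_le m1 => p.
  have e0 := expR_gt0 (lin w p); have [_ b1] := bN p; have [_ b2] := exp_lin_bounds p wK.
  have E : u p - a * expR (lin w p) = expR (lin w p) * (H p - a) - d.
    by rewrite /H /g expRN; move: e0; move: (expR _) => e e0; field; exact: lt0r_neq0.
  rewrite E; apply: le_trans (ler_wpM2l (expR_ge0 _) (sqrD_le _ _)) _.
  rewrite sqrrN exprMn mulrDr [leRHS]mulrDr; apply: lerD.
    have -> : expR (- lin w p) * (2 * (expR (lin w p) ^+ 2 * (H p - a) ^+ 2)) = expR (lin w p) * (2 * (H p - a) ^+ 2).
      by rewrite expRN; move: e0; move: (expR _) => e e0; field; exact: lt0r_neq0.
    by apply: ler_wpM2r => //; rewrite mulr_ge0 // sqr_ge0.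
  by apply: ler_wpM2r => //; rewrite mulr_ge0 // sqr_ge0.
have h3 : J (fun p => (H p - a) ^+ 2) <= 2 * J (Gam H H).
  apply: le_trans (Poincare hn hsigma sH); rewrite le_eqVlt; apply/orP; left; apply/eqP.
  rewrite (_ : J _ = J (fun p => (H p ^+ 2 + (- 2 * a) * H p) + a ^+ 2)); last by apply: Int_eq => p; ring.
  intD m1.
  intD m1.
  intZ m1.
  by rewrite (Int_cst m1) -/a /nrm2; ring.
have h4 : J (Gam H H) <= (M + 1) * expR (2 * K) * J (fun p => g p * Gam qq qq p).
  intZ' m1.
  apply: (Int_le m1); [by cnt|by cnt|move=> p]; rewrite Gam_log -/H.
  have [b1 _] := exp_lin_bounds p wK; have G0 := Gam_ge0 H p.
  rewrite mulrA; apply: ler_peMl => //.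
  have -> : (M + 1) * expR (2 * K) * ((g p)^-1 * expR (lin w p) ^+ 2) =
    ((M + 1) / g p) * (expR K * expR (lin w p)) ^+ 2.
    by rewrite mulr_natl mulr2n expRD; ring.
  have c1 : 1 <= (M + 1) / g p by rewrite ler_pdivlMr; [rewrite mul1r /g; exact: lerD|exact: g0].
  have c2 : 1 <= expR K * expR (lin w p).
    by apply: le_trans (ler_wpM2l eK b1); rewrite -expRD addrN expR0.
  by rewrite -[leLHS]mulr1; apply: ler_pM => //; rewrite exprn_ege1.
have := le_trans h1 (ler_wpM2l eK (le_trans (weighted_dist a) h2)).
move=> h5; apply: le_trans h5 _; rewrite mulrA; have EK : 0 <= expR K * expR K by rewrite mulr_ge0.
apply: (@le_trans _ _ (expR K * expR K * (2 * (2 * ((M + 1) * expR (2 * K) * J (fun p => g p * Gam qq qq p))) + 2 * d ^+ 2))).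
  apply: ler_wpM2l => //; rewrite lerD2r ler_wpM2l //; apply: le_trans h3 _.
  by rewrite ler_wpM2l.
have e4 : expR (4 * K) = expR K * expR K * (expR K * expR K) by rewrite -!expRD; congr expR; ring.
have e2 : expR (2 * K) = expR K * expR K by rewrite -expRD; congr expR; ring.
by rewrite le_eqVlt e4 e2; apply/orP; left; apply/eqP; ring.
Qed.

Lemma rel_ent_upper : J (fun p => rel_ent (g p) (rho * gibbs w p)) <=
  expR (2 * K) / rho * (2 * D + 2 * d ^+ 2).
Proof.
have sG := sm_gibbsw w; have gg p : 0 < rho * gibbs w p by rewrite mulr_gt0 ?gibbs_gt0.
have s1 := sm_ln g0 sg; have s2 : sm (fun p => ln (rho * gibbs w p)) by apply: sm_ln; smt.
have sr : sm (fun p => rel_ent (g p) (rho * gibbs w p)) by rewrite /rel_ent; smt.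
have -> : expR (2 * K) / rho * (2 * D + 2 * d ^+ 2) =
    J (fun p => expR (2 * K) / rho * (2 * (u p - rho * gibbs w p) ^+ 2 + 2 * d ^+ 2)).
  intZ m1.
  intD m1.
  by rewrite (IntZ m1); [rewrite (Int_cst m1) mulr1|cnt].
int_le m1 => p.
apply: le_trans (rel_ent_le (g0 p) (gg p)) _; rewrite mulrC.
have [b1 _] := gibbs_bounds p wK.
apply: ler_pM; [by rewrite invr_ge0 ltW|exact: sqr_ge0| |].
  rewrite invfM mulrC; apply: ler_wpM2r; first by rewrite invr_ge0 ltW.
  by rewrite -[expR _]invrK lef_pV2 ?posrE ?invr_gt0 ?expR_gt0 ?gibbs_gt0 // -expRN.
have -> : g p - rho * gibbs w p = (u p - rho * gibbs w p) + d by rewrite /g; ring.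
exact: sqrD_le.
Qed.

Lemma rel_ent_lower : (4 * (M + 1 + rho * expR (2 * K)))^-1 * (D / 2 - d ^+ 2) <=
  J (fun p => rel_ent (g p) (rho * gibbs w p)).
Proof.
have sG := sm_gibbsw w; have gg p : 0 < rho * gibbs w p by rewrite mulr_gt0 ?gibbs_gt0.
have s1 := sm_ln g0 sg; have s2 : sm (fun p => ln (rho * gibbs w p)) by apply: sm_ln; smt.
have sr : sm (fun p => rel_ent (g p) (rho * gibbs w p)) by rewrite /rel_ent; smt.
set B := M + 1 + _.
have -> : (4 * B)^-1 * (D / 2 - d ^+ 2) =
    J (fun p => (4 * B)^-1 * (2^-1 * (u p - rho * gibbs w p) ^+ 2 - d ^+ 2)).
  intZ m1.
  intB m1.
  rewrite (Int_cst m1) mulr1; intZ m1.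
  by rewrite /D /nrm2 mulrC [_ * 2^-1]mulrC mulrC.
int_le m1 => p.
have [_ b2] := gibbs_bounds p wK.
have gB : g p <= B.
  by rewrite /B /g -addrA; apply: lerD => //; apply: ler_wpDr => //; rewrite mulr_ge0 ?expR_ge0 // ltW.
have mB : rho * gibbs w p <= B.
  rewrite /B; apply: ler_wpDl; last by apply: ler_wpM2l => //; exact: ltW.
  by have := u0 p; have := uM p; lra.
apply: le_trans (rel_ent_ge (g0 p) (gg p) gB mB).
rewrite mulrC; apply: ler_wpM2r.
  by rewrite invr_ge0 mulr_ge0 // (le_trans (ltW (g0 p))).
have -> : g p - rho * gibbs w p = (u p - rho * gibbs w p) + d by rewrite /g; ring.
by apply: le_trans (sqrD_ge _ _); rewrite mulrC.
Qed.

(* The dissipation, by parts, of the relative free energy along the Fokker-Planck operator. *)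
Lemma dissipation (tu : R) :
  J (fun p => (ln (g p) + 1 - lin w p) * (tu * (Lap u p - Gam (lin w) u p + (n%:R - 1) * (lin w p * u p)))) =
  - tu * J (fun p => g p * Gam qq qq p) - tu * (d * ((n%:R - 1) * J (fun p => qq p * lin w p))).
Proof.
have sl := sm_lin w; have s1 := sm_ln g0 sg; pose q1 p := qq p + 1.
have sq1 : sm q1 by rewrite /q1; smt.
have squ : sm (fun p => q1 p * u p) by smt.
have E p : (ln (g p) + 1 - lin w p) * (tu * (Lap u p - Gam (lin w) u p + (n%:R - 1) * (lin w p * u p))) =
    tu * (q1 p * Lap u p - q1 p * Gam (lin w) u p - (q1 p * u p) * Lap (lin w) p).
  by rewrite Lap_lin /q1 /qq; ring.
rewrite (Int_eq _ E); intZ m1.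
intB m1.
intB m1.
rewrite (Int_Gam hsigma sq1 su) (Int_Gam hsigma squ sl).
have Gq1 k p : Gam q1 k p = Gam qq k p.
  by rewrite /q1 GamDl //; [rewrite Gam_cstl addr0|exact: sm_cst].
have E2 p : Gam (fun p => q1 p * u p) (lin w) p = q1 p * Gam (lin w) u p + u p * Gam qq (lin w) p.
  rewrite GamMl // Gq1 (GamC u); ring.
rewrite (Int_eq _ E2); intD m1.
have E3 : J (Gam q1 u) = J (fun p => g p * Gam qq qq p) + J (fun p => g p * Gam qq (lin w) p).
  intD' m1; apply: Int_eq => p; rewrite Gq1 -mulrDr.
  have Gu : Gam qq u p = Gam qq g p.
    by rewrite GamC (GamC qq) /g GamDl //; [rewrite Gam_cstl addr0|exact: sm_cst].
  have Gl : Gam (fun p => ln (g p)) qq p = (g p)^-1 * Gam g qq p.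
    exact: (@Gam_comp R n (@ln R) (fun x => x^-1) g qq (fun x => is_derive1_ln (g0 x)) sg p).
  have -> : Gam qq qq p + Gam qq (lin w) p = Gam (fun p => ln (g p)) qq p.
    have e1 : Gam qq qq p = Gam (fun p => ln (g p)) qq p - Gam (lin w) qq p by rewrite {1}/qq GamBl.
    by rewrite e1 (GamC qq (lin w)) subrK.
  rewrite Gl mulrA divff ?mul1r ?Gu ?(GamC g) //; apply: lt0r_neq0; exact: g0.
(* The constant d in g is not transported by the drift, which leaves the error term. *)
have E4 : J (fun p => g p * Gam qq (lin w) p) = J (fun p => u p * Gam qq (lin w) p) + d * J (Gam qq (lin w)).
  intZ' m1.
  by rewrite -(IntD m1); [apply: Int_eq => p; rewrite /g mulrDl|cnt|cnt].
have E5 : J (Gam qq (lin w)) = (n%:R - 1) * J (fun p => qq p * lin w p).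
  rewrite -[LHS]opprK -(Int_Gam hsigma sq sl) -(IntN m1); last by cnt.
  intZ' m1.
  by apply: Int_eq => p; rewrite Lap_lin; ring.
by rewrite E3 E4 E5; ring.
Qed.

(** The logarithm of rho gibbs is ln rho + lin w - ln Z, so besides the relative entropy only
    integrals of u and of u lin w occur, up to d. For w = [ww u] they combine with Phi into [VV]. *)
Lemma entropy_identity : J (fun p => g p * ln (g p)) =
  J (fun p => rel_ent (g p) (rho * gibbs w p)) + rho * ln rho + J (fun p => u p * lin w p) - rho * ln (ZW w)
  + d * (ln rho - ln (ZW w) + 1).
Proof.
have sG := sm_gibbsw w.
have s1 := sm_ln g0 sg; have Z0 := ZW_gt0 w.
have lg p : ln (rho * gibbs w p) = ln rho + lin w p - ln (ZW w).
  by rewrite lnM ?posrE ?gibbs_gt0 // ln_div ?posrE ?expR_gt0 // expRK addrA.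
pose c := ln rho - ln (ZW w).
have E p : rel_ent (g p) (rho * gibbs w p) =
    g p * ln (g p) - (c * u p + u p * lin w p + (d * lin w p + d * (c + 1) + (u p - rho * gibbs w p))).
  by rewrite /rel_ent lg /g /c; ring.
rewrite (Int_eq _ E); intB m1.
intD m1.
intD m1.
intD m1.
intD m1.
rewrite (IntN m1); last by cnt.
intD m1.
rewrite !(IntZ m1); [|by cnt..].
rewrite umass gibbs_mass (lin_mean hn hsigma) (Int_cst m1) mulr1 /c; ring.
Qed.

Lemma ln_bound p : `|qq p| <= M + K - ln d.
Proof.
have ld : ln d <= 0 by apply: ln_le0.
have M0 : 0 <= M by apply: le_trans (u0 p) (uM p).
have l1 : ln d <= ln (g p) by rewrite ler_ln ?posrE // /g lerDr.
have l2 : ln (g p) <= M.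
  have := ln_le_sub1 (g0 p); have := uM p; have d1' := d1; rewrite /g; lra.
have := le_trans (lin_le w p) wK; rewrite !ler_norml /qq => /andP[a1 a2].
by apply/andP; split; lra.
Qed.

End Fixed_time.

Lemma ZW_ZZ w : ZW w = ZZ sigma (enorm w) (unit_vec R hn).
Proof.
have [->|w0] := eqVneq w 0.
  rewrite enorm0.
  by apply: Int_eq => p; rewrite mul0r /lin edotC edot0l.
have e0 : 0 < enorm w by rewrite enorm_gt0.
rewrite -(@ZZ_unit R n sigma hn hsigma (enorm w) ((enorm w)^-1 *: w)); last 2 first.
- by rewrite edotZl edotZr -enorm_sqr; move: e0; move: (enorm w) => x x0; field; exact: lt0r_neq0.
- exact: unit_vec1.
by apply: Int_eq => p; rewrite linZ mulrA divff ?mul1r // gt_eqF.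
Qed.

Lemma FP_adjoint (g : pt -> R) (w a : V) : sm g ->
  J (fun p => (Lap g p - Gam (lin w) g p + (n%:R - 1) * (lin w p * g p)) * lin a p) =
  J (fun p => g p * (Gam (lin w) (lin a) p - (n%:R - 1) * lin a p)).
Proof.
move=> sg; have sw := sm_lin w; have sa := sm_lin a; have sga : sm (fun p => g p * lin a p) by smt.
have E p : (Lap g p - Gam (lin w) g p + (n%:R - 1) * (lin w p * g p)) * lin a p =
  Lap g p * lin a p - (Gam (fun p => g p * lin a p) (lin w) p + (g p * lin a p) * Lap (lin w) p)
  + g p * Gam (lin w) (lin a) p.
  by rewrite GamMl // (GamC (lin w) g) (GamC (lin w) (lin a)) Lap_lin; ring.
rewrite (Int_eq _ E); intD m1.
intB m1.
intD m1.
rewrite (Int_Gam hsigma sga sw) subrr subr0 -(Int_Lap_sym hsigma sg sa); intD' m1.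
by apply: Int_eq => p; rewrite Lap_lin; ring.
Qed.

(** The Gibbs state is stationary for the operator with frozen w; it may therefore be subtracted in
    the velocity of the flux. *)
Lemma gibbs_equilibrium (w a : V) : J (fun p => gibbs w p * (Gam (lin w) (lin a) p - (n%:R - 1) * lin a p)) = 0.
Proof.
have sw := sm_lin w; have sa := sm_lin a; have se := sm_exp_lin w.
have E p : gibbs w p * (Gam (lin w) (lin a) p - (n%:R - 1) * lin a p) =
    (ZW w)^-1 * (Gam (fun p => expR (lin w p)) (lin a) p + expR (lin w p) * Lap (lin a) p).
  have -> : Gam (fun p => expR (lin w p)) (lin a) p = expR (lin w p) * Gam (lin w) (lin a) p.
    exact: (@Gam_comp R n expR expR (lin w) (lin a) (fun q => is_derive_expR _) sw p).
  by rewrite Lap_lin /gibbs; ring.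
rewrite (Int_eq _ E); intZ m1.
intD m1.
by rewrite (Int_Gam hsigma se sa) subrr mulr0.
Qed.

Lemma gibbs_mean (w : V) : J (fun p => gibbs w p * lin w p) = enorm w * order_param n (enorm w).
Proof.
have [->|w0] := eqVneq w 0.
  rewrite enorm0.
  rewrite mul0r -[RHS](mul0r 1) -(Int_cst m1 0); apply: Int_eq => p.
  by rewrite /lin edotC edot0l mulr0.
have e0 : 0 < enorm w by rewrite enorm_gt0.
have x1 : edot ((enorm w)^-1 *: w) ((enorm w)^-1 *: w) = 1.
  by rewrite edotZl edotZr -enorm_sqr; move: e0; move: (enorm w) => x x0; field; exact: lt0r_neq0.
have E p : enorm w * lin ((enorm w)^-1 *: w) p = lin w p.
  by rewrite linZ mulrA divff ?mul1r // gt_eqF.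
rewrite (order_paramE hn hsigma (enorm w) x1) mulrA -(IntZ m1); last first.
  by have := sm_cont (sm_gibbs (enorm w) ((enorm w)^-1 *: w)); have := cont_lin ((enorm w)^-1 *: w); exact: contM.
have -> : J (fun p => expR (enorm w * lin ((enorm w)^-1 *: w) p)) = ZW w by apply: Int_eq => p; rewrite E.
have -> : J (fun p => enorm w * (lin ((enorm w)^-1 *: w) p * expR (enorm w * lin ((enorm w)^-1 *: w) p))) =
  J (fun p => lin w p * expR (lin w p)) by apply: Int_eq => p; rewrite mulrA E.
rewrite -(IntZr m1); last by cnt.
by apply: Int_eq => p; rewrite /gibbs; ring.
Qed.

Lemma Gam_lin_bound (w a : V) p : `|Gam (lin w) (lin a) p| <= 2 * enorm w * enorm a.
Proof.
rewrite Gam_lin; apply: le_trans (ler_normB _ _) _.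
have h1 := edot_le w a; have h2 : `|lin w p * lin a p| <= enorm w * enorm a.
  by rewrite normrM; apply: ler_pM => //; exact: lin_le.
have -> : 2 * enorm w * enorm a = enorm w * enorm a + enorm w * enorm a by ring.
exact: lerD.
Qed.

Lemma Int_bound_nrm2 (g h : pt -> R) (M : R) : cont g -> cont h -> 0 <= M -> (forall p, `|h p| <= M) ->
  `|J (fun p => g p * h p)| <= M * Num.sqrt (nrm2 g).
Proof.
move=> cg ch M0 hM; apply: le_trans (Int_norm m1 _) _; first by cnt.
apply: (@le_trans _ _ (J (fun p => M * (`|g p| * 1)))).
  int_le m1 => p.
  by rewrite normrM mulr1 mulrC ler_wpM2r.
intZ m1.
apply: ler_wpM2l => //; have cng := cont_norm cg.
have h1 := CS_sqrt hsigma cng (@cont_cst R n 1); apply: (le_trans (le_trans (ler_norm _) h1)).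
have -> : nrm2 (fun=> 1) = 1 by rewrite /nrm2 (Int_cst m1) expr1n mulr1.
have -> : nrm2 (fun p => `|g p|) = nrm2 g.
  by apply: Int_eq => p; rewrite real_normK // num_real.
by rewrite sqrtr1 mulr1.
Qed.

Lemma linB (x y : V) p : lin (x - y) p = lin x p - lin y p.
Proof. by rewrite /lin edotDr edotNr. Qed.

Lemma enormN (x : V) : enorm (- x) = enorm x.
Proof. by rewrite /enorm edotNl edotNr opprK. Qed.

Lemma enormD (x y : V) : enorm (x + y) <= enorm x + enorm y.
Proof.
rewrite -(@ler_pXn2r _ 2) ?nnegrE ?addr_ge0 ?enorm_ge0 // enorm_sqr edotDl !edotDr (edotC y x).
have := edot_le x y => /(le_trans (ler_norm _)); rewrite -!enorm_sqr.
by move: (enorm x) (enorm y) (edot x y) => a b d; nra.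
Qed.

Lemma expR_lip (K x y : R) : `|x| <= K -> `|y| <= K -> `|expR x - expR y| <= expR K * `|x - y|.
Proof.
wlog xy : x y / y <= x => [H hx hy|hx hy].
  by have [h|/ltW h] := leP y x; [exact: H|rewrite distrC [`|x - y|]distrC; exact: H].
rewrite !ger0_norm ?subr_ge0 ?ler_expR //.
have := expR_ge1Dx (y - x); rewrite expRD expRN => h.
have x0 := expR_gt0 x; have xK : expR x <= expR K by rewrite ler_expR (le_trans (ler_norm _)).
have h2 : (1 + (y - x)) * expR x <= expR y.
  by apply: le_trans (ler_wpM2r (ltW x0) h) _; rewrite -mulrA mulVf ?mulr1 // gt_eqF.
have h3 : expR x * (x - y) <= expR K * (x - y) by rewrite ler_wpM2r // subr_ge0.
move: h2 h3; rewrite mulrDl mul1r; have -> : (y - x) * expR x = - (expR x * (x - y)) by ring.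
by move: (expR x * _) (expR K * _) => a b; lra.
Qed.

Lemma gibbs_lip (K : R) : exists2 C : R, 0 <= C & forall w w' : V, enorm w <= K -> enorm w' <= K ->
  nrm2 (fun p => gibbs w p - gibbs w' p) <= C * enorm (w - w') ^+ 2.
Proof.
pose A := expR K; have A0 : 0 < A by exact: expR_gt0.
pose B := A * A + A * A * A * A; have B0 : 0 <= B by rewrite addr_ge0 ?mulr_ge0 // ltW.
exists (B ^+ 2) => [|w w' wK wK']; first exact: sqr_ge0.
have sG := sm_gibbsw w; have sG' := sm_gibbsw w'.
have lK (z : V) (p : pt) : enorm z <= K -> `|lin z p| <= K by move=> zK; exact: le_trans (lin_le z p) zK.
have d0 := enorm_ge0 (w - w').
have le p : `|expR (lin w p) - expR (lin w' p)| <= A * enorm (w - w').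
  apply: (le_trans (expR_lip (lK w p wK) (lK w' p wK'))); apply: ler_wpM2l; first exact: ltW.
  by rewrite -linB; exact: lin_le.
have lZ : `|ZW w - ZW w'| <= A * enorm (w - w').
  intB' m1.
  by rewrite -[leRHS]mulr1; apply: (Int_bound m1); [by cnt|exact: le].
have inv z : enorm z <= K -> (ZW z)^-1 <= A.
  move=> zK; have [h _] := ZW_bounds zK; have Z0 := ZW_gt0 z.
  by rewrite -[A]invrK lef_pV2 ?posrE ?invr_gt0 // /A -expRN.
have key p : `|gibbs w p - gibbs w' p| <= B * enorm (w - w').
  have Z0 := ZW_gt0 w; have Z0' := ZW_gt0 w'.
  have -> : gibbs w p - gibbs w' p = (ZW w)^-1 * (expR (lin w p) - expR (lin w' p)) -
    expR (lin w' p) * (ZW w)^-1 * (ZW w')^-1 * (ZW w - ZW w').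
    by rewrite /gibbs; field; rewrite !gt_eqF.
  apply: le_trans (ler_normB _ _) _; rewrite /B mulrDl; apply: lerD.
    rewrite normrM -mulrA; apply: ler_pM => //; rewrite ger0_norm ?invr_ge0 ?(ltW Z0) //; exact: inv.
  have [_ e1] := exp_lin_bounds p wK'.
  rewrite normrM (_ : A * A * A * A * enorm (w - w') = A * A * A * (A * enorm (w - w'))); last by ring.
  apply: ler_pM => //; rewrite !normrM !ger0_norm ?invr_ge0 ?(ltW Z0) ?(ltW Z0') ?expR_ge0 //.
  apply: ler_pM; rewrite ?mulr_ge0 ?invr_ge0 ?(ltW Z0) ?(ltW Z0') ?expR_ge0 //; last exact: inv.
  by apply: ler_pM; rewrite ?invr_ge0 ?(ltW Z0) ?expR_ge0 //; exact: inv.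
rewrite -exprMn -[leRHS]mulr1 -(Int_cst m1); int_le m1 => p.
rewrite -[leLHS]real_normK ?num_real //; apply: lerXn2r; rewrite ?nnegrE //.
exact: mulr_ge0.
Qed.

End Gibbs.

(** With a(t) = (A / m) e^(- m t), y - a is nondecreasing and y + a nonincreasing; the limit is the
    supremum of the former. *)
Lemma exp_speed_limit (R : realType) (y dy : R -> R) (A m T : R) : 0 <= A -> 0 < m ->
  (forall t : R, T <= t -> is_derive t 1 y (dy t)) -> (forall t : R, T <= t -> `|dy t| <= A * expR (- m * t)) ->
  exists l : R, forall t : R, T <= t -> `|y t - l| <= A / m * expR (- m * t).
Proof.
move=> A0 m0 hy hdy; pose a (t : R) := A / m * expR (- m * t).
have da (t : R) : is_derive t 1 a (- (A * expR (- m * t))).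
  have h1 : is_derive t 1 (fun s : R => - m * s) (- m).
    by have h := is_deriveZ (- m) (is_derive_id t (1 : R)); apply: (is_derive_eq h); rewrite /GRing.scale /= mulr1.
  have h := is_deriveZ (A / m) (@is_derive1_comp _ _ (fun s : R => - m * s) _ _ _ (is_derive_expR _) h1).
  by apply: (is_derive_eq h); rewrite /GRing.scale /=; field; exact: lt0r_neq0.
have up (s t : R) : T <= s -> s <= t -> y s - a s <= y t - a t.
  move=> Ts st; rewrite -subr_ge0 -[leLHS](mul0r (t - s)).
  apply: (@derive_ge_growth R (fun x => y x - a x) (fun x => dy x - - (A * expR (- m * x)))) => // x sx xt.
    exact: is_deriveB (hy x (le_trans Ts sx)) (da x).
  by have := hdy x (le_trans Ts sx); rewrite ler_norml => /andP[h _]; lra.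
have dn (s t : R) : T <= s -> s <= t -> y t + a t <= y s + a s.
  move=> Ts st; rewrite -lerN2 -subr_ge0 -[leLHS](mul0r (t - s)).
  apply: (@derive_ge_growth R (fun x => - (y x + a x)) (fun x => - (dy x + - (A * expR (- m * x))))) => // x sx xt.
    exact: is_deriveN (is_deriveD (hy x (le_trans Ts sx)) (da x)).
  by have := hdy x (le_trans Ts sx); rewrite ler_norml => /andP[_ h]; lra.
have a0 t : 0 <= a t by rewrite mulr_ge0 ?expR_ge0 // divr_ge0 // ltW.
have cross (s t : R) : T <= s -> T <= t -> y s - a s <= y t + a t.
  move=> Ts Tt; have [st|ts] := leP s t.
    by apply: le_trans (up s t Ts st) _; have := a0 t; lra.
  by apply: le_trans _ (dn t s Tt (ltW ts)); have := a0 s; lra.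
pose S := [set y s - a s | s in [set s | T <= s]].
have S0 : S !=set0 by exists (y T - a T), T => /=.
have Sb t : T <= t -> ubound S (y t + a t) by move=> Tt _ [s /= Ts <-]; exact: cross.
have hS : has_sup S by split => //; exists (y T + a T); exact: Sb.
exists (sup S) => t Tt; rewrite ler_distl -/(a t); apply/andP; split.
  by rewrite lerBlDr; apply: ge_sup => //; exact: Sb.
by rewrite -lerBlDr; apply: (sup_upper_bound hS); exists t.
Qed.

Lemma le_sum3 (R : realFieldType) (a b c d x e : R) :
  a - b <= c -> e < d + a - b -> 0 <= x -> e <= d + c + x.
Proof. by move=> *; lra. Qed.

Lemma rate_ge (R : realFieldType) (b g q u x y z : R) :
  - u <= x -> u + g <= y -> b <= g / 2 + z -> q = z + y -> g / 2 - q <= x - b.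
Proof. by move=> *; lra. Qed.

(** * From L^2 convergence to all Sobolev norms *)

Section Sobolev_convergence.
Variables (R : realType) (n : nat) (sigma : probability (borel_rV R n) R).
Hypotheses (hn : (2 <= n)%N) (hsigma : uniform_sphere sigma).
Notation V := 'rV[R]_n.
Notation pt := (pt R n).
Notation nrm2 := (nrm2 sigma).
Notation iLap := (fun q : nat => iter q (@Lap R n)).
Variable f : R -> V -> R.
Notation u := (fun t => f t \o vec (n:=n)).
Hypothesis su : forall t : R, 1 <= t -> sm (u t).
Hypothesis hreg : forall k, exists M : R, forall t : R, 1 <= t -> nrm2 (iLap k (u t)) <= M.
Variables (G : V -> R) (g : pt -> R).
Hypothesis sg : sm g.
Hypothesis hG : forall p, G (vec p) = g p.
Notation N := (fun t => nrm2 (fun p => u t p - g p)).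

(** By interpolation, Lap^k of the difference is bounded through its L^2 norm and Lap^(2 k), and the
    latter is bounded in time. *)
Lemma Hs_dist_L2 s : exists C M : R, [/\ 0 <= C, 0 <= M & forall t : R, 1 <= t ->
  (Hs_dist sigma s (f t) G <= (C * Num.sqrt (N t + M * Num.sqrt (N t)))%:E)%E].
Proof.
have [C [k [C0 hC]]] := Hs_dist_le hn hsigma s.
have [M hM] := hreg (2 * k)%N.
pose Q := 2 * Num.max 0 M + 2 * nrm2 (iLap (2 * k)%N g).
exists C, (Num.sqrt Q); split => //.
move=> t t1; have sut := su t1; pose w p := u t p - g p.
have sw : sm w by rewrite /w; smt.
have hw p : w p = f t (vec p) - G (vec p) by rewrite hG.
apply: le_trans (hC (f t) G w hw sw) _; rewrite lee_fin; apply: ler_wpM2l => //.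
have hI : nrm2 (iLap k w) <= Num.sqrt (nrm2 w) * Num.sqrt (nrm2 (iLap (2 * k)%N w)) := nrm2_iLap_interp hsigma k sw.
apply: ler_wsqrtr; rewrite lerD2l; apply: (le_trans hI).
rewrite mulrC; apply: ler_wpM2r; first exact: sqrtr_ge0.
apply: ler_wsqrtr.
have E j : iLap j w = fun p => iLap j (u t) p + - iLap j g p.
  elim: j => [//|j IH]; rewrite [LHS]iterS IH; apply/funext => p.
  by rewrite (LapB (sm_iLap j sut) (sm_iLap j sg)).
have s1 := sm_iLap (2 * k) sut; have s2 := sm_iLap (2 * k) sg.
rewrite E; have s3 := smN s2; apply: le_trans (nrm2D hsigma (sm_cont s1) (sm_cont s3)) _.
have -> : nrm2 (fun p => - iLap (2 * k)%N g p) = nrm2 (iLap (2 * k)%N g).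
  by rewrite /nrm2; apply: Int_eq => p; rewrite sqrrN.
by rewrite /Q lerD2r ler_wpM2l // le_max hM // orbT.
Qed.

Lemma L2_converges_exp (K l T : R) : 0 <= K -> 0 < l -> 1 <= T ->
  (forall t : R, T <= t -> N t <= K * expR (- l * t)) -> converges_exp_to sigma f G.
Proof.
move=> K0 l0 T1 hN s; have [C [M [C0 M0 hC]]] := Hs_dist_L2 s.
pose Q := K + M * Num.sqrt K; have Q0 : 0 <= Q by rewrite addr_ge0 ?mulr_ge0 ?sqrtr_ge0.
have sqe (x : R) : Num.sqrt (expR x) = expR (x / 2).
  have -> : expR x = expR (x / 2) ^+ 2 by rewrite expr2 -expRD; congr expR; lra.
  by rewrite sqrtr_sqr ger0_norm // expR_ge0.
(* The norm is the square root of a quantity of order the square root of N t, which divides the rate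
   by 4. The added 1 makes the constant positive. *)
exists (C * Num.sqrt Q + 1), (l / 4), T; split.
- by rewrite ltr_wpDl // mulr_ge0 // sqrtr_ge0.
- by rewrite divr_gt0.
- by lra.
move=> t Tt; have t1 := le_trans T1 Tt; apply: le_trans (hC t t1) _; rewrite lee_fin.
rewrite mulrDl mul1r; apply: ler_wpDr; first exact: expR_ge0.
rewrite -mulrA; apply: ler_wpM2l => //.
have -> : expR (- (l / 4) * t) = Num.sqrt (expR (- l * t / 2)) by rewrite sqe; congr expR; lra.
rewrite -sqrtrM //; apply: ler_wsqrtr; have Nt := hN t Tt.
have e1 : expR (- l * t) <= expR (- l * t / 2).
  have lt0 : 0 <= l * t by apply: mulr_ge0; [exact: ltW|lra].
  by rewrite ler_expR !mulNr; lra.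
rewrite /Q mulrDl; apply: lerD; first by apply: le_trans Nt _; rewrite ler_wpM2l.
have -> : M * Num.sqrt K * expR (- l * t / 2) = M * Num.sqrt (K * expR (- l * t)) by rewrite sqrtrM // sqe mulrA.
by apply: ler_wpM2l => //; exact: ler_wsqrtr.
Qed.

Lemma L2_converges : (forall e : R, 0 < e -> exists T : R, forall t : R, T <= t -> N t <= e) ->
  converges_to sigma f G.
Proof.
move=> hN s; have [C [M [C0 M0 hC]]] := Hs_dist_L2 s.
have cN : N t @[t --> +oo] --> (0 : R).
  apply/cvgrPdist_le => e e0; have [T hT] := hN e e0.
  near=> t; rewrite sub0r normrN ger0_norm ?nrm2_ge0 //; apply: hT.
  by near: t; apply: nbhs_pinfty_ge; exact: num_real.
have cs : Num.sqrt (N t) @[t --> +oo] --> (0 : R).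
  by rewrite -[X in _ --> X]sqrtr0; apply: (cvg_comp _ _ cN); exact: sqrt_continuous.
have cu : (C * Num.sqrt (N t + M * Num.sqrt (N t)))%:E @[t --> +oo] --> 0%E.
  apply: cvg_EFin; first by near=> t.
  rewrite -[X in _ --> X](mulr0 C); apply: cvgM; first exact: cvg_cst.
  rewrite -[X in _ --> X]sqrtr0.
  have c2 : N t + M * Num.sqrt (N t) @[t --> +oo] --> (0 : R).
    rewrite -[X in _ --> X](addr0 0); apply: cvgD => //.
    by rewrite -[X in _ --> X](mulr0 M); apply: cvgM => //; exact: cvg_cst.
  by apply: (cvg_comp _ _ c2); exact: sqrt_continuous.
apply: (@squeeze_cvge _ _ _ _ (fun=> 0%E) _ (fun t => (C * Num.sqrt (N t + M * Num.sqrt (N t)))%:E)) => //.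
  near=> t; apply/andP; split; first exact: poweR_ge0.
  by apply: hC; near: t; apply: nbhs_pinfty_ge; exact: num_real.
exact: cvg_cst.
Unshelve. all: by end_near. Qed.

End Sobolev_convergence.

(** * Large time behaviour *)

Section Solution_flux.
Variables (R : realType) (n : nat) (sigma : probability (borel_rV R n) R).
Hypotheses (hn : (2 <= n)%N) (hsigma : uniform_sphere sigma).
Notation n1 := (n%:R - 1).
Notation V := 'rV[R]_n.
Notation pt := (pt R n).
Notation J := (Int sigma).
Notation nrm2 := (nrm2 sigma).
Let m1 := sigma_mass hsigma.
Variables (nu tau : R -> R).
Hypothesis hcoef : admissible_coefficients nu tau.
Variable f0 : {measure set (borel_rV R n) -> \bar R}.
Variable rho : R.
Hypothesis hrho : 0 < rho.
Hypothesis hmass : f0 (@sphere R n) = rho%:E.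
Variable f : R -> V -> R.
Hypothesis hf : solution sigma nu tau f0 f.
Notation u := (fun t => f t \o vec (n:=n)).
Notation v := (fun t => time_deriv f t \o vec (n:=n)).
Notation k := (Defs.ratio nu tau).

Definition flux_norm (g : pt -> R) : R := enorm (flx sigma g).
Definition ww (g : pt -> R) : V := (k (flux_norm g) / flux_norm g) *: flx sigma g.
Definition dist_gibbs (g : pt -> R) : R := nrm2 (fun p => g p - rho * gibbs sigma (ww g) p).
Notation r := (fun t => flux_norm (u t)).
Notation D := (fun t => dist_gibbs (u t)).

Lemma enorm_ww g : enorm (ww g) = k (flux_norm g).
Proof.
have e0 : 0 <= flux_norm g by exact: enorm_ge0.
rewrite /ww enormZ; last by rewrite divr_ge0 ?(ratio_ge0 hcoef).
have [->|r0] := eqVneq (flux_norm g) 0; first by rewrite (ratio0 hcoef) !mul0r.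
by rewrite divfK.
Qed.

Lemma edot_flx_ww g : edot (flx sigma g) (ww g) = k (flux_norm g) * flux_norm g.
Proof.
rewrite /ww edotZr -enorm_sqr -/(flux_norm g).
have [->|r0] := eqVneq (flux_norm g) 0; first by rewrite (ratio0 hcoef) !mul0r.
by rewrite expr2 mulrA divfK.
Qed.

Lemma drift_ww g : drift sigma nu g = tau (flux_norm g) *: ww g.
Proof.
have e0 : 0 <= flux_norm g by exact: enorm_ge0.
have t0 : 0 < tau (flux_norm g) by case: (hcoef) => h _ _ _ _; case: (h _ e0).
rewrite /drift /ww scalerA /Defs.ratio -/(flux_norm g); congr (_ *: _).
by rewrite mulrA; congr (_ * _); rewrite mulrCA divff ?mulr1 // gt_eqF.
Qed.

Lemma solution_fp (t : R) : 0 < t -> forall p, v t p =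
  tau (r t) * (Lap (u t) p - Gam (lin (ww (u t))) (u t) p + n1 * (lin (ww (u t)) p * u t p)).
Proof.
move=> t0 p; transitivity (tau (enorm (flx sigma (u t))) * Lap (u t) p - Gam (lin (drift sigma nu (u t))) (u t) p
  + n1 * lin (drift sigma nu (u t)) p * u t p); first exact: (solution_pde hf t0).
by rewrite drift_ww linZ Gam_linZ -/(flux_norm (u t)); ring.
Qed.

Lemma solution_r (t : R) : 0 < t -> 0 <= r t /\ r t <= rho.
Proof.
move=> t0; split; first exact: enorm_ge0.
have [Cb [CM [Lt [Lb hc]]]] := admissible_coef hcoef.
exact: (solution_flux_le hn hsigma hmass hf hc t0).
Qed.

Lemma solution_pos (t : R) p : 0 < t -> 0 <= u t p.
Proof.
have [Cb [CM [Lt [Lb hc]]]] := admissible_coef hcoef.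
exact: (solution_ge0 hn hsigma hmass hf hc).
Qed.

Lemma enorm_ww_le (t : R) : 0 < t -> enorm (ww (u t)) <= k rho.
Proof.
move=> /solution_r[r0 r1]; rewrite enorm_ww; exact: ratio_le hcoef _ _ r0 r1.
Qed.

Lemma flx_derive (t : R) i : 0 < t -> is_derive t 1 (fun s => flx sigma (u s) 0 i) (flx sigma (v t) 0 i).
Proof.
move=> t0; rewrite flx_coord; have := flow_Int hsigma (solution_flow hf) t0 (cont_lin (e_ R i)).
by congr (is_derive t 1 _ _); apply/funext => s; rewrite flx_coord.
Qed.

Lemma edot_flx_derive (t : R) : 0 < t ->
  is_derive t 1 (fun s => edot (flx sigma (u s)) (flx sigma (u s))) (2 * edot (flx sigma (v t)) (flx sigma (u t))).
Proof.
move=> t0; rewrite {2}/edot mulr_sumr /edot.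
apply: (@is_derive_bigsum R _ _ (fun i s => flx sigma (u s) 0 i * flx sigma (u s) 0 i)
  (fun i s => 2 * (flx sigma (v s) 0 i * flx sigma (u s) 0 i))) => i.
have h := flx_derive i t0; have h2 := is_derive_mul h h.
by apply: (is_derive_eq h2); ring.
Qed.

Lemma r_derive (t : R) : 0 < t -> r t != 0 ->
  is_derive t 1 r (edot (flx sigma (v t)) (flx sigma (u t)) / r t).
Proof.
move=> t0 r0; have rp : 0 < r t by rewrite lt_neqAle eq_sym r0 enorm_ge0.
have e0 : 0 < edot (flx sigma (u t)) (flx sigma (u t)) by rewrite -enorm_sqr exprn_gt0.
have h := @is_derive1_comp _ _ (fun s => edot (flx sigma (u s)) (flx sigma (u s))) _ _ _ (is_derive1_sqrt e0) (edot_flx_derive t0).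
apply: (is_derive_eq h); rewrite -/(flux_norm (u t)) /= /flux_norm /enorm in r0 *.
by field.
Qed.

(** The norm of the flux may fail to be differentiable where the flux vanishes. There r (t + h) =
    O(|h|) is enough, because Phi has derivative k 0 = 0 at 0. *)
Lemma Phi_derive (t : R) : 0 < t ->
  is_derive t 1 (fun s => Phi nu tau (r s)) (J (fun p => v t p * lin (ww (u t)) p)).
Proof.
move=> t0; have cv : cont (v t) by exact/sm_cont/(flow_smd (solution_flow hf) t0).
rewrite Int_flx //; have [E|r0] := eqVneq (r t) 0; last first.
  have h := @is_derive1_comp _ _ r _ _ _ (is_derive_Phi hcoef (enorm_ge0 _)) (r_derive t0 r0).
  by apply: (is_derive_eq h); rewrite /ww edotZr mulrA mulrAC.
have -> : edot (flx sigma (v t)) (ww (u t)) = 0.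
  by rewrite /ww E (ratio0 hcoef) mul0r scale0r edotC edot0l.
have uv := solution_flow hf.
have [C C0 [d d0 hC]] : exists2 C : R, 0 <= C & exists2 d : R, 0 < d & forall h : R, `|h| < d -> r (t + h) <= C * `|h|.
  have [M [dM [M0 dM0 _ hM]]] := flow_bnd uv 0 t0.
  have [d d0 hd] := flow_diff uv 0 t0 ltr01.
  have vM p : `|v t p| <= M.
    by apply: (@bnd_sup R n 0 M (v t) p); by apply: (hM t _).2; rewrite subrr normr0.
  exists (M + 1); first by rewrite addr_ge0.
  exists (Num.min d t) => [|h]; first by rewrite lt_min d0.
  rewrite lt_min => /andP[h1 h2]; have th : 0 < t + h by move: h2; rewrite ltr_norml; lra.
  have su := flow_sm uv t0; have sh := flow_sm uv th.
  have [->|h0] := eqVneq h 0; first by rewrite addr0 E normr0 mulr0.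
  have B p : `|u (t + h) p - u t p| <= (M + 1) * `|h|.
    have := bnd_sup p (hd h h0 h1) => H.
    have -> : u (t + h) p - u t p = (h^-1 * (u (t + h) p - u t p) - v t p + v t p) * h.
      by rewrite subrK mulrC mulrA divff ?mul1r.
    rewrite normrM ler_wpM2r //; apply: le_trans (ler_normD _ _) _.
    by rewrite addrC; apply: lerD.
  have [->|r0] := eqVneq (r (t + h)) 0; first by rewrite mulr_ge0 ?addr_ge0.
  have rp : 0 < r (t + h) by rewrite lt_neqAle eq_sym r0 enorm_ge0.
  rewrite -(ler_pM2l rp) -expr2 /flux_norm enorm_sqr -/(flux_norm (u (t + h))).
  set wv := flx sigma (u (t + h)).
  have -> : edot wv wv = J (fun p => (u (t + h) p - u t p) * lin wv p).
    have e0 : edot (flx sigma (u t)) wv = 0.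
      have := E; rewrite /flux_norm => /eqP; rewrite enorm_eq0 => /eqP ->; exact: edot0l.
    rewrite -(Int_flx hsigma); last by cnt.
    rewrite -[LHS]subr0 -e0 -(Int_flx hsigma); last by cnt.
    intB' m1.
    by apply: Int_eq => p; rewrite mulrBl.
  apply: le_trans (ler_norm _) _; rewrite -[leRHS]mulr1; apply: (Int_bound m1); first by cnt.
  move=> p; rewrite normrM mulrC; apply: ler_pM => //; exact: lin_le.
have hP := is_derive_Phi hcoef (lexx (0 : R)); rewrite (ratio0 hcoef) in hP.
move/is_derive_epsP : hP => hP; apply/is_derive_epsP => e e0.
have C1 : 0 < C + 1 by rewrite ltr_wpDl.
have [d' d'0 hd'] := hP (e / (C + 1)) (divr_gt0 e0 C1).
exists (Num.min d (d' / (C + 1))) => [|h]; first by rewrite lt_min d0 divr_gt0.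
rewrite lt_min => /andP[h1 h2]; rewrite E mulr0 subr0.
have r1 := hC h h1; have r0 : 0 <= r (t + h) by exact: enorm_ge0.
have r2 : r (t + h) <= (C + 1) * `|h| by apply: le_trans r1 _; rewrite ler_wpM2r // lerDl.
have := hd' (r (t + h)); rewrite add0r mulr0 subr0 ger0_norm // => H.
apply: le_trans (H _) _.
  by apply: le_lt_trans r2 _; rewrite mulrC -ltr_pdivlMr.
by rewrite -mulrA ler_pM2l // mulrC ler_pdivrMr // mulrC.
Qed.

Lemma xlnx_derive (d : R) (t : R) : 0 < d -> 0 < t ->
  is_derive t 1 (fun s => J (fun p => (u s p + d) * ln (u s p + d)) - Phi nu tau (r s))
    (J (fun p => (ln (u t p + d) + 1 - lin (ww (u t)) p) * v t p)).
Proof.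
move=> d0 t0; have uv := solution_flow hf; have su := flow_sm uv t0; have sv := flow_smd uv t0.
have up p : 0 < u t p + d by rewrite ltr_wpDl // solution_pos.
have sl : sm (fun p => ln (u t p + d)) by apply: sm_ln => //; smt.
have h1 : is_derive t 1 (fun s => J (fun p => (u s p + d) * ln (u s p + d))) (J (fun p => (ln (u t p + d) + 1) * v t p)).
  apply: (@flow_Int_comp R n sigma hsigma u v (fun x => (x + d) * ln (x + d)) (fun x => ln (x + d) + 1) [set x | 0 <= x] t) => //.
  - move=> x /= x0; have xd : 0 < x + d by rewrite ltr_wpDl.
    have h := is_deriveD (is_derive_id x (1 : R)) (is_derive_cst d x (1 : R)).
    have h2 := @is_derive1_comp _ _ (fun y : R => y + d) _ _ _ (is_derive1_ln xd) h.
    have h3 := is_derive_mul h h2; apply: (is_derive_eq h3).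
    by rewrite addr0 mul1r mulr1 divff // gt_eqF.
  - move=> M; exists (M + d + `|ln d| + 1) => x /= x0; rewrite ger0_norm // => xM.
    have xd : 0 < x + d by rewrite ltr_wpDl.
    have l1 : ln d <= ln (x + d) by rewrite ler_ln ?posrE // lerDr.
    have l2 := ln_le_sub1 xd; have l3 := ler_norm (ln d); have l4 := ler_norm (- ln d); rewrite normrN in l4.
    by rewrite ler_norml; apply/andP; split; lra.
  - by move=> s p s0; exact: solution_pos.
have h := is_deriveB h1 (Phi_derive t0); apply: (is_derive_eq h).
intB' m1.
by apply: Int_eq => p; ring.
Qed.

(** E is the free energy of f + d, minus rho ln rho. The errors are of order d, d^2 or d |ln d|,
    with constants coming from bounds valid for t >= 1, so that d can be chosen from e alone. *)
Theorem entropy_estimate : exists c c1 C : R, [/\ 0 < c, 0 < c1, 0 <= C &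
  forall e : R, 0 < e -> exists E dE : R -> R, forall t : R, 1 <= t ->
    [/\ is_derive t 1 E (dE t), dE t <= - c * D t + e,
        c1 * D t - e <= E t - VV k (fun x => ln (ZZ sigma x (unit_vec R hn))) (Phi nu tau) rho (r t)
      & E t - VV k (fun x => ln (ZZ sigma x (unit_vec R hn))) (Phi nu tau) rho (r t) <= C * D t + e]].
Proof.
have uv := solution_flow hf; have [Cb [CM [Lt [Lb hc]]]] := admissible_coef hcoef.
have [tm tm0 htm] := coef_tau_min hc (ltW hrho).
have [M M0 hM] := solution_sup_bounded hn hsigma hrho hmass hf hc.
pose K := k rho; have K0 : 0 <= K by exact: ratio_ge0 hcoef _ (ltW hrho).
have n2 : 0 <= n%:R - 1 :> R by have := n_ge2 R hn; lra.
have MK : 0 <= (M + K) * K + 2 * K.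
  by apply: addr_ge0; apply: mulr_ge0 => //; exact: addr_ge0.
pose A := 4 * expR (4 * K) * (M + 1); have A0 : 0 < A by rewrite !mulr_gt0 ?expR_gt0 // ltr_wpDl.
pose P := 2 * expR (2 * K); have P0 : 0 < P by rewrite mulr_gt0 ?expR_gt0.
pose B := M + 1 + rho * expR (2 * K).
have B0 : 0 < B by rewrite /B addr_gt0 ?mulr_gt0 ?expR_gt0 // ltr_wpDl.
have CM0 := coef_CM0 hc.
exists (tm / A), (8 * B)^-1, (P / rho); split.
- by rewrite divr_gt0.
- by rewrite invr_gt0 mulr_gt0.
- by rewrite divr_ge0 // ltW.
(* Q1, Q2, Q3 and Q4 are the error coefficients of the dissipation, of the upper and lower bounds of
   the relative entropy, and of the entropy identity. *)
pose Q1 := tm / A * P + CM * (n1 * ((M + K) * K + 2 * K)).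
pose Q2 := P / rho; pose Q3 := (4 * B)^-1; pose Q4 := `|ln rho| + K + 1.
have Q10 : 0 <= Q1.
  apply: addr_ge0; first by rewrite mulr_ge0 ?divr_ge0 // ltW.
  by apply: mulr_ge0 => //; exact: mulr_ge0.
have Q20 : 0 <= Q2 by rewrite divr_ge0 // ltW.
have Q30 : 0 <= Q3 by rewrite invr_ge0 mulr_ge0 // ltW.
have Q40 : 0 <= Q4 by rewrite !addr_ge0.
move=> e e0; pose Q := Q1 + Q2 + Q3 + Q4 + 1.
have [Q0 QA QB QC] : [/\ 0 < Q, Q1 <= Q, Q3 + Q4 <= Q & Q2 + Q4 <= Q] by rewrite /Q; split; lra.
pose s := Num.min 1 (e / Q); have s0 : 0 < s by rewrite lt_min ltr01 divr_gt0.
have s1 : s <= 1 by rewrite /s ge_min lexx.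
have sQ : s * Q <= e by rewrite -ler_pdivlMr // /s ge_min lexx orbT.
(* A square, so that d |ln d| <= 2 s. *)
pose d := s ^+ 2; have d0 : 0 < d by rewrite exprn_gt0.
have ds : d <= s by rewrite /d expr2 ler_piMr // ltW.
have d1 : d <= 1 by exact: le_trans ds s1.
have d2s : d ^+ 2 <= s by apply: le_trans ds; rewrite expr2 ler_piMr // ltW.
have ld : d * - ln d <= 2 * s.
  have h := ln_le_sub1 (_ : 0 < s^-1); rewrite invr_gt0 lnV ?posrE // in h.
  have -> : d * - ln d = 2 * (s ^+ 2 * - ln s) by rewrite /d lnXn // -mulr_natl; ring.
  rewrite ler_pM2l //; apply: (@le_trans _ _ (s ^+ 2 * s^-1)).
    by apply: ler_wpM2l; [exact: sqr_ge0|have := h s0; lra].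
  by rewrite expr2 -mulrA divff ?mulr1 // gt_eqF.
pose w t := ww (u t).
exists (fun t => J (fun p => (u t p + d) * ln (u t p + d)) - Phi nu tau (r t) - rho * ln rho).
exists (fun t => J (fun p => (ln (u t p + d) + 1 - lin (w t) p) * v t p)).
move=> t t1; have t0 := lt_le_trans ltr01 t1.
have su := flow_sm uv t0; have u0 p := solution_pos p t0.
have uM p : u t p <= M by apply: le_trans (ler_norm _) (hM t p t1).
have um : J (u t) = rho := solution_mass hn hsigma hmass hf t0.
have wK : enorm (w t) <= K := enorm_ww_le t0.
have [r0 r1] := solution_r t0.
have Dd : D t = nrm2 (fun p => u t p - rho * gibbs sigma (w t) p) by [].
pose q p := ln (u t p + d) - lin (w t) p.
pose I := J (fun p => (u t p + d) * Gam q q p).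
have hI := D_le_dissipation hn hsigma su u0 uM um wK d0 d1.
rewrite -Dd -/A -/P -/I in hI.
have Eid := entropy_identity hn hsigma (w t) su u0 um hrho d0.
have [Zb1 Zb2] := ZW_bounds hsigma wK.
have lZ : `|ln (ZW sigma (w t))| <= K.
  have Z0 := ZW_gt0 hsigma (w t); rewrite ler_norml; apply/andP; split.
    by rewrite -[leLHS]expRK ler_ln ?posrE ?expR_gt0.
  by rewrite -[leRHS]expRK ler_ln ?posrE ?expR_gt0.
have Vid : VV k (fun x => ln (ZZ sigma x (unit_vec R hn))) (Phi nu tau) rho (r t) =
    J (fun p => u t p * lin (w t) p) - rho * ln (ZW sigma (w t)) - Phi nu tau (r t).
  rewrite /VV ger0_norm // (ZW_ZZ hn hsigma) /w enorm_ww (Int_flx hsigma) ?edot_flx_ww ?(mulrC (k _)) //.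
  by cnt.
pose lr := ln rho - ln (ZW sigma (w t)) + 1.
have hlr : `|d * lr| <= s * (`|ln rho| + K + 1).
  rewrite normrM (gtr0_norm d0); apply: ler_pM => //; first exact: ltW.
  apply: le_trans (ler_normD _ _) _; rewrite normr1 lerD2r.
  by apply: le_trans (ler_normB _ _) _; rewrite lerD2l.
pose Hr := J (fun p => rel_ent (u t p + d) (rho * gibbs sigma (w t) p)).
have EV : J (fun p => (u t p + d) * ln (u t p + d)) - Phi nu tau (r t) - rho * ln rho -
    VV k (fun x => ln (ZZ sigma x (unit_vec R hn))) (Phi nu tau) rho (r t) = Hr + d * lr.
  by rewrite Vid Eid /Hr /lr; ring.
have up := rel_ent_upper hsigma su u0 hrho wK d0.
have low := rel_ent_lower hsigma su u0 uM hrho wK d0 d1.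
have sQs x : x <= Q -> s * x <= e by move=> xQ; apply: le_trans sQ; rewrite ler_wpM2l // ltW.
split.
- have h := is_deriveB (xlnx_derive d0 t0) (is_derive_cst (rho * ln rho) t (1 : R)).
  by apply: (is_derive_eq h); rewrite subr0.
- have -> : J (fun p => (ln (u t p + d) + 1 - lin (w t) p) * v t p) =
    - tau (r t) * I - tau (r t) * (d * (n1 * J (fun p => q p * lin (w t) p))).
    rewrite -(dissipation hsigma (w t) su u0 d0 (tau (r t))).
    by apply: Int_eq => p; congr (_ * _); exact: (solution_fp t0 p).
  have T1 : tm <= tau (r t) by exact: htm.
  have T2 : tau (r t) <= CM by exact: coef_M hc _ r0.
  have T0 : 0 <= tau (r t) by apply: le_trans T1; exact: ltW.
  have ud p : 0 < u t p + d by rewrite ltr_wpDl.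
  have sln : sm (fun p => ln (u t p + d)) by apply: sm_ln => //; smt.
  have sq : sm q by rewrite /q; smt.
  have I0 : 0 <= I by apply: Int_ge0 => p; rewrite mulr_ge0 ?Gam_ge0 // ltW.
  have b1 : - tau (r t) * I <= - (tm / A) * D t + s * (tm / A * P).
    have c1 : - tau (r t) * I <= - tm * I by rewrite !mulNr lerN2 ler_wpM2r.
    apply: le_trans c1 _.
    have c2 : tm / A * D t <= tm / A * (A * I + P * d ^+ 2) by rewrite ler_wpM2l // divr_ge0 // ltW.
    have c3 : tm / A * (A * I + P * d ^+ 2) = tm * I + d ^+ 2 * (tm / A * P) by field; exact: lt0r_neq0.
    have c4 : d ^+ 2 * (tm / A * P) <= s * (tm / A * P).
      by apply: ler_wpM2r => //; rewrite mulr_ge0 ?divr_ge0 // ltW.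
    rewrite c3 in c2; rewrite !mulNr; exact: (slack1 c2 c4).
  have b2 : - (tau (r t) * (d * (n1 * J (fun p => q p * lin (w t) p)))) <=
      s * (CM * (n1 * ((M + K) * K + 2 * K))).
    apply: le_trans (ler_norm _) _; rewrite normrN normrM (ger0_norm T0) normrM (gtr0_norm d0).
    rewrite normrM (_ : `|n%:R - 1| = n%:R - 1); last by rewrite ger0_norm.
    have jb : `|J (fun p => q p * lin (w t) p)| <= (M + K - ln d) * K.
      rewrite -[leRHS]mulr1; apply: (Int_bound m1); first by cnt.
      move=> p; rewrite normrM; apply: ler_pM => //; last by apply: le_trans (lin_le _ p) wK.
      exact: (ln_bound u0 uM wK d0 d1 p).
    have -> : s * (CM * (n1 * ((M + K) * K + 2 * K))) =
      CM * (n1 * (s * ((M + K) * K) + 2 * s * K)) by ring.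
    apply: ler_pM => //; first by apply: mulr_ge0; [exact: ltW|exact: mulr_ge0].
    rewrite mulrCA; apply: ler_wpM2l; first exact: n2.
    apply: le_trans (ler_wpM2l (ltW d0) jb) _.
    have -> : d * ((M + K - ln d) * K) = d * ((M + K) * K) + d * - ln d * K by ring.
    apply: lerD; first by apply: ler_wpM2r => //; rewrite mulr_ge0 ?addr_ge0.
    by apply: ler_wpM2r.
  have b3 : s * Q1 <= e by exact: sQs.
  rewrite /Q1 mulrDr in b3; exact: (slack2 b1 b2 b3).
- rewrite EV; have c1 : (4 * B)^-1 * (D t / 2 - d ^+ 2) = (8 * B)^-1 * D t - d ^+ 2 * Q3.
    by rewrite /Q3; field; exact: lt0r_neq0.
  have c2 : d ^+ 2 * Q3 <= s * Q3 by apply: ler_wpM2r.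
  have c3 : s * (Q3 + Q4) <= e by exact: sQs.
  rewrite -/Hr -/B c1 in low; rewrite mulrDr in c3; move: hlr; rewrite -/Q4 ler_norml => /andP[c4 _].
  exact: (slack3 low c2 c3 c4).
rewrite EV; have c1 : expR (2 * K) / rho * (2 * D t + 2 * d ^+ 2) = P / rho * D t + d ^+ 2 * Q2.
  by rewrite /Q2 /P; field; exact: lt0r_neq0.
have c2 : d ^+ 2 * Q2 <= s * Q2 by apply: ler_wpM2r.
have c3 : s * (Q2 + Q4) <= e by exact: sQs.
rewrite -/Hr c1 in up; rewrite mulrDr in c3; move: hlr; rewrite -/Q4 ler_norml => /andP[_ c4].
exact: (slack4 up c2 c3 c4).
Qed.

Notation F := (fun t => flx sigma (u t)).
Notation w := (fun t => ww (u t)).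
Notation ee := (fun t p => u t p - rho * gibbs sigma (ww (u t)) p).

Lemma flux_velocity (t : R) (a : V) : 0 < t ->
  edot (flx sigma (v t)) a = tau (r t) * J (fun p => u t p * (Gam (lin (w t)) (lin a) p - n1 * lin a p)).
Proof.
move=> t0; have su := flow_sm (solution_flow hf) t0.
have cv : cont (v t) by exact/sm_cont/(flow_smd (solution_flow hf) t0).
have sw := sm_lin (w t).
rewrite -(FP_adjoint hsigma (w t) a su); intZ' m1.
rewrite -(Int_flx hsigma) //; apply: Int_eq => p; rewrite mulrA; congr (_ * _).
exact: (solution_fp t0 p).
Qed.

Lemma flux_velocity_gibbs (t : R) (a : V) : 0 < t ->
  edot (flx sigma (v t)) a = tau (r t) * J (fun p => ee t p * (Gam (lin (w t)) (lin a) p - n1 * lin a p)).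
Proof.
move=> t0; rewrite flux_velocity //; congr (_ * _).
have su := flow_sm (solution_flow hf) t0; have sg := sm_gibbsw sigma (w t).
have sw := sm_lin (w t); have sa := sm_lin a.
have E p : ee t p * (Gam (lin (w t)) (lin a) p - n1 * lin a p) =
  u t p * (Gam (lin (w t)) (lin a) p - n1 * lin a p) -
  rho * (gibbs sigma (w t) p * (Gam (lin (w t)) (lin a) p - n1 * lin a p)) by ring.
rewrite (Int_eq _ E); intB m1.
intZ m1.
by rewrite (gibbs_equilibrium hsigma) mulr0 subr0.
Qed.

Lemma sm_ee (t : R) : 0 < t -> sm (ee t).
Proof.
move=> t0; have su := flow_sm (solution_flow hf) t0; have sg := sm_gibbsw sigma (w t); smt.
Qed.

(** Only the deviation from the Gibbs state moves the flux, and its L^2 norm is the square root of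
    D. *)
Lemma flux_speed : exists2 C : R, 0 <= C & forall t (a : V), 0 < t ->
  `|edot (flx sigma (v t)) a| <= C * Num.sqrt (D t) * enorm a.
Proof.
have [Cb [CM [Lt [Lb hc]]]] := admissible_coef hcoef.
have n2 : 0 <= n%:R - 1 :> R by have := n_ge2 R hn; lra.
have K0 := ratio_ge0 hcoef (ltW hrho).
have CM0 := coef_CM0 hc.
pose B := 2 * k rho + n1; have B0 : 0 <= B by apply: addr_ge0 => //; exact: (mulr_ge0 (ler0n R 2) K0).
exists (CM * B) => [|t a t0]; first exact: mulr_ge0.
rewrite flux_velocity_gibbs // normrM.
have [r0 r1] := solution_r t0.
have [_ T0] := coef_pos hc r0; have T1 := coef_M hc r0.
have sw := sm_lin (w t); have sa := sm_lin a; have se := sm_ee t0.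
rewrite (gtr0_norm T0) -!mulrA; apply: ler_pM => //; first exact: ltW.
have -> : B * (Num.sqrt (D t) * enorm a) = (B * enorm a) * Num.sqrt (nrm2 (ee t)) by rewrite mulrA mulrAC.
apply: (Int_bound_nrm2 hsigma); [by cnt|by cnt|by rewrite mulr_ge0 ?enorm_ge0|move=> p].
apply: le_trans (ler_normB _ _) _; rewrite /B [leRHS]mulrDl; apply: lerD.
  apply: le_trans (Gam_lin_bound (w t) a p) _; apply: ler_wpM2r; first exact: enorm_ge0.
  by rewrite ler_wpM2l // (enorm_ww_le t0).
by rewrite normrM ger0_norm // ler_wpM2l // lin_le.
Qed.

(** The flux is a multiple of w, and [gibbs_mean] gives the mean of lin w under the Gibbs state. *)
Lemma ee_flux (t : R) : 0 < t -> r t != 0 ->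
  J (fun p => ee t p * lin (F t) p) = r t * (r t - rho * order_param n (k (r t))).
Proof.
move=> t0 r0; have rp : 0 < r t by rewrite lt_neqAle eq_sym r0 enorm_ge0.
have kp := ratio_gt0 hcoef rp.
have su := flow_sm (solution_flow hf) t0; have sg := sm_gibbsw sigma (w t).
have E p : ee t p * lin (F t) p = u t p * lin (F t) p - rho * (r t / k (r t) * (gibbs sigma (w t) p * lin (w t) p)).
  have -> : lin (w t) p = k (r t) / r t * lin (F t) p by rewrite linZ.
  have gen (x y a b e : R) : 0 < x -> 0 < y -> (e - rho * b) * a = e * a - rho * (y / x * (b * (x / y * a))).
    by move=> x0 y0; field; rewrite !gt_eqF.
  exact: gen.
rewrite (Int_eq _ E); intB m1.
intZ m1.
intZ m1.
rewrite (gibbs_mean hn hsigma) enorm_ww (Int_flx hsigma); last by cnt.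
rewrite -enorm_sqr -/(flux_norm (u t)) /=.
have k0 : k (flux_norm (u t)) != 0 by rewrite gt_eqF.
by field.
Qed.

(** Tests the deviation from the Gibbs state against lin J, which is bounded by r on the sphere. *)
Lemma flux_gap_le (t : R) : 0 < t -> r t != 0 -> (r t - rho * order_param n (k (r t))) ^+ 2 <= D t.
Proof.
move=> t0 r0; have rp : 0 < r t by rewrite lt_neqAle eq_sym r0 enorm_ge0.
have se := sm_ee t0; have sl := sm_lin (F t).
have H := @Int_bound_nrm2 R n sigma hsigma (ee t) (lin (F t)) (r t) (sm_cont se) (sm_cont sl) (ltW rp) (lin_le (F t)).
rewrite ee_flux // normrM (gtr0_norm rp) ler_pM2l // in H.
rewrite -[leLHS]real_normK ?num_real // -[leRHS]sqr_sqrtr ?nrm2_ge0 //.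
by apply: lerXn2r; rewrite ?nnegrE ?sqrtr_ge0.
Qed.

(** Along J the velocity is the exact term - (n - 1) r G plus a remainder with the factor |w| |J|.
    As |w| <= B r, the remainder is still O(sqrt D) after division by r^2, uniformly as r tends to
    0. *)
Lemma flux_log_speed : exists2 C : R, 0 <= C & forall t : R, 0 < t -> r t != 0 ->
  - n1 * tau (r t) * ((r t - rho * order_param n (k (r t))) / r t) - C * Num.sqrt (D t) <=
  edot (flx sigma (v t)) (F t) / r t ^+ 2.
Proof.
have [Cb [CM [Lt [Lb hc]]]] := admissible_coef hcoef.
have [B B0 hB] := ratio_bound hcoef (ltW hrho).
have CM0 := coef_CM0 hc.
exists (CM * (2 * B)) => [|t t0 r0]; first by rewrite !mulr_ge0.
have rp : 0 < r t by rewrite lt_neqAle eq_sym r0 enorm_ge0.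
have [_ r1] := solution_r t0.
have [_ T0] := coef_pos hc (ltW rp); have T1 := coef_M hc (ltW rp).
have sw := sm_lin (w t); have sa := sm_lin (F t); have se := sm_ee t0.
rewrite flux_velocity_gibbs //.
have -> : J (fun p => ee t p * (Gam (lin (w t)) (lin (F t)) p - n1 * lin (F t) p)) =
  J (fun p => ee t p * Gam (lin (w t)) (lin (F t)) p) - n1 * J (fun p => ee t p * lin (F t) p).
  intZ' m1.
  by rewrite -(IntB m1); [apply: Int_eq => p; ring|cnt|cnt].
rewrite ee_flux //; set G := r t - _; set X := J _.
have hX : `|X| <= 2 * B * r t ^+ 2 * Num.sqrt (D t).
  apply: (Int_bound_nrm2 hsigma); [by cnt|by cnt|by rewrite !mulr_ge0 ?exprn_ge0 ?(ltW rp)|move=> p].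
  apply: le_trans (Gam_lin_bound (w t) (F t) p) _; rewrite enorm_ww -/(flux_norm (u t)).
  exact: double_bound (ltW rp) (hB _ rp r1).
have -> : tau (r t) * (X - n1 * (r t * G)) / r t ^+ 2 =
   - n1 * tau (r t) * (G / r t) + tau (r t) * (X / r t ^+ 2) by field.
rewrite lerD2l lerNl; apply: le_trans (ler_norm _) _; rewrite normrN normrM (gtr0_norm T0) -mulrA.
apply: ler_pM => //; first exact: ltW.
rewrite normrM [`|(_ ^+ 2)^-1|]ger0_norm; last by rewrite invr_ge0 exprn_ge0 // ltW.
by rewrite ler_pdivrMr ?exprn_gt0 // mulrAC.
Qed.

(** The derivative of |J|^2 is at least - C |J|^2, again because |w| <= B |J|; Gronwall's inequality
    is applied to - |J|^2. *)
Lemma flux_norm_positive (a t : R) : 0 < a -> a <= t -> r a != 0 -> r t != 0.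
Proof.
move=> a0 at_ ra.
have [Cb [CM [Lt [Lb hc]]]] := admissible_coef hcoef.
have [B B0 hB] := ratio_bound hcoef (ltW hrho).
have n2 : 0 <= n%:R - 1 :> R by have := n_ge2 R hn; lra.
pose R2 t := edot (F t) (F t).
pose C := 2 * (CM * (2 * B * rho + n1)).
have bound (s : R) : 0 < s -> - (2 * edot (flx sigma (v s)) (F s)) <= - C * - R2 s.
  move=> s0; have [r0 r1] := solution_r s0.
  have [_ T0] := coef_pos hc r0; have T1 := coef_M hc r0.
  have su := flow_sm (solution_flow hf) s0.
  have sw := sm_lin (w s); have sa := sm_lin (F s).
  have -> : - C * - R2 s = 2 * (CM * ((2 * B * rho + n1) * R2 s)) by rewrite /C; ring.
  rewrite -mulrN ler_pM2l // flux_velocity //.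
  apply: le_trans (ler_norm _) _; rewrite normrN normrM (gtr0_norm T0).
  apply: ler_pM => //; first exact: ltW.
  have -> : J (fun p => u s p * (Gam (lin (w s)) (lin (F s)) p - n1 * lin (F s) p)) =
    J (fun p => u s p * Gam (lin (w s)) (lin (F s)) p) - n1 * J (fun p => u s p * lin (F s) p).
    intZ' m1.
    by rewrite -(IntB m1); [apply: Int_eq => p; ring|cnt|cnt].
  rewrite (Int_flx hsigma); last by cnt.
  rewrite -/(R2 s); apply: le_trans (ler_normB _ _) _; rewrite [leRHS]mulrDl; apply: lerD; last first.
    by rewrite ger0_norm // mulr_ge0 // edot_ge0.
  apply: le_trans (Int_norm m1 _) _; first by cnt.
  have -> : 2 * B * rho * R2 s = J (fun p => u s p * (2 * B * R2 s)).
    rewrite (IntZr m1); last by cnt.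
    by rewrite (solution_mass hn hsigma hmass hf s0); ring.
  int_le m1 => p.
  have u0 := solution_pos p s0.
  rewrite normrM (ger0_norm u0) ler_wpM2l //; apply: le_trans (Gam_lin_bound (w s) (F s) p) _.
  rewrite enorm_ww /R2 -enorm_sqr -/(flux_norm (u s)).
  have [->|r0'] := eqVneq (flux_norm (u s)) 0; first by rewrite expr0n !mulr0.
  have rp : 0 < r s by rewrite lt_neqAle eq_sym r0' r0.
  exact: double_bound r0 (hB _ rp r1).
have := @gronwall R (fun s => - R2 s) (fun s => - (2 * edot (flx sigma (v s)) (F s))) C a t at_.
move=> H; have {}H : - R2 t <= - R2 a * expR (- C * (t - a)).
  apply: H => s sa st; last exact: bound (lt_le_trans a0 sa).
  exact/is_deriveN/(edot_flx_derive)/(lt_le_trans a0 sa).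
have ra2 : 0 < R2 a by rewrite /R2 -enorm_sqr exprn_gt0 // lt_neqAle eq_sym ra enorm_ge0.
have rt2 : 0 < R2 t.
  by apply: (@lt_le_trans _ _ (R2 a * expR (- C * (t - a)))); [rewrite mulr_gt0 ?expR_gt0|rewrite -lerN2 -mulNr].
by apply/eqP => E; move: rt2; rewrite /R2 -enorm_sqr -/(flux_norm (u t)) E expr0n ltxx.
Qed.

Section Large_time.
Variable kappa_max : \bar R.
Variable j : R -> R.
Hypothesis hj : is_inverse_ratio nu tau kappa_max j.
Variable rho_c : \bar R.
Hypothesis hrho_c : is_critical_density n j rho_c.
Hypothesis hjc : forall kappa : R, 0 < kappa -> (kappa%:E < kappa_max)%E ->
  derivable (fun u : R => j u / order_param n u) kappa 1 /\
  0 < derive1 (fun u : R => j u / order_param n u) kappa.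
Notation c := (@order_param R n).
Notation lnZ := (fun x => ln (ZZ sigma x (unit_vec R hn))).
Notation W := (VV k lnZ (Phi nu tau) rho).
Notation Gap := (GG0 k c rho).
Let th := thermo_sphere hn hsigma hcoef hj hjc.

Lemma gap_le_D (t : R) : 0 < t -> r t != 0 -> Gap (r t) ^+ 2 <= D t.
Proof. exact: flux_gap_le. Qed.

Lemma D_ge0 (t : R) : 0 <= D t.
Proof. exact: nrm2_ge0. Qed.

Lemma regular q : exists M : R, forall t : R, 1 <= t -> nrm2 (iter q (@Lap R n) (u t)) <= M.
Proof.
have [Cb [CM [Lt [Lb hc]]]] := admissible_coef hcoef.
exact: (solution_iLap_bounded hn hsigma hrho hmass hf hc).
Qed.

Lemma sm_u (t : R) : 1 <= t -> sm (u t).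
Proof. by move=> t1; apply: (flow_sm (solution_flow hf)); exact: lt_le_trans t1. Qed.

(** Passes through the Gibbs state of parameter [ww (u t)], with [gibbs_lip] for the change of
    parameter. *)
Lemma L2_dist_gibbs (K : R) : exists2 C : R, 0 <= C & forall (t : R) (W' : V), 1 <= t -> enorm W' <= K ->
  nrm2 (fun p => u t p - rho * gibbs sigma W' p) <= 2 * D t + C * enorm (w t - W') ^+ 2.
Proof.
have [C C0 hC] := @gibbs_lip R n sigma hsigma (Num.max K (k rho)).
have rC : 0 <= rho ^+ 2 * C by apply: mulr_ge0 => //; exact: sqr_ge0.
exists (2 * (rho ^+ 2 * C)) => [|t W' t1 WK]; first exact: mulr_ge0.
have t0 := lt_le_trans ltr01 t1; have su := sm_u t1.
have wK := enorm_ww_le t0.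
have sG := sm_gibbsw sigma (w t); have sG' := sm_gibbsw sigma W'.
pose A p := u t p - rho * gibbs sigma (w t) p.
pose B p := rho * (gibbs sigma (w t) p - gibbs sigma W' p).
have sA : sm A by rewrite /A; smt.
have sB : sm B by rewrite /B; smt.
have -> : (fun p => u t p - rho * gibbs sigma W' p) = fun p => A p + B p.
  by apply/funext => p; rewrite /A /B; ring.
apply: le_trans (nrm2D hsigma (sm_cont sA) (sm_cont sB)) _; rewrite lerD2l -mulrA ler_wpM2l //.
have sd : sm (fun p => gibbs sigma (w t) p - gibbs sigma W' p) by smt.
rewrite /B (nrm2Z hsigma _ (sm_cont sd)) -mulrA; apply: ler_wpM2l; first exact: sqr_ge0.
by apply: hC; rewrite le_max ?WK // wK orbT.
Qed.

Lemma gibbs0 p : gibbs sigma 0 p = 1.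
Proof.
have l0 q : lin (0 : V) q = 0 by rewrite /lin edotC edot0l.
have Z1 : ZW sigma (0 : V) = 1 * 1.
  by rewrite -(Int_cst (sigma_mass hsigma)); apply: Int_eq => q; rewrite l0 expR0.
by rewrite /gibbs l0 expR0 Z1 mulr1 divr1.
Qed.

Lemma L2_dist_uniform : exists2 C : R, 0 <= C & forall t : R, 1 <= t ->
  nrm2 (fun p => u t p - rho) <= 2 * D t + C * r t ^+ 2.
Proof.
have [C C0 hC] := L2_dist_gibbs 0; have [B B0 hB] := ratio_bound hcoef (ltW hrho).
exists (C * B ^+ 2) => [|t t1]; first by rewrite mulr_ge0 ?sqr_ge0.
have t0 := lt_le_trans ltr01 t1.
have e0 : enorm (0 : V) = 0 by apply/eqP; rewrite enorm_eq0.
have := hC t 0 t1; rewrite e0 => /(_ (lexx 0)).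
under [X in nrm2 X]eq_fun do rewrite gibbs0 mulr1.
rewrite subr0 enorm_ww => h; apply: le_trans h _; rewrite lerD2l -mulrA ler_wpM2l //.
have [r0 r1] := solution_r t0.
rewrite -exprMn; apply: lerXn2r; rewrite ?nnegrE; [exact: ratio_ge0 hcoef _ r0|exact: mulr_ge0|].
have [->|r0'] := eqVneq (r t) 0; first by rewrite (ratio0 hcoef) mulr0.
by apply: hB => //; rewrite lt_neqAle eq_sym r0'.
Qed.

Lemma W_le_sqr : exists2 B : R, 0 <= B & forall t : R, 0 < t -> W (r t) - W 0 <= B * r t ^+ 2.
Proof.
have [B B0 hB] := ratio_bound hcoef (ltW hrho); exists B => // t t0.
have [r0 r1] := solution_r t0.
apply: le_trans (VV_le th hrho r0) _.
have [->|r0'] := eqVneq (r t) 0; first by rewrite !mul0r expr0n mulr0.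
have rp : 0 < r t by rewrite lt_neqAle eq_sym r0'.
by rewrite expr2 mulrA mulrC; apply: ler_wpM2r => //; exact: hB.
Qed.

(** GG0 r >= d r gives r^2 <= D / d^2. This bounds both V r - V 0 and the distance from the Gibbs
    state to the uniform one by multiples of D. *)
Lemma subcritical : (rho%:E < rho_c)%E -> converges_exp_to sigma f (fun=> rho).
Proof.
move=> hlt; have [c0 [c1 [C [cp c1p Cp hE]]]] := entropy_estimate.
have [d d0 hd] := GG0_subcritical th hrho hrho_c hlt.
have [B B0 hB] := W_le_sqr.
have rD (t : R) : 1 <= t -> r t ^+ 2 <= d ^- 2 * D t.
  move=> t1; have t0 := lt_le_trans ltr01 t1.
  have [r0 r1] := solution_r t0.
  have [->|r0'] := eqVneq (r t) 0; first by rewrite expr0n mulr_ge0 ?invr_ge0 ?sqr_ge0 ?D_ge0.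
  have rp : 0 < r t by rewrite lt_neqAle eq_sym r0'.
  rewrite ler_pdivlMl ?exprn_gt0 // -exprMn; apply: le_trans (gap_le_D t0 r0').
  have h := hd _ rp; have dr : 0 <= d * r t by rewrite mulr_ge0 // ltW.
  by apply: lerXn2r; rewrite ?nnegrE // (le_trans dr).
have d2 : 0 <= d ^- 2 by rewrite invr_ge0 sqr_ge0.
have [K [l [K0 l0 hK]]] : exists K l : R, [/\ 0 <= K, 0 < l & forall t : R, 1 <= t -> D t <= K * expR (- l * t)].
  apply: (@free_energy_exp R D (fun t => W (r t)) c0 c1 C (W 0) 1 cp c1p Cp hE _ _ 1 (B * d ^- 2)) => //.
  - by move=> t _; exact: D_ge0.
  - by move=> t t1; apply: (VV_min0 th hrho hrho_c (ltW hlt)); exact: enorm_ge0.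
  - exact: mulr_ge0.
  move=> t t1; apply: le_trans (hB t (lt_le_trans ltr01 t1)) _; rewrite -mulrA ler_wpM2l //.
  exact: rD.
have [A A0 hA] := L2_dist_uniform.
apply: (@L2_converges_exp R n sigma hn hsigma f sm_u regular (fun=> rho) (fun=> rho) _ _ ((2 + A * d ^- 2) * K) l 1) => //.
- exact: sm_cst.
- by rewrite mulr_ge0 // addr_ge0 // mulr_ge0.
move=> t t1; apply: le_trans (hA t t1) _; have Kt := hK t t1.
apply: (@le_trans _ _ (2 * (K * expR (- l * t)) + A * (d ^- 2 * (K * expR (- l * t))))).
  apply: lerD; first exact: ler_wpM2l.
  by apply: ler_wpM2l => //; apply: le_trans (rD t t1) _; exact: ler_wpM2l.
by rewrite le_eqVlt; apply/orP; left; apply/eqP; ring.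
Qed.

(** At the threshold GG0 may vanish at 0 faster than linearly. It is bounded from below only for r
    away from 0, which yields convergence without a rate. *)
Lemma critical : rho%:E = rho_c -> converges_to sigma f (fun=> rho).
Proof.
move=> heq; have [c0 [c1 [C [cp c1p Cp hE]]]] := entropy_estimate.
have [B B0 hB] := W_le_sqr; have [A A0 hA] := L2_dist_uniform.
have hle : (rho%:E <= rho_c)%E by rewrite heq.
have D0 t : 1 <= t -> 0 <= D t by move=> _; exact: D_ge0.
have U0 (t : R) : 1 <= t -> W 0 <= W (r t).
  by move=> t1; apply: (VV_min0 th hrho hrho_c hle); exact: enorm_ge0.
have r_small (e g t : R) : 0 < g -> (forall x, e <= x -> g <= Gap x) -> 1 <= t -> 0 < e -> D t < g ^+ 2 -> r t < e.
  move=> g0 hg t1 e0 Dg; rewrite ltNge; apply/negP => er; have t0 := lt_le_trans ltr01 t1.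
  have r0 : r t != 0 by rewrite gt_eqF // (lt_le_trans e0).
  have gG : g ^+ 2 <= Gap (r t) ^+ 2.
    by apply: lerXn2r; rewrite ?nnegrE ?(ltW g0) // ?hg // (le_trans (ltW g0)) // hg.
  by have := le_lt_trans (le_trans gG (gap_le_D t0 r0)) Dg; rewrite ltxx.
(* The free energy gets arbitrarily small, since it dissipates at a positive rate otherwise. *)
have small (e : R) : 0 < e -> exists2 s : R, 1 <= s & C * D s + W (r s) - W 0 <= e.
  move=> e0; apply: contrapT => /forallPNP H.
  have {}H (s : R) : 1 <= s -> e < C * D s + W (r s) - W 0.
    by move=> s1; rewrite ltNge; apply/negP => h; exact: (H s).
  pose x := Num.sqrt (e / 2 / (B + 1)); have B1 : 0 < B + 1 by rewrite ltr_wpDl.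
  have x0 : 0 < x by rewrite sqrtr_gt0 !divr_gt0.
  have Bx : B * x ^+ 2 <= e / 2.
    rewrite /x sqr_sqrtr; last by rewrite !divr_ge0 // ltW.
    apply: (@le_trans _ _ ((B + 1) * (e / 2 / (B + 1)))); last by rewrite mulrC divfK // gt_eqF.
    by apply: ler_wpM2r; [rewrite !divr_ge0 // ltW|rewrite lerDl].
  have [g g0 hg] := GG0_critical th hrho hrho_c heq x0.
  pose d0 := Num.min (g ^+ 2) (e / 2 / (C + 1)); have C1 : 0 < C + 1 by rewrite ltr_wpDl.
  have d00 : 0 < d0 by rewrite lt_min exprn_gt0 // !divr_gt0.
  have hD (s : R) : 1 <= s -> d0 <= D s.
    move=> s1; rewrite leNgt; apply/negP => Dd; have := H s s1; apply/negP; rewrite -leNgt.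
    have rx : r s < x.
      by apply: r_small g0 hg s1 x0 _; apply: lt_le_trans Dd _; rewrite /d0 ge_min lexx.
    have h1 := hB s (lt_le_trans ltr01 s1).
    have h2 : B * r s ^+ 2 <= B * x ^+ 2.
      by apply: ler_wpM2l => //; apply: lerXn2r; rewrite ?nnegrE ?enorm_ge0 ?(ltW x0) ?(ltW rx).
    have h3 : C * D s <= e / 2.
      apply: (@le_trans _ _ ((C + 1) * (e / 2 / (C + 1)))); last by rewrite mulrC divfK // gt_eqF.
      apply: ler_pM => //; [exact: D_ge0|by rewrite lerDl|apply: le_trans (ltW Dd) _].
      by rewrite /d0 ge_min lexx orbT.
    move: h1 h2 h3 Bx; move: (C * _) (W _) (W 0) (B * _) (B * _) => a b b' q q'; lra.
  (* Applied to L = 0: since D >= d0, the rate 1 - D / d0 is nonpositive, which contradicts the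
     decrease of the energy to a finite minimum. *)
  apply: (@no_growth R D (fun t => W (r t)) c0 c1 C (W 0) 1 cp c1p hE D0 U0 (fun=> 0) (fun=> 0) 1 d0^-1 0) => //.
  - by rewrite invr_ge0 ltW.
  by move=> t t1; rewrite subr_le0 ler_pdivlMl // mulr1 hD.
have DD (e : R) : 0 < e -> exists2 s : R, 1 <= s & forall t : R, s <= t -> D t <= e.
  move=> e0; have [s s1 hs] := small (c1 * e) (mulr_gt0 c1p e0); exists s => // t st.
  have h1 := free_energy_le cp hE D0 s1 st; have h2 := U0 t (le_trans s1 st).
  rewrite -(ler_pM2l c1p); move: hs h1 h2; move: (C * _) (W (r s)) (W 0) (W (r t)) (c1 * _) (c1 * _) => *; lra.
apply: (@L2_converges R n sigma hn hsigma f sm_u regular (fun=> rho) (fun=> rho)) => //; first exact: sm_cst.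
move=> e e0; pose x := Num.sqrt (e / 2 / (A + 1)); have A1 : 0 < A + 1 by rewrite ltr_wpDl.
have x0 : 0 < x by rewrite sqrtr_gt0 !divr_gt0.
have Ax : A * x ^+ 2 <= e / 2.
  rewrite /x sqr_sqrtr; last by rewrite !divr_ge0 // ltW.
  apply: (@le_trans _ _ ((A + 1) * (e / 2 / (A + 1)))); last by rewrite mulrC divfK // gt_eqF.
  by apply: ler_wpM2r; [rewrite !divr_ge0 // ltW|rewrite lerDl].
have [g g0 hg] := GG0_critical th hrho hrho_c heq x0.
have q0 : 0 < Num.min (g ^+ 2 / 2) (e / 4) by rewrite lt_min !divr_gt0 // exprn_gt0.
have [s s1 hs] := DD _ q0; exists s => t st; have t1 := le_trans s1 st.
have := hs t st; rewrite le_min => /andP[h1 h2].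
have rx : r t < x.
  apply: (r_small _ _ _ g0 hg t1 x0); apply: le_lt_trans h1 _.
  by have := exprn_gt0 2 g0; move: (g ^+ 2) => *; lra.
apply: le_trans (hA t t1) _.
have h3 : A * r t ^+ 2 <= A * x ^+ 2.
  by apply: ler_wpM2l => //; apply: lerXn2r; rewrite ?nnegrE ?enorm_ge0 ?(ltW x0) ?(ltW rx).
move: h2 h3 Ax; move: (D t) (A * _) (A * _) => a b b'; lra.
Qed.

Section Supercritical.
Hypothesis hsup : (rho_c < rho%:E)%E.
Variable ks : R.
Hypotheses (ks0 : 0 < ks) (ksM : (ks%:E < kappa_max)%E) (qks : j ks / c ks = rho).
Notation rs := (j ks).

(* While the free energy stays away from its minimum, [ln r] grows: near [r = 0] because the uniform
   distribution is unstable, elsewhere because the dissipation is bounded from below. *)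
Lemma free_energy_small (C : R) (a e : R) : 0 <= C -> 1 <= a -> r a != 0 -> 0 < e ->
  exists2 s : R, a <= s & C * D s + W (r s) - W rs <= e.
Proof.
move=> C0 a1 ra e0; apply: contrapT => /forallPNP H.
have {}H (s : R) : a <= s -> e < C * D s + W (r s) - W rs.
  by move=> s1; rewrite ltNge; apply/negP => h; exact: (H s).
have a0 := lt_le_trans ltr01 a1.
have rp (t : R) : a <= t -> 0 < r t.
  move=> at_; rewrite lt_neqAle enorm_ge0 andbT eq_sym.
  exact: (flux_norm_positive a0 at_ ra).
have rle (t : R) : a <= t -> r t <= rho.
  by move=> at_; have [] := solution_r (lt_le_trans a0 at_).
have [c0 [c1 [C' [cp c1p Cp hE]]]] := entropy_estimate.
have [Cb [CM [Lt [Lb hc]]]] := admissible_coef hcoef.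
have [tm tm0 htm] := coef_tau_min hc (ltW hrho).
have n2 : 1 <= n%:R - 1 :> R by have := n_ge2 R hn; lra.
have n20 : 0 < n%:R - 1 :> R by exact: lt_le_trans n2.
have [m [r1 [m0 mr r10 hm]]] := q_small th hrho hrho_c hsup.
have [C2 C20 hC2] := GG0_coercive th ks0 ksM qks rho r10.
have [b b0 hb] := flux_log_speed.
have CM0 := coef_CM0 hc.
(* A lower bound for - (n - 1) tau G / r where r <= r1, since G / r <= 1 - rho / m there. *)
pose g0 := n1 * tm * (rho / m - 1).
have g00 : 0 < g0 by rewrite mulr_gt0 ?mulr_gt0 // subr_gt0 ltr_pdivlMr // mul1r.
pose d0 := e / (C + C2 + 1); have CC : 0 < C + C2 + 1 by rewrite ltr_wpDl // addr_ge0.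
have d00 : 0 < d0 by rewrite divr_gt0.
(* The first term absorbs b sqrt D by Young's inequality. The second compensates the possible
   decrease of ln r where r > r1, because D >= d0 there. *)
pose Q := b ^+ 2 / (2 * g0) + (n1 * CM + g0) / d0.
have Q1 : 0 <= b ^+ 2 / (2 * g0) by rewrite divr_ge0 ?sqr_ge0 // mulr_ge0 // ltW.
have nCM : 0 <= n1 * CM by rewrite mulr_ge0 // ltW.
have Q2 : 0 <= (n1 * CM + g0) / d0 by rewrite divr_ge0 ?addr_ge0 // ltW.
have bD (t : R) : b * Num.sqrt (D t) <= g0 / 2 + b ^+ 2 / (2 * g0) * D t.
  have Dt := D_ge0 t; rewrite -{2}(sqr_sqrtr Dt); move: (Num.sqrt (D t)) => x.
  rewrite -subr_ge0; have -> : g0 / 2 + b ^+ 2 / (2 * g0) * x ^+ 2 - b * x = (b * x - g0) ^+ 2 / (2 * g0).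
    by field; exact: lt0r_neq0.
  by rewrite divr_ge0 ?sqr_ge0 // mulr_ge0 // ltW.
pose dL (t : R) := edot (flx sigma (v t)) (F t) / r t ^+ 2.
have a1e (t : R) : a <= t -> 1 <= t by exact: le_trans.
apply: (@no_growth R D (fun t => W (r t)) c0 c1 C' (W rs) a cp c1p _ _ _ (fun t => ln (r t)) dL (g0 / 2) Q (ln rho)) => //.
- move=> x x0; have [E [dE h]] := hE x x0; exists E, dE => t at_; exact: h (a1e t at_).
- by move=> t _; exact: D_ge0.
- by move=> t at_; apply: (VV_min th ks0 ksM qks); exact: enorm_ge0.
- by rewrite divr_gt0.
- by rewrite addr_ge0.
- move=> t at_; have r0 := rp t at_; have t0 := lt_le_trans a0 at_.
  have h := @is_derive1_comp _ _ r _ _ _ (is_derive1_ln r0) (r_derive t0 (lt0r_neq0 r0)).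
  apply: (is_derive_eq h); rewrite /dL; move: r0; move: (edot _ _) (flux_norm _) => x y y0.
  by field; exact: lt0r_neq0.
- move=> t at_; have r0 := rp t at_; have t0 := lt_le_trans a0 at_.
  have T1 := htm (r t) (ltW r0) (rle t at_); have T2 := coef_M hc (ltW r0).
  have T0 := lt_le_trans tm0 T1.
  apply: le_trans (hb t t0 (lt0r_neq0 r0)); rewrite -/(Gap (r t)); have hbD := bD t.
  have Dt := D_ge0 t.
  have QD : Q * D t = b ^+ 2 / (2 * g0) * D t + (n1 * CM + g0) / d0 * D t by rewrite /Q mulrDl.
  have [rr1|rr1] := leP (r t) r1.
    have hG : Gap (r t) / r t <= 1 - rho / m.
      rewrite ler_pdivrMr // mulrC.
      by apply: (GG0_q_le th hrho m0 r0); exact: hm.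
    have h1 : g0 <= - n1 * tau (r t) * (Gap (r t) / r t).
      have -> : - n1 * tau (r t) * (Gap (r t) / r t) = n1 * (tau (r t) * - (Gap (r t) / r t)) by ring.
      rewrite /g0 -mulrA; apply: ler_wpM2l; first exact: ltW.
      apply: ler_pM; [exact: ltW| |exact: T1|].
        by rewrite subr_ge0 ler_pdivlMr // mul1r ltW.
      by rewrite lerNr opprB.
    have h2 : 0 <= (n1 * CM + g0) / d0 * D t by rewrite mulr_ge0.
    move: h1 h2 hbD QD; move: (_ * (Gap _ / _)) (_ / d0 * _) (b * _) (_ * D t) (Q * _) => *; lra.
  have [_ hV] := hC2 (r t) (ltW rr1) (rle t at_).
  have hGD := gap_le_D t0 (lt0r_neq0 r0).
  (* For r > r1 the excess of free energy, assumed larger than e, is at most (C + C2) D by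
     [GG0_coercive]. *)
  have hd : d0 <= D t.
    have := H t at_; have := le_trans hV (ler_wpM2l C20 hGD) => x1 x2.
    rewrite /d0 ler_pdivrMr // mulrC; have -> : (C + C2 + 1) * D t = C * D t + C2 * D t + D t by ring.
    exact: (le_sum3 x1 x2 Dt).
  have h1 : - (n1 * CM) <= - n1 * tau (r t) * (Gap (r t) / r t).
    rewrite !mulNr lerN2 -mulrA; apply: ler_wpM2l; first exact: ltW.
    have g1 : Gap (r t) / r t <= 1 by rewrite ler_pdivrMr // mul1r (GG0_le th hrho r0).
    apply: le_trans (ler_wpM2l (ltW T0) g1) _; by rewrite mulr1.
  have h2 : n1 * CM + g0 <= (n1 * CM + g0) / d0 * D t.
    by rewrite -mulrA ler_peMr ?addr_ge0 ?(ltW g00) // mulrC ler_pdivlMr // mul1r.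
  exact: (rate_ge h1 h2 hbD QD).
move=> t at_; rewrite ler_ln ?posrE ?rle //; exact: rp.
Qed.

Lemma enorm_e i : enorm (e_ R i : V) = 1.
Proof. by rewrite /enorm /e_ edot_delta !mxE !eqxx sqrtr1. Qed.

(** Once the free energy is below the barrier of [VV_gap], r remains above rs / 2. There
    [GG0_coercive] makes D decay exponentially, hence also the speed of J, and the limit of J
    provides the direction. *)
Lemma supercritical (t1 : R) : 0 < t1 -> r t1 != 0 ->
  exists Omega : V, sphere Omega /\
    converges_exp_to sigma f (fun x => rho * von_mises_fisher sigma ks Omega x).
Proof.
move=> t10 rt1; pose a := Num.max 1 t1.
have a1 : 1 <= a by rewrite le_max lexx.
have ra : r a != 0.
  by apply: (flux_norm_positive t10 _ rt1); rewrite le_max lexx orbT.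
have rs0 := rs_gt0 th ks0 ksM.
have [c0 [c1 [C [cp c1p Cp hE]]]] := entropy_estimate.
pose r1 := rs / 2; have r10 : 0 < r1 by rewrite divr_gt0.
have r1s : r1 < rs by rewrite /r1; lra.
have [eta eta0 heta] := VV_gap th hrho ks0 ksM qks r10 r1s.
have [T aT hT] := free_energy_small Cp a1 ra (divr_gt0 eta0 (ltr0n R 2)).
have T1 := le_trans a1 aT; have T0 := lt_le_trans ltr01 T1.
have D0 (t : R) : 1 <= t -> 0 <= D t by move=> _; exact: D_ge0.
have U0 (t : R) : 1 <= t -> W rs <= W (r t).
  by move=> _; apply: (VV_min th ks0 ksM qks); exact: enorm_ge0.
have rge (t : R) : T <= t -> r1 < r t.
  move=> Tt; rewrite ltNge; apply/negP => rr1.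
  have h1 := free_energy_le cp hE D0 T1 Tt; have h2 := heta (r t) (enorm_ge0 _) rr1.
  have h3 : 0 <= c1 * D t by rewrite mulr_ge0 ?D_ge0 // ltW.
  have eta0' := eta0; move: hT h1 h2 h3; move: (C * _) (W _) (W _) (W _) (c1 * _) => *; lra.
have rp (t : R) : T <= t -> 0 < r t by move=> Tt; exact: lt_trans (rge t Tt).
have tp (t : R) : T <= t -> 0 < t by exact: lt_le_trans.
have rle (t : R) : T <= t -> r t <= rho.
  by move=> Tt; have [] := solution_r (tp t Tt).
have [C2 C20 hC2] := GG0_coercive th ks0 ksM qks rho r10.
have [K [l [K0 l0 hK]]] : exists K l : R, [/\ 0 <= K, 0 < l & forall t : R, T <= t -> D t <= K * expR (- l * t)].
  apply: (@free_energy_exp R D (fun t => W (r t)) c0 c1 C (W rs) 1 cp c1p Cp hE D0 U0 T C2) => //.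
  move=> t Tt; have [_ h] := hC2 (r t) (ltW (rge t Tt)) (rle t Tt); apply: le_trans h _.
  by apply: ler_wpM2l => //; apply: gap_le_D; [exact: tp|exact/lt0r_neq0/rp].
pose m := l / 2; have m0 : 0 < m by rewrite divr_gt0.
pose E (t : R) := expR (- m * t); have E0 t : 0 <= E t by exact: expR_ge0.
have E2 t : E t ^+ 2 = expR (- l * t) by rewrite expr2 -expRD; congr expR; rewrite /m; field.
have sD (t : R) : T <= t -> Num.sqrt (D t) <= Num.sqrt K * E t.
  move=> Tt; apply: le_trans (ler_wsqrtr (hK t Tt)) _.
  by rewrite sqrtrM // -E2 sqrtr_sqr ger0_norm.
have kks (t : R) : T <= t -> `|k (r t) - ks| <= C2 * Num.sqrt K * E t.
  move=> Tt; have [h _] := hC2 (r t) (ltW (rge t Tt)) (rle t Tt); apply: le_trans h _.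
  rewrite -mulrA; apply: ler_wpM2l => //; apply: le_trans (sD t Tt); rewrite -sqrtr_sqr; apply: ler_wsqrtr.
  by apply: gap_le_D; [exact: tp|exact/lt0r_neq0/rp].
have [A A0 hA] := flux_speed.
pose A' := A * Num.sqrt K; have A'0 : 0 <= A' by rewrite mulr_ge0 ?sqrtr_ge0.
have hlim (i : 'I_n) : exists l : R, forall t, T <= t -> `|F t 0 i - l| <= A' / m * E t.
  apply: (@exp_speed_limit R (fun t => F t 0 i) (fun t => flx sigma (v t) 0 i) A' m T) => //.
    by move=> t Tt; exact: (flx_derive i (tp t Tt)).
  move=> t Tt; have := hA t (e_ R i) (tp t Tt); rewrite enorm_e mulr1 /e_ edot_delta => h.
  by apply: le_trans h _; rewrite -mulrA ler_wpM2l // sD.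
have [lv hlv] := boolp.choice hlim.
pose Jv : V := \row_i lv i; pose B := n%:R * (A' / m).
have B0 : 0 <= B by rewrite mulr_ge0 // divr_ge0 // ltW.
have hJ (t : R) : T <= t -> enorm (F t - Jv) <= B * E t.
  move=> Tt; rewrite /B -mulrA; apply: enorm_le_coord; first by rewrite mulr_ge0 ?divr_ge0 // ltW.
  by move=> i; rewrite !mxE; have := hlv i t Tt; rewrite !mxE.
(* A zero limit would make r exponentially small, whereas r > r1. *)
have Jv0 : 0 < enorm Jv.
  rewrite lt_neqAle enorm_ge0 andbT; apply/negP => /eqP Jz.
  have rB (t : R) : T <= t -> r t <= B * E t.
    move=> Tt; have := enormD (F t - Jv) Jv; rewrite subrK -Jz addr0 => h.
    exact: le_trans h (hJ t Tt).
  (* At this time B e^(- m t) <= r1, because e^(m t) >= 1 + m t. *)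
  pose t := T + B / (r1 * m); have Tt : T <= t by rewrite lerDl divr_ge0 // mulr_ge0 // ltW.
  have := lt_le_trans (rge t Tt) (rB t Tt); apply/negP; rewrite -leNgt.
  have h1 : 1 + m * t <= expR (m * t) by exact: expR_ge1Dx.
  have h2 : B / r1 <= expR (m * t).
    apply: le_trans h1; rewrite /t mulrDr.
    have -> : m * (B / (r1 * m)) = B / r1 by field; rewrite !gt_eqF.
    by have : 0 <= m * T by [rewrite mulr_ge0 // ltW]; lra.
  rewrite /E mulNr expRN ler_pdivrMr ?expR_gt0 // mulrC -ler_pdivrMr //.
pose Om : V := (enorm Jv)^-1 *: Jv.
have Om1 : enorm Om = 1.
  by rewrite /Om enormZ ?invr_ge0 ?enorm_ge0 // mulVf // gt_eqF.
exists Om; split; first exact: Om1.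
pose W' := ks *: Om.
have W'k : enorm W' <= ks by rewrite enormZ ?(ltW ks0) // Om1 mulr1.
(* One contribution from k (r t) - ks, and two from the error on J: on the vector and on its
   norm. *)
pose B2 := C2 * Num.sqrt K + ks * (2 * B / enorm Jv).
have B20 : 0 <= B2.
  by apply: addr_ge0; rewrite ?mulr_ge0 ?sqrtr_ge0 ?invr_ge0 ?enorm_ge0 // ltW.
have hw (t : R) : T <= t -> enorm (w t - W') <= B2 * E t.
  move=> Tt; have r0 := rp t Tt; have J1 := hJ t Tt.
  have ks00 := ks0; have Jn : enorm Jv != 0 by rewrite gt_eqF.
  have rn : r t != 0 by rewrite gt_eqF.
  (* Changes successively the factor k (r t) into ks, the vector F t into Jv, and the norm r t into
     that of Jv, so that each term carries one small factor. *)
  have dec : w t - W' = ((k (r t) - ks) / r t) *: F t +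
     ((ks / enorm Jv) *: (F t - Jv) + (ks * ((enorm Jv - r t) / (r t * enorm Jv))) *: F t).
    rewrite /W' /Om /ww -/(flux_norm (u t)) scalerBr !scalerA; apply/rowP => i; rewrite !mxE.
    by move: (Int _ _) (lv i) Jn rn (k _); move: (enorm Jv) (flux_norm _) => x y a' b' x0 y0 kk; field; rewrite x0 y0.
  rewrite dec; apply: le_trans (enormD _ _) _.
  have dn : `|enorm Jv - r t| <= B * E t.
    rewrite ler_norml; apply/andP; split.
      have := enormD (F t - Jv) Jv; rewrite subrK => h; move: (le_trans h (lerD J1 (lexx _))).
      by rewrite -/(flux_norm (u t)); lra.
    have := enormD (Jv - F t) (F t); rewrite subrK -(enormN (Jv - F t)) opprB => h.
    by move: (le_trans h (lerD J1 (lexx _))); rewrite -/(flux_norm (u t)); lra.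
  have nZ (x : R) (y : V) : enorm (x *: y) = `|x| * enorm y.
    have [x0|x0] := leP 0 x; first by rewrite enormZ // ger0_norm.
    by rewrite -(enormN (x *: y)) -scaleNr enormZ ?oppr_ge0 ?(ltW x0) // ltr0_norm.
  rewrite /B2 [leRHS]mulrDl; apply: lerD.
    rewrite nZ -/(flux_norm (u t)) normrM normfV (gtr0_norm r0) divfK //.
    exact: kks.
  apply: le_trans (enormD _ _) _; rewrite !nZ -/(flux_norm (u t)).
  rewrite !normrM !normfV normrM (gtr0_norm ks00) (gtr0_norm r0) (gtr0_norm Jv0).
  have -> : ks * (2 * B / enorm Jv) * E t = ks / enorm Jv * (B * E t) + ks / enorm Jv * (B * E t) by ring.
  apply: lerD; first by apply: ler_wpM2l => //; rewrite divr_ge0 // ltW.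
  have -> : ks * (`|enorm Jv - r t| / (r t * enorm Jv)) * r t = ks / enorm Jv * `|enorm Jv - r t|.
    by field; rewrite Jn rn.
  by apply: ler_wpM2l => //; rewrite divr_ge0 // ltW.
have [A2 A20 hA2] := L2_dist_gibbs ks.
apply: (@L2_converges_exp R n sigma hn hsigma f sm_u regular _ (fun p => rho * gibbs sigma W' p) _ _ (2 * K + A2 * B2 ^+ 2) l T) => //.
- by have := sm_gibbsw sigma W'; smt.
- move=> p; congr (_ * _); rewrite /von_mises_fisher sphere_int_vec /gibbs /ZW.
  have lE q : lin W' q = ks * edot (vec q) Om by rewrite /W' linZ.
  by rewrite lE; congr (_ / _); apply: Int_eq => q; rewrite /= lE.
- by rewrite addr_ge0 ?mulr_ge0 ?sqr_ge0.
move=> t Tt; apply: le_trans (hA2 t W' (le_trans T1 Tt) W'k) _; rewrite [leRHS]mulrDl -!mulrA; apply: lerD.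
  by apply: ler_wpM2l => //; exact: hK.
apply: ler_wpM2l => //; rewrite [leRHS]mulrA -expr2 -E2 -exprMn; apply: lerXn2r; rewrite ?nnegrE ?enorm_ge0 ?mulr_ge0 //.
exact: hw.
Qed.

End Supercritical.

End Large_time.

End Solution_flux.

Theorem proposition4p1 (R : realType) (n : nat) (hn : (2 <= n)%N)
    (sigma : probability (borel_rV R n) R) (hsigma : uniform_sphere sigma)
    (nu tau : R -> R) (hcoef : admissible_coefficients nu tau)
    (kappa_max : \bar R) (hkmax : is_kappa_max nu tau kappa_max)
    (j : R -> R) (hj : is_inverse_ratio nu tau kappa_max j)
    (rho_c : \bar R) (hrho_c : is_critical_density n j rho_c)
    (f0 : {measure set (borel_rV R n) -> \bar R})
    (hf0 : f0 (~` @sphere R n) = 0%E)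
    (rho : R) (hrho : 0 < rho) (hmass : f0 (@sphere R n) = rho%:E)
    (f : R -> 'rV[R]_n -> R) (hf : solution sigma nu tau f0 f)
    (hjc : forall kappa : R, 0 < kappa -> (kappa%:E < kappa_max)%E ->
       derivable (fun u : R => j u / order_param n u) kappa 1 /\
       0 < derive1 (fun u : R => j u / order_param n u) kappa) :
  [/\ (rho%:E < rho_c)%E -> converges_exp_to sigma f (fun=> rho),
      rho%:E = rho_c -> converges_to sigma f (fun=> rho)
    & (rho_c < rho%:E)%E -> measure_flux f0 != 0 ->
      exists kappa : R,
        [/\ 0 < kappa, (kappa%:E < kappa_max)%E, rho * order_param n kappa = j kappa,
            forall kappa' : R, 0 < kappa' -> (kappa'%:E < kappa_max)%E ->
              rho * order_param n kappa' = j kappa' -> kappa' = kappa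
          & exists Omega : 'rV[R]_n, sphere Omega /\
              converges_exp_to sigma f
                (fun x => rho * von_mises_fisher sigma kappa Omega x)]].
Proof.
have th := thermo_sphere hn hsigma hcoef hj hjc.
split; [exact: (subcritical hn hsigma hcoef hrho hmass hf hj hrho_c hjc)|
  exact: (critical hn hsigma hcoef hrho hmass hf hj hrho_c hjc)|move=> hsup hflux].
have [ks [ks0 ksM qks]] := equilibrium th hrho hrho_c hsup.
have [t1 t10 rt1] := solution_flux0 hn hsigma hmass hf hflux.
have eqE x : 0 < x -> (rho * order_param n x = j x) <-> j x / order_param n x = rho.
  move=> x0; have c0 := th_c0 th x0; split=> [<-|<-]; first by rewrite mulfK // gt_eqF.
  by rewrite divfK // gt_eqF.
exists ks; split => //; first exact/eqE.
  by move=> x x0 xM /(eqE x x0) qx; exact: (q_inj th ks0 ksM qks x0 xM qx).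
apply: (supercritical hn hsigma hcoef hrho hmass hf hj hrho_c hjc hsup ks0 ksM qks t10).
by rewrite enorm_eq0.
Qed.
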